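(* Let $1<p,q<\infty$, $d,r\in\mathbb{N}$, $K_1,K_2>0$ and $C_K=[-K_1,K_1]\times[-K_2,K_2]^d$. Let $\Phi$, $\psi$ and $\rho$ satisfy assumptions $(A_1)$, $(A_2)$ and $(A_3)$ of the context respectively. Let $\{(x_j,y_k)\}_{j,k\in\mathbb{N}}$ be i.i.d. random variables with values in $C_K$, drawn from a probability distribution over $C_K$ with density function $\rho$. For $N\in\mathbb{N}$, $0<\mu\le1$ and $0<\eta<\mu\,\mathcal{C}_{\rho,1}$, let $m,n\in\mathbb{N}$ be such that $$nm>\frac{54r\sqrt2(\ln2)(2N+1)^{d+1}}{\eta}\Big(2+\frac{81}{\eta}\Big).$$ Then the sampling inequality $$\Big(nm\|\psi\|_{L^{1,1}(C_K)}(\mu\,\mathcal{C}_{\rho,1}-\eta)\Big)\|f\|_{L^{p,q}(\mathbb{R}\times\mathbb{R}^d)}\le\sum_{j=1}^n\sum_{k=1}^m|(f*\psi)(x_j,y_k)|$$ $$\le\Big(nm\|\psi\|_{L^{1,1}(C_K)}\big(\mathcal{C}_{\rho,2}(2K_1)^{\frac{p-1}{p}}(2K_2)^{\frac{d(q-1)}{q}}+\eta\big)\Big)\|f\|_{L^{p,q}(\mathbb{R}\times\mathbb{R}^d)}$$ for the functions $f\in V_{N,\psi}^{p,q}(\Phi,\mu,C_K)$ holds (simultaneously for all such $f$) with probability at least $$1-\mathcal{A}_1\exp\Big(-nm\frac{3\eta^2}{4c^{*}(6c^{*}+\eta)}\Big)-\mathcal{A}_2\exp\Big(-nm\frac{\eta^2}{18\sqrt2(81+2\eta)}\Big),$$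 where $$\mathcal{A}_1=2\exp\big(r(2N+1)^{d+1}\ln(4c^{*}+1)\big),\qquad \mathcal{A}_2=\frac{4\big((2c^{*}+\frac14)(c^{*}+\frac14)\big)^{r(2N+1)^{d+1}}}{3r(\ln2)^2(2N+1)^{d+1}},$$ $$c^{*}=\frac{4\tilde c}{2^{\frac{p+q}{pq}}\alpha_1}\Big(\sum_{k_1\in\mathbb{Z}}\frac{1}{(1+|k_1|)^{\frac{s_1p}{p-1}}}\Big)^{\frac{p-1}{p}}\Big(\sum_{k_2\in\mathbb{Z}^d}\frac{1}{(1+|k_2|)^{\frac{s_2q}{q-1}}}\Big)^{\frac{q-1}{q}}.$$
   Context: Mixed norms: for measurable $f:\mathbb{R}\times\mathbb{R}^d\to\mathbb{C}$, $\|f\|_{L^{p,q}(\mathbb{R}\times\mathbb{R}^d)}=\big(\int_{\mathbb{R}}(\int_{\mathbb{R}^d}|f(x,y)|^q\,dy)^{p/q}dx\big)^{1/p}$; $L^{1,1}(C_K)=L^1(C_K)$. For sequences, $\|c\|_{l^{p,q}}=\big(\sum_{k_1\in\mathbb{Z}}(\sum_{k_2\in\mathbb{Z}^d}|c(k_1,k_2)|^q)^{p/q}\big)^{1/p}$. For $\mathbf{c}=(c_1,\dots,c_r)^T$, $\|\mathbf{c}\|_{l^{p,q}}=\sum_{i=1}^r\|c_i\|_{l^{p,q}}$. On $\mathbb{Z}^d$ and $\mathbb{R}^d$, $|\cdot|$ denotes the maximum norm. Spaces: $\Phi=(\phi_1,\dots,\phi_r)^T$ with $\phi_i\in L^{p,q}(\mathbb{R}\times\mathbb{R}^d)$.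 For $N\in\mathbb{N}$, $V_N^{p,q}(\Phi)=\{\sum_{i=1}^r\sum_{|k_1|\le N}\sum_{|k_2|\le N}c_i(k_1,k_2)\phi_i(\cdot-k_1,\cdot-k_2)\}$ ($k_1\in\mathbb{Z}$, $k_2\in\mathbb{Z}^d$, arbitrary complex coefficients). For $0<\mu\le1$, $V_{N,\psi}^{p,q}(\Phi,\mu,C_K)=\{f\in V_N^{p,q}(\Phi):\mu\|\psi\|_{L^1(\mathbb{R}^{d+1})}\|f\|_{L^{p,q}(\mathbb{R}\times\mathbb{R}^d)}\le\int_{C_K}|(f*\psi)(x,y)|\,dx\,dy\}$. Assumptions: $(A_1)$ There are positive constants $\alpha_1,\alpha_2$ with $\alpha_1\|\mathbf{c}\|_{l^{p,q}}\le\big\|\sum_{k_1\in\mathbb{Z}}\sum_{k_2\in\mathbb{Z}^d}\mathbf{c}^T(k_1,k_2)\Phi(\cdot-k_1,\cdot-k_2)\big\|_{L^{p,q}(\mathbb{R}\times\mathbb{R}^d)}\le\alpha_2\|\mathbf{c}\|_{l^{p,q}}$ for all $\mathbf{c}\in(l^{p,q}(\mathbb{Z}\times\mathbb{Z}^d))^r$; moreover each $\phi_i$ is continuous and $|\phi_i(x,y)|\le\frac{\tilde c}{(1+|x|)^{s_1}(1+|y|)^{s_2}}$ for all $(x,y)\in\mathbb{R}\times\mathbb{R}^d$, with constants $\tilde c>0$ and $s_1,s_2>d+1-\frac1p-\frac dq$, $s_1,s_2>0$. $(A_2)$ $\psi\in L^1(\mathbb{R}^{d+1})$ with $\mathrm{supp}(\psi)\subseteq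 C_K$. $(A_3)$ $\rho$ is a probability density function on $C_K$ with $\mathcal{C}_{\rho,1}\le\rho(x,y)\le\mathcal{C}_{\rho,2}$ for all $(x,y)\in C_K$, where $\mathcal{C}_{\rho,1},\mathcal{C}_{\rho,2}$ are positive constants. Convention: $(x_j,y_k)$ is the name of the random point of $C_K$ indexed by the pair $(j,k)$; the points for different pairs $(j,k)$ are independent and identically distributed. *)

(* Defs.v *)
From HB Require Import structures.
From mathcomp Require Import all_boot all_order all_algebra.
From mathcomp Require Import complex.
From mathcomp Require Import all_classical all_reals all_analysis.

Set Implicit Arguments.
Unset Strict Implicit.
Unset Printing Implicit Defensive.

Import Order.TTheory GRing.Theory Num.Theory.
Import ComplexField.Normc.
Import numFieldNormedType.Exports.

Local Open Scope classical_set_scope.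
Local Open Scope ring_scope.

(* R[i] is not an instance of the topological structures in either library;
   this is the topology of the modulus. *)
HB.instance Definition _ (R : rcfType) := NormedModule.copy R[i] R[i]^o.

(* R^d is 'rV[R]_d, whose library norm `|v| is the maximum norm. It carries no
   sigma-algebra in the library: we use the one generated by the coordinates. *)
Definition measure_rV_display : measure_display.
Proof. exact: default_measure_display. Qed.

Section measurable_rV.
Variables (R : realType) (d : nat).

Let coors (i : 'I_d) (v : 'rV[R]_d) : R := v ord0 i.

Let rV_set0 : g_sigma_preimage coors set0.
Proof. exact: sigma_algebra0. Qed.

Let rV_setC A : g_sigma_preimage coors A -> g_sigma_preimage coors (~` A).
Proof. exact: sigma_algebraC. Qed.

Let rV_bigcup (F : (set _)^nat) : (forall i, g_sigma_preimage coors (F i)) ->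
  g_sigma_preimage coors (\bigcup_i (F i)).
Proof. exact: sigma_algebra_bigcup. Qed.

HB.instance Definition _ := @isMeasurable.Build measure_rV_display ('rV[R]_d)
  (g_sigma_preimage coors) rV_set0 rV_setC rV_bigcup.

Lemma measurable_coord (i : 'I_d) :
  measurable_fun [set: 'rV[R]_d] (fun v : 'rV[R]_d => v ord0 i).
Proof.
move=> _ Y mY; rewrite setTI; apply: sub_sigma_algebra => /=.
rewrite -bigcup_seq/=; exists i => /=; first by rewrite mem_index_enum.
by exists Y => //; rewrite setTI.
Qed.

Lemma measurable_fun_rV d1 (T1 : measurableType d1) (f : T1 -> 'rV[R]_d) :
  (forall i, measurable_fun [set: T1] (fun x => f x ord0 i)) ->
  measurable_fun [set: T1] f.
Proof.
move=> mf; apply: (@measurability _ _ _ _ _ _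
  (\big[setU/set0]_(i < d) preimage_set_system setT (coors i) measurable)) => //.
move=> _ [B + <-]; rewrite -bigcup_seq /= => -[i _ [C mC <-]].
rewrite !setTI; have := mf i measurableT C mC; rewrite setTI; exact.
Qed.

End measurable_rV.

(* The library's canonical sigma-finite structure on product_measure1 is keyed
   on subprobabilities, hence this restatement. *)
Lemma sigma_finite_product_measure1 d1 d2 (T1 : measurableType d1)
    (T2 : measurableType d2) (R : realType)
    (m1 : {sigma_finite_measure set T1 -> \bar R})
    (m2 : {sigma_finite_measure set T2 -> \bar R}) :
  sigma_finite setT (m1 \x m2)%E.
Proof.
have /sigma_finiteP[F [TF ndF Foo]] := sigma_finiteT m1.
have /sigma_finiteP[G [TG ndG Goo]] := sigma_finiteT m2.
exists (fun n => F n `*` G n).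
  rewrite -setXTT TF TG predeqE => -[x y]; split.
    move=> [/= [n _ Fnx] [k _ Gky]]; exists (maxn n k) => //; split.
    - by move: x Fnx; exact/subsetPset/ndF/leq_maxl.
    - by move: y Gky; exact/subsetPset/ndG/leq_maxr.
  by move=> [n _ []/= ? ?]; split; exists n.
move=> k; have [? ?] := Foo k; have [? ?] := Goo k.
split; first exact: measurableX.
by rewrite product_measure1E// lte_mul_pinfty// ge0_fin_numE.
Qed.

Definition cons_rV (R : realType) (d : nat) (z : measurableTypeR R * 'rV[R]_d) :
  'rV[R]_d.+1 := row_mx (const_mx z.1 : 'rV[R]_1) z.2.

Definition uncons_rV (R : realType) (d : nat) (v : 'rV[R]_d.+1) :
  measurableTypeR R * 'rV[R]_d := (v ord0 ord0, \row_j v ord0 (lift ord0 j)).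

Fixpoint lebesgue_rV (R : realType) (d : nat) : set 'rV[R]_d -> \bar R :=
  match d with
  | 0%N => \d_(0 : 'rV[R]_0)
  | d'.+1 => pushforward (lebesgue_measure \x @lebesgue_rV R d')%E (@cons_rV R d')
  end.

Section lebesgue_rV_measure.
Variable R : realType.

Lemma cons_rV0 d (z : measurableTypeR R * 'rV[R]_d) : cons_rV z ord0 ord0 = z.1.
Proof. by rewrite /cons_rV mxE; case: splitP => // j _; rewrite mxE. Qed.

Lemma cons_rVS d (z : measurableTypeR R * 'rV[R]_d) (j : 'I_d) :
  cons_rV z ord0 (lift ord0 j) = z.2 ord0 j.
Proof.
rewrite /cons_rV mxE; case: splitP => [[[|k] //]|k /= kj].
by congr (z.2 _ _); apply: val_inj; case: kj.
Qed.

Lemma cons_rVK d : cancel (@cons_rV R d) (@uncons_rV R d).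
Proof.
move=> z; rewrite /uncons_rV cons_rV0 [RHS]surjective_pairing; congr pair.
by apply/rowP => j; rewrite mxE cons_rVS.
Qed.

Lemma measurable_cons_rV d : measurable_fun setT (@cons_rV R d).
Proof.
apply: measurable_fun_rV => i; case: (unliftP ord0 i) => [j|] ->.
  under [X in measurable_fun _ X]eq_fun do rewrite cons_rVS.
  exact: (measurableT_comp (measurable_coord j)).
under [X in measurable_fun _ X]eq_fun do rewrite cons_rV0.
exact: measurable_fst.
Qed.

Lemma measurable_uncons_rV d : measurable_fun setT (@uncons_rV R d).
Proof.
apply: measurable_fun_pair; first exact: measurable_coord.
apply: measurable_fun_rV => i.
under [X in measurable_fun _ X]eq_fun do rewrite mxE.
exact: measurable_coord.
Qed.

Lemma lebesgue_rV_sigma_finite_measure d :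
  exists m : {sigma_finite_measure set 'rV[R]_d -> \bar R},
    (m : set _ -> \bar R) = @lebesgue_rV R d.
Proof.
elim: d => [|d [m mE]]; first by exists \d_(0 : 'rV[R]_0).
have [F FT Foo] := sigma_finite_product_measure1 (@lebesgue_measure R) m.
pose nu : {measure set 'rV[R]_d.+1 -> \bar R} :=
  measure_function_pushforward__canonical__measure_function_Measure
    (lebesgue_measure \x m)%E (@measurable_cons_rV d).
have nu_fin : sigma_finite setT nu.
  exists (fun n => @uncons_rV R d @^-1` F n).
    by rewrite -preimage_bigcup -FT preimage_setT.
  move=> n; have [mFn Fnoo] := Foo n; split.
    by rewrite -[X in measurable X]setTI; exact: measurable_uncons_rV.
  rewrite /nu/= /pushforward/= -comp_preimage.
  by rewrite (_ : _ \o _ = id)//; apply/funext => z /=; rewrite cons_rVK.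
pose sfin := Measure_isSigmaFinite.Build _ _ _ nu nu_fin.
pose nu' : {sigma_finite_measure set 'rV[R]_d.+1 -> \bar R} :=
  HB.pack (nu : set _ -> \bar R) (Measure.class nu) sfin.
by exists nu'; rewrite /= -mE.
Qed.

Section instances.
Variable d : nat.

Let lebesgue_rV0 : @lebesgue_rV R d set0 = 0%E.
Proof. by have [m <-] := lebesgue_rV_sigma_finite_measure d. Qed.

Let lebesgue_rV_ge0 A : (0 <= @lebesgue_rV R d A)%E.
Proof.
by have [m <-] := lebesgue_rV_sigma_finite_measure d; exact: measure_ge0.
Qed.

Let lebesgue_rV_sigma_additive : semi_sigma_additive (@lebesgue_rV R d).
Proof.
have [m <-] := lebesgue_rV_sigma_finite_measure d.
exact: measure_semi_sigma_additive.
Qed.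

HB.instance Definition _ := isMeasure.Build _ _ _ (@lebesgue_rV R d)
  lebesgue_rV0 lebesgue_rV_ge0 lebesgue_rV_sigma_additive.

Let lebesgue_rV_sigma_finite : sigma_finite setT (@lebesgue_rV R d).
Proof.
by have [m <-] := lebesgue_rV_sigma_finite_measure d; exact: sigma_finiteT.
Qed.

HB.instance Definition _ := Measure_isSigmaFinite.Build _ _ _
  (@lebesgue_rV R d) lebesgue_rV_sigma_finite.

End instances.
End lebesgue_rV_measure.

Arguments lebesgue_rV {R d}.

Section spaces.
Variables (R : realType) (d : nat).

Local Notation plane := (measurableTypeR R * 'rV[R]_d)%type.

Definition lebesgue_plane : set plane -> \bar R :=
  (lebesgue_measure \x lebesgue_rV)%E.

HB.instance Definition _ := Measure.on lebesgue_plane.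
HB.instance Definition _ := Measure_isSigmaFinite.Build _ _ _ lebesgue_plane
  (sigma_finite_product_measure1 (@lebesgue_measure R) (@lebesgue_rV R d)).

Definition cmeasurable (f : R * 'rV[R]_d -> R[i]) :=
  measurable_fun [set: plane] (fun z => complex.Re (f z)) /\
  measurable_fun [set: plane] (fun z => complex.Im (f z)).

Definition cintegral (f : R * 'rV[R]_d -> R[i]) : R[i] :=
  Complex (\int[lebesgue_plane]_z complex.Re (f z))
          (\int[lebesgue_plane]_z complex.Im (f z)).

Definition mixed_norm (p q : R) (f : R * 'rV[R]_d -> R[i]) : \bar R :=
  ((\int[lebesgue_measure]_x
     ((\int[lebesgue_rV]_y ((normc (f (x, y)) `^ q)%:E)) `^ (p / q))) `^ p^-1)%E.

Definition in_Lpq (p q : R) (f : R * 'rV[R]_d -> R[i]) :=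
  cmeasurable f /\ (mixed_norm p q f < +oo)%E.

Definition L1norm (D : set (R * 'rV[R]_d)) (f : R * 'rV[R]_d -> R[i]) : \bar R :=
  (\int[lebesgue_plane]_(z in D) (normc (f z))%:E)%E.

Definition in_L1 (f : R * 'rV[R]_d -> R[i]) :=
  cmeasurable f /\ (L1norm setT f < +oo)%E.

Definition convolution (f g : R * 'rV[R]_d -> R[i]) (z : R * 'rV[R]_d) : R[i] :=
  cintegral (fun w => f (z - w) * g w).

(* The support of a class of functions modulo null sets: the complement of the
   union of the open sets on which the function vanishes almost everywhere. *)
Definition ess_support (f : R * 'rV[R]_d -> R[i]) : set (R * 'rV[R]_d) :=
  [set z | forall U, open_nbhs z U ->
     ~ {ae lebesgue_plane, forall w, U w -> f w = 0}].

Definition box (K1 K2 : R) : set (R * 'rV[R]_d) :=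
  [set z : R * 'rV[R]_d | - K1 <= z.1 <= K1 /\
     forall i, - K2 <= z.2 ord0 i <= K2].

End spaces.

Section shift_spaces.
Variable R : realType.

(* Sums of absolutely summable families, indexed by a countable type without a
   preferred enumeration. *)
Definition family_sum (I : choiceType) (u : I -> R) : R :=
  fine (\esum_(i in [set: I]) (Num.max (u i) 0)%:E) -
  fine (\esum_(i in [set: I]) (Num.max (- u i) 0)%:E).

Definition cfamily_sum (I : choiceType) (u : I -> R[i]) : R[i] :=
  Complex (family_sum (fun i => complex.Re (u i)))
          (family_sum (fun i => complex.Im (u i))).

Variables d r : nat.

Local Notation lattice := (int * 'rV[int]_d)%type.

Definition lattice_point (k : lattice) : R * 'rV[R]_d :=
  (k.1%:~R, map_mx intr k.2).

Definition seq_norm (p q : R) (c : lattice -> R[i]) : \bar R :=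
  ((\esum_(k1 in [set: int])
     ((\esum_(k2 in [set: 'rV[int]_d]) ((normc (c (k1, k2)) `^ q)%:E))
        `^ (p / q))) `^ p^-1)%E.

Definition vseq_norm (p q : R) (c : 'I_r -> lattice -> R[i]) : \bar R :=
  (\sum_(i < r) seq_norm p q (c i))%E.

Implicit Types (Phi : 'I_r -> R * 'rV[R]_d -> R[i]).

Definition shift_series Phi (c : 'I_r -> lattice -> R[i])
    (z : R * 'rV[R]_d) : R[i] :=
  cfamily_sum (fun k : lattice =>
    \sum_(i < r) c i k * Phi i (z - lattice_point k)).

Definition stable_shifts (p q alpha1 alpha2 : R) Phi :=
  forall c : 'I_r -> lattice -> R[i],
    (forall i, seq_norm p q (c i) < +oo)%E ->
    (alpha1%:E * vseq_norm p q c <= mixed_norm p q (shift_series Phi c))%E /\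
    (mixed_norm p q (shift_series Phi c) <= alpha2%:E * vseq_norm p q c)%E.

Definition decaying (ct s1 s2 : R) (f : R * 'rV[R]_d -> R[i]) :=
  forall z : R * 'rV[R]_d,
    normc (f z) <= ct / ((1 + `|z.1|) `^ s1 * (1 + `|z.2|) `^ s2).

Definition lattice_ball (N : nat) : set lattice :=
  [set k | `|(lattice_point k).1| <= N%:R /\ `|(lattice_point k).2| <= N%:R].

Definition shift_space (N : nat) Phi : set (R * 'rV[R]_d -> R[i]) :=
  [set f | exists c : 'I_r -> lattice -> R[i],
     f = (fun z => \sum_(i < r) \sum_(k \in lattice_ball N)
                     c i k * Phi i (z - lattice_point k))].

Definition concentrated_space (p q : R) (N : nat)
    (psi : R * 'rV[R]_d -> R[i]) Phi (mu : R) (CK : set (R * 'rV[R]_d)) :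
    set (R * 'rV[R]_d -> R[i]) :=
  [set f | shift_space N Phi f /\
     (mu%:E * L1norm setT psi * mixed_norm p q f
      <= L1norm CK (convolution f psi))%E].

Definition cstar (p q ct alpha1 s1 s2 : R) : R :=
  4 * ct / (2 `^ ((p + q) / (p * q)) * alpha1)
  * (family_sum (fun k1 : int =>
       1 / (1 + `|k1%:~R : R|) `^ (s1 * p / (p - 1)))) `^ ((p - 1) / p)
  * (family_sum (fun k2 : 'rV[int]_d =>
       1 / (1 + `|map_mx intr k2 : 'rV[R]_d|) `^ (s2 * q / (q - 1))))
    `^ ((q - 1) / q).

Definition coef_A1 (N : nat) (cs : R) : R :=
  2 * expR ((r * (2 * N + 1) ^ d.+1)%:R * ln (4 * cs + 1)).

Definition coef_A2 (N : nat) (cs : R) : R :=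
  4 * ((2 * cs + 1 / 4) * (cs + 1 / 4)) ^+ (r * (2 * N + 1) ^ d.+1)
  / (3 * r%:R * ln 2 ^+ 2 * ((2 * N + 1) ^ d.+1)%:R).

End shift_spaces.

Definition mutually_independent dT dV (T : measurableType dT)
    (V : measurableType dV) (R : realType) (P : probability T R) (I : eqType)
    (X : I -> T -> V) :=
  forall (s : seq I) (A : I -> set V), uniq s -> (forall i, measurable (A i)) ->
    P (\big[setI/setT]_(i <- s) (X i @^-1` A i)) =
    (\prod_(i <- s) P (X i @^-1` A i))%E.

(* rho is a density on CK: its values outside CK are irrelevant. *)
Definition prob_density (R : realType) (d : nat) (CK : set (R * 'rV[R]_d))
    (rho : R * 'rV[R]_d -> R) :=
  measurable_fun (CK : set (measurableTypeR R * 'rV[R]_d)) rho /\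
  (forall z, CK z -> 0 <= rho z) /\
  (\int[@lebesgue_plane R d]_(z in CK) (rho z)%:E = 1)%E.

(* Main.v *)
Require Import Defs.
From mathcomp Require Import zify.
From mathcomp Require Import all_boot all_order all_algebra.
From mathcomp Require Import complex.
From mathcomp Require Import all_classical all_reals all_analysis.
From mathcomp Require Import measurable_realfun.
From mathcomp Require Import ring lra.

Set Implicit Arguments.
Unset Strict Implicit.
Unset Printing Implicit Defensive.

Import Order.TTheory GRing.Theory Num.Theory.
Import ComplexField.Normc.
Import numFieldNormedType.Exports.

Local Open Scope classical_set_scope.
Local Open Scope ring_scope.

(** Stability of the shifts and Hoelder's inequality bound every [f] in the shift
    space on [C_K - C_K] by [B = k * U ^ ((q - 1) / q)] times its norm, where [U] is
    the supremum, over the difference of two copies of the window, of the lattice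
    sum [S y = \sum_k (1 + |y - k|) ^ (- s2 * q / (q - 1))], and
    [c^* = k * (2 * S 0) ^ ((q - 1) / q)] (the full lattice sum at [0]).  Since [U]
    can exceed [2 * S 0] by an arbitrarily large factor as [d] grows, the constants
    rest on a dichotomy: either [U <= 2.3 * (2 * S 0)], or one shell of lattice
    points dominates [U], and then the mean [A] of [S] over every translate of the
    window is so small that [U * A <= 1.04 * (2 * S 0) ^ 2].  In the first case
    [B <= 2.3 * c^*] and one-sided Hoeffding bounds suffice; in the second the
    second moment of a sample is at most [B] times its mean, and Bernstein bounds
    apply with [B * h <= 1.04 * c^* ^ 2], where [h] bounds the means.  Uniformity
    over [f] comes from chaining along nets of the unit ball of the coefficient
    space, of real dimension [2 * r * (2 * N + 1) ^ (d + 1)]; the same nets write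
    the event as a countable intersection. *)

(** * Lattice sums *)

(** Why a single shell can dominate: moving the centre from a lattice point to a half-integer point
    replaces the count [(2k+1)^d] at radius [k] by [(2k+2)^d] at radius [k + 1/2]. With [m = 2k + 3]
    and [s = s2 q / (q-1)], the new term exceeds that of shell [k] only if [s < d (1 + 1/(m-2))],
    and that of shell [k+1] only if [s > d (1 + 1/m)]; for different [k] these ranges are disjoint.
    Two more obstacles shape the proof. With [D = r (2N+1)^(d+1)], the first net of the chaining has
    up to [(4c+1)^(2D)] points, but the claimed constant allows only [(4c+1)^D]. The surplus is paid
    by half of a doubled exponent, since the claim is trivial unless
    [2 (4c+1)^D <= exp (M eta^2 / (8 c^2))]. Moreover [rho] may put its mass where the lattice sum
    is large, so a mean under [rho] is controlled only by the geometric mean of [h] and the constant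
    [Top] of the upper inequality. For the lower tail the samples are therefore reweighted to the
    constant density [C1]; for the upper tail the gap between that geometric mean and [Top] is spent
    on a larger deviation. *)

Section log_inequalities.
Variable R : realType.
Implicit Types (a b i m x y : R).

Lemma ln_leB1 x : 0 < x -> ln x <= x - 1.
Proof.
move=> x0; rewrite -ler_expR lnK ?posrE//.
by apply: le_trans (expR_ge1Dx _); rewrite addrC subrK.
Qed.

(** Weighted arithmetic-geometric inequality for [i / m] with weight [m] and [y] with weight [1]:
    the tangent bounds of [ln] at the mean [t] are added, and their linear parts cancel ([h3]). *)
Lemma ln_weighted_AGM m i y : 0 < m -> 0 < i -> 0 < y ->
  m * (ln i - ln m) + ln y <= (m + 1) * (ln (i + y) - ln (m + 1)).
Proof.
move=> m0 i0 y0; have [t tD] : exists t, t = (i + y) / (m + 1) by eexists.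
have m10 : 0 < m + 1 by lra.
have t0 : 0 < t by rewrite tD divr_gt0 ?addr_gt0.
have tE : ln t = ln (i + y) - ln (m + 1) by rewrite tD ln_div ?posrE ?addr_gt0.
rewrite -tE.
have := ln_leB1 (divr_gt0 (divr_gt0 i0 m0) t0).
rewrite !ln_div ?posrE ?divr_gt0// => h1.
have := ln_leB1 (divr_gt0 y0 t0).
rewrite !ln_div ?posrE ?divr_gt0// => h2.
have h3 : m * (i / m / t - 1) + (y / t - 1) = 0.
  rewrite tD; field; lra.
have : m * (ln i - ln m - ln t) <= m * (i / m / t - 1) by rewrite ler_pM2l.
lra.
Qed.

End log_inequalities.

(** * One half-integer shell against its two neighbours *)

Section spike.
Variables (R : realType) (d s : R).
Hypothesis d0 : 0 < d.

(** Logarithm of [a ^ d * b ^ (- s)], a number of lattice points times the profile at radius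
    [b - 1]. With [m = 2k + 3], the notations [x] and [x'] below are the shells [k] and [k + 1] seen
    from a lattice point, and [w] is the shell of radius [k + 1/2] seen from a half-integer
    point. *)
Definition logterm (a b : R) := d * ln a - s * ln b.

Variable m : R.
Hypothesis m3 : 3 <= m.

Local Notation x := (logterm (m - 2) ((m - 1) / 2)).
Local Notation w := (logterm (m - 1) (m / 2)).
Local Notation x' := (logterm m ((m + 1) / 2)).

Let ln2 (a : R) : 0 < a -> ln (a / 2) = ln a - ln 2.
Proof. by move=> a0; rewrite ln_div ?posrE. Qed.

(** The quantity [n (ln (n+1) - ln n)] increases with [n], so going from [m - 2] to [m - 1] points
    gains at most [d (m-1) / (m-2)] times the increment of the logarithm of the radius; for larger
    [s] the decay wins. *)
Lemma logterm_down : d * (m - 1) / (m - 2) <= s -> w <= x.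
Proof.
move=> hs; have m3' := m3; have d0' := d0; rewrite /logterm !ln2; try lra.
have := @ln_weighted_AGM R (m - 2) (m - 1) 1; rewrite ln1.
have -> : m - 2 + 1 = m - 1 by ring.
have -> : m - 1 + 1 = m by ring.
move=> /(_ ltac:(lra) ltac:(lra) ltac:(lra)).
set a := ln (m - 2); set b := ln (m - 1); set c := ln m => h.
have cb : 0 <= c - b by rewrite subr_ge0 ler_ln ?posrE; lra.
have h1 : d * (b - a) <= d * (m - 1) / (m - 2) * (c - b).
  rewrite -mulrA -mulrA ler_pM2l// mulrCA ler_pdivlMl; lra.
have h2 : d * (m - 1) / (m - 2) * (c - b) <= s * (c - b) by apply: ler_wpM2r.
lra.
Qed.

(** Here [n (ln n - ln (n-1))] decreases with [n], which is the form suited to a comparison with the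
    next shell. *)
Lemma ln_consecutive :
  (m + 1) * (ln (m + 1) - ln m) <= m * (ln m - ln (m - 1)).
Proof.
have m3' := m3; have := @ln_weighted_AGM R m (m - 1) 1; rewrite ln1 subrK.
move=> /(_ ltac:(lra) ltac:(lra) ltac:(lra)); lra.
Qed.

Lemma logterm_up : s <= d * (m + 1) / m -> w <= x'.
Proof.
move=> hs; have m3' := m3; have d0' := d0; rewrite /logterm !ln2; try lra.
have := ln_consecutive.
set e := ln (m + 1); set b := ln (m - 1); set c := ln m => h.
have cb : 0 <= e - c by rewrite subr_ge0 ler_ln ?posrE; lra.
have h1 : d * (m + 1) / m * (e - c) <= d * (c - b).
  by rewrite -mulrA -mulrA ler_pM2l// mulrCA ler_pdivrMl; lra.
have h2 : s * (e - c) <= d * (m + 1) / m * (e - c) by apply: ler_wpM2r.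
lra.
Qed.

(* [y i] is the logarithm of the contribution of the count [i] on the shells
   from radius [(i + 13/10) / 2] on. *)
Local Notation y := (fun i => logterm i ((i + 13/10) / 2)).

(** Concavity at the count [m]. The offset [13/10], in place of the [1] of a full shell, is the
    source of the gain [d / m * ln (13/10)]; the slope of the remaining term is positive under the
    spike condition. *)
Lemma logterm_le_next i : 0 < i ->
  y i <= x' - d / m * ln (13/10) + (s - d * (m + 1) / m) * (ln (m + 1) - ln (i + 13/10)).
Proof.
move=> i0; have m3' := m3; have d0' := d0; rewrite /logterm !ln2; try lra.
have := @ln_weighted_AGM R m i (13/10) ltac:(lra) i0 ltac:(lra).
set a := ln i; set b := ln (13/10); set c := ln m; set e := ln (m + 1).
set f := ln (i + _) => h.
have : d / m * (m * (a - c) + b) <= d / m * ((m + 1) * (f - e)).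
  by rewrite ler_pM2l// divr_gt0//; lra.
have -> : d / m * (m * (a - c) + b) = d * (a - c) + d / m * b.
  by field; lra.
have -> : d / m * ((m + 1) * (f - e)) = d * (m + 1) / m * (f - e) by ring.
lra.
Qed.

Lemma logterm_le_prev i : 0 < i ->
  y i <= x - d / (m - 2) * ln (13/10)
       + (d * (m - 1) / (m - 2) - s) * (ln (i + 13/10) - ln (m - 1)).
Proof.
move=> i0; have m3' := m3; have d0' := d0; rewrite /logterm !ln2; try lra.
have := @ln_weighted_AGM R (m - 2) i (13/10) ltac:(lra) i0 ltac:(lra).
have -> : m - 2 + 1 = m - 1 by ring.
set a := ln i; set b := ln (13/10); set c := ln (m - 2); set e := ln (m - 1).
set f := ln (i + _) => h.
have : d / (m - 2) * ((m - 2) * (a - c) + b) <= d / (m - 2) * ((m - 1) * (f - e)).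
  by rewrite ler_pM2l// divr_gt0//; lra.
have -> : d / (m - 2) * ((m - 2) * (a - c) + b) = d * (a - c) + d / (m - 2) * b.
  by field; lra.
have -> : d / (m - 2) * ((m - 1) * (f - e)) = d * (m - 1) / (m - 2) * (f - e) by ring.
lra.
Qed.

Hypothesis sP : d * (m + 1) / m < s.

Let ds : d < s.
Proof.
have m3' := m3; apply: lt_trans sP; rewrite ltr_pdivlMr; last lra.
by rewrite ltr_pM2l//; lra.
Qed.

(* The shells of the spike are rare: this bounds how far the spike can exceed
   the geometric mean of its two neighbours. *)
Lemma spike_excess : 5 <= m ->
  (w - x) + (w - x') <= d * (2 * m - 1) / (m ^+ 3 * (m - 2)).
Proof.
move=> m5; have m3' := m3; have d0' := d0; rewrite /logterm !ln2; try lra.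
(* Writing [s = d + (s - d)], the excess is [d] times the logarithm of this ratio minus a
   nonnegative multiple of [s - d]; the ratio exceeds 1 only by [(2m-1) / (m^3 (m-2))]. *)
have := @ln_leB1 R ((m - 1) ^+ 3 * (m + 1) / (m ^+ 3 * (m - 2))).
have p1 : 0 < m - 1 by lra.
have p2 : 0 < m - 2 by lra.
have p3 : 0 < m by lra.
have p4 : 0 < m + 1 by lra.
rewrite divr_gt0 ?mulr_gt0 ?exprn_gt0// => /(_ isT).
rewrite ln_div ?posrE ?mulr_gt0 ?exprn_gt0//.
rewrite [ln ((m - 1) ^+ 3 * _)]lnM ?[ln (m ^+ 3 * _)]lnM ?posrE ?exprn_gt0// !lnXn//.
have -> : (m - 1) ^+ 3 * (m + 1) / (m ^+ 3 * (m - 2)) - 1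
   = (2 * m - 1) / (m ^+ 3 * (m - 2)) by field; lra.
set a := ln (m - 2); set b := ln (m - 1); set c := ln m; set e := ln (m + 1).
set k := _ / _ => h.
have h1 : b + e <= 2 * c.
  rewrite -lnM ?posrE// mulr_natl -lnXn// ler_ln ?posrE ?mulr_gt0 ?exprn_gt0//.
  by rewrite -subr_ge0; have -> : m ^+ 2 - (m - 1) * (m + 1) = 1 by ring.
have ds' := ds; have h2 : 0 <= (s - d) * (2 * c - b - e) by apply: mulr_ge0; lra.
have h3 : d * (b *+ 3 + e - (c *+ 3 + a)) <= d * k by rewrite ler_pM2l.
rewrite -mulrA -/k; lra.
Qed.

(** For centres within [9/20] of the origin the larger count is available only from radius
    [k + 11/20] on. The additional [1/20] erases the spike: the term falls below the geometric mean
    of its neighbours. *)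
Lemma logterm_ramp : 5 <= m ->
  logterm (m - 1) ((m + 1/10) / 2) <= (x + x') / 2.
Proof.
move=> m5; have m3' := m3; have d0' := d0; rewrite /logterm !ln2; try lra.
have p1 : 0 < m - 1 by lra.
have p2 : 0 < m - 2 by lra.
have p3 : 0 < m by lra.
have p4 : 0 < m + 1 by lra.
have p5 : 0 < m + 1/10 by lra.
have h : ln (m - 1) *+ 2 + ln (m - 1) + ln (m + 1) <= ln m + ln (m - 2) + ln (m + 1/10) *+ 2.
  rewrite -!lnXn// -!lnM ?posrE ?mulr_gt0 ?exprn_gt0//.
  rewrite ler_ln ?posrE ?mulr_gt0 ?exprn_gt0//.
  rewrite -subr_ge0.
  have -> : m * (m - 2) * (m + 1/10) ^+ 2 - (m - 1) ^+ 2 * (m - 1) * (m + 1)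
    = m ^+ 2 * (1/5 * m - 39/100) - (2 + 1/50) * m + 1 by field.
  have q1 : 5 * m <= m ^+ 2 by rewrite expr2 ler_pM2r.
  have q2 : 5 * m * (61/100) <= m ^+ 2 * (1/5 * m - 39/100).
    by apply: ler_pM => //; lra.
  lra.
have h1 : ln (m - 1) + ln (m + 1) <= ln (m + 1/10) *+ 2.
  rewrite -lnXn// -lnM ?posrE// ler_ln ?posrE ?mulr_gt0 ?exprn_gt0//.
  rewrite -subr_ge0; have -> : (m + 1/10) ^+ 2 - (m - 1) * (m + 1) = 1/5 * m + 101/100 by field.
  lra.
have ds' := ds; have h2 : 0 <= (s - d) * (ln (m + 1/10) *+ 2 - ln (m - 1) - ln (m + 1)).
  by apply: mulr_ge0; lra.
have h3 : 0 <= d * (ln m + ln (m - 2) + ln (m + 1/10) *+ 2 - (ln (m - 1) *+ 2 + ln (m - 1) + ln (m + 1))).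
  by apply: mulr_ge0; lra.
lra.
Qed.

End spike.

(** * The averaged terms under a high spike *)

Section spike_terms.
Variables (R : realType) (d s m : R).
Hypotheses (d0 : 0 < d) (m3 : 3 <= m).

Local Notation x := (logterm d s (m - 2) ((m - 1) / 2)).
Local Notation w := (logterm d s (m - 1) (m / 2)).
Local Notation x' := (logterm d s m ((m + 1) / 2)).
Local Notation y i := (logterm d s i ((i + 13/10) / 2)).

Hypotheses (sP : d * (m + 1) / m < s) (sQ : s < d * (m - 1) / (m - 2)).
Hypotheses (wx : 9/10 <= w - x) (wx' : 9/10 <= w - x').

(** A height [9/10] over the next shell forces [s - d (m+1) / m >= 2], because its product with
    [ln ((m+1)/m) <= 1/3] is at least [9/10]. The later terms thus decay at least like inverse
    squares. *)
Lemma spike_after i : m - 3/10 <= i ->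
  y i <= x' - d / m * ln (13/10) + 2 * (ln (m + 1) - ln (i + 13/10)).
Proof.
move=> mi; have m3' := m3; have d0' := d0.
apply: le_trans (logterm_le_next s d0' m3' _) _; first lra.
rewrite lerD2l; apply: ler_wnM2r.
  by rewrite subr_le0 ler_ln ?posrE; lra.
have wx'' := wx'; move: wx''; rewrite /logterm !ln_div ?posrE; try lra.
have := @ln_consecutive R m m3'; set e := ln (m + 1); set b := ln (m - 1).
set c := ln m => h h'.
have ec : m * (e - c) <= 1.
  have := @ln_leB1 R ((m + 1) / m); rewrite divr_gt0; try lra.
  move=> /(_ isT); rewrite ln_div ?posrE; try lra.
  rewrite -/e -/c; have -> : (m + 1) / m - 1 = m^-1 by field; lra.
  by rewrite -(ler_pM2l (x := m)) ?divff; lra.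
have ec0 : 0 < e - c by rewrite subr_gt0 ltr_ln ?posrE; lra.
have h2 : d / m * ((m + 1) * (e - c)) <= d / m * (m * (c - b)).
  by rewrite ler_pM2l// divr_gt0//; lra.
have h3 : d / m * (m * (c - b)) = d * (c - b) by field; lra.
have h4 : 9/10 <= (s - d * (m + 1) / m) * (e - c).
  have -> : (s - d * (m + 1) / m) * (e - c) = s * (e - c) - d / m * ((m + 1) * (e - c)) by ring.
  lra.
rewrite -(ler_pM2r ec0); apply: le_trans h4.
have : 3 * (e - c) <= m * (e - c) by rewrite ler_pM2r//.
lra.
Qed.

(** Below the spike the bound of [logterm_le_prev] grows with [i], with a slope [Q] of order
    [d / m^2]. Lowering [ln (13/10)] to [ln (5/4)] in the gain pays for this growth. *)
Lemma spike_before i : 5 <= m -> 0 < i -> i <= m - 1 ->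
  y i <= x - d / m * ln (5/4).
Proof.
move=> m5 i0 im; have m3' := m3; have d0' := d0.
apply: le_trans (logterm_le_prev s d0' m3' i0) _.
set Q := _ - s; set f := ln (i + _) - _.
have d1 : 0 < d / (m * (m - 2)) by rewrite divr_gt0// mulr_gt0; lra.
have Q0 : 0 < Q by rewrite subr_gt0; exact: sQ.
have Q1 : Q <= d / (m * (m - 2)) * 2.
  have sP' := sP; rewrite /Q; apply: le_trans (lerB (lexx _) (ltW sP')) _.
  by rewrite le_eqVlt; apply/orP; left; apply/eqP; field; lra.
(* [(m + 3/10) / (m - 1)] is largest at [m = 5], where it equals [53/40]. *)
have f1 : f <= ln (53/40).
  rewrite /f lerBlDr -lnM ?posrE; try lra.
  by rewrite ler_ln ?posrE; lra.
have h0 : 0 <= ln (53/40 : R) by rewrite ln_ge0; lra.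
have h1 : Q * f <= d / (m * (m - 2)) * (2 * ln (53/40)).
  rewrite mulrA; apply: (@le_trans _ _ (Q * ln (53/40))); first by rewrite ler_pM2l.
  by rewrite ler_wpM2r.
have l2 : ln (5/4 : R) <= ln (13/10) by rewrite ler_ln ?posrE; lra.
have l3 : ln (13/10 : R) *+ 5 >= ln (5/4) *+ 3 + ln (53/40) *+ 2.
  have : ln (5/4 : R) + ln (53/40) <= ln (13/10) + ln (13/10).
    rewrite -!lnM ?posrE; try lra.
    by rewrite ler_ln ?posrE; lra.
  lra.
have h2 : 0 <= d / (m * (m - 2)) * ((m - 5) * (ln (13/10) - ln (5/4)) + (ln (13/10) *+ 5 - (ln (5/4) *+ 3 + ln (53/40) *+ 2))).
  apply: mulr_ge0; first exact: ltW.
  by apply: addr_ge0; [apply: mulr_ge0|]; lra.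
have h3 : d / (m - 2) * ln (13/10) = d / (m * (m - 2)) * (m * ln (13/10)) by field; lra.
have h4 : d / m * ln (5/4) = d / (m * (m - 2)) * ((m - 2) * ln (5/4)) by field; lra.
rewrite h3 h4; lra.
Qed.

(** [w] is the mean of its neighbours plus half the excess [g]. By [spike_excess] a large [g] needs
    a large [d], so that [d / m * ln (5/4)], with [ln (5/4) >= 1/5], is at least [33/100 * m * g];
    finally [g >= 9/5]. *)
Lemma spike_gain : 5 <= m ->
  w - d / m * ln (5/4) <= (x + x') / 2 - (m * (33/100) - 1/2) * (9/5).
Proof.
move=> m5; have m3' := m3; have d0' := d0; have wx1 := wx; have wx2 := wx'.
have := @spike_excess R d s d0' m m3' sP m5.
set g := w - x + _ => h.
have p2 : 0 < m - 2 by lra.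
have l5 : 1/5 <= ln (5/4 : R).
  have := @ln_leB1 R (4/5) ltac:(lra).
  by have -> : (4/5 : R) = (5/4)^-1; [field | rewrite lnV ?posrE; lra].
have h1 : m * (33/100) * g <= d / m * (1/5).
  apply: (@le_trans _ _ (m * (33/100) * (d * (2 * m - 1) / (m ^+ 3 * (m - 2))))).
    by rewrite ler_pM2l//; lra.
  rewrite -subr_ge0.
  have -> : d / m * (1/5) - m * (33/100) * (d * (2 * m - 1) / (m ^+ 3 * (m - 2)))
     = d / (m ^+ 2 * (m - 2)) * ((m * (m - 5) + 3 * (m - 5) + 15 - 33/20 * (2 * m - 1)) / 5) by field; lra.
  have p1 : 0 <= m ^+ 2 * (m - 2) by apply: mulr_ge0; [apply: exprn_ge0|]; lra.
  apply: mulr_ge0; first by rewrite divr_ge0// ltW.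
  have q0 : 0 <= (m - 1/2) * (m - 5) by apply: mulr_ge0; lra.
  by lra.
have h2 : d / m * (1/5) <= d / m * ln (5/4) by rewrite ler_pM2l// divr_gt0//; lra.
have h3 : (m * (33/100) - 1/2) * (9/5) <= (m * (33/100) - 1/2) * g.
  by rewrite /g ler_pM2l; lra.
rewrite /g in h1 h3; lra.
Qed.

(** An excess of [9/5] in [spike_excess] bounds [d] from below: high spikes exist only in high
    dimension. *)
Lemma spike_dim : 5 <= m -> 5 * (m + 1) / 2 <= d.
Proof.
move=> m5; have m3' := m3; have d0' := d0; have wx1 := wx; have wx2 := wx'.
have := @spike_excess R d s d0' m m3' sP m5.
set g := w - x + _ => h.
have {h} : 9/5 <= d * (2 * m - 1) / (m ^+ 3 * (m - 2)) by rewrite /g in h; lra.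
have p2 : 0 < m - 2 by lra.
have p : 0 < m ^+ 3 * (m - 2) by rewrite mulr_gt0// exprn_gt0//; lra.
rewrite ler_pdivlMr// => h.
have q1 : 5 * m <= m ^+ 2 by rewrite expr2 ler_pM2r; lra.
have q2 : m ^+ 2 * 15 <= m ^+ 3 * (m - 2).
  rewrite (exprSr m 2) -mulrA ler_pM2l; last by rewrite exprn_gt0; lra.
  by rewrite -[X in X <= _](_ : 5 * 3 = _); [apply: ler_pM; lra | ring].
rewrite leNgt; apply/negP => h'.
have q3 : d * (2 * m - 1) <= 5 * (m + 1) / 2 * (2 * m - 1) by rewrite ler_pM2r; lra.
have q4 : 5 * (m + 1) / 2 * (2 * m - 1) = 5 * m ^+ 2 + 5/2 * m - 5/2 by field.
rewrite q4 in q3; lra.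
Qed.

End spike_terms.

(** * The first shell, [m = 3], by explicit numbers *)

Section first_spike.
Variables (R : realType) (d s : R).
Hypotheses (d0 : 0 < d) (s0 : 0 <= s) (s2d : s <= 2 * d).

Local Notation x' := (logterm d s 3 2).
Local Notation w := (logterm d s 2 (3/2)).
Local Notation y i := (logterm d s i ((i + 13/10) / 2)).
Local Notation spike := (ln (13/5 : R)).

Hypotheses (hw : spike < w) (hw' : spike < w - x').

(** A linear form on the cone [0 <= s <= 2d] is nonpositive as soon as it is so on the edges [s = 0]
    and [s = 2d]. *)
Let lin (p r : R) : p <= 0 -> p + 2 * r <= 0 -> d * p + s * r <= 0.
Proof.
move=> p0 pr0; have d0' := d0; have s0' := s0; have s2d' := s2d.
have h1 : 0 <= s * (- (p + 2 * r)) by rewrite mulr_ge0//; lra.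
have h2 : 0 <= (2 * d - s) * (- p) by rewrite mulr_ge0//; lra.
lra.
Qed.

Let ln_le (a b : R) : 0 < a -> a <= b -> ln a <= ln b.
Proof. by move=> a0 ab; rewrite ler_ln ?posrE// (lt_le_trans a0). Qed.

Let l32 : ln (3/2 : R) = ln 3 - ln 2. Proof. by rewrite ln_div ?posrE. Qed.

(** [2^19 < 3^12], from the convergent [19/12] of [ln 3 / ln 2]; it controls the coefficient of [s]
    when the two spike hypotheses are combined. *)
Let num19_12 : ln (2 : R) *+ 19 <= ln 3 *+ 12.
Proof. by rewrite -!lnXn//; apply: ln_le; lra. Qed.

Lemma first_spike_dim : 18 <= d.
Proof.
have := d0; have := hw; have := hw'; rewrite /logterm l32 => hw1 hw2 d0'.
have n1 : (ln (2 : R) *+ 12) *+ 3 <= (ln 3 *+ 7) *+ 3 + spike *+ 2.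
  rewrite -!mulrnA -!lnXn -?lnM ?posrE ?exprn_gt0//; try lra.
  by apply: ln_le; [rewrite exprn_gt0|]; lra.
have n0 : 0 < spike by rewrite ln_gt0; lra.
have n2 : s * (ln (2 : R) *+ 19 - ln 3 *+ 12) <= 0.
  by rewrite mulr_ge0_le0// subr_le0.
rewrite leNgt; apply/negP => h.
have n3 : 0 <= (18 - d) * (ln (2 : R) *+ 12 - ln 3 *+ 7).
  rewrite mulr_ge0//; first by lra.
  rewrite subr_ge0 -!lnXn//; apply: ln_le; first by rewrite exprn_gt0.
  by lra.
lra.
Qed.

Lemma first_spike_y2 : w + y 2 <= x' - 3/4 * spike.
Proof.
have := d0; have := hw; have := hw'; rewrite /logterm l32 => hw1 hw2 d0'.
have n1 : ln (2 : R) *+ 11 - ln 3 *+ 7 <= 0.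
  by rewrite subr_le0 -!lnXn//; apply: ln_le; [rewrite exprn_gt0|lra].
have e1 : ln ((2 + 13/10) / 2) = ln (3 : R) - ln 2 + ln (11/10).
  rewrite -ln_div ?posrE// -lnM ?posrE; try lra.
  by congr ln; field.
have n2 : ln (2 : R) *+ 11 - ln 3 *+ 7 + 2 * (ln 2 *+ 18 - ln 3 *+ 11 - ln (11/10) *+ 4) <= 0.
  suff : ln (2 : R) *+ 47 <= ln 3 *+ 29 + ln (11/10) *+ 8 by lra.
  rewrite -!lnXn -?lnM ?posrE ?exprn_gt0//; try lra.
  by apply: ln_le; [rewrite exprn_gt0|]; lra.
have := lin n1 n2.
rewrite e1; lra.
Qed.

Let small i : 0 < i ->
  ln (2 : R) *+ 8 + ln i *+ 4 <= ln 3 *+ 7 ->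
  (ln (2 : R) *+ 8 + ln i *+ 4 - ln 3 *+ 7)
    + 2 * (ln 2 *+ 19 - ln 3 *+ 12 + (ln (3/2) - ln ((i + 13/10) / 2)) *+ 4) <= 0 ->
  w + y i <= x' - spike.
Proof.
have := d0; have := hw; have := hw'; rewrite /logterm l32 => hw1 hw2 d0' i0 n1 n2.
have := lin _ n2; lra.
Qed.

Lemma first_spike_y17 : w + y (17/10) <= x' - spike.
Proof.
have e : ((17/10 + 13/10) / 2 : R) = 3/2 by field.
have n1 : ln (2 : R) *+ 8 + ln (17/10) *+ 4 <= ln 3 *+ 7.
  rewrite -!lnXn -?lnM ?posrE ?exprn_gt0//; try lra.
  by apply: ln_le; [rewrite mulr_gt0 ?exprn_gt0|]; lra.
apply: small; first by lra.
  by [].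
by rewrite e subrr mul0rn addr0; have := num19_12; lra.
Qed.

Lemma first_spike_y1 : w + y 1 <= x' - spike.
Proof.
have e : ((1 + 13/10) / 2 : R) = 23/20 by field.
apply: small; first by lra.
  rewrite ln1 mul0rn addr0 -!lnXn//.
  by apply: ln_le; [rewrite exprn_gt0|]; lra.
rewrite e ln1 mul0rn addr0 l32.
suff : ln (2 : R) *+ 38 <= ln 3 *+ 23 + ln (23/20) *+ 8 by lra.
rewrite -!lnXn -?lnM ?posrE ?exprn_gt0//; try lra.
by apply: ln_le; [rewrite exprn_gt0|]; lra.
Qed.

Lemma first_spike_y07 : w + y (7/10) <= x' - spike.
Proof.
have e : ((7/10 + 13/10) / 2 : R) = 1 by field.
apply: small; first by lra.
  rewrite -!lnXn -?lnM ?posrE ?exprn_gt0//; try lra.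
  by apply: ln_le; [rewrite mulr_gt0 ?exprn_gt0|]; lra.
rewrite e ln1 l32 subr0.
suff : ln (2 : R) *+ 38 + ln (7/10) *+ 4 <= ln 3 *+ 23 by lra.
rewrite -!lnXn -?lnM ?posrE ?exprn_gt0//; try lra.
by apply: ln_le; [rewrite mulr_gt0 ?exprn_gt0|]; lra.
Qed.

Lemma first_spike_gain : w - d / 3 * ln (13/10) <= x' / 2 - 5/8 * spike.
Proof.
have := d0; have := hw; have := hw'; rewrite /logterm l32 => hw1 hw2 d0'.
have n0 : 0 < spike by rewrite ln_gt0; lra.
have n2 : s * (ln (2 : R) *+ 19 - ln 3 *+ 12) <= 0.
  by rewrite mulr_ge0_le0// subr_le0.
have n1 : 41/100 * (ln (2 : R) *+ 12 - ln 3 *+ 7) <= ln (13/10).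
  have l0 : 0 < ln (13/10 : R) by rewrite ln_gt0; lra.
  suff : ln (2 : R) *+ 60 <= ln 3 *+ 35 + ln (13/10) *+ 12 by lra.
  rewrite -!lnXn -?lnM ?posrE ?exprn_gt0//; try lra.
  by apply: ln_le; [rewrite exprn_gt0|]; lra.
have n3 : d / 3 * (41/100 * (ln (2 : R) *+ 12 - ln 3 *+ 7)) <= d / 3 * ln (13/10).
  by rewrite ler_pM2l// divr_gt0.
lra.
Qed.

(** The case [m = 3] of [logterm_ramp]; the value [0] is the logarithm of the term of the first
    shell, the single point at distance zero. *)
Lemma first_ramp : 4/3 * d <= s -> logterm d s 2 (31/20) <= Num.max 0 x'.
Proof.
move=> sd; have d0' := d0; rewrite le_max.
set w' := logterm d s 2 _; suff : w' <= 0 \/ w' <= x' by case=> ->; rewrite ?orbT.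
have n1 : ln (2 : R) *+ 19 <= ln 3 *+ 12 by exact: num19_12.
have n2 : ln (2 : R) *+ 24 <= ln (31/20) *+ 7 + ln (31/10) *+ 12.
  rewrite -!lnXn -?lnM ?posrE ?exprn_gt0//; try lra.
  by apply: ln_le; [rewrite exprn_gt0|]; lra.
have e : ln (31/10 : R) = ln (31/20) + ln 2.
  by rewrite -lnM ?posrE; [congr ln; field|lra..].
have h1 : d * (ln (2 : R) *+ 19 - ln 3 *+ 12) <= 0 by rewrite mulr_ge0_le0 ?subr_le0// ltW.
have h2 : s * (ln (2 : R) *+ 24 - (ln (31/20) *+ 7 + ln (31/10) *+ 12)) <= 0.
  by rewrite mulr_ge0_le0 ?subr_le0.
have [h|h] := leP w' 0; first by left.
right; move: h; rewrite /w' /logterm e in h2 *; lra.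
Qed.

End first_spike.

Section spike_constants.
Variable R : realType.
Local Notation spike := (ln (13/5 : R)).

Lemma expR_spike : expR (- spike) = 5/13.
Proof. by rewrite expRN lnK ?posrE; [field | lra]. Qed.

Let expR_spike_le (a b : nat) (c : R) : 0 < c -> (0 < b)%N ->
  1 <= (13/5) ^+ a * c ^+ b -> expR (- (a%:R / b%:R * spike)) <= c.
Proof.
move=> c0 b0 h; rewrite -ler_ln ?posrE ?expR_gt0// expRK.
have bR : 0 < b%:R :> R by rewrite ltr0n.
have g : 0 < 13/5 :> R by lra.
have : 0 <= a%:R * spike + b%:R * ln c.
  by rewrite !(mulr_natl (ln _)) -!lnXn// -lnM ?posrE ?exprn_gt0// ln_ge0.
have -> : a%:R * spike = b%:R * (a%:R / b%:R * spike).
  by rewrite mulrA mulrCA divff ?mulr1// gt_eqF.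
by rewrite -mulrDr pmulr_rge0//; lra.
Qed.

Lemma expR_spike34 : expR (- (3/4 * spike)) <= 49/100.
Proof. by apply: expR_spike_le => //; lra. Qed.

Lemma expR_spike58 : expR (- (5/8 * spike)) <= 56/100.
Proof. by apply: expR_spike_le => //; lra. Qed.

(** [325/1000] lies just above [3 sqrt 3 / 16], the maximum of [r^3 / (1 + r^2)^2], attained at
    [r = sqrt 3]; the squares used vanish at or next to that point. *)
Lemma cubic_le (r : R) : 0 < r -> r ^+ 3 <= 325/1000 * (1 + r ^+ 2) ^+ 2.
Proof.
move=> r0; have h1 : 0 <= (1 - r ^+ 2 / 3) ^+ 2 by exact: sqr_ge0.
have h2 : 0 <= r ^+ 2 * (1 - 15/26 * r) ^+ 2 by rewrite mulr_ge0 ?sqr_ge0.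
have h3 : 0 <= r ^+ 2 * r ^+ 2 by rewrite mulr_ge0 ?sqr_ge0.
lra.
Qed.

End spike_constants.

(** * The height of a spike times the averaged sum *)

Section spike_product.
Variables (R : realType) (d : nat) (s : R).

Lemma expR_logterm (a b : R) : 0 < a -> 0 < b ->
  expR (logterm d%:R s a b) = a ^+ d * b `^ (- s).
Proof.
move=> a0 b0; rewrite /logterm expRD expRM_natl lnK ?posrE//.
by rewrite /powR gt_eqF// mulNr.
Qed.

(** The inverse squares telescope through [1/(j+2)^2 <= 1/(j+1) - 1/(j+2)]. The shell [j + 1 = M]
    contributes [c2], the ones after it at most [(M+1) c2]; the induction carries the exact
    remainder. *)
Lemma shell_sum_le (M J : nat) (c1 c2 : R) : (0 < M)%N -> 0 <= c1 -> 0 <= c2 ->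
  \sum_(j < J) (if (j.+1 < M)%N then c1 else c2 * (M.+1%:R / j.+2%:R) ^+ 2)
  <= M.-1%:R * c1 + c2 * M.+2%:R.
Proof.
move=> M0 c10 c20.
have sq0 : 0 <= c2 * M.+1%:R ^+ 2 by rewrite mulr_ge0 ?exprn_ge0.
suff : \sum_(j < J) (if (j.+1 < M)%N then c1 else c2 * (M.+1%:R / j.+2%:R) ^+ 2)
  <= (if (J < M)%N then J%:R * c1
      else M.-1%:R * c1 + (c2 * M.+2%:R - c2 * M.+1%:R ^+ 2 / J.+1%:R)).
  move=> /le_trans; apply; case: ltnP => JM.
    rewrite ler_wpDr ?mulr_ge0// ler_wpM2r// ler_nat -ltnS prednK//.
  by rewrite lerD2l gerBl divr_ge0.
elim: J => [|J IH]; first by rewrite big_ord0 M0 mul0r.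
rewrite big_ord_recr/=; apply: le_trans (lerD IH (lexx _)) _.
have [JM|] := ltnP J.+1 M.
  by rewrite (ltn_trans _ JM)// -natr1 mulrDl mul1r.
rewrite leq_eqVlt => /predU1P[MJ|MJ].
  subst M; rewrite ltnSn/= lerD2l divff// expr1n mulr1.
  rewrite expr2 mulrA mulfK// -mulrBr -natrB//.
  by rewrite ler_peMr// subSn// subnn.
rewrite ltnNge -ltnS MJ/= -addrA lerD2l -addrA lerD2l.
have -> : c2 * (M.+1%:R / J.+2%:R) ^+ 2 = c2 * M.+1%:R ^+ 2 / (J.+2%:R * J.+2%:R).
  by rewrite expr_div_n mulrA (expr2 J.+2%:R).
have e : c2 * M.+1%:R ^+ 2 / J.+1%:R - c2 * M.+1%:R ^+ 2 / J.+2%:R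
    = c2 * M.+1%:R ^+ 2 / (J.+1%:R * J.+2%:R).
  have := ltr0Sn R J; rewrite -[J.+2%:R]natr1.
  by move: (J.+1%:R : R) => p p0; field; apply/andP; split; lra.
have : c2 * M.+1%:R ^+ 2 / (J.+2%:R * J.+2%:R) <= c2 * M.+1%:R ^+ 2 / (J.+1%:R * J.+2%:R).
  by rewrite ler_wpM2l// lef_pV2 ?posrE ?mulr_gt0// ler_pM2r// ler_nat.
rewrite -e; move: (c2 * _ / (_ * _)) (c2 * _ / J.+1%:R) (c2 * _ / J.+2%:R).
by move=> u v z; lra.
Qed.

(** Dominates one layer of the mean of the lattice sum over a window. At radius [(j+1)/2] a
    coordinate sees at most [j + 1] integers; at radius [j/2 + 3/20] it sees at most [j + 7/10] on
    average. Each count is multiplied by the profile at the start of its layer. *)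
Definition avg_term (j : nat) : R :=
  j.+1%:R ^+ d * ((j.+1%:R + 13/10) / 2) `^ (- s)
  + (j.+1%:R - 3/10) ^+ d * ((j.+1%:R - 3/10 + 13/10) / 2) `^ (- s).

Lemma avg_termE j : avg_term j =
  expR (logterm d%:R s j.+1%:R ((j.+1%:R + 13/10) / 2))
  + expR (logterm d%:R s (j.+1%:R - 3/10) ((j.+1%:R - 3/10 + 13/10) / 2)).
Proof.
have j1 : (1 : R) <= j.+1%:R by rewrite ler1n.
rewrite !expR_logterm //; lra.
Qed.

Lemma avg_term_ge0 j : 0 <= avg_term j.
Proof. by rewrite avg_termE addr_ge0// expR_ge0. Qed.

Hypothesis d0 : (0 < d)%N.

Variable k : nat.
Let M := k.*2.+3.
Let m : R := M%:R.

Local Notation x := (logterm d%:R s (m - 2) ((m - 1) / 2)).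
Local Notation w := (logterm d%:R s (m - 1) (m / 2)).
Local Notation x' := (logterm d%:R s m ((m + 1) / 2)).
Local Notation spike := (ln (13/5 : R)).

Hypotheses (sP : d%:R * (m + 1) / m < s) (sQ : s < d%:R * (m - 1) / (m - 2)).
Hypotheses (wx : spike < w - x) (wx' : spike < w - x').

Let dR : 0 < d%:R :> R. Proof. by rewrite ltr0n. Qed.

Let sumXX := expR x + expR x'.

Let m3 : 3 <= m. Proof. by rewrite ler_nat. Qed.

(** [e <= 28/10], from [(1 - 1/32)^(-32)], and [(28/10)^9 <= (13/5)^10]. *)
Let spike_ge : 9/10 <= spike.
Proof.
suff : 9 <= spike *+ 10 by lra.
rewrite -lnXn; last by lra.
have -> : (9 : R) = ln (expR 1 ^+ 9) by rewrite lnXn ?expR_gt0// expRK.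
rewrite ler_ln ?posrE ?exprn_gt0 ?expR_gt0//.
apply: (@le_trans _ _ ((28/10) ^+ 9)); last by lra.
have h : expR 1 <= 28/10 :> R.
  have : expR (- (1/32)) >= 31/32 :> R.
    by apply: le_trans (expR_ge1Dx _); lra.
  move=> h; have h2 : expR (1/32) <= 32/31 :> R.
    have := expRxMexpNx_1 (1/32 : R).
    have : expR (1/32) * (31/32) <= expR (1/32) * expR (- (1/32)) :> R.
      by rewrite ler_pM2l ?expR_gt0.
    by lra.
  have -> : expR 1 = expR (1/32) ^+ 32 :> R.
    by rewrite -expRM_natl; congr expR; field.
  apply: (@le_trans _ _ ((32/31) ^+ 32)); last by lra.
  by apply: lerXn2r => //; rewrite nnegrE ?expR_ge0//; lra.
by apply: lerXn2r => //; rewrite nnegrE ?expR_ge0//; lra.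
Qed.

(** Cuts the averaged sum at shell [M]: [c1] bounds every earlier term, and afterwards both summands
    of [avg_term] decay like inverse squares, whence the factor [2]. *)
Let combine (c1 c2 : R) : 0 <= c1 ->
  (forall j, (j.+1 < M)%N -> expR w * avg_term j <= c1) ->
  (forall i : R, m - 3/10 <= i ->
     w + logterm d%:R s i ((i + 13/10) / 2) <= c2 + 2 * (ln (m + 1) - ln (i + 13/10))) ->
  forall J, expR w * \sum_(j < J) avg_term j
    <= M.-1%:R * c1 + 2 * expR c2 * M.+2%:R.
Proof.
move=> c10 h1 h2 J.
have c20 : 0 <= 2 * expR c2 by rewrite mulr_ge0 ?expR_ge0.
apply: le_trans (@shell_sum_le M J c1 (2 * expR c2) isT c10 c20).
rewrite mulr_sumr; apply: ler_sum => j _; case: ifPn => [|]; first exact: h1.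
rewrite -leqNgt => Mj.
have mj : m <= j.+1%:R by rewrite ler_nat.
have m3' := m3.
have after (i : R) : m - 3/10 <= i -> j.+2%:R <= i + 13/10 ->
    expR (w + logterm d%:R s i ((i + 13/10) / 2)) <= expR c2 * (M.+1%:R / j.+2%:R) ^+ 2.
  move=> mi ji; have -> : expR c2 * (M.+1%:R / j.+2%:R) ^+ 2
     = expR (c2 + 2 * (ln (m + 1) - ln j.+2%:R)).
    rewrite expRD expRM_natl -ln_div ?posrE//; last by lra.
    by rewrite lnK ?posrE ?divr_gt0 /m ?natr1//; lra.
  rewrite ler_expR; apply: le_trans (h2 _ mi) _.
  by rewrite lerD2l ler_pM2l// lerD2l lerN2 ler_ln ?posrE//; lra.
rewrite avg_termE mulrDr -!expRD.
have j2 : (j.+2%:R : R) = j.+1%:R + 1 by rewrite natr1.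
set Z := _ ^+ 2; have -> : 2 * expR c2 * Z = expR c2 * Z + expR c2 * Z by ring.
by apply: lerD; apply: after; lra.
Qed.

Let amgm (a b : R) : expR ((a + b) / 2) <= (expR a + expR b) / 2.
Proof.
have -> : expR ((a + b) / 2) = expR (a / 2) * expR (b / 2).
  by rewrite -expRD; congr expR; field.
have sq (c : R) : expR c = expR (c / 2) ^+ 2.
  by rewrite -expRM_natl; congr expR; field.
rewrite [in leRHS](sq a) [in leRHS](sq b).
move: (expR (a / 2)) (expR (b / 2)) => p q.
have : 0 <= (p - q) ^+ 2 by exact: sqr_ge0.
rewrite sqrrB => h; lra.
Qed.

Lemma spike_dim_ge : 5 * (m + 1) / 2 <= d%:R.
Proof.
have [k0|k0] := posnP k.
  have m3E : m = 3 by rewrite /m /M k0.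
  have sP' := sP; have sQ' := sQ; rewrite m3E in sP' sQ'.
  have e1 : (3 - 2 = 1 :> R) by lra.
  have e2 : ((3 - 1) / 2 = 1 :> R) by lra.
  have e3 : (3 - 1 = 2 :> R) by lra.
  have s2 : s <= 2 * d%:R by rewrite e1 e3 divr1 mulrC in sQ'; exact: ltW.
  have s0 : 0 <= s by have := dR; lra.
  have e4 : ((3 + 1) / 2 = 2 :> R) by lra.
  have w1 := wx; have w2 := wx'.
  rewrite m3E e1 e2 e3 {2}/logterm ln1 !mulr0 subrr subr0 in w1.
  rewrite m3E e3 e4 in w2.
  rewrite m3E; have := first_spike_dim dR s0 w1 w2; lra.
have m5 : 5 <= m by rewrite ler_nat /M; case: (k) k0 => [|k']//; rewrite doubleS.
have := spike_ge; have wx1 := wx; have wx1' := wx' => h.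
by apply: (spike_dim dR m3 sP) => //; lra.
Qed.

(** For [m >= 5] the factor [exp (- t)] of [spike_gain] beats the number [m + 2] of shells, and
    [exp ((x+x')/2)] is at most half of [sumXX]. For [m = 3], with [r = exp (x'/2)], the sum is at
    most [7/4 r^2 + 56/10 r^3], hence at most [(7/16 + 182/100) (1 + r^2)^2], which fixes
    [226/100]. *)
Lemma spike_product J :
  expR w * \sum_(j < J) avg_term j <= 226/100 * sumXX ^+ 2.
Proof.
have n1 (c : R) : 0 < c -> 5/13 * c + 5/13 * c <= 7/8 * c by move=> c0; lra.
have n2 (c : R) : 0 < c -> 49/100 * c + 5/13 * c <= 7/8 * c by move=> c0; lra.
have X0 := expR_gt0 x; have X0' := expR_gt0 x'.
have sp := spike_ge.
have [k0|k0] := posnP k.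
  have m3E : m = 3 by rewrite /m /M k0.
  have sP' := sP; have sQ' := sQ; rewrite m3E in sP' sQ'.
  have e1 : (3 - 2 = 1 :> R) by lra.
  have e2 : ((3 - 1) / 2 = 1 :> R) by lra.
  have e3 : (3 - 1 = 2 :> R) by lra.
  have s2 : s <= 2 * d%:R by rewrite e1 e3 divr1 mulrC in sQ'; exact: ltW.
  have s0 : 0 <= s by have := dR; lra.
  have e4 : ((3 + 1) / 2 = 2 :> R) by lra.
  have w1 := wx; have w2 := wx'.
  rewrite m3E e1 e2 e3 {2}/logterm ln1 !mulr0 subrr subr0 in w1.
  rewrite m3E e3 e4 in w2.
  have x0 : x = 0 by rewrite m3E e1 e2 /logterm ln1 !mulr0 subrr.
  have y2 := first_spike_y2 dR s0 s2 w1 w2.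
  have y17 := first_spike_y17 dR s0 s2 w1 w2.
  have y1 := first_spike_y1 dR s0 s2 w1 w2.
  have y07 := first_spike_y07 dR s0 s2 w1 w2.
  have g := first_spike_gain dR s0 w1 w2.
  rewrite /sumXX x0 expR0 m3E e3 e4.
  set x3 := logterm _ s 3 2 in y2 y17 y1 y07 g w2 *.
  have le1 (t : R) : t <= x3 - spike -> expR t <= 5/13 * expR x3.
    by move=> h; rewrite -expR_spike -expRD ler_expR addrC.
  have le2 (t : R) : t <= x3 - 3/4 * spike -> expR t <= 49/100 * expR x3.
    move=> h; apply: (@le_trans _ _ (expR (- (3/4 * spike)) * expR x3)).
      by rewrite -expRD ler_expR addrC.
    by rewrite ler_pM2r ?expR_gt0// expR_spike34.
  (* [7/8] dominates [49/100 + 5/13], the two summands at count [2], and also twice [5/13], those at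
     count [1]. The exponent for the later shells comes from [first_spike_gain]. *)
  have := @combine (7/8 * expR x3) (3/2 * x3 - 5/8 * spike).
  rewrite m3E e3 mulr_ge0 ?expR_ge0//.
  move=> /(_ isT).
  have h1 : forall j : nat, (j.+1 < M)%N ->
      expR (logterm d%:R s 2 (3 / 2)) * avg_term j <= 7/8 * expR x3.
    have E0 := expR_gt0 x3.
    have e07 : (1 - 3/10 : R) = 7/10 by field.
    have e17 : (2 - 3/10 : R) = 17/10 by field.
    rewrite /M k0 => -[|[|]]// _; rewrite avg_termE mulrDr -!expRD ?e07 ?e17.
      exact: le_trans (lerD (le1 _ y1) (le1 _ y07)) (n1 _ E0).
    exact: le_trans (lerD (le2 _ y2) (le1 _ y17)) (n2 _ E0).
  move=> /(_ h1) h2; apply: le_trans (h2 _ J) _; clear h2 h1 y2 y17 y1 y07 X0 X0'.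
    move=> i i3; have m3' := m3.
    have := @spike_after R d%:R s m dR m3; rewrite m3E.
    rewrite e3 e4 => /(_ _ i i3); have w2' := w2.
    by rewrite -/x3 => h; have := h (le_trans sp (ltW w2')); lra.
  rewrite /M k0/= [expR (3/2 * x3 - _)]expRD.
  set r := expR (x3 / 2).
  have r0 : 0 < r by exact: expR_gt0.
  have -> : expR x3 = r ^+ 2 by rewrite /r -expRM_natl; congr expR; field.
  have -> : expR (3/2 * x3) = r ^+ 3 by rewrite /r -expRM_natl; congr expR; field.
  have r3 : 0 < r ^+ 3 by rewrite exprn_gt0.
  have h3 : r ^+ 3 * expR (- (5/8 * spike)) <= r ^+ 3 * (56/100).
    by rewrite ler_pM2l// expR_spike58.
  have h4 := cubic_le r0.
  have h5 : 4 * r ^+ 2 <= (1 + r ^+ 2) ^+ 2.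
    have : 0 <= (1 - r ^+ 2) ^+ 2 by exact: sqr_ge0.
    lra.
  rewrite double0. move: h3 h4 h5; move: (expR _) => E; lra.
have m5 : 5 <= m by rewrite ler_nat /M; case: (k) k0 => [|k']//; rewrite doubleS.
have wx1 := wx; have wx1' := wx'.
have a1 : 9/10 <= w - x by lra.
have a1' : 9/10 <= w - x' by lra.
have gain := spike_gain dR m3 sP a1 a1' m5.
set D := d%:R / m * ln (5/4) in gain.
have l54 : D <= d%:R / m * ln (13/10).
  have l0 : ln (5/4 : R) <= ln (13/10) by rewrite ler_ln ?posrE; lra.
  have dm0 : 0 <= d%:R / m by rewrite divr_ge0.
  exact: ler_wpM2l.
have h1 : forall j : nat, (j.+1 < M)%N ->
    expR w * avg_term j <= 2 * expR (w + x - D).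
  move=> j jM; rewrite avg_termE mulrDr -!expRD.
  have j1 : j.+1%:R <= m - 1 by rewrite lerBrDr natr1 ler_nat.
  have j0 : (1 : R) <= j.+1%:R by rewrite ler1n.
  have := @spike_before _ _ _ _ dR m3 sP sQ _ m5.
  rewrite -/D => bef.
  have b1 := bef j.+1%:R ltac:(lra) j1.
  have b2 := bef (j.+1%:R - 3/10) ltac:(lra) ltac:(lra).
  set E := expR (w + x - D); have -> : 2 * E = E + E by ring.
  by apply: lerD; rewrite ler_expR -[leRHS]addrA lerD2l.
have h2 : forall i : R, m - 3 / 10 <= i ->
    w + logterm d%:R s i ((i + 13/10) / 2) <= w + x' - D + 2 * (ln (m + 1) - ln (i + 13/10)).
  move=> i mi; have := spike_after dR m3 a1' mi; move: l54.
  have triv (a b c e f g : R) : c <= e -> a <= b - e + f -> g + a <= g + b - c + f by lra.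
  exact: triv.
apply: le_trans (combine _ h1 h2 J) _; first by rewrite mulr_ge0 ?expR_ge0.
set t := (m * (33/100) - 1/2) * (9/5) in gain.
have EX (c : R) : expR (w + c - D) <= expR ((x + x') / 2) * expR (- t) * expR c.
  by rewrite -!expRD ler_expR; lra.
have E0 : 0 < expR (- t) by exact: expR_gt0.
(* [t] is linear in [m], so the quadratic [(1 + t/2)^2 <= exp t] already absorbs [m + 2]. *)
have G : (m + 2) * expR (- t) <= 226/100.
  have t0 : 0 <= 1 + t / 2 by rewrite /t; lra.
  have q : (1 + t / 2) ^+ 2 <= expR t.
    have -> : expR t = expR (t / 2) ^+ 2 by rewrite -expRM_natl; congr expR; field.
    by apply: lerXn2r; rewrite ?nnegrE ?expR_ge0// expR_ge1Dx.
  have m2 : m + 2 <= 226/100 * expR t.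
    have : 0 <= (m - 5) * (m - 5) by apply: mulr_ge0; rewrite subr_ge0.
    rewrite /t in q *; lra.
  rewrite -(ler_pM2r (expR_gt0 t)) -mulrA -expRD addNr expR0 mulr1.
  exact: m2.
have M1 : (M.-1%:R : R) <= m + 2.
  by rewrite /m -natrD ler_nat addn2 (leq_trans (leq_pred _))// ltnW.
have M2 : (M.+2%:R : R) = m + 2 by rewrite /m -natrD addn2.
rewrite M2.
apply: (@le_trans _ _ ((m + 2) * (2 * expR (w + x - D)) + (2 * expR (w + x' - D)) * (m + 2))).
  by rewrite lerD2r ler_wpM2r// mulr_ge0 ?expR_ge0.
have := EX x; have := EX x'; have := amgm x x'; rewrite /sumXX.
set p := expR ((x + x') / 2); set e := expR (- t) in E0 G *.
set X := expR x; set X' := expR x'; move=> pX e2 e1.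
have p0 : 0 < p by exact: expR_gt0.
have XX : 0 < X + X' by rewrite addr_gt0// expR_gt0.
apply: (@le_trans _ _ ((m + 2) * e * (2 * p * (X + X')))).
  have -> : (m + 2) * e * (2 * p * (X + X')) = (m + 2) * (2 * (p * e * X)) + 2 * (p * e * X') * (m + 2) by ring.
  have m20 : 0 < m + 2 by rewrite -M2 ltr0n.
  by apply: lerD; [rewrite ler_pM2l// ler_pM2l | rewrite ler_pM2r// ler_pM2l].
have q1 : 2 * p * (X + X') <= (X + X') ^+ 2.
  by rewrite expr2 ler_pM2r// -ler_pdivlMl// mulrC.
apply: le_trans (_ : 226/100 * (2 * p * (X + X')) <= _).
  by rewrite ler_pM2r// !mulr_gt0.
by apply: ler_wpM2l; [exact: divr_ge0 (ler0n _ _) (ler0n _ _) | exact: q1].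
Qed.

End spike_product.

(** * Centred sums, suprema and the dichotomy *)

Section lattice_sums.
Variables (R : realType) (d : nat) (s : R).
Hypotheses (d0 : (0 < d)%N) (ds : d%:R < s).

Local Notation pw b := (b `^ (- s)).

(** Summation by parts of the lattice sum at the origin: [(2k+1)^d] points have norm at most [k],
    and the profile drops by this difference between the norms [k] and [k + 1]. *)
Definition shell_term (k : nat) : R :=
  (k.*2.+1)%:R ^+ d * (pw k.+1%:R - pw k.+2%:R).

(** The worst centre: between the radii [k + sp] and [k + 1] a coordinate may see [2k + 2] integers
    instead of [2k + 1]. The offset [sp] is [1/2] for arbitrary centres and [11/20] for centres near
    the origin. *)
Definition sup_extra (sp : R) (k : nat) : R :=
  (k.*2.+2)%:R ^+ d * (pw (k.+1%:R + sp) - pw k.+2%:R).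

Definition sup_term (sp : R) (k : nat) : R :=
  (k.*2.+1)%:R ^+ d * (pw k.+1%:R - pw (k.+1%:R + sp)) + sup_extra sp k.

Let s0 : 0 < s. Proof. by apply: le_lt_trans ds. Qed.

Let pw_le (a b : R) : 0 < a -> a <= b -> pw b <= pw a.
Proof.
move=> a0 ab; have b0 : 0 < b by apply: lt_le_trans ab.
rewrite !powRN lef_pV2 ?posrE ?powR_gt0//.
by rewrite ge0_ler_powR ?nnegrE// ltW.
Qed.

Let pwD (a b : R) : 0 < a -> 0 < b -> pw a - pw b = pw a * (1 - (a / b) `^ s).
Proof.
move=> a0 b0; rewrite mulrBr mulr1; congr (_ - _).
rewrite /powR !gt_eqF ?divr_gt0// -expRD ln_div ?posrE//.
by congr expR; ring.
Qed.

Lemma shell_term_ge0 k : 0 <= shell_term k.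
Proof.
by rewrite mulr_ge0 ?exprn_ge0// subr_ge0 pw_le// ler_nat.
Qed.

Let half_nat k : ((k.*2.+3%:R - 1) / 2 : R) = k.+1%:R.
Proof.
have -> : k.*2.+3 = (2 * k.+1).+1 by lia.
by rewrite -natr1 natrM; field.
Qed.

Let m2 k : (k.*2.+3%:R - 2 : R) = k.*2.+1%:R.
Proof. by rewrite -natrB. Qed.
Let m1 k : (k.*2.+3%:R - 1 : R) = k.*2.+2%:R.
Proof. by rewrite -natr1 addrK. Qed.
Let half2 k : ((k.*2.+3%:R + 1) / 2 : R) = k.+2%:R.
Proof. by rewrite -(half_nat k.+1) doubleS -[k.*2.+2.+3%:R]natr1 addrK natr1. Qed.
Let half1 k : (k.*2.+3%:R / 2 : R) = k.+1%:R + 1/2.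
Proof. by rewrite -(half_nat k); field. Qed.

Let X k : R := k.*2.+1%:R ^+ d * pw k.+1%:R.
Let W (sp : R) k : R := k.*2.+2%:R ^+ d * pw (k.+1%:R + sp).

Let XE k : X k = expR (logterm d%:R s (k.*2.+3%:R - 2) ((k.*2.+3%:R - 1) / 2)).
Proof. by rewrite half_nat m2 expR_logterm. Qed.
Let X'E k : X k.+1 = expR (logterm d%:R s k.*2.+3%:R ((k.*2.+3%:R + 1) / 2)).
Proof. by rewrite half2 expR_logterm. Qed.
Let WE k : W (1/2) k = expR (logterm d%:R s (k.*2.+3%:R - 1) (k.*2.+3%:R / 2)).
Proof. by rewrite half1 m1 expR_logterm//; have := ltr0Sn R k; lra. Qed.

Let dR : 0 < d%:R :> R. Proof. by rewrite ltr0n. Qed.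
Let m3 k : 3 <= k.*2.+3%:R :> R. Proof. by rewrite ler_nat. Qed.

Let X_ge0 k : 0 <= X k.
Proof. by rewrite mulr_ge0 ?exprn_ge0 ?powR_ge0. Qed.
Let W_ge0 sp k : 0 <= W sp k.
Proof. by rewrite mulr_ge0 ?exprn_ge0 ?powR_ge0. Qed.

Let ratio_le (a b : R) : 0 <= a -> a <= b -> 1 - b `^ s <= 1 - a `^ s.
Proof.
move=> a0 ab; by rewrite lerD2l lerN2 ge0_ler_powR ?nnegrE ?(ltW s0) ?(le_trans a0 ab).
Qed.

Let ratio_ge0 (a : R) : 0 <= a -> a <= 1 -> 0 <= 1 - a `^ s.
Proof.
move=> a0 a1; rewrite subr_ge0; have <- : 1 `^ s = 1 :> R by rewrite powR1.
by rewrite ge0_ler_powR ?nnegrE ?(ltW s0).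
Qed.

Let extra_half k (sp : R) : 1/2 <= sp -> sup_extra sp k <= sup_extra (1/2) k.
Proof.
move=> h; apply: ler_wpM2l; first by rewrite exprn_ge0.
rewrite lerD2r; apply: pw_le; last by rewrite lerD2l.
by have := ltr0Sn R k; lra.
Qed.

Let extra_W k sp : sup_extra sp k <= W sp k.
Proof. by rewrite ler_wpM2l ?exprn_ge0// gerBl powR_ge0. Qed.

Let extraE k : sup_extra (1/2) k =
  W (1/2) k * (1 - ((k.+1%:R + 1/2) / k.+2%:R) `^ s).
Proof.
by rewrite /sup_extra pwD ?mulrA// addr_gt0.
Qed.

Let kS k : (k.+2%:R : R) = k.+1%:R + 1. Proof. by rewrite natr1. Qed.

(** Both sides are a leading term times [1 - ratio ^ s]. [logterm_down] compares the leading terms,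
    and the half layer, being thinner, has the smaller second factor. *)
Lemma sup_extra_down k (sp : R) : 1/2 <= sp ->
  d%:R * (k.*2.+3%:R - 1) / (k.*2.+3%:R - 2) <= s ->
  sup_extra sp k <= shell_term k.
Proof.
move=> h hs; apply: le_trans (extra_half _ h) _; rewrite extraE.
have WX : W (1/2) k <= X k by rewrite XE WE ler_expR; exact: logterm_down.
rewrite /shell_term pwD// mulrA -/(X k).
have k0 := ltr0Sn R k.
have h0 : 0 <= (k.+1%:R + 1/2) / k.+2%:R :> R by rewrite divr_ge0// addr_ge0.
apply: ler_pM => //; first by apply: ratio_ge0 => //; rewrite ler_pdivrMr// (kS k); lra.
apply: ratio_le; first by rewrite divr_ge0// addr_ge0.
rewrite ler_pM2r ?invr_gt0//; lra.
Qed.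

Lemma sup_extra_up k (sp : R) : 1/2 <= sp ->
  s <= d%:R * (k.*2.+3%:R + 1) / k.*2.+3%:R ->
  sup_extra sp k <= shell_term k.+1.
Proof.
move=> h hs; apply: le_trans (extra_half _ h) _; rewrite extraE.
have WX : W (1/2) k <= X k.+1 by rewrite X'E WE ler_expR; exact: logterm_up.
rewrite /shell_term pwD// mulrA -/(X k.+1).
have k0 := ltr0Sn R k.
have h0 : 0 <= (k.+1%:R + 1/2) / k.+2%:R :> R by rewrite divr_ge0// addr_ge0.
apply: ler_pM => //; first by apply: ratio_ge0 => //; rewrite ler_pdivrMr// (kS k); lra.
apply: ratio_le; first by rewrite divr_ge0.
rewrite ler_pdivrMr// mulrAC ler_pdivlMr// !(kS k) !(kS k.+1) (kS k).
by move: (k.+1%:R : R) k0 => t t0; nra.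
Qed.

(** The thresholds [d (1 + 1/m)] decrease to [d < s], so there is a least shell whose threshold lies
    below [s]; it is the only candidate for a spike. *)
Let spike_index : exists2 k, d%:R * (k.*2.+3%:R + 1) / k.*2.+3%:R < s &
  forall j, (j < k)%N -> s <= d%:R * (j.*2.+3%:R + 1) / j.*2.+3%:R.
Proof.
pose P k := d%:R * (k.*2.+3%:R + 1) / k.*2.+3%:R < s.
have exP : exists k, P k.
  have sd : 0 < s - d%:R by rewrite subr_gt0.
  have [k hk] : exists k : nat, d%:R / (s - d%:R) < k%:R.
    by exists (Num.truncn (d%:R / (s - d%:R))).+1; exact: truncnS_gt.
  exists k; rewrite /P ltr_pdivrMr//.
  rewrite ltr_pdivrMr// in hk.
  have : k%:R * (s - d%:R) <= k.*2.+3%:R * (s - d%:R).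
    by rewrite ler_pM2r// ler_nat; lia.
  lra.
case: (ex_minnP exP) => k Pk kmin; exists k => // j jk.
by rewrite leNgt; apply/negP => /kmin; rewrite leqNgt jk.
Qed.

Variable S0 : R.
Hypothesis S0_ge : forall M, \sum_(k < M) shell_term k + X M <= S0.

Let shell_sum_S0 M : \sum_(k < M) shell_term k <= S0.
Proof. by apply: le_trans (S0_ge M); rewrite lerDl. Qed.

Let X_S0 M : X M <= S0.
Proof. by apply: le_trans (S0_ge M); rewrite lerDr sumr_ge0// => i _; exact: shell_term_ge0. Qed.

(** The boundary term in [S0_ge] is what lets two consecutive leading terms fit below [S0], up to
    the subtracted loss. *)
Let XX_S0 k : X k - k.*2.+1%:R ^+ d * pw k.+2%:R + X k.+1 <= S0.
Proof.
apply: le_trans (S0_ge k.+1); rewrite big_ord_recr/= lerD2r.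
by rewrite /shell_term mulrBr lerDr sumr_ge0// => i _; exact: shell_term_ge0.
Qed.

(** The excess of shell [k] is charged to shell [k + 1] below [k0] and to shell [k] above it, so no
    shell is charged twice and only the excess at [k0] costs [B]. *)
Let extra_sum k0 (sp B : R) : 0 <= B ->
  (forall k, (k < k0)%N -> sup_extra sp k <= shell_term k.+1) ->
  sup_extra sp k0 <= B ->
  (forall k, (k0 < k)%N -> sup_extra sp k <= shell_term k) ->
  1/2 <= sp -> sp <= 1 ->
  forall M, \sum_(k < M) sup_term sp k <= 2 * S0 + B.
Proof.
move=> B0 up mid down sp0 sp1 M.
have split_le : \sum_(k < M) sup_term sp k <=
    \sum_(k < M) shell_term k + \sum_(k < M) sup_extra sp k.
  rewrite -big_split/=; apply: ler_sum => k _; rewrite lerD2r ler_wpM2l ?exprn_ge0//.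
  rewrite lerD2l lerN2; apply: pw_le; last by rewrite kS lerD2l.
  by have := ltr0Sn R k; lra.
suff H : \sum_(k < M) sup_extra sp k <= S0 + B.
  by have := shell_sum_S0 M; lra.
suff : \sum_(k < M) sup_extra sp k <=
    if (M <= k0)%N then \sum_(k < M.+1) shell_term k
    else \sum_(k < M) shell_term k + B.
  by case: ifP => _ h; [have := shell_sum_S0 M.+1 | have := shell_sum_S0 M]; lra.
elim: M {split_le} => [|M IH].
  by rewrite big_ord0 leq0n sumr_ge0// => i _; exact: shell_term_ge0.
rewrite big_ord_recr/=; case: ltngtP IH => Mk IH.
- by rewrite big_ord_recr/=; apply: lerD => //; exact: up.
- rewrite big_ord_recr/= addrAC; apply: lerD => //; exact: down.
- by rewrite -Mk in mid; apply: lerD.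
Qed.

Let S0_gt0 : 0 < S0.
Proof.
apply: lt_le_trans (X_S0 0); rewrite /X double0 expr1n mul1r.
by rewrite powR_gt0.
Qed.

Let after_spike k0 k (sp : R) : 1/2 <= sp ->
  d%:R * (k0.*2.+3%:R + 1) / k0.*2.+3%:R < s -> (k0 < k)%N ->
  sup_extra sp k <= shell_term k.
Proof.
move=> h sP k0k; apply: sup_extra_down => //.
apply/ltW; apply: le_lt_trans sP; rewrite m1 m2 -[k.*2.+2%:R]natr1.
have e (a : R) : 0 < a -> (a + 1) / a = 1 + a^-1.
  by move=> a0; rewrite mulrDl divff ?gt_eqF// mul1r.
rewrite -!mulrA ler_pM2l// !e// lerD2l.
by rewrite lef_pV2 ?posrE ?ltr0n// ler_nat !ltnS -doubleS leq_double.
Qed.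

Let spike_down k0 (sp : R) : 1/2 <= sp ->
  d%:R * (k0.*2.+3%:R - 1) / (k0.*2.+3%:R - 2) <= s -> sup_extra sp k0 <= S0.
Proof.
move=> h sQ; apply: le_trans (sup_extra_down h sQ) _.
apply: le_trans (shell_sum_S0 k0.+1); rewrite big_ord_recr/= lerDr.
by rewrite sumr_ge0// => i _; exact: shell_term_ge0.
Qed.

Let expR_max (a b c : R) : a <= Num.max b c -> expR b <= S0 -> expR c <= S0 -> expR a <= S0.
Proof.
move=> h hb hc; move: h; rewrite le_max => /orP[] h.
  by apply: le_trans hb; rewrite ler_expR.
by apply: le_trans hc; rewrite ler_expR.
Qed.

(** At offset [11/20] the spike is below one of its neighbours, hence below [S0], and [extra_sum]
    gives [2 S0 + S0]. *)
Lemma sup_term_narrow M : \sum_(k < M) sup_term (11/20) k <= 3 * S0.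
Proof.
have [k0 sP up] := spike_index.
have -> : 3 * S0 = 2 * S0 + S0 by ring.
apply: (@extra_sum k0) => //; last first.
- by lra.
- by lra.
- by move=> k; apply: after_spike sP; lra.
- have [sQ|sQ] := lerP (d%:R * (k0.*2.+3%:R - 1) / (k0.*2.+3%:R - 2)) s.
    by apply: spike_down sQ; lra.
  apply: le_trans (extra_W _ _) _.
  have WE' : W (11/20) k0 = expR (logterm d%:R s (k0.*2.+3%:R - 1) ((k0.*2.+3%:R + 1/10) / 2)).
    have -> : (k0.*2.+3%:R + 1/10) / 2 = k0.+1%:R + 11/20 :> R.
      by rewrite -(half_nat k0); field.
    by rewrite m1 expR_logterm// addr_gt0// divr_gt0.
  have hX : expR (logterm d%:R s (k0.*2.+3%:R - 2) ((k0.*2.+3%:R - 1) / 2)) <= S0.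
    by rewrite -XE X_S0.
  have hX' : expR (logterm d%:R s k0.*2.+3%:R ((k0.*2.+3%:R + 1) / 2)) <= S0.
    by rewrite -X'E X_S0.
  rewrite WE'; apply: expR_max hX hX'.
  have [k00|k00] := posnP k0.
    rewrite k00 double0 in sP *.
    have e1 : (3 - 2 = 1 :> R) by lra.
    have e2 : ((3 - 1) / 2 = 1 :> R) by lra.
    have e3 : (3 - 1 = 2 :> R) by lra.
    have e4 : ((3 + 1) / 2 = 2 :> R) by lra.
    have e5 : ((3 + 1/10) / 2 = 31/20 :> R) by lra.
    rewrite e2 e1 e3 e4 e5 {2}/logterm ln1 !mulr0 subrr.
    by apply: first_ramp => //; [exact: ltW | lra].
  have m5 : 5 <= k0.*2.+3%:R :> R.
    by rewrite ler_nat; case: (k0) k00 => [|k']//; rewrite doubleS.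
  apply: le_trans (logterm_ramp dR (m3 k0) sP m5) _.
  set a := logterm _ _ _ _; set b := logterm _ _ _ ((_ + 1) / 2).
  rewrite le_max; have [ab|ab] := leP a b.
    by apply/orP; right; lra.
  by apply/orP; left; lra.
- by move=> k /up; apply: sup_extra_up; lra.
- exact: ltW.
Qed.

(** The cut [W = 13/5 S0] is where [2 S0 + W] reaches [23/5 S0], that is [23/10] of [2 S0]. Above it
    the supremum is at most [23/13 W]; with [X k0 + X (k0+1) <= S0 / (99/100)] the product is
    bounded by [23/13 * 226/100 / (99/100)^2 < 4 * 104/100] times [S0^2]. *)
Lemma lattice_dichotomy :
  (forall M, \sum_(k < M) sup_term (1/2) k <= 23/5 * S0) \/
  (forall M J, (\sum_(k < M) sup_term (1/2) k) * \sum_(j < J) avg_term d s j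
     <= 104/100 * (2 * S0) ^+ 2).
Proof.
have [k0 sP up] := spike_index.
have up' k : (k < k0)%N -> sup_extra (1/2) k <= shell_term k.+1.
  by move=> /up; apply: sup_extra_up; lra.
have down' k : (k0 < k)%N -> sup_extra (1/2) k <= shell_term k.
  by apply: after_spike sP; lra.
have half : 1/2 <= 1 :> R by lra.
have S0' := S0_gt0.
have [sQ|sQ] := lerP (d%:R * (k0.*2.+3%:R - 1) / (k0.*2.+3%:R - 2)) s.
  left=> M; apply: le_trans (_ : 2 * S0 + S0 <= _); last by lra.
  by apply: (@extra_sum k0) => //; [exact: ltW | apply: spike_down sQ; lra].
have [WS|WS] := lerP (W (1/2) k0) (13/5 * S0).
  left=> M; apply: le_trans (_ : 2 * S0 + 13/5 * S0 <= _); last by lra.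
  apply: (@extra_sum k0) => //; first by rewrite mulr_ge0 ?ltW//; lra.
  exact: le_trans (extra_W _ _) WS.
right=> M J.
have g : 0 < 13/5 :> R by lra.
have gt_spike (x : R) : expR x <= S0 ->
    ln (13/5) < logterm d%:R s (k0.*2.+3%:R - 1) (k0.*2.+3%:R / 2) - x.
  move=> xS; rewrite ltrBrDr -ltr_expR expRD lnK ?posrE// -WE.
  by apply: le_lt_trans WS; rewrite ler_pM2l.
have wx := gt_spike _ (_ : expR (logterm d%:R s (k0.*2.+3%:R - 2) ((k0.*2.+3%:R - 1) / 2)) <= S0).
have {}wx := wx ltac:(by rewrite -XE X_S0).
have wx' := gt_spike _ (_ : expR (logterm d%:R s k0.*2.+3%:R ((k0.*2.+3%:R + 1) / 2)) <= S0).
have {}wx' := wx' ltac:(by rewrite -X'E X_S0).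
have dim := spike_dim_ge d0 sP sQ wx wx'.
have prod := spike_product d0 sP sQ wx wx' J.
rewrite -WE -XE -X'E in prod.
have XX : 99/100 * (X k0 + X k0.+1) <= S0.
  (* A high spike forces [d >= 5 (k0 + 2)], so the [s]-th power of the ratio is at most
     [exp (-5) <= 1/100]: the loss in [XX_S0] is negligible. *)
  have small : k0.*2.+1%:R ^+ d * pw k0.+2%:R <= 1/100 * X k0.
    have -> : k0.*2.+1%:R ^+ d * pw k0.+2%:R = (k0.+1%:R / k0.+2%:R) `^ s * X k0.
      rewrite /X mulrCA; congr (_ * _); rewrite mulrC.
      by have := @pwD k0.+1%:R k0.+2%:R; rewrite !ltr0n => /(_ isT isT); lra.
    rewrite ler_wpM2r// /powR gt_eqF ?divr_gt0//.
    have h1 : ln (k0.+1%:R / k0.+2%:R) <= - (k0.+2%:R^-1) :> R.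
      apply: le_trans (ln_leB1 _) _; first by rewrite divr_gt0.
      have e (t : R) : 0 < t -> t / (t + 1) - 1 = - (t + 1)^-1 by move=> t0; field; lra.
      by rewrite (kS k0) e.
    have h2 : 5 <= s / k0.+2%:R.
      rewrite ler_pdivlMr//; apply: le_trans (ltW ds); apply: le_trans dim.
      by rewrite -mulrA half2.
    have h3 : s * ln (k0.+1%:R / k0.+2%:R) <= -5.
      apply: le_trans (_ : s * - (k0.+2%:R^-1) <= _); first by rewrite ler_pM2l.
      by rewrite mulrN lerN2.
    have h4 : 100 <= expR 5 :> R.
      have -> : 5 = 32%:R * (5/32) :> R by field.
      rewrite expRM_natl; apply: (@le_trans _ _ ((1 + 5/32) ^+ 32)); first by lra.
      by apply: lerXn2r; rewrite ?nnegrE ?expR_ge0 ?expR_ge1Dx//; lra.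
    apply: le_trans (_ : expR (-5) <= _); first by rewrite ler_expR.
    by rewrite expRN mul1r lef_pV2 ?posrE ?expR_gt0.
  have := XX_S0 k0; have := X_ge0 k0.+1; lra.
have UW : \sum_(k < M) sup_term (1/2) k <= 23/13 * W (1/2) k0.
  apply: le_trans (_ : 2 * S0 + W (1/2) k0 <= _); last by lra.
  by apply: (@extra_sum k0) => //; exact: extra_W.
have A0 : 0 <= \sum_(j < J) avg_term d s j.
  by rewrite sumr_ge0// => j _; exact: avg_term_ge0.
apply: (@le_trans _ _ (23/13 * (226/100 * (X k0 + X k0.+1) ^+ 2))).
  apply: le_trans (_ : 23/13 * (W (1/2) k0 * \sum_(j < J) avg_term d s j) <= _).
    by rewrite [leRHS]mulrA; exact: (ler_wpM2r A0 UW).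
  by rewrite ler_pM2l//; lra.
have sq : (99/100 * (X k0 + X k0.+1)) ^+ 2 <= S0 ^+ 2.
  have X1 := X_ge0 k0; have X2 := X_ge0 k0.+1.
  by apply: lerXn2r; rewrite ?nnegrE; lra.
have triv (a b : R) : 0 <= b -> (99/100) ^+ 2 * a <= b -> 23/13 * (226/100 * a) <= 104/100 * (2 ^+ 2 * b).
  by move=> b0 h; lra.
rewrite exprMn in sq; rewrite [(2 * S0) ^+ 2]exprMn.
by apply: triv sq; rewrite exprn_ge0// ltW.
Qed.

End lattice_sums.

(** * Counting lattice points around a centre *)

Section lattice_count.
Variables (R : realType) (d N : nat) (s : R).
Local Notation pw b := (b `^ (- s)).
Local Notation box_index := {ffun 'I_d -> 'I_(N.*2.+1)}.

Definition box_point (k : box_index) : 'rV[R]_d := \row_i ((k i)%:R - N%:R).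

Definition lattice_sum (y : 'rV[R]_d) : R := \sum_k pw (1 + `|y - box_point k|).

(** The inequality is strict, so that an interval of integer length [m] contains at most [m] of the
    integers. *)
Definition near_count (t w : R) : R :=
  \sum_(n < N.*2.+1) (`|t - (n%:R - N%:R)| < w)%R%:R.

Lemma rV_norm_lt (y : 'rV[R]_d) (w : R) : 0 < w ->
  (`|y| < w) = [forall i, `|y ord0 i| < w].
Proof.
move=> w0; rewrite (_ : `|y| = mx_norm y)// mx_normrE; apply/bigmax_ltP/forallP => [[_ h] i|h].
  exact: (h (ord0, i)).
by split=> // -[j i] _ /=; rewrite (ord1 j).
Qed.

Lemma rV_norm_le (y : 'rV[R]_d) (w : R) : 0 <= w ->
  (`|y| <= w) = [forall i, `|y ord0 i| <= w].
Proof.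
move=> w0; rewrite (_ : `|y| = mx_norm y)// mx_normrE; apply/bigmax_leP/forallP => [[_ h] i|h].
  exact: (h (ord0, i)).
by split=> // -[j i] _ /=; rewrite (ord1 j).
Qed.

(** Balls of the maximum norm are products, so the count factors over the coordinates. *)
Lemma sum_norm_lt (y : 'rV[R]_d) (w : R) : 0 < w ->
  \sum_k ((`|y - box_point k| < w)%R%:R : R) = \prod_i near_count (y ord0 i) w.
Proof.
move=> w0; rewrite /near_count bigA_distr_bigA; apply: eq_bigr => k _.
rewrite rV_norm_lt//.
have -> : [forall i, `|(y - box_point k) ord0 i| < w]
    = [forall i, `|y ord0 i - ((k i)%:R - N%:R)| < w].
  by apply: eq_forallb => i; rewrite !mxE.
case: forallP => [h|/forallP].
  by rewrite big1// => i _; rewrite h.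
by rewrite negb_forall => /existsP[i /negbTE hi]; rewrite (bigD1 i)//= hi mul0r.
Qed.

(** All indices with [P] lie within [m] of the least one, and subtracting it injects them into [m]
    values. *)
Lemma bool_sum_le (K m : nat) (P : pred 'I_K) :
  (forall i j, P i -> P j -> (j < i + m)%N) -> \sum_(i < K) (P i)%:R <= m%:R :> R.
Proof.
move=> h; rewrite -natr_sum ler_nat.
have -> : (\sum_(i < K) P i)%N = #|P|.
  by rewrite -sum1_card [RHS]big_mkcond; apply: eq_bigr => i _; rewrite -[i \in P]/(P i); case: (P i).
have [/existsP[i0 Pi0]|/existsPn h0] := boolP [exists i, P i]; last first.
  by rewrite eq_card0// => i; apply/negbTE/h0.
case: (arg_minnP (fun i : 'I_K => i : nat) Pi0) => i Pi imin.
have m0 : (0 < m)%N by rewrite -(ltn_add2l i) addn0 h.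
case: m m0 h => // m _ h; rewrite -[leqRHS]card_ord.
apply: (@leq_card_in _ _ (fun j : 'I_K => inord (j - i) : 'I_m.+1)).
move=> j j' Pj Pj' /(congr1 val); rewrite /= !inordK.
- by move=> e; apply/val_inj => /=; have := imin _ Pj; have := imin _ Pj'; lia.
- by have := h _ _ Pi Pj'; have := imin _ Pj'; lia.
- by have := h _ _ Pi Pj; have := imin _ Pj; lia.
Qed.

Let nat_lt_add (i j m : nat) (t u v : R) : t <= i%:R + u -> j%:R + v < t ->
  u - v <= m%:R -> (j < i + m)%N.
Proof.
move=> h1 h2 h3; rewrite -(@ltr_nat R) natrD; lra.
Qed.

Lemma near_count_le (t w : R) (m : nat) : 2 * w <= m%:R -> near_count t w <= m%:R.
Proof.
move=> wm; apply: bool_sum_le => i j.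
rewrite !ltr_norml => /andP[h1 h2] /andP[h3 h4].
by apply: (@nat_lt_add i j m t (w - N%:R) (- w - N%:R)); lra.
Qed.

(** [11/20 + 9/20 = 1], so a counted integer has modulus at most [k]; this matches the two constants
    of the narrow case. *)
Lemma near_count_narrow (t : R) (k : nat) : `|t| <= 9/20 ->
  near_count t (k%:R + 11/20) <= k.*2.+1%:R.
Proof.
move=> ht; apply: bool_sum_le => i j.
move: ht; rewrite !ltr_norml ler_norml => /andP[t1 t2] /andP[h1 h2] /andP[h3 h4].
have i1 : (N < i + k.+1)%N by rewrite -(@ltr_nat R) natrD -natr1; lra.
have i2 : (j < N + k.+1)%N by rewrite -(@ltr_nat R) natrD -natr1; lra.
lia.
Qed.

Lemma near_count_ge0 t w : 0 <= near_count t w.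
Proof. by apply: sumr_ge0. Qed.

Hypothesis s0 : 0 < s.

Lemma powRN_le (a b : R) : 0 < a -> a <= b -> pw b <= pw a.
Proof.
move=> a0 ab; have b0 : 0 < b by apply: lt_le_trans ab.
rewrite !powRN lef_pV2 ?posrE ?powR_gt0//.
by rewrite ge0_ler_powR ?nnegrE ?(ltW s0) ?(ltW a0) ?(ltW b0).
Qed.

(** The profile at [r] is the sum of its drops beyond [r]. Two breakpoints per layer allow the count
    to change inside a shell. *)
Lemma layer_cake (a b : nat -> R) (r : R) (J : nat) :
  (forall k, 0 < a k) -> (forall k, a k <= b k) -> (forall k, b k <= a k.+1) ->
  a 0%N <= r ->
  pw r <= \sum_(k < J) ((r < b k)%R%:R * (pw (a k) - pw (b k))
                        + (r < a k.+1)%R%:R * (pw (b k) - pw (a k.+1)))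
          + pw (a J).
Proof.
move=> a0 ab ba ar.
have b0 k : 0 < b k by apply: lt_le_trans (ab k).
have pab k : 0 <= pw (a k) - pw (b k) by rewrite subr_ge0 powRN_le.
have pba k : 0 <= pw (b k) - pw (a k.+1) by rewrite subr_ge0 powRN_le.
elim: J => [|J IH]; first by rewrite big_ord0 add0r powRN_le.
rewrite big_ord_recr/=.
set S := \sum_(k < J) _ in IH *.
have S0 : 0 <= S.
  by rewrite sumr_ge0// => k _; rewrite addr_ge0// mulr_ge0.
have [rb|br] := ltP r (b J).
  rewrite (lt_le_trans rb)//= !mul1r; lra.
have [ra|ra] := ltP r (a J.+1); rewrite ?mul1r ?mul0r ?add0r.
  have : pw r <= pw (b J) by apply: powRN_le.
  lra.
have : pw r <= pw (a J.+1) by apply: powRN_le.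
lra.
Qed.

Lemma lattice_sum_layers (a b : nat -> R) (y : 'rV[R]_d) (J : nat) :
  a 0%N = 1 -> (forall k, a k < b k) -> (forall k, b k < a k.+1) ->
  lattice_sum y <= \sum_(k < J)
     ((\prod_i near_count (y ord0 i) (b k - 1)) * (pw (a k) - pw (b k))
      + (\prod_i near_count (y ord0 i) (a k.+1 - 1)) * (pw (b k) - pw (a k.+1)))
     + #|{: box_index}|%:R * pw (a J).
Proof.
move=> a1 ab ba.
have a1' k : 1 <= a k.
  by elim: k => [|k IH]; [rewrite a1 | rewrite (le_trans IH)// (le_trans (ltW (ab k)))// ltW].
have a0 k : 0 < a k by apply: lt_le_trans (a1' k).
have b1 k : 1 < b k by apply: le_lt_trans (ab k).
apply: le_trans (_ : \sum_k (\sum_(j < J)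
    ((1 + `|y - box_point k| < b j)%R%:R * (pw (a j) - pw (b j))
     + (1 + `|y - box_point k| < a j.+1)%R%:R * (pw (b j) - pw (a j.+1))) + pw (a J)) <= _).
  apply: ler_sum => k _; apply: layer_cake => // [j|j|]; [exact: ltW|exact: ltW|].
  by rewrite a1 lerDl.
rewrite big_split/= sumr_const -(mulr_natl (pw (a J))) lerD2r exchange_big/=.
have lt1 v : 1 < v ->
    \sum_k ((1 + `|y - box_point k| < v)%R%:R : R) = \prod_i near_count (y ord0 i) (v - 1).
  by move=> v1; rewrite -sum_norm_lt ?subr_gt0//; apply: eq_bigr => k _; rewrite ltrBrDl.
apply: ler_sum => j _; rewrite big_split/= -!mulr_suml !lt1//.
by rewrite (lt_trans (b1 j)).
Qed.

Lemma lattice_sum_sup (y : 'rV[R]_d) (sp : R) (J : nat) : 0 < sp -> sp < 1 ->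
  (forall i k, near_count (y ord0 i) (k%:R + sp) <= k.*2.+1%:R) ->
  lattice_sum y <= \sum_(k < J) sup_term d s sp k
                   + #|{: box_index}|%:R * pw J.+1%:R.
Proof.
move=> sp0 sp1 h.
pose a k : R := k.+1%:R; pose b k : R := k.+1%:R + sp.
have ab k : a k < b k by rewrite ltrDl.
have ba k : b k < a k.+1 by rewrite /a -[k.+2%:R]natr1 ltrD2l.
apply: le_trans (lattice_sum_layers y J (erefl : a 0%N = 1) ab ba) _.
have a0 k : 0 < a k by [].
rewrite lerD2r; apply: ler_sum => k _; apply: lerD; apply: ler_wpM2r.
- by rewrite subr_ge0; apply: powRN_le => //; exact: ltW.
- rewrite -[X in _ <= _ ^+ X]card_ord -prodr_const; apply: ler_prod => i _.
  by rewrite near_count_ge0 /b -natr1 addrAC addrK h.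
- by rewrite subr_ge0; apply: powRN_le => //; [exact: lt_trans (ab k) | exact: ltW].
- rewrite -[X in _ <= _ ^+ X]card_ord -prodr_const; apply: ler_prod => i _.
  rewrite near_count_ge0 /a -natr1 addrK; apply: near_count_le.
  by rewrite -natrM ler_nat; lia.
Qed.

(** Cutting the layers at [J] leaves a multiple of [(J+1)^(- s)]; this removes it by letting [J]
    grow. *)
Lemma le_add_powRN (x B C : R) :
  (forall J : nat, x <= B + C * pw J.+1%:R) -> x <= B.
Proof.
move=> h; have [C0|C0] := lerP C 0.
  by apply: le_trans (h 0%N) _; rewrite gerDl mulr_le0_ge0 ?powR_ge0.
apply/ler_addgt0Pr => e e0.
pose J := Num.truncn ((C / e) `^ s^-1).
apply: le_trans (h J) _; rewrite lerD2l -ler_pdivlMl//.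
have : (C / e) `^ s^-1 <= J.+1%:R by apply/ltW/truncnS_gt.
move=> /(@ge0_ler_powR _ s (ltW s0)); rewrite !nnegrE => /(_ (powR_ge0 _ _) (ler0n _ _)).
rewrite -powRrM mulVf ?gt_eqF// powRr1 ?(ltW (divr_gt0 C0 e0))// => hJ.
rewrite powRN (mulrC _ e) -[leRHS]invf_div.
by rewrite lef_pV2 ?posrE ?powR_gt0 ?divr_gt0.
Qed.

End lattice_count.

Section exhaustion.
Variable R : realType.

Lemma fsbig_range (V : Type) (idx : V) (op : Monoid.com_law idx) (I : finType)
    (T : choiceType) (e : I -> T) (F : T -> V) : injective e ->
  \big[op/idx]_(j \in range e) F j = \big[op/idx]_i F (e i).
Proof.
move=> ie; rewrite fsbig_image; last by move=> x y _ _; exact: ie.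
rewrite [RHS]fsbig_seq ?index_enum_uniq//.
rewrite (_ : [set` index_enum I] = setT)//.
by apply/seteqP; split=> // x _ /=; rewrite mem_index_enum.
Qed.

Variables (T : choiceType) (I : nat -> finType) (e : forall N, I N -> T) (u : T -> R).
Hypothesis u0 : forall k, 0 <= u k.
Hypothesis e_inj : forall N, injective (e (N := N)).
Hypothesis exhaust : forall X : set T, finite_set X -> exists N, X `<=` range (e (N := N)).

(** The uniform bound [B] makes the extended sum finite; an infinite one would be sent to [0] by
    [fine]. *)
Lemma family_sum_exhaust (B : R) : (forall N, \sum_i u (e (N := N) i) <= B) ->
  forall N, \sum_i u (e (N := N) i) <= family_sum u.
Proof.
move=> uB N.
have E : family_sum u = fine (\esum_(i in [set: T]) (u i)%:E).
  rewrite /family_sum (_ : \esum_(i in _) (Num.max (- u i) 0)%:E = 0%E); last first.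
    by apply: esum1 => i _; rewrite max_r// oppr_le0.
  rewrite subr0; congr fine; apply: eq_esum => i _.
  by rewrite max_l.
have range_sum M : (\sum_(k \in range (e (N := M))) (u k)%:E = (\sum_i u (e (N := M) i))%:E)%E.
  by rewrite fsbig_range// sumEFin.
have leB : (\esum_(i in [set: T]) (u i)%:E <= B%:E)%E.
  apply: ge_ereal_sup => _ [X [finX _] <-].
  have [M XM] := exhaust finX.
  apply: le_trans (_ : (\sum_(k \in range (e (N := M))) (u k)%:E <= _)%E).
    apply: lee_fsum_nneg_subset => //.
    - by apply: finite_image; exact: finite_finset.
    - by move=> k; rewrite !inE; exact: XM.
    - by move=> k _; rewrite lee_fin.
  by rewrite range_sum lee_fin.
rewrite E -lee_fin fineK; last first.
  rewrite ge0_fin_numE ?(le_lt_trans leB) ?ltry//.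
  by apply: esum_ge0 => k _; rewrite lee_fin.
apply: esum_ge; exists (range (e (N := N))); last by rewrite range_sum.
by split=> //; apply: finite_image; exact: finite_finset.
Qed.

End exhaustion.

(** * The full lattice sum *)

Section lattice_total.
Variable R : realType.

Definition int_point (N : nat) (n : 'I_(N.*2.+1)) : int := n%:Z - N%:Z.

Definition int_box (d N : nat) (k : {ffun 'I_d -> 'I_(N.*2.+1)}) : 'rV[int]_d :=
  \row_i int_point (k i).

Lemma int_point_inj N : injective (@int_point N).
Proof. by move=> i j; rewrite /int_point => h; apply/val_inj => /=; lia. Qed.

Lemma int_pointP N (z : int) : (`|z| <= N)%N -> exists n, @int_point N n = z.
Proof.
move=> h; have h' : (`|(z + N%:Z)%R| < N.*2.+1)%N by lia.
by exists (Ordinal h'); rewrite /int_point /=; lia.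
Qed.

Lemma int_box_inj d N : injective (@int_box d N).
Proof.
move=> k k' /rowP h; apply/ffunP => i.
by have := h i; rewrite !mxE => /int_point_inj.
Qed.

Lemma int_boxP d N (z : 'rV[int]_d) : (forall i, (`|z ord0 i| <= N)%N) ->
  exists k, @int_box d N k = z.
Proof.
move=> h; have h' i := int_pointP (h i).
exists [ffun i => sval (cid (h' i))]; apply/rowP => i.
by rewrite mxE ffunE (svalP (cid (h' i))).
Qed.

Lemma int_pointE N (n : 'I_(N.*2.+1)) : (int_point n)%:~R = n%:R - N%:R :> R.
Proof. by rewrite /int_point rmorphB /= !pmulrn. Qed.

Lemma int_boxE d N (k : {ffun 'I_d -> 'I_(N.*2.+1)}) :
  map_mx intr (int_box k) = box_point R k.
Proof. by apply/rowP => i; rewrite !mxE int_pointE. Qed.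

Lemma int_exhaust (X : set int) : finite_set X ->
  exists N, X `<=` range (@int_point N).
Proof.
move=> /finite_seqP[s ->]; exists (\max_(z <- s) `|z|)%N => z /= zs.
have [|n <-] := @int_pointP (\max_(z <- s) `|z|)%N z; last by exists n.
by rewrite (big_rem z)//= leq_maxl.
Qed.

Lemma int_box_exhaust d (X : set 'rV[int]_d) : finite_set X ->
  exists N, X `<=` range (@int_box d N).
Proof.
move=> /finite_seqP[s ->].
exists (\max_(z <- s) \max_(i < d) `|z ord0 i|)%N => z /= zs.
have [|n <-] := @int_boxP d (\max_(z <- s) \max_(i < d) `|z ord0 i|)%N z; last by exists n.
by move=> i; rewrite (big_rem z)//= leq_max (leq_bigmax i).
Qed.

Variables (d : nat) (s : R).
Hypotheses (d0 : (0 < d)%N) (ds : d%:R < s).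

Local Notation pw b := (b `^ (- s)).

Let s0 : 0 < s. Proof. by apply: le_lt_trans ds. Qed.

(** Discrete counterpart of the integral of [t ^ (- (1 + e))], by which the sums of powers
    telescope. *)
Lemma powRN_telescope (e : R) (k : nat) : 0 < e -> (0 < k)%N ->
  k.+1%:R `^ (- (1 + e)) <= e^-1 * (k%:R `^ (- e) - k.+1%:R `^ (- e)).
Proof.
move=> e0 k0; have kR : 0 < k%:R :> R by rewrite ltr0n.
rewrite ler_pdivlMl//.
have -> : k%:R `^ (- e) = k.+1%:R `^ (- e) * expR (e * (ln k.+1%:R - ln k%:R)) :> R.
  by rewrite /powR !gt_eqF// -expRD; congr expR; ring.
have -> : k.+1%:R `^ (- (1 + e)) = k.+1%:R `^ (- e) * k.+1%:R^-1 :> R.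
  rewrite opprD addrC powRD; last by rewrite pnatr_eq0 implybT.
  by rewrite (powRN _ 1) powRr1.
rewrite mulrCA -[X in _ <= _ - X]mulr1 -mulrBr ler_wpM2l ?powR_ge0//.
have h := expR_ge1Dx (e * (ln k.+1%:R - ln k%:R)).
have : k.+1%:R^-1 <= ln k.+1%:R - ln k%:R :> R.
  have := @ln_leB1 R (k%:R / k.+1%:R); rewrite divr_gt0// => /(_ isT).
  rewrite ln_div ?posrE//.
  have -> : k%:R / k.+1%:R - 1 = - k.+1%:R^-1 :> R.
    by rewrite -[k.+1%:R]natr1; field; lra.
  by move: (ln k%:R) (ln k.+1%:R) (k.+1%:R^-1) => a b c; lra.
move=> h'; rewrite -(ler_pM2l e0) in h'; apply: le_trans h' _.
by rewrite lerBrDl.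
Qed.

(** The profile drops by at most [s (k+1)^(-1-s)] against at most [2^d (k+1)^d] points, a summable
    power because [d < s]. *)
Lemma shell_sum_bounded : exists B, forall M, \sum_(k < M) shell_term d s k <= B.
Proof.
pose e := s - d%:R; have e0 : 0 < e by rewrite subr_gt0.
pose C := s * 2 ^+ d; have C0 : 0 < C by rewrite mulr_gt0 ?exprn_gt0.
have term k : shell_term d s k <= C * k.+1%:R `^ (- (1 + e)).
  have k1 : 0 < k.+1%:R :> R by [].
  have h1 : (k.*2.+1)%:R ^+ d <= 2 ^+ d * k.+1%:R ^+ d :> R.
    by rewrite -exprMn; apply: lerXn2r; rewrite ?nnegrE// -natrM ler_nat; lia.
  have h2 : pw k.+1%:R - pw k.+2%:R <= s * k.+1%:R `^ (- (1 + s)) :> R.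
    have -> : pw k.+2%:R = pw k.+1%:R * expR (- (s * (ln k.+2%:R - ln k.+1%:R))) :> R.
      by rewrite /powR !gt_eqF// -expRD; congr expR; ring.
    have -> : k.+1%:R `^ (- (1 + s)) = pw k.+1%:R * k.+1%:R^-1 :> R.
      rewrite opprD addrC powRD; last by rewrite pnatr_eq0 implybT.
      by rewrite (powRN _ 1) powRr1.
    rewrite mulrCA -[X in X - _]mulr1 -mulrBr ler_wpM2l ?powR_ge0//.
    have h := expR_ge1Dx (- (s * (ln k.+2%:R - ln k.+1%:R))).
    have : ln k.+2%:R - ln k.+1%:R <= k.+1%:R^-1 :> R.
      have := @ln_leB1 R (k.+2%:R / k.+1%:R); rewrite divr_gt0// => /(_ isT).
      rewrite ln_div ?posrE//.
      have -> : k.+2%:R / k.+1%:R - 1 = k.+1%:R^-1 :> R.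
        by rewrite -[k.+2%:R]natr1 mulrDl divff ?pnatr_eq0// mul1r addrAC subrr add0r.
      by [].
    move=> h'; rewrite -(ler_pM2l s0) in h'; apply: le_trans h'.
    by rewrite lerBlDl -lerBlDr.
  rewrite /shell_term /C; apply: (@le_trans _ _ ((2 ^+ d * k.+1%:R ^+ d) * (s * k.+1%:R `^ (- (1 + s))))).
    apply: ler_pM => //; rewrite ?exprn_ge0// subr_ge0.
    by apply: (powRN_le s0) => //; rewrite ler_nat.
  have -> : - (1 + e) = d%:R + - (1 + s) by rewrite /e; ring.
  rewrite powRD; last by rewrite pnatr_eq0 implybT.
  by rewrite powR_mulrn//; lra.
exists (C * (1 + e^-1)) => M.
apply: (@le_trans _ _ (C * \sum_(k < M) k.+1%:R `^ (- (1 + e)))).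
  by rewrite mulr_sumr; apply: ler_sum => k _.
rewrite ler_pM2l//.
case: M => [|M]; first by rewrite big_ord0 addr_ge0 ?invr_ge0 ?ltW.
suff : \sum_(k < M.+1) k.+1%:R `^ (- (1 + e)) <= 1 + e^-1 * (1 - M.+1%:R `^ (- e)).
  move=> /le_trans; apply; rewrite lerD2l; apply: ler_piMr.
    by rewrite invr_ge0 ltW.
  by rewrite gerBl powR_ge0.
elim: M => [|M IH]; first by rewrite big_ord_recr big_ord0 /= !powR1 subrr mulr0 add0r addr0.
rewrite big_ord_recr/=; apply: le_trans (lerD IH (powRN_telescope e0 (ltn0Sn M))) _.
lra.
Qed.

(** [2k + 2 <= 2 (2k + 1)] per coordinate. The factor [2^d] serves for finiteness in general; for
    [d = 1] it is the factor [2] needed in the first variable. *)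
Lemma sup_term_half_le k : sup_term d s (1/2) k <= 2 ^+ d * shell_term d s k.
Proof.
rewrite /sup_term /sup_extra /shell_term.
set a := pw _; set b := pw _; set c := pw _.
have k0 := ltr0Sn R k; have kS : k.+2%:R = k.+1%:R + 1 :> R by rewrite natr1.
have ab : b <= a by apply: (powRN_le s0) => //; lra.
have bc : c <= b by apply: (powRN_le s0); [lra | rewrite (kS); lra].
have h : k.*2.+2%:R ^+ d <= 2 ^+ d * k.*2.+1%:R ^+ d :> R.
  by rewrite -exprMn; apply: lerXn2r; rewrite ?nnegrE// -natrM ler_nat; lia.
have h' : k.*2.+1%:R ^+ d <= 2 ^+ d * k.*2.+1%:R ^+ d :> R.
  by rewrite ler_peMl ?exprn_ge0// exprn_ege1//; lra.
set x := k.*2.+1%:R ^+ d in h h' *; set y := k.*2.+2%:R ^+ d in h *.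
have -> : 2 ^+ d * (x * (a - c)) = 2 ^+ d * x * (a - b) + 2 ^+ d * x * (b - c) by ring.
by apply: lerD; apply: ler_wpM2r => //; rewrite subr_ge0.
Qed.

Lemma lattice_sum_bounded : exists B, forall N y, @lattice_sum R d N s y <= B.
Proof.
have [B hB] := shell_sum_bounded; exists (2 ^+ d * B) => N y.
apply: (@le_add_powRN _ s s0 _ _ #|{: {ffun 'I_d -> 'I_(N.*2.+1)}}|%:R) => J.
have half0 : 0 < 1/2 :> R by lra.
have half1 : 1/2 < 1 :> R by lra.
have cnt (i : 'I_d) (k : nat) : near_count N (y ord0 i) (k%:R + 1/2) <= k.*2.+1%:R.
  by apply: (@near_count_le R N _ _ k.*2.+1); rewrite -[k.*2.+1%:R]natr1 -mul2n natrM; lra.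
apply: le_trans (lattice_sum_sup s0 J half0 half1 cnt) _.
rewrite lerD2r; apply: le_trans (_ : 2 ^+ d * \sum_(k < J) shell_term d s k <= _).
  by rewrite mulr_sumr; apply: ler_sum => k _; exact: sup_term_half_le.
by rewrite ler_wpM2l// exprn_ge0.
Qed.

Lemma shell_cake (r : R) M : 0 <= r -> r <= M%:R ->
  \sum_(k < M) (r <= k%:R)%R%:R * (pw k.+1%:R - pw k.+2%:R) + pw M.+1%:R <= pw (1 + r).
Proof.
move=> r0; elim: M => [|M IH] rM.
  rewrite big_ord0 add0r (_ : r = 0) ?addr0//; apply/eqP; rewrite eq_le r0 andbT; exact: rM.
rewrite big_ord_recr/=; have [rM'|Mr] := leP r M%:R.
  by rewrite mul1r; have := IH rM'; lra.
rewrite big1 ?add0r ?mul0r ?add0r => [|k _].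
  by apply: (powRN_le s0); [lra | rewrite -[M.+2%:R]natr1; lra].
rewrite leNgt (_ : k%:R < r) ?mul0r//; apply: le_lt_trans Mr.
by rewrite ler_nat ltnW.
Qed.

Lemma centered_count M k : (k <= M)%N ->
  \sum_(n < M.*2.+1) (`|0 - (n%:R - M%:R)| <= k%:R :> R)%R%:R >= k.*2.+1%:R :> R.
Proof.
move=> kM.
have -> : k.*2.+1%:R = \sum_(M - k <= i < (M + k).+1) 1%:R :> R.
  by rewrite -natr_sum sum_nat_const_nat muln1; congr (_%:R); lia.
rewrite (big_nat_widenl _ 0%N)// (big_nat_widen _ _ M.*2.+1); last by lia.
rewrite big_mkcond/= big_mkord; apply: ler_sum => i _; case: ifPn => // /andP[h1 h2].
rewrite (_ : `|_| <= _)// ler_norml.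
have : (M <= i + k)%N by lia.
rewrite -(@ler_nat R) natrD => h3.
have : (i <= M + k)%N by lia.
rewrite -(@ler_nat R) natrD => h4.
by apply/andP; split; lra.
Qed.

Lemma lattice_sum_shells M :
  \sum_(k < M) shell_term d s k + M.*2.+1%:R ^+ d * pw M.+1%:R
  <= @lattice_sum R d M s 0.
Proof.
rewrite /lattice_sum.
apply: le_trans (_ : \sum_(kk : {ffun 'I_d -> 'I_(M.*2.+1)}) (\sum_(k < M)
   (`|0 - box_point R kk| <= k%:R)%R%:R * (pw k.+1%:R - pw k.+2%:R) + pw M.+1%:R) <= _); last first.
  apply: ler_sum => kk _; apply: shell_cake => //.
  rewrite rV_norm_le//; apply/forallP => i; rewrite !mxE ler_norml.
  have h : (kk i <= 2 * M)%N by have := ltn_ord (kk i); lia.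
  rewrite -(@ler_nat R) natrM in h.
  have : 0 <= (kk i)%:R :> R by [].
  by move=> h'; apply/andP; split; lra.
rewrite big_split/= sumr_const; apply: lerD; last first.
  by rewrite card_ffun !card_ord -(mulr_natl (pw _)) natrX.
rewrite exchange_big/=; apply: ler_sum => k _; rewrite -mulr_suml.
apply: ler_wpM2r; first by rewrite subr_ge0; apply: (powRN_le s0); rewrite ?ler_nat.
have -> : \sum_(kk : {ffun 'I_d -> 'I_(M.*2.+1)}) (`|0 - box_point R kk| <= k%:R)%R%:R
   = \prod_(i < d) \sum_(n < M.*2.+1) (`|0 - (n%:R - M%:R)| <= k%:R :> R)%R%:R :> R.
  rewrite bigA_distr_bigA; apply: eq_bigr => kk _; rewrite rV_norm_le//.
  have -> : [forall i, `|(0 - box_point R kk) ord0 i| <= k%:R]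
      = [forall i, `|0 - ((kk i)%:R - M%:R)| <= k%:R :> R].
    by apply: eq_forallb => i; rewrite !mxE.
  case: forallP => [h|/forallP].
    by rewrite big1// => i _; rewrite h.
  by rewrite negb_forall => /existsP[i /negbTE hi]; rewrite (bigD1 i)//= hi mul0r.
rewrite -[X in _ ^+ X <= _]card_ord -prodr_const; apply: ler_prod => i _.
by rewrite ler0n centered_count// ltnW.
Qed.

(** The sum inside [cstar], written in the same form so that it can be folded there. *)
Definition lattice_total : R := family_sum (fun k : 'rV[int]_d =>
  1 / (1 + `|map_mx intr k : 'rV[R]_d|) `^ s).

Lemma lattice_total_shells M :
  \sum_(k < M) shell_term d s k + M.*2.+1%:R ^+ d * pw M.+1%:R <= lattice_total.
Proof.
apply: le_trans (lattice_sum_shells M) _.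
have E N : @lattice_sum R d N s 0 = \sum_k 1 / (1 + `|map_mx intr (@int_box d N k) : 'rV[R]_d|) `^ s.
  by apply: eq_bigr => k _; rewrite int_boxE sub0r normrN powRN div1r.
have [B hB] := lattice_sum_bounded.
rewrite E; apply: (@family_sum_exhaust R _ (fun N => {ffun 'I_d -> 'I_(N.*2.+1)})
  (@int_box d)) => [k|N|X|N].
- by rewrite div1r invr_ge0 powR_ge0.
- exact: int_box_inj.
- exact: int_box_exhaust.
- by rewrite -E; exact: hB.
Qed.

End lattice_total.

Section integer_total.
Variables (R : realType) (s : R).
Hypothesis s1 : 1 < s.

Local Notation pw b := (b `^ (- s)).

Definition int_total : R := family_sum (fun k : int => 1 / (1 + `|k%:~R : R|) `^ s).

Let s0 : 0 < s. Proof. by apply: lt_trans s1. Qed.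
Let ds : 1%:R < s. Proof. by []. Qed.

Lemma rV1_norm (v : 'rV[R]_1) : `|v| = `|v ord0 ord0|.
Proof.
apply/eqP; rewrite eq_le; apply/andP; split.
  by rewrite rV_norm_le//; apply/forallP => i; rewrite (ord1 i).
by have := lexx `|v|; rewrite {1}rV_norm_le// => /forallP.
Qed.

Lemma lattice_sum1 N (x : R) : @lattice_sum R 1 N s (const_mx x) =
  \sum_(n < N.*2.+1) pw (1 + `|x - (n%:R - N%:R)|).
Proof.
rewrite /lattice_sum.
rewrite (reindex (fun n : 'I_(N.*2.+1) => [ffun _ : 'I_1 => n])) /=; last first.
  exists (fun k : {ffun 'I_1 -> 'I_(N.*2.+1)} => k ord0) => [n _|k _].
    by rewrite ffunE.
  by apply/ffunP => i; rewrite ffunE (ord1 i).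
by apply: eq_bigr => n _; rewrite rV1_norm !mxE ffunE.
Qed.

(** In one dimension the count at any centre is at most twice the centred one, so the first variable
    needs no dichotomy: the loss is a factor [2], which [cstar] contains. *)
Lemma int_window_le N (x : R) :
  \sum_(n < N.*2.+1) pw (1 + `|x - (n%:R - N%:R)|) <= 2 * int_total.
Proof.
have total M : \sum_(k < M) shell_term 1 s k <= int_total.
  have E L : @lattice_sum R 1 L s 0 = \sum_n 1 / (1 + `|(@int_point L n)%:~R : R|) `^ s.
    rewrite -(_ : const_mx 0 = 0 :> 'rV[R]_1); last by apply/rowP => i; rewrite !mxE.
    by rewrite lattice_sum1; apply: eq_bigr => n _; rewrite int_pointE sub0r normrN powRN div1r.
  have [B hB] := @lattice_sum_bounded R 1 s isT ds.
  apply: le_trans (_ : @lattice_sum R 1 M s 0 <= _).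
    apply: le_trans (@lattice_sum_shells R 1 s isT ds M).
    by rewrite lerDl mulr_ge0 ?exprn_ge0 ?powR_ge0.
  rewrite E; apply: (@family_sum_exhaust R _ (fun N => 'I_(N.*2.+1)) (@int_point)) => [k|L|X|L].
  - by rewrite div1r invr_ge0 powR_ge0.
  - exact: int_point_inj.
  - exact: int_exhaust.
  - by rewrite -E; exact: hB.
rewrite -lattice_sum1.
apply: (@le_add_powRN _ s s0 _ _ #|{: {ffun 'I_1 -> 'I_(N.*2.+1)}}|%:R) => J.
have half0 : 0 < 1/2 :> R by lra.
have half1 : 1/2 < 1 :> R by lra.
have cnt (i : 'I_1) (k : nat) : near_count N ((const_mx x : 'rV[R]_1) ord0 i) (k%:R + 1/2) <= k.*2.+1%:R.
  by apply: (@near_count_le R N _ _ k.*2.+1); rewrite -[k.*2.+1%:R]natr1 -mul2n natrM; lra.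
apply: le_trans (lattice_sum_sup s0 J half0 half1 cnt) _.
rewrite lerD2r; apply: le_trans (_ : 2 * \sum_(k < J) shell_term 1 s k <= _).
  rewrite mulr_sumr; apply: ler_sum => k _.
  by apply: le_trans (@sup_term_half_le R 1 s isT ds k) _; rewrite expr1.
by rewrite ler_pM2l.
Qed.

Lemma int_total_gt0 : 0 < int_total.
Proof.
have := int_window_le 0 0; rewrite big_ord_recl big_ord0 addr0 /= => h.
suff : 0 < 2 * int_total by rewrite pmulr_rgt0.
by apply: lt_le_trans h; rewrite powR_gt0// subrr subr0 normr0 addr0.
Qed.

End integer_total.

Section lattice_total_pos.
Variables (R : realType) (d : nat) (s : R).
Hypotheses (d0 : (0 < d)%N) (ds : d%:R < s).

Lemma lattice_total_gt0 : 0 < lattice_total d s.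
Proof.
apply: lt_le_trans (lattice_total_shells d0 ds 0).
by rewrite big_ord0 add0r double0 expr1n mul1r powR_gt0.
Qed.

End lattice_total_pos.

(** * Integrals of products over a cube *)

Section product_integral.
Variable R : realType.

(** Induction on [d]: the measure on rows is the image of a product under [cons_rV], and Tonelli
    splits off the first coordinate. *)
Lemma integral_rV_prod d (f : 'I_d -> R -> R) (a : 'I_d -> R) :
  (forall i, measurable_fun setT (f i : measurableTypeR R -> R)) ->
  (forall i t, 0 <= f i t) ->
  (forall i, \int[lebesgue_measure]_t (f i t)%:E = (a i)%:E)%E ->
  (\int[lebesgue_rV]_(y in [set: 'rV[R]_d]) (\prod_i f i (y ord0 i))%:E = (\prod_i a i)%:E)%E.
Proof.
elim: d f a => [|d IH] f a mf f0 fa.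
  under eq_integral do rewrite big_ord0.
  by rewrite big_ord0 integral_cst//= mul1e diracT.
have mF : measurable_fun [set: 'rV[R]_d.+1] (EFin \o (fun y : 'rV[R]_d.+1 => \prod_i f i (y ord0 i) : R)).
  apply/measurable_EFinP; apply: measurable_prod => i _.
  exact: (measurableT_comp (mf i) (measurable_coord i)).
have mF' : measurable_fun [set: 'rV[R]_d] (EFin \o (fun y : 'rV[R]_d => \prod_(i < d) f (lift ord0 i) (y ord0 i) : R)).
  apply/measurable_EFinP; apply: measurable_prod => i _.
  exact: (measurableT_comp (mf _) (measurable_coord i)).
have F0 (y : 'rV[R]_d) : (0 <= (\prod_(i < d) f (lift ord0 i) (y ord0 i))%:E)%E.
  by rewrite lee_fin prodr_ge0.
have -> : @lebesgue_rV R d.+1 =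
    pushforward (lebesgue_measure \x @lebesgue_rV R d)%E (@cons_rV R d) by [].
rewrite ge0_integral_pushforward//=; last 2 first.
- exact: measurable_cons_rV.
- by move=> y _; rewrite lee_fin prodr_ge0.
rewrite preimage_setT fubini_tonelli1/=; last 2 first.
- exact: (measurableT_comp mF (@measurable_cons_rV R d)).
- by move=> z; rewrite lee_fin prodr_ge0.
transitivity (\int[lebesgue_measure]_t ((f ord0 t)%:E * (\prod_(i < d) a (lift ord0 i))%:E))%E.
  apply: eq_integral => t _; rewrite /fubini_F/=.
  transitivity (\int[@lebesgue_rV R d]_y
      ((f ord0 t)%:E * (\prod_(i < d) f (lift ord0 i) (y ord0 i))%:E))%E.
    apply: eq_integral => y _; rewrite big_ord_recl cons_rV0 EFinM.
    by under eq_bigr do rewrite cons_rVS.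
  rewrite ge0_integralZl//; last by rewrite lee_fin.
  congr (_ * _)%E.
  by apply: (IH (fun i => f (lift ord0 i)) (fun i => a (lift ord0 i))).
rewrite ge0_integralZr//.
- by rewrite fa -EFinM big_ord_recl.
- by apply/measurable_EFinP; exact: mf.
- by move=> t _; rewrite lee_fin.
- rewrite lee_fin prodr_ge0// => i _; rewrite -lee_fin -fa.
  by apply: integral_ge0 => t _; rewrite lee_fin.
Qed.

Definition sym_itv (K : R) : set R := `[- K, K]%classic.

Lemma measurable_sym_itv (K : R) : measurable (sym_itv K : set (measurableTypeR R)).
Proof. exact: measurable_itv. Qed.

#[local] Hint Extern 0 (measurable (sym_itv _)) => solve [exact: measurable_sym_itv] : core.

Lemma lebesgue_sym_itv (K : R) : 0 < K -> (lebesgue_measure (sym_itv K) = (2 * K)%:E)%E.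
Proof.
move=> K0; rewrite /sym_itv lebesgue_measure_itv/= lte_fin.
by rewrite ifT; [rewrite -EFinD; congr EFin; ring | lra].
Qed.

Definition rV_box (d : nat) (K : R) : set 'rV[R]_d :=
  [set y | forall i, - K <= y ord0 i <= K].

Lemma measurable_rV_box d K : measurable (@rV_box d K).
Proof.
have -> : @rV_box d K = \bigcap_(i in [set: 'I_d])
    ((fun y : 'rV[R]_d => y ord0 i : measurableTypeR R) @^-1` `[- K, K]).
  apply/seteqP; split => y /= h.
    by move=> i _; rewrite /= in_itv/=; exact: h.
  by move=> i; have := h i I; rewrite /= in_itv.
apply: fin_bigcap_measurable; first by [].

move=> i _.
by have := @measurable_coord R d i measurableT _ (measurable_itv `[- K, K]); rewrite setTI.
Qed.

Lemma rV_box_indic d K (y : 'rV[R]_d) :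
  \1_(rV_box K) y = \prod_i \1_(sym_itv K) (y ord0 i) :> R.
Proof.
rewrite indicE; have [h|h] := boolP (y \in rV_box K).
  rewrite big1// => i _; rewrite indicE mem_set// /sym_itv/=.
  by rewrite in_itv/=; move: h; rewrite inE; exact.
have : exists i, ~ (- K <= y ord0 i <= K).
  apply: contrapT => /forallNP h'; move/negP: h; apply.
  by rewrite inE => i; apply: contrapT; exact: h'.
move=> [i hi]; by rewrite (bigD1 i)//= indicE memNset ?mul0r// /sym_itv/= in_itv.
Qed.

Lemma integral_rV_box d (K : R) (g : 'I_d -> R -> R) (a : 'I_d -> R) :
  (forall i, measurable_fun setT (g i : measurableTypeR R -> R)) ->
  (forall i t, 0 <= g i t) ->
  (forall i, \int[lebesgue_measure]_(t in (sym_itv K)) (g i t)%:E = (a i)%:E)%E ->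
  (\int[lebesgue_rV]_(y in rV_box K) (\prod_i g i (y ord0 i))%:E = (\prod_i a i)%:E)%E.
Proof.
move=> mg g0 ga; rewrite integral_mkcond.
rewrite -(@integral_rV_prod d (fun i t => g i t * \1_(sym_itv K) t) a).
- apply: eq_integral => y _; rewrite /patch big_split/= -rV_box_indic indicE.
  by case: ifPn => _; rewrite ?mulr1 ?mulr0.
- move=> i; by apply: measurable_funM => //; apply: measurable_indic; exact: measurable_sym_itv.
- by move=> i t; rewrite mulr_ge0.
- move=> i; rewrite -ga [RHS]integral_mkcond; apply: eq_integral => t _.
  by rewrite /patch indicE; case: ifPn => _; rewrite ?mulr1 ?mulr0.
Qed.

Lemma lebesgue_rV_box d (K : R) : 0 < K -> (lebesgue_rV (@rV_box d K) = ((2 * K) ^+ d)%:E)%E.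
Proof.
move=> K0; rewrite -[LHS]mul1e -integral_cst; last exact: measurable_rV_box.
have -> : (2 * K) ^+ d = \prod_(i < d) (2 * K) by rewrite prodr_const card_ord.
rewrite -(@integral_rV_box d K (fun _ _ => 1))//.
  by apply: eq_integral => y _; rewrite big1.
move=> i; rewrite integral_cst; last exact: measurable_sym_itv.
by rewrite mul1e; exact: lebesgue_sym_itv.
Qed.

End product_integral.

(** * Mean number of integers near a moving point *)

Section average_count.
Variables (R : realType) (N : nat).

#[local] Hint Extern 0 (measurable (sym_itv _)) => solve [exact: measurable_sym_itv] : core.

Local Notation clamp h u := (Num.min (Num.max (u + h) 0) (2 * h)).

Lemma near_count_indic (t tau w : R) : near_count N (t - tau) w =
  \sum_(n < N.*2.+1) \1_(`]tau + (n%:R - N%:R) - w, tau + (n%:R - N%:R) + w[%classic : set R) t.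
Proof.
apply: eq_bigr => n _; rewrite indicE; congr ((nat_of_bool _)%:R).
rewrite ltr_norml mem_setE in_itv/=.
by apply/andP/andP => -[h1 h2]; split; lra.
Qed.

Lemma measurable_near_count (tau w : R) :
  measurable_fun setT (fun t : measurableTypeR R => near_count N (t - tau) w).
Proof.
under [X in measurable_fun _ X]eq_fun do rewrite near_count_indic.
by apply: measurable_sum => n; exact: measurable_indic.
Qed.

Let clamp_le (h x y : R) : x <= y -> clamp h x <= clamp h y.
Proof.
move=> xy; rewrite le_min !ge_min lexx orbT andbT ge_max !le_max lerD2r xy.
by rewrite lexx orbT.
Qed.

(** [clamp h u] is the length of the part of []-h, h[] below [u], so an overlap of intervals is a
    difference of clamps, a form that telescopes over integer centres. *)
Let measure_clamp (a b c h : R) : a <= b -> 0 < h ->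
  (lebesgue_measure (`](c - h)%R, (c + h)%R[%classic `&` `[a, b]%classic : set R)
   <= (clamp h (b - c) - clamp h (a - c))%:E)%E.
Proof.
move=> ab h0.
apply: (@le_trans _ _ (lebesgue_measure (`[(Num.max a (c - h))%R, (Num.min b (c + h))%R]%classic : set R))).
  apply: le_measure; rewrite ?inE//; first exact: measurableI.
  move=> t /= [+ +]; rewrite !in_itv/= => /andP[h1 h2] /andP[h3 h4].
  by rewrite ge_max le_min h3 h4 !ltW.
rewrite lebesgue_measure_itv/= lte_fin; case: ifPn => _; last first.
  by rewrite lee_fin subr_ge0; apply: clamp_le => //; rewrite lerD2r.
rewrite -EFinB lee_fin.
have u1 : Num.min b (c + h) - (c - h) <= clamp h (b - c).
  have m1 : Num.min b (c + h) <= b by rewrite ge_min lexx.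
  have m2 : Num.min b (c + h) <= c + h by rewrite ge_min lexx orbT.
  rewrite le_min le_max; apply/andP; split; last by lra.
  by apply/orP; left; lra.
have u2 : clamp h (a - c) <= Num.max a (c - h) - (c - h).
  have m1 : a <= Num.max a (c - h) by rewrite le_max lexx.
  have m2 : c - h <= Num.max a (c - h) by rewrite le_max lexx orbT.
  rewrite ge_min ge_max; apply/orP; left; apply/andP; split; lra.
have -> : Num.min b (c + h) - Num.max a (c - h)
    = (Num.min b (c + h) - (c - h)) - (Num.max a (c - h) - (c - h)) by ring.
exact: lerB.
Qed.

(* On an interval of length at most 1 the difference of clamps is dominated by a
   telescoping sum; longer intervals are cut into pieces. *)
Let clamp_sum (tau a b : R) : 9/20 <= b - a ->
  \sum_(n < N.*2.+1) (clamp (3/20) (b - (tau + (n%:R - N%:R)))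
                      - clamp (3/20) (a - (tau + (n%:R - N%:R)))) <= 7/10 * (b - a).
Proof.
pose F a b := \sum_(n < N.*2.+1) (clamp (3/20) (b - (tau + (n%:R - N%:R)))
                      - clamp (3/20) (a - (tau + (n%:R - N%:R)))).
have F_add a' b' c' : F a' c' = F a' b' + F b' c'.
  rewrite /F -big_split/=; apply: eq_bigr => n _; ring.
have F_short a' b' : b' <= a' + 1 -> F a' b' <= 3/10.
  move=> ab; pose g (n : nat) : R := - clamp (3/20) (a' + 1 - (tau + (n%:R - N%:R))).
  apply: (@le_trans _ _ (\sum_(n < N.*2.+1) (g n.+1 - g n))).
    apply: ler_sum => n _; rewrite /g -[n.+1%:R]natr1.
    have -> : a' + 1 - (tau + (n%:R + 1 - N%:R)) = a' - (tau + (n%:R - N%:R)) by ring.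
    rewrite opprK [leRHS]addrC lerD2r.
    by apply: clamp_le; rewrite lerD2r.
  rewrite -(big_mkord xpredT (fun n => g n.+1 - g n)) telescope_sumr//.
  have clamp0 (u : R) : 0 <= clamp (3/20) u <= 2 * (3/20).
    by rewrite le_min ge_min le_max !lexx !orbT; lra.
  rewrite /g opprK.
  move: (clamp0 (a' + 1 - (tau + ((N.*2.+1)%:R - N%:R)))) (clamp0 (a' + 1 - (tau + (0%:R - N%:R)))).
  by move=> /andP[h1 h2] /andP[h3 h4]; lra.
suff H k : forall a b, 9/20 <= b - a -> b - a <= 9/20 * (k.+1%:R + 1) -> F a b <= 7/10 * (b - a).
  move=> ab; apply: (H (Num.truncn ((b - a) / (9/20)))) => //.
  have := truncnS_gt ((b - a) / (9/20)); rewrite ltr_pdivrMr; lra.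
elim: k => [|k IH] a' b' h1 h2.
  (* [3/10 <= 7/10 * 9/20]: between lengths [9/20] and [9/10] the bound for a single period
     suffices, and this is the origin of [7/10]. *)
  by apply: (@le_trans _ _ (3/10)); [apply: F_short|]; lra.
have [h3|h3] := leP (b' - a') (9/10).
  by apply: (@le_trans _ _ (3/10)); [apply: F_short|]; lra.
rewrite (F_add _ (a' + 9/20)).
have s1 : F a' (a' + 9/20) <= 3/10 by apply: F_short; lra.
have s2 : F (a' + 9/20) b' <= 7/10 * (b' - (a' + 9/20)).
  by apply: IH; rewrite -1?[k.+2%:R]natr1 in h2 *; lra.
lra.
Qed.

Lemma integral_near_count (tau K : R) : 9/20 <= 2 * K ->
  (\int[lebesgue_measure]_(t in (sym_itv K)) (near_count N (t - tau) (3/20))%:E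
   <= (7/10 * (2 * K))%:E)%E.
Proof.
move=> hK.
under eq_integral do rewrite near_count_indic -sumEFin.
rewrite ge0_integral_sum//; last first.
  by move=> n; apply/measurable_EFinP; exact: measurable_indic.
apply: (@le_trans _ _ (\sum_(n < N.*2.+1) (clamp (3/20) (K - (tau + (n%:R - N%:R)))
                      - clamp (3/20) (- K - (tau + (n%:R - N%:R))))%:E)%E).
  apply: lee_sum => n _; rewrite integral_indic//.
  by apply: measure_clamp; lra.
rewrite sumEFin lee_fin; apply: le_trans (@clamp_sum tau (- K) K _) _; lra.
Qed.

(** The interval of half-width [j/2 + h] is one of half-width [h] at its left end, followed by a
    half-open interval of length [j], which holds at most [j] integers. *)
Lemma near_count_split (j : nat) (t h : R) : 0 < h -> 
  near_count N t (j%:R / 2 + h) <= j%:R + near_count N (t - j%:R / 2) h.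
Proof.
move=> h0; rewrite /near_count.
apply: le_trans (_ : \sum_(n < N.*2.+1) ((t - j%:R / 2 + h <= n%:R - N%:R < t + j%:R / 2 + h)%R%:R
   + (`|t - j%:R / 2 - (n%:R - N%:R)| < h)%R%:R) <= _).
  apply: ler_sum => n _; rewrite -natrD ler_nat !ltr_norml.
  case: (boolP (_ <= _ < _)%R) => [_|]; first exact: leq_trans (leq_b1 _) (leq_addr _ _).
  rewrite negb_and -ltNge -leNgt add0n => /orP[h1|h1].
    by case: (boolP (_ && _)) => // /andP[h2 h3]; rewrite (_ : _ && _)//; apply/andP; split; lra.
  by case: (boolP (_ && _)) => // /andP[h2 h3]; lra.
rewrite big_split/= lerD2r; apply: bool_sum_le => i i' /andP[h1 h2] /andP[h3 h4].
rewrite -(@ltr_nat R) natrD; lra.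
Qed.

Lemma integral_near_count_split (j : nat) (tau K : R) : 0 < K -> 9/20 <= 2 * K ->
  exists2 c : R, (\int[lebesgue_measure]_(t in (sym_itv K))
     (near_count N (t - tau) (j%:R / 2 + 3/20))%:E = c%:E)%E &
   0 <= c <= (j%:R + 7/10) * (2 * K).
Proof.
move=> K0 hK.
have I0 : (0 <= \int[lebesgue_measure]_(t in (sym_itv K))
     (near_count N (t - tau) (j%:R / 2 + 3/20))%:E)%E.
  by apply: integral_ge0 => t _; rewrite lee_fin near_count_ge0.
have I1 : (\int[lebesgue_measure]_(t in (sym_itv K))
     (near_count N (t - tau) (j%:R / 2 + 3/20))%:E <= ((j%:R + 7/10) * (2 * K))%:E)%E.
  apply: (@le_trans _ _ (\int[lebesgue_measure]_(t in (sym_itv K))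
     (j%:R%:E + (near_count N (t - (tau + j%:R / 2)) (3/20))%:E))%E).
    apply: ge0_le_integral => //=.
    - by move=> t _; rewrite lee_fin near_count_ge0.
    - apply/measurable_EFinP; apply: measurable_funTS; exact: measurable_near_count.
    - apply: emeasurable_funD => //; apply/measurable_EFinP; apply: measurable_funTS.
      exact: measurable_near_count.
    - move=> t _; rewrite -EFinD lee_fin opprD addrA; apply: near_count_split; lra.
  rewrite ge0_integralD//=; last 2 first.
  - by move=> t _; rewrite lee_fin near_count_ge0.
  - by apply/measurable_EFinP; apply: measurable_funTS; exact: measurable_near_count.
  rewrite integral_cst//= [lebesgue_measure _]lebesgue_sym_itv//.
  rewrite -EFinM (mulrDl j%:R) EFinD; apply: leeD => //; exact: integral_near_count.
move: I0 I1; case: (integral _ _ _) => [c| |]//; rewrite !lee_fin => c0 c1.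
by exists c => //; rewrite c0.
Qed.

End average_count.

Section measurable_norm.
Variables (R : realType) (d : nat).

Lemma rV_box_norm (r : R) : 0 <= r -> rV_box r = [set y : 'rV[R]_d | `|y| <= r].
Proof.
move=> r0; apply/seteqP; split => y /=; rewrite rV_norm_le//.
  by move=> h; apply/forallP => i; rewrite ler_norml; exact: h.
by move=> /forallP h i; have := h i; rewrite ler_norml.
Qed.

Lemma measurable_rV_norm : measurable_fun setT (fun y : 'rV[R]_d => `|y| : measurableTypeR R).
Proof.
apply: (measurability _ (RGenOInfty.measurableE R)) => // _ [_ [r ->] <-].
rewrite setTI; have [r0|r0] := leP 0 r; last first.
  rewrite (_ : _ @^-1` _ = setT); first exact: measurableT.
  apply/seteqP; split => // y _ /=; rewrite in_itv/= andbT.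
  exact: lt_le_trans r0 _.
rewrite (_ : _ @^-1` _ = ~` rV_box r); first by apply: measurableC; exact: measurable_rV_box.
rewrite rV_box_norm//; apply/seteqP; split => y /=; rewrite in_itv/= andbT.
  by rewrite ltNge => /negP.
by move=> /negP; rewrite -ltNge.
Qed.

Lemma measurable_rV_sub (w : 'rV[R]_d) : measurable_fun setT (fun y : 'rV[R]_d => y - w).
Proof.
apply: measurable_fun_rV => i.
under [X in measurable_fun _ X]eq_fun do rewrite !mxE.
by apply: measurable_funB => //; exact: measurable_coord.
Qed.

Lemma measurable_lattice_sum N (s : R) (w : 'rV[R]_d) :
  measurable_fun setT (fun y : 'rV[R]_d => lattice_sum N s (y - w)).
Proof.
apply: measurable_sum => k.
apply: (measurableT_comp (measurable_powR _)).
apply: measurable_funD => //.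
under [X in measurable_fun _ X]eq_fun do rewrite -addrA -opprD.
exact: (measurableT_comp measurable_rV_norm (measurable_rV_sub _)).
Qed.

End measurable_norm.

(** * The mean of the lattice sum over a translated window *)

Section lattice_average.
Variables (R : realType) (d N : nat) (s K : R) (w : 'rV[R]_d).
Hypotheses (s0 : 0 < s) (K0 : 0 < K) (hK : 9/20 <= 2 * K).

Local Notation pw b := (b `^ (- s)).

Lemma measurable_rV_prod_count (v : R) : measurable_fun setT
  (fun y : 'rV[R]_d => \prod_i near_count N ((y - w) ord0 i) v).
Proof.
under [X in measurable_fun _ X]eq_fun do under eq_bigr do rewrite !mxE.
apply: measurable_prod => i _.
exact: (measurableT_comp (measurable_near_count N (w ord0 i) v) (measurable_coord i)).
Qed.

Let cell (k : nat) (y : 'rV[R]_d) : R :=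
  \prod_i near_count N ((y - w) ord0 i) (k%:R / 2 + 3/20).

Let integral_cell k : exists2 c : R,
  (\int[lebesgue_rV]_(y in rV_box K) (cell k y)%:E = c%:E)%E &
  c <= (k%:R + 7/10) ^+ d * (2 * K) ^+ d.
Proof.
have h i := @integral_near_count_split R N k (w ord0 i) K K0 hK.
pose c i := sval (cid2 (h i)).
have cE i : (\int[lebesgue_measure]_(t in sym_itv K)
    (near_count N (t - w ord0 i) (k%:R / 2 + 3/20))%:E = (c i)%:E)%E.
  by rewrite /c; case: cid2.
have c_le i : 0 <= c i <= (k%:R + 7/10) * (2 * K) by rewrite /c; case: cid2.
exists (\prod_i c i).
  rewrite -(@integral_rV_box R d K (fun i t => near_count N (t - w ord0 i) (k%:R / 2 + 3/20)))//.
  - by apply: eq_integral => y _; congr EFin; apply: eq_bigr => i _; rewrite !mxE.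
  - by move=> i; exact: measurable_near_count.
  - by move=> i t; exact: near_count_ge0.
rewrite -exprMn -[X in _ <= _ ^+ X]card_ord -prodr_const.
by apply: ler_prod => i _; exact: c_le.
Qed.

(** Layers break at [(k+2)/2] and again [3/20] later. The counts of half-width [k/2 + 3/20] are left
    to be averaged; those of half-width [(k+1)/2] are at most [k + 1] at every centre. *)
Let lattice_sum_cells (J : nat) (y : 'rV[R]_d) :
  lattice_sum N s (y - w) <=
  \sum_(k < J) (pw (k.+2%:R / 2) - pw (k.+2%:R / 2 + 3/20)) * cell k y +
  (\sum_(k < J) k.+1%:R ^+ d * (pw (k.+2%:R / 2 + 3/20) - pw (k.+3%:R / 2))
   + #|{: {ffun 'I_d -> 'I_(N.*2.+1)}}|%:R * pw (J.+2%:R / 2)).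
Proof.
pose a k : R := k.+2%:R / 2; pose b k : R := k.+2%:R / 2 + 3/20.
have kS k : k.+1%:R = k%:R + 1 :> R by rewrite natr1.
have ab k : a k < b k by rewrite ltrDl; lra.
have ba k : b k < a k.+1 by rewrite /a /b (kS k.+2); lra.
have a0 : a 0%N = 1 by rewrite /a divff.
have ap k : 0 < a k by rewrite divr_gt0.
apply: le_trans (lattice_sum_layers N s0 (y - w) J a0 ab ba) _.
rewrite addrA lerD2r -big_split/=; apply: ler_sum => k _; apply: lerD.
  rewrite mulrC le_eqVlt; apply/orP; left; apply/eqP; congr (_ * _).
  apply: eq_bigr => i _; congr (near_count _ _ _).
  by rewrite /b (kS k.+1) (kS k); field.
apply: ler_wpM2r.
  rewrite subr_ge0; apply: (powRN_le s0); first exact: lt_trans (ab k).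
  exact: ltW.
rewrite -[X in _ <= _ ^+ X]card_ord -prodr_const; apply: ler_prod => i _.
rewrite near_count_ge0; apply: near_count_le.
by rewrite /a (kS k.+2) (kS k.+1); lra.
Qed.

Lemma integral_lattice_sum (B : R) : (forall J, \sum_(j < J) avg_term d s j <= B) ->
  (\int[lebesgue_rV]_(y in rV_box K) (lattice_sum N s (y - w))%:E
   <= (B * (2 * K) ^+ d)%:E)%E.
Proof.
move=> hB.
set C : R := #|{: {ffun 'I_d -> 'I_(N.*2.+1)}}|%:R.
set V := (2 * K) ^+ d; have V0 : 0 < V by rewrite exprn_gt0 ?mulr_gt0.
have pos k : 0 < k.+2%:R / 2 :> R by rewrite divr_gt0.
have pos' k : 0 < k.+2%:R / 2 + 3/20 :> R by rewrite addr_gt0.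
have D1 k : 0 <= pw (k.+2%:R / 2) - pw (k.+2%:R / 2 + 3/20) :> R.
  by rewrite subr_ge0; apply: (powRN_le s0) => //; rewrite lerDl; lra.
have D2 k : 0 <= pw (k.+2%:R / 2 + 3/20) - pw (k.+3%:R / 2) :> R.
  rewrite subr_ge0; apply: (powRN_le s0) => //.
  by rewrite -[k.+3%:R]natr1; lra.
have mcell k : measurable_fun (rV_box K) (EFin \o cell k).
  by apply/measurable_EFinP; apply: measurable_funTS; exact: measurable_rV_prod_count.
have cell0 k y : 0 <= cell k y by apply: prodr_ge0 => i _; exact: near_count_ge0.
have mQ := @measurable_rV_box R d K.
have bound J : (\int[lebesgue_rV]_(y in rV_box K) (lattice_sum N s (y - w))%:E
    <= ((B + C * pw (J.+2%:R / 2)) * V)%:E)%E.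
  set E := \sum_(k < J) k.+1%:R ^+ d * (pw (k.+2%:R / 2 + 3/20) - pw (k.+3%:R / 2))
     + C * pw (J.+2%:R / 2).
  have E0 : 0 <= E.
    by rewrite addr_ge0 ?mulr_ge0 ?powR_ge0// sumr_ge0// => k _; rewrite mulr_ge0 ?exprn_ge0.
  apply: (@le_trans _ _ (\int[lebesgue_rV]_(y in rV_box K)
     (\sum_(k < J) (pw (k.+2%:R / 2) - pw (k.+2%:R / 2 + 3/20))%:E * (cell k y)%:E + E%:E))%E).
    have mS k : measurable_fun (rV_box K) (fun y =>
        ((pw (k.+2%:R / 2) - pw (k.+2%:R / 2 + 3/20))%:E * (cell k y)%:E)%E).
      by apply: emeasurable_funM => //; exact: mcell.
    apply: ge0_le_integral => //.
    - by move=> y _; rewrite lee_fin; apply: sumr_ge0 => k _; exact: powR_ge0.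
    - by apply/measurable_EFinP; apply: measurable_funTS; exact: measurable_lattice_sum.
    - by apply: emeasurable_funD => //; apply: emeasurable_sum.
    - move=> y _; under eq_bigr do rewrite -EFinM.
      by rewrite sumEFin -EFinD lee_fin; exact: lattice_sum_cells.
  rewrite ge0_integralD//; last 2 first.
  - by move=> y _; apply: sume_ge0 => k _; rewrite mule_ge0 ?lee_fin.
  - by apply: emeasurable_sum => k; apply: emeasurable_funM => //; exact: mcell.
  rewrite ge0_integral_sum//; last 2 first.
  - by move=> k; apply: emeasurable_funM => //; exact: mcell.
  - by move=> k y _; rewrite mule_ge0 ?lee_fin.
  rewrite integral_cst// [X in (_ + _ * X)%E](_ : _ = V%:E); last exact: lebesgue_rV_box.
  apply: (@le_trans _ _ (\sum_(k < J) ((pw (k.+2%:R / 2) - pw (k.+2%:R / 2 + 3/20))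
      * ((k%:R + 7/10) ^+ d * V))%:E + (E * V)%:E)%E).
    apply: leeD => //; apply: lee_sum => k _.
    rewrite ge0_integralZl//; last 3 first.
    - exact: mcell.
    - by move=> y _; rewrite lee_fin.
    - by rewrite lee_fin.
    have [c -> c_le] := integral_cell k.
    by rewrite -EFinM lee_fin ler_wpM2l.
  rewrite sumEFin -EFinD lee_fin.
  under eq_bigr do rewrite mulrA.
  rewrite -mulr_suml -mulrDl ler_pM2r// /E addrA lerD2r.
  apply: le_trans (hB J); rewrite -big_split/=; apply: ler_sum => k _.
  rewrite /avg_term addrC; apply: lerD.
    rewrite ler_wpM2l ?exprn_ge0//.
    have -> : (k.+1%:R + 13/10) / 2 = k.+2%:R / 2 + 3/20 :> R.
      by rewrite -[k.+2%:R]natr1; field.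
    by rewrite gerBl powR_ge0.
  have -> : k.+1%:R - 3/10 = k%:R + 7/10 :> R by rewrite -natr1; field.
  have -> : (k%:R + 7/10 + 13/10) / 2 = k.+2%:R / 2 :> R.
    by rewrite -[k.+2%:R]natr1 -[k.+1%:R]natr1; field.
  rewrite mulrC ler_wpM2l ?exprn_ge0 ?addr_ge0//.
  by rewrite gerBl powR_ge0.
have I0 : (0 <= \int[lebesgue_rV]_(y in rV_box K) (lattice_sum N s (y - w))%:E)%E.
  by apply: integral_ge0 => y _; rewrite lee_fin; apply: sumr_ge0 => k _; exact: powR_ge0.
move: I0 bound; case: (integral _ _ _) => [x| |]// _ bound; last first.
  by have := bound 0%N; rewrite leye_eq.
rewrite lee_fin -ler_pdivrMr//.
apply: (@le_add_powRN _ s s0 _ _ (C * 2 `^ s)) => J.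
have := bound J; rewrite lee_fin ler_pdivrMr// => /le_trans; apply.
rewrite ler_pM2r// lerD2l -mulrA; apply: ler_wpM2l => //.
have -> : 2 `^ s * pw J.+1%:R = pw (J.+1%:R / 2) :> R.
  rewrite powRM ?invr_ge0// mulrC; congr (_ * _).
  by rewrite -(powR_inv1 (_ : 0 <= 2)) // -powRrM mulN1r opprK.
by apply: (powRN_le s0); [rewrite divr_gt0 | rewrite ler_pM2r ?invr_gt0// ler_nat].
Qed.

End lattice_average.

(** * Independence and one-sided tail bounds *)

Section weighted_pushforward.
Context d1 d2 (T : measurableType d1) (V : measurableType d2) (R : realType).
Variables (mu : {measure set T -> \bar R}) (Q : {measure set V -> \bar R}).
Variables (G : T -> R) (X : T -> V) (C : R).
Hypotheses (mG : measurable_fun setT G) (G0 : forall x, 0 <= G x).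
Hypotheses (mX : measurable_fun setT X) (C0 : 0 <= C).
Hypothesis GQ : forall A, measurable A ->
  (\int[mu]_(x in X @^-1` A) (G x)%:E = C%:E * Q A)%E.

Import HBNNSimple.

(** The identity on sets extends through simple functions and monotone convergence. The weight [G]
    plays two roles later: the other factors of a product of independent variables, and a
    density. *)
Lemma ge0_integral_weight (phi : V -> R) : measurable_fun setT phi ->
  (forall v, 0 <= phi v) ->
  (\int[mu]_x (G x * phi (X x))%:E = C%:E * \int[Q]_v (phi v)%:E)%E.
Proof.
move=> mphi phi0.
have mphiE : measurable_fun setT (EFin \o phi) by apply/measurable_EFinP.
pose h := nnsfun_approx measurableT mphiE.
have h0 n v : 0 <= h n v by [].
have mh n : measurable_fun setT (h n) by exact: measurable_funP.
have hcvg v : (EFin \o h n) v @[n --> \oo] --> (phi v)%:E.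
  by apply: cvg_nnsfun_approx => // u _; rewrite lee_fin.
have hnd v m n : (m <= n)%N -> h m v <= h n v.
  by move=> mn; exact/lefP/nd_nnsfun_approx.
have mpre A : measurable A -> measurable (X @^-1` A).
  by move=> mA; rewrite -[X in measurable X]setTI; exact: mX.
rewrite -ge0_integralZl//; last by move=> v _; rewrite lee_fin.
transitivity (limn (fun n => \int[mu]_x (G x * h n (X x))%:E))%E.
  rewrite -monotone_convergence//.
  - apply: eq_integral => x _; apply/esym/cvg_lim => //.
    rewrite EFinM; under eq_fun do rewrite EFinM.
    by apply: cvgeZl => //; exact: hcvg.
  - move=> n; apply/measurable_EFinP; apply: measurable_funM => //.
    exact: (measurableT_comp (mh n)).
  - by move=> n x _; rewrite lee_fin mulr_ge0.
  - by move=> x _ m n mn; rewrite lee_fin ler_wpM2l// hnd.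
transitivity (limn (fun n => \int[Q]_v (C * h n v)%:E))%E; last first.
  rewrite -monotone_convergence//.
  - apply: eq_integral => v _; apply/cvg_lim => //.
    under eq_fun do rewrite EFinM.
    by apply: cvgeZl => //; exact: hcvg.
  - by move=> n; apply/measurable_EFinP; apply: measurable_funM.
  - by move=> n v _; rewrite lee_fin mulr_ge0.
  - by move=> v _ m n mn; rewrite lee_fin ler_wpM2l// hnd.
congr (limn _); apply/funext => n.
have mfib k : measurable (h n @^-1` [set k]).
  by rewrite -[X in measurable X]setTI; exact: mh.
have hE v : h n v = \sum_(k \in range (h n)) Num.max k 0 * \1_(h n @^-1` [set k]) v.
  rewrite {1}fimfunE; apply: eq_fsbigr => k; rewrite inE => -[u _ <-].
  by rewrite max_l.
have m0 (k : R) : 0 <= Num.max k 0 by rewrite le_max lexx orbT.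
have mI k : measurable_fun setT (fun x => \1_(h n @^-1` [set k]) (X x) : R).
  by apply: (measurableT_comp (measurable_indic (mfib k))).
transitivity (\sum_(k \in range (h n)) (Num.max k 0)%:E * (C%:E * Q (h n @^-1` [set k])))%E.
  transitivity (\int[mu]_x (\sum_(k \in range (h n))
      (Num.max k 0 * (G x * \1_(h n @^-1` [set k]) (X x)))%:E))%E.
    apply: eq_integral => x _; rewrite hE fsumEFin// mulr_fsumr//.
    by congr EFin; apply: eq_fsbigr => k _; rewrite mulrCA.
  rewrite ge0_integral_fsum//; last 2 first.
  - by move=> k; apply/measurable_EFinP; do 2 apply: measurable_funM => //.
  - by move=> k x _; rewrite lee_fin !mulr_ge0.
  apply: eq_fsbigr => k _; under eq_integral do rewrite EFinM.
  rewrite ge0_integralZl//; last 3 first.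
  - by apply/measurable_EFinP; apply: measurable_funM.
  - by move=> x _; rewrite lee_fin mulr_ge0.
  - by rewrite lee_fin.
  congr (_ * _)%E; rewrite -GQ// [RHS]integral_mkcond; apply: eq_integral => x _.
  rewrite /patch indicE; have -> : (X x \in h n @^-1` [set k]) = (x \in X @^-1` (h n @^-1` [set k])).
    by apply/idP/idP; rewrite !inE.
  by case: ifPn => _; rewrite ?mulr1 ?mulr0.
transitivity (\int[Q]_v (\sum_(k \in range (h n))
    (Num.max k 0 * (C * \1_(h n @^-1` [set k]) v))%:E))%E; last first.
  apply: eq_integral => v _; rewrite hE fsumEFin// mulr_fsumr//.
  by congr EFin; apply: eq_fsbigr => k _; rewrite mulrCA.
rewrite ge0_integral_fsum//; last 2 first.
- by move=> k; apply/measurable_EFinP; do 2 apply: measurable_funM => //; exact: measurable_indic.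
- by move=> k v _; rewrite lee_fin !mulr_ge0.
apply: eq_fsbigr => k _; under [RHS]eq_integral do rewrite EFinM.
rewrite ge0_integralZl//; last 3 first.
- by apply/measurable_EFinP; apply: measurable_funM => //; exact: measurable_indic.
- by move=> x _; rewrite lee_fin mulr_ge0.
- by rewrite lee_fin.
under [X in (_ = _ * X)%E]eq_integral do rewrite EFinM.
rewrite ge0_integralZl//; last by apply/measurable_EFinP; exact: measurable_indic.
by rewrite integral_indic// setIT.
Qed.

End weighted_pushforward.

Section product_of_independent.
Context dT dV (T : measurableType dT) (V : measurableType dV) (R : realType).
Variables (P : probability T R) (Q : probability V R) (I : eqType).
Variable X : I -> T -> V.
Hypothesis mX : forall i, measurable_fun setT (X i).
Hypothesis law : forall i A, measurable A -> P (X i @^-1` A) = Q A.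
Hypothesis indep : mutually_independent P X.
Variables (phi : V -> R) (c : R).
Hypotheses (mphi : measurable_fun setT phi) (phi0 : forall v, 0 <= phi v).
Hypothesis phic : (\int[Q]_v (phi v)%:E = c%:E)%E.

Let mpre i A : measurable A -> measurable (X i @^-1` A).
Proof. by move=> mA; rewrite -[X in measurable X]setTI; exact: mX. Qed.

Let minter (s : seq I) (A : I -> set V) : (forall i, measurable (A i)) ->
  measurable (\big[setI/setT]_(i <- s) (X i @^-1` A i)).
Proof.
move=> mA; elim/big_rec: _ => // i B _ mB.
by apply: measurableI => //; exact: mpre.
Qed.

Let mprod (s : seq I) : measurable_fun setT (fun w => \prod_(i <- s) phi (X i w)).
Proof.
apply: measurable_prod => i _.
by apply: measurableT_comp.
Qed.

(** Events on [s1] and integrands on [s2] coexist so that the induction can turn one event at a time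
    into an integrand: the statement for [i :: s1] is exactly the identity on sets required by
    [ge0_integral_weight]. *)
Lemma integral_indep_prod_aux (s2 s1 : seq I) (A : I -> set V) :
  uniq (s1 ++ s2) -> (forall i, measurable (A i)) ->
  (\int[P]_(w in \big[setI/setT]_(i <- s1) (X i @^-1` A i))
      (\prod_(i <- s2) phi (X i w))%:E
   = (fine (\prod_(i <- s1) Q (A i)) * c ^+ size s2)%:E)%E.
Proof.
elim: s2 s1 A => [|i s2 IH] s1 A.
  rewrite cats0 => us mA; under eq_integral do rewrite big_nil.
  rewrite integral_cst ?mul1e; last exact: minter.
  rewrite expr0 mulr1; apply: etrans (indep us mA) _.
  under eq_bigr do rewrite law//.
  rewrite fineK//; elim/big_rec: _ => // j x _ fx.
  by rewrite fin_numM// fin_num_measure.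
move=> us mA.
set E := \big[setI/setT]_(j <- s1) _.
have mE : measurable E by exact: minter.
have := us; rewrite cat_uniq /= negb_or => /and4P[us1 /andP[is1 s12] is2 us2].
have c0 : 0 <= c.
  by rewrite -lee_fin -phic; apply: integral_ge0 => v _; rewrite lee_fin.
pose G w := \1_E w * \prod_(j <- s2) phi (X j w).
have GQ B : measurable B ->
    (\int[P]_(w in X i @^-1` B) (G w)%:E
     = (fine (\prod_(j <- s1) Q (A j)) * c ^+ size s2)%:E * Q B)%E.
  move=> mB; pose A' j := if j == i then B else A j.
  have mA' j : measurable (A' j) by rewrite /A'; case: ifP.
  have A's j : j \in s1 -> A' j = A j.
    by move=> js; rewrite /A'; case: eqP => // ji; rewrite -ji js in is1.
  have A'i : A' i = B by rewrite /A' eqxx.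
  have us' : uniq ((i :: s1) ++ s2).
    by rewrite /= mem_cat negb_or is1 is2 cat_uniq us1 s12 us2.
  have := IH (i :: s1) A' us' mA'.
  rewrite !big_cons A'i /=.
  rewrite [in LHS](_ : \big[setI/setT]_(j <- s1) _ = E); last first.
    by rewrite /E; apply: eq_big_seq => j js; rewrite A's.
  rewrite (eq_big_seq (fun j => Q (A j))); last by move=> j js; rewrite A's.
  move=> IHi.
  transitivity ((\int[P]_(w in X i @^-1` B `&` E) (\prod_(j <- s2) phi (X j w))%:E)%E).
    rewrite integral_mkcondr; apply: eq_integral => w _; rewrite patchE /G.
    rewrite indicE; case: ifP => wE; last by rewrite mul0r.
    by rewrite mul1r.
  rewrite IHi; have fQ : (\prod_(j <- s1) Q (A j))%E \is a fin_num.
    elim/big_rec: _ => // j x _ fx; by rewrite fin_numM// fin_num_measure.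
  rewrite fineM// ?fin_num_measure// -[in RHS](@fineK _ (Q B)) ?fin_num_measure//.
  by rewrite -EFinM; congr EFin; ring.
have mG : measurable_fun setT G.
  by apply: measurable_funM => //; exact: measurable_indic.
have G0 w : 0 <= G w.
  by rewrite mulr_ge0// ?indicE// prodr_ge0.
have C0 : 0 <= fine (\prod_(j <- s1) Q (A j))%E * c ^+ size s2.
  by rewrite mulr_ge0 ?exprn_ge0// fine_ge0// prode_ge0.
have := ge0_integral_weight mG G0 (mX i) C0 GQ mphi phi0.
rewrite phic -EFinM -mulrA -exprSr /= => <-.
rewrite integral_mkcond; apply: eq_integral => w _; rewrite patchE /G big_cons indicE.
case: ifP => wE; last by rewrite !mul0r.
by rewrite mul1r mulrC.
Qed.

Lemma integral_indep_prod (s : seq I) : uniq s ->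
  (\int[P]_w (\prod_(i <- s) phi (X i w))%:E = (c ^+ size s)%:E)%E.
Proof.
move=> us; have := @integral_indep_prod_aux s [::] (fun=> setT) us (fun=> measurableT).
by rewrite !big_nil => ->; rewrite mul1r.
Qed.

End product_of_independent.

Section exponential_bounds.
Variable R : realType.
Implicit Types (x h p b : R).

Lemma derive_ge0_le (f f' : R -> R) a b : a <= b ->
  (forall x, is_derive x 1 f (f' x)) ->
  (forall x, a <= x <= b -> 0 <= f' x) -> f a <= f b.
Proof.
move=> ab df f'0; have [|c /[!in_itv]/= cab E] := MVT_segment ab (fun x _ => df x).
  apply: derivable_within_continuous => x _.
  exact: (@ex_derive _ _ _ _ _ _ _ (df x)).
by rewrite -subr_ge0 E mulr_ge0 ?subr_ge0// f'0.
Qed.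

(* The [2/1] Pade approximant of the exponential. *)
Lemma expR_le_pade x : (6 - 2 * x) * expR x <= 6 + 4 * x + x ^+ 2.
Proof.
(* [K] is the derivative of [H], both vanish at [0], and the derivative of [K] is
   [exp (- t) * t^2 >= 0]; hence [H] has its minimum at [0]. *)
pose K t : R := 2 - expR (- t) * (2 + 2 * t + t ^+ 2).
pose H t : R := expR (- t) * (6 + 4 * t + t ^+ 2) - (6 - 2 * t).
have dK (t : R) : is_derive t 1 K (expR (- t) * t ^+ 2).
  by apply: is_derive_eq; rewrite /GRing.scale/=; ring.
have dH (t : R) : is_derive t 1 H (K t).
  by apply: is_derive_eq; rewrite /K /GRing.scale/=; ring.
have K0 : K 0 = 0 by rewrite /K oppr0 expR0; ring.
have H0 : H 0 = 0 by rewrite /H oppr0 expR0; ring.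
have dK0 t : 0 <= expR (- t) * t ^+ 2 by rewrite mulr_ge0 ?expR_ge0 ?sqr_ge0.
have Hx : 0 <= H x.
  have [x0|x0] := leP 0 x.
    rewrite -H0; apply: (derive_ge0_le x0 dH) => t /andP[t0 _].
    by rewrite -K0; exact: (derive_ge0_le t0 dK).
  rewrite -H0 -lerN2; apply: (@derive_ge0_le (- H) (- K)).
  - exact: ltW.
  - move=> t /andP[_ t0]; rewrite oppr_ge0 -K0.
    by apply: (derive_ge0_le t0 dK) => *; exact: dK0.
have E : 6 + 4 * x + x ^+ 2 - (6 - 2 * x) * expR x = expR x * H x.
  rewrite /H mulrBr mulrA -expRD subrr expR0; ring.
by rewrite -subr_ge0 E mulr_ge0 ?expR_ge0.
Qed.

(** The rational bound equals [1 + x + x^2 / (2 (1 - x/3))], whose last coefficient increases in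
    [x]; an upper bound on [x] therefore suffices, however negative [x] may be. *)
Lemma expR_le_bernstein x b : x <= b -> b < 3 ->
  expR x <= 1 + x + x ^+ 2 * (2 * (1 - b / 3))^-1.
Proof.
move=> xb b3; have x3 : 0 < 6 - 2 * x by lra.
have H : expR x <= (6 + 4 * x + x ^+ 2) / (6 - 2 * x).
  by rewrite ler_pdivlMr// mulrC expR_le_pade.
apply: (le_trans H).
have -> : (6 + 4 * x + x ^+ 2) / (6 - 2 * x) =
    1 + x + x ^+ 2 * (2 * (1 - x / 3))^-1.
  by field; rewrite !gt_eqF//; lra.
rewrite lerD2l ler_wpM2l ?sqr_ge0// lef_pV2 ?posrE; lra.
Qed.

(** The second derivative of [ln (1 - p + p * exp t)] is [v (1 - v) <= 1/4], with [v] the tilted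
    probability. *)
Lemma hoeffding_chord p h : 0 <= p -> p <= 1 -> 0 <= h ->
  1 - p + p * expR h <= expR (h * p + h ^+ 2 / 8).
Proof.
move=> p0 p1 h0.
pose u t : R := 1 - p + p * expR t.
have u0 t : 0 < u t.
  rewrite /u; have := expR_gt0 t; move: p0; rewrite le_eqVlt => /orP[/eqP<-|p0] e0.
    by rewrite mul0r; lra.
  by have := mulr_gt0 p0 e0; lra.
pose K t : R := t / 4 + p - p * expR t * (u t)^-1.
pose H t : R := t ^+ 2 / 8 + t * p - ln (u t).
have du (t : R) : is_derive t 1 u (p * expR t).
  by apply: is_derive_eq; rewrite /GRing.scale/=; ring.
have dK (t : R) : is_derive t 1 K (4^-1 - (p * expR t / u t) * (1 - p * expR t / u t)).
  have un0 := lt0r_neq0 (u0 t).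
  have dV := is_deriveV un0.
  apply: is_derive_eq; rewrite /GRing.scale/=.
  by field; rewrite gt_eqF.
have dH (t : R) : is_derive t 1 H (K t).
  have dl := is_derive1_ln (u0 t).
  have := @is_derive1_comp R (@ln R) u t _ _ dl (du t) => dc.
  have -> : H = (fun t => t ^+ 2 / 8 + t * p) - (@ln R \o u) by [].
  apply: is_derive_eq; rewrite /GRing.scale/= /K; field; exact: lt0r_neq0.
have K0 : K 0 = 0.
  by rewrite /K /u expR0 !mulr1 subrK mul0r add0r divr1 subrr.
have H0 : H 0 = 0 by by rewrite /H /u expR0 mulr1 subrK ln1 expr0n !mul0r addr0 subr0.
have Hh : 0 <= H h.
  rewrite -H0; apply: (derive_ge0_le h0 dH) => t /andP[t0 _].
  rewrite -K0; apply: (derive_ge0_le t0 dK) => s _.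
  set v := p * _ / _; have := sqr_ge0 (v - 2^-1).
  have -> : (v - 2^-1) ^+ 2 = 4^-1 - v * (1 - v) by field.
  by [].
rewrite -/(u h) -[u h]lnK ?posrE// ler_expR -subr_ge0; apply: le_trans Hh _.
by rewrite /H; lra.
Qed.

End exponential_bounds.

Section concentration.
Context dV (V : measurableType dV) (R : realType) (Q : probability V R).
Implicit Types (F : V -> R) (lam t b v m : R).

Definition bounded_measurable F :=
  measurable_fun setT F /\ exists C, forall x, `|F x| <= C.

Lemma bounded_measurable_integrable F :
  bounded_measurable F -> Q.-integrable setT (EFin \o F).
Proof.
move=> [mF [C HC]]; apply: measurable_bounded_integrable => //.
  by rewrite ltey_eq fin_num_measure.
exists C; split; first exact: num_real.
by move=> M CM v _; exact: le_trans (HC v) (ltW CM).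
Qed.

Lemma bounded_measurable_cst c : bounded_measurable (fun=> c).
Proof. by split => //; exists `|c|. Qed.

Lemma bounded_measurableD F G : bounded_measurable F -> bounded_measurable G ->
  bounded_measurable (fun x => F x + G x).
Proof.
move=> [mF [C HC]] [mG [D HD]]; split; first exact: measurable_funD.
by exists (C + D) => x; apply: le_trans (ler_normD _ _) _; exact: lerD.
Qed.

Lemma bounded_measurableM F G : bounded_measurable F -> bounded_measurable G ->
  bounded_measurable (fun x => F x * G x).
Proof.
move=> [mF [C HC]] [mG [D HD]]; split; first exact: measurable_funM.
by exists (C * D) => x; rewrite normrM ler_pM.
Qed.

Lemma bounded_measurable_expR F : bounded_measurable F ->
  bounded_measurable (fun x => expR (F x)).
Proof.
move=> [mF [C HC]]; split; first exact: measurableT_comp.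
exists (expR C) => x; rewrite ger0_norm ?expR_ge0// ler_expR.
exact: le_trans (ler_norm _) (HC x).
Qed.

Local Notation E F := (Rintegral Q [set: V] F).

Lemma mean_cst c : E (fun=> c) = c.
Proof. by rewrite Rintegral_cst//; have /= -> := probability_setT Q; rewrite mulr1. Qed.

Lemma meanD F G : bounded_measurable F -> bounded_measurable G ->
  E (fun x => F x + G x) = E F + E G.
Proof. by move=> bF bG; rewrite RintegralD//; exact: bounded_measurable_integrable. Qed.

Lemma meanZ F c : bounded_measurable F -> E (fun x => c * F x) = c * E F.
Proof. by move=> bF; rewrite RintegralZl//; exact: bounded_measurable_integrable. Qed.

Lemma le_mean F G : bounded_measurable F -> bounded_measurable G ->
  (forall x, F x <= G x) -> E F <= E G.
Proof.
by move=> bF bG FG; rewrite le_Rintegral//; exact: bounded_measurable_integrable.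
Qed.

(** Convexity places the exponential below its chord over the range, which reduces the bound to a
    law on two points. *)
Lemma mgf_hoeffding F lo b lam : bounded_measurable F -> 0 < b -> 0 <= lam ->
  (forall x, lo <= F x <= lo + b) ->
  E (fun x => expR (lam * F x)) <= expR (lam * E F + lam ^+ 2 * b ^+ 2 / 8).
Proof.
move=> bF b0 l0 FB.
have bl c : bounded_measurable (fun x => c * F x).
  by apply: bounded_measurableM => //; exact: bounded_measurable_cst.
pose p := (E F - lo) / b.
pose k := (expR (lam * b) - 1) / b.
have k0 : 0 <= k.
  by rewrite divr_ge0 ?(ltW b0)// subr_ge0 -expR0 ler_expR mulr_ge0 ?(ltW b0).
apply: (@le_trans _ _ (E (fun x => expR (lam * lo) * (1 - k * lo) +
    (expR (lam * lo) * k) * F x))).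
  apply: le_mean => [||x].
  - exact: bounded_measurable_expR.
  - by apply: bounded_measurableD => //; exact: bounded_measurable_cst.
  have /andP[F1 F2] := FB x; pose th := (F x - lo) / b.
  have th0 : 0 <= th by rewrite divr_ge0 ?(ltW b0)// subr_ge0.
  have th1 : th <= 1 by rewrite ler_pdivrMr// mul1r lerBlDl.
  have -> : lam * F x = lam * lo + th * (lam * b).
    by rewrite /th; field; rewrite gt_eqF.
  rewrite expRD; have -> : expR (lam * lo) * (1 - k * lo) + expR (lam * lo) * k * F x
      = expR (lam * lo) * (1 - th + th * expR (lam * b)).
    by rewrite /th /k; field; rewrite gt_eqF.
  rewrite ler_wpM2l ?expR_ge0//.
  have := convex_expR (Itv01 th0 th1) (lam * b) 0.
  by rewrite !convRE/= expR0 mulr1 mulr0 addr0 addrC.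
rewrite meanD ?mean_cst ?meanZ//; last exact: bounded_measurable_cst.
have -> : expR (lam * lo) * (1 - k * lo) + expR (lam * lo) * k * E F =
    expR (lam * lo) * (1 - p + p * expR (lam * b)).
  by rewrite /p /k; field; rewrite gt_eqF.
have lE : lo <= E F.
  rewrite -(mean_cst lo); apply: le_mean => //; first exact: bounded_measurable_cst.
  by move=> x; have /andP[] := FB x.
have Eb : E F <= lo + b.
  rewrite -(mean_cst (lo + b)); apply: le_mean => //; first exact: bounded_measurable_cst.
  by move=> x; have /andP[] := FB x.
have -> : lam * E F + lam ^+ 2 * b ^+ 2 / 8 =
    lam * lo + (lam * b * p + (lam * b) ^+ 2 / 8).
  by rewrite /p; field; rewrite gt_eqF.
rewrite expRD ler_wpM2l ?expR_ge0//; apply: hoeffding_chord.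
- by rewrite divr_ge0 ?(ltW b0)// subr_ge0.
- by rewrite ler_pdivrMr// mul1r lerBlDl.
- by rewrite mulr_ge0 ?(ltW b0).
Qed.

(** Only an upper bound on [F] and its uncentred second moment enter, and both are available for the
    samples through their means. *)
Lemma mgf_bernstein F lam b v : bounded_measurable F -> 0 <= lam ->
  (forall x, F x <= b) -> E (fun x => F x * F x) <= v -> lam * b < 3 ->
  E (fun x => expR (lam * F x)) <=
    expR (lam * E F + lam ^+ 2 * v * (2 * (1 - lam * b / 3))^-1).
Proof.
move=> bF l0 Fb Fv lb.
set k := (2 * _)^-1; have k0 : 0 <= k by rewrite invr_ge0; lra.
have bl c : bounded_measurable (fun x => c * F x).
  by apply: bounded_measurableM => //; exact: bounded_measurable_cst.
have bq c : bounded_measurable (fun x => c * (F x * F x)).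
  apply: bounded_measurableM; first exact: bounded_measurable_cst.
  exact: bounded_measurableM.
have b1 : bounded_measurable (fun=> 1 : R) by exact: bounded_measurable_cst.
apply: (@le_trans _ _ (E (fun x => 1 + lam * F x + (lam ^+ 2 * k) * (F x * F x)))).
  apply: le_mean => [||x].
  - exact: bounded_measurable_expR.
  - by do 2?apply: bounded_measurableD.
  have H : lam * F x <= lam * b by rewrite ler_wpM2l.
  apply: le_trans (expR_le_bernstein H lb) _.
  rewrite -/k lerD2l le_eqVlt; apply/orP; left; apply/eqP; ring.
rewrite !meanD// ?mean_cst ?meanZ//; last 2 first.
- exact: bounded_measurableM.
- exact: bounded_measurableD.
apply: le_trans (expR_ge1Dx _).
rewrite -addrA lerD2l lerD2l [leRHS]mulrAC ler_wpM2l//.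
by rewrite mulr_ge0 ?sqr_ge0.
Qed.

End concentration.

Section tails.
Context dT dV (T : measurableType dT) (V : measurableType dV) (R : realType).
Variables (P : probability T R) (Q : probability V R) (I : eqType).
Variable X : I -> T -> V.
Hypothesis mX : forall i, measurable_fun setT (X i).
Hypothesis law : forall i A, measurable A -> P (X i @^-1` A) = Q A.
Hypothesis indep : mutually_independent P X.
Variables (s : seq I) (F : V -> R).
Hypotheses (us : uniq s) (bF : bounded_measurable F).

Local Notation E F := (Rintegral Q [set: V] F).

Lemma measurable_sum_sample :
  measurable_fun setT (fun w => \sum_(i <- s) F (X i w)).
Proof.
apply: measurable_sum => i; apply: measurableT_comp => //.
by case: bF.
Qed.

Lemma measurable_sum_sample_ge a :
  measurable [set w | a <= \sum_(i <- s) F (X i w)].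
Proof.
have := measurable_sum_sample measurableT (measurable_itv `[a, +oo[).
rewrite setTI; congr measurable; apply/seteqP; split => w /=;
  by rewrite in_itv/= andbT.
Qed.

Lemma chernoff (lam a K : R) : 0 <= lam -> E (fun x => expR (lam * F x)) <= expR K ->
  (P [set w | (a <= \sum_(i <- s) F (X i w))%R] <=
     (expR ((size s)%:R * K - lam * a))%:E)%E.
Proof.
move=> l0 EK.
have bl : bounded_measurable (fun x => lam * F x).
  by apply: bounded_measurableM => //; exact: bounded_measurable_cst.
have be := bounded_measurable_expR bl.
have ie := bounded_measurable_integrable Q be.
have Ec : (\int[Q]_v (expR (lam * F v))%:E = (E (fun x => expR (lam * F x)))%:E)%E.
  by rewrite /Rintegral fineK//; exact: integrable_fin_num.
have H := @integral_indep_prod _ _ _ _ _ P Q I X mX law indep _ _ be.1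
  (fun=> expR_ge0 _) Ec s us.
set c := E _ in EK Ec H; set A := [set w | _].
have c0 : 0 <= c by apply: Rintegral_ge0 => x _; exact: expR_ge0.
have mA : measurable A by exact: measurable_sum_sample_ge.
have mprod : measurable_fun setT (fun w => \prod_(i <- s) expR (lam * F (X i w))).
  by apply: measurable_prod => i _; exact: (measurableT_comp be.1 (mX i)).
have -> : P A = (\int[P]_w (\1_A w)%:E)%E by rewrite integral_indic// setIT.
apply: (@le_trans _ _ (\int[P]_w ((expR (- (lam * a)))%:E *
    (\prod_(i <- s) expR (lam * F (X i w)))%:E))%E).
  apply: ge0_le_integral => //.
  - by apply/measurable_EFinP; apply: measurable_indic.
  - by apply/measurable_EFinP; apply: measurable_funM.
  move=> w _; rewrite -EFinM lee_fin indicE.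
  have [wA|wA] := boolP (w \in A); last first.
    by rewrite mulr_ge0 ?expR_ge0// prodr_ge0// => i _; exact: expR_ge0.
  rewrite -expR_sum -expRD -[leLHS]expR0 ler_expR -mulr_sumr addrC subr_ge0.
  by rewrite ler_wpM2l//; move: wA; rewrite inE.
rewrite ge0_integralZl//; [|exact/measurable_EFinP|]; last first.
  by move=> w _; rewrite lee_fin prodr_ge0// => i _; exact: expR_ge0.
rewrite H -EFinM lee_fin addrC expRD ler_wpM2l ?expR_ge0//.
by rewrite expRM_natl lerXn2r ?nnegrE ?expR_ge0.
Qed.

Lemma hoeffding (lo b t : R) : 0 < b -> 0 < t -> (forall x, lo <= F x <= lo + b) ->
  (P [set w | ((size s)%:R * (E F + t) <= \sum_(i <- s) F (X i w))%R]
    <= (expR (- ((size s)%:R * (2 * t ^+ 2 / b ^+ 2))))%:E)%E.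
Proof.
move=> b0 t0 FB.
(* [4 t / b^2] minimises [lam^2 b^2 / 8 - lam t]. *)
have l0 : 0 <= 4 * t / b ^+ 2 by rewrite divr_ge0 ?sqr_ge0// mulr_ge0// ltW.
apply: (le_trans (chernoff _ l0 (mgf_hoeffding Q bF b0 l0 FB))).
rewrite lee_fin ler_expR le_eqVlt; apply/orP; left; apply/eqP.
by field; rewrite gt_eqF.
Qed.

Lemma bernstein (b v t : R) : 0 <= b -> 0 < v -> 0 < t -> (forall x, F x <= b) ->
  E (fun x => F x * F x) <= v ->
  (P [set w | ((size s)%:R * (E F + t) <= \sum_(i <- s) F (X i w))%R]
    <= (expR (- ((size s)%:R * (t ^+ 2 / (2 * (v + b * t / 3))))))%:E)%E.
Proof.
move=> b0 v0 t0 Fb Fv.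
have bt : 0 <= b * t by rewrite mulr_ge0// ltW.
have D0 : 0 < v + b * t / 3 by lra.
(* For this [lam] the factor [1 - lam b / 3] equals [v / (v + b t / 3)], and the exponent
   collapses. *)
have l0 : 0 <= t / (v + b * t / 3) by rewrite divr_ge0 ?ltW.
have lb : t / (v + b * t / 3) * b < 3.
  by rewrite mulrAC ltr_pdivrMr//; lra.
apply: (le_trans (chernoff _ l0 (mgf_bernstein bF l0 Fb Fv lb))).
rewrite lee_fin ler_expR le_eqVlt; apply/orP; left; apply/eqP.
have D1 : 0 < v * 3 + b * t by lra.
by field; rewrite !gt_eqF//; lra.
Qed.

End tails.

(** * Nets and chaining *)

Section packing.
Variables (R : realType) (I : finType).
Local Notation vec := {ffun I -> R}.
Variables (N : vec -> R) (al be : R).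
Hypotheses (al0 : 0 < al) (be0 : 0 < be).
Hypothesis ND : forall a b : vec, N (a + b) <= N a + N b.
Hypothesis NZ : forall t (a : vec), N (t *: a) = `|t| * N a.
Hypothesis Nlow : forall (a : vec) i, al * `|a i| <= N a.
Hypothesis Nup : forall (a : vec) t, (forall i, `|a i| <= t) -> N a <= be * t.

Lemma normN a : N (- a) = N a.
Proof. by rewrite -scaleN1r NZ normrN1 mul1r. Qed.

Lemma norm0 : N 0 = 0.
Proof. by rewrite -(scale0r 0) NZ normr0 mul0r. Qed.

Lemma normB a b : N (a - b) <= N a + N b.
Proof. by rewrite -(normN b); exact: ND. Qed.

Lemma norm_distC a b : N (a - b) = N (b - a).
Proof. by rewrite -normN opprB. Qed.

Definition separated (e : R) (s : seq vec) :=
  uniq s /\ forall x y, x \in s -> y \in s -> x != y -> e <= N (x - y).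

Lemma pigeonhole_separated M dl (s : seq vec) : 0 <= M -> 0 < dl ->
  (forall x i, x \in s -> `|x i| <= M) -> separated (2 * be * dl) s ->
  (size s)%:R <= (2 * M / dl + 1) ^+ #|I|.
Proof.
move=> M0 dl0 sM [us sep].
pose L := Num.trunc (2 * M / dl).
pose cell (x : vec) : {ffun I -> 'I_L.+1} :=
  [ffun i => inord (Num.trunc ((x i + M) / dl))].
have cellE x i : x \in s ->
    (cell x i)%:R <= (x i + M) / dl < (cell x i)%:R + 1.
  move=> xs; have /ler_normlP[x1 x2] := sM x i xs.
  have h0 : 0 <= (x i + M) / dl by rewrite divr_ge0 ?(ltW dl0)//; lra.
  have tL : (Num.trunc ((x i + M) / dl) <= L)%N.
    rewrite truncn_le_nat; apply: le_lt_trans (truncnS_gt _).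
    by rewrite ler_pM2r ?invr_gt0//; lra.
  by rewrite ffunE inordK// natr1; apply: truncn_itv.
have cinj : {in s &, injective cell}.
  move=> x y xs ys cxy; apply/eqP/negPn/negP => xy.
  have := sep _ _ xs ys xy; apply/negP; rewrite -ltNge.
  have : N (x - y) <= be * dl.
    apply: Nup => i; rewrite !ffunE.
    have /andP[] := cellE x i xs; have /andP[] := cellE y i ys; rewrite cxy.
    rewrite !ler_pdivlMr// !ltr_pdivrMr// => h1 h2 h3 h4.
    by apply/ler_normlP; split; lra.
  move=> /le_lt_trans; apply; have := mulr_gt0 be0 dl0; lra.
have : (size (map cell s) <= #|{ffun I -> 'I_L.+1}|)%N.
  by rewrite -(card_uniqP _) ?max_card// map_inj_in_uniq.
rewrite size_map card_ffun card_ord => sL.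
apply: (@le_trans _ _ ((L.+1 ^ #|I|)%:R)); first by rewrite ler_nat.
rewrite natrX lerXn2r ?nnegrE//.
  by have : 0 <= 2 * M / dl; [rewrite divr_ge0 ?(ltW dl0)//; lra|lra].
by rewrite -natr1 lerD2r truncn_le divr_ge0 ?(ltW dl0)//; lra.
Qed.

(** [tau] solves [2 tau / (1 - tau) = e]: the tails of two words bring distinct first letters closer
    by at most [e (1 - tau^k)], and at least [e tau^k] is left. *)
Lemma separated_power e tau (s : seq vec) k : 0 < e -> tau = e / (2 + e) ->
  (forall x, x \in s -> N x <= 1) -> separated e s ->
  exists s' : seq vec, [/\ size s' = (size s ^ k)%N,
    forall x, x \in s' -> N x <= (1 - tau ^+ k) / (1 - tau) &
    separated (e * tau ^+ k) s'].
Proof.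
move=> e0 tauE s1 [us sep].
have tau0 : 0 < tau by rewrite tauE divr_gt0//; lra.
have tau1 : tau < 1 by rewrite tauE ltr_pdivrMr; lra.
elim: k => [|k [s' [sz N' [us' sep']]]].
  exists [:: 0]; split => // [x|]; first by rewrite inE => /eqP->; rewrite norm0 expr0 subrr mul0r.
  by split => // x y; rewrite !inE => /eqP-> /eqP->; rewrite eqxx.
have tk0 : 0 < tau ^+ k by rewrite exprn_gt0.
have tk1 : tau ^+ k <= 1 by rewrite exprn_ile1 ?ltW.
have key x y x' y' : x \in s -> y \in s' -> x' \in s -> y' \in s' ->
    (x, y) != (x', y') -> e * tau ^+ k.+1 <= N (x + tau *: y - (x' + tau *: y')).
  move=> xs ys x's y's; have -> : x + tau *: y - (x' + tau *: y') = (x - x') + tau *: (y - y').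
    by rewrite scalerBr opprD addrACA.
  have [<-|xx'] := eqVneq x x'.
    rewrite xpair_eqE eqxx /= => yy'; rewrite subrr add0r NZ gtr0_norm//.
    by rewrite exprS mulrCA ler_pM2l// sep'.
  move=> _; have := sep _ _ xs x's xx'.
  have : N (x - x') <= N (x - x' + tau *: (y - y')) + tau * N (y - y').
    have {1}-> : x - x' = (x - x' + tau *: (y - y')) - tau *: (y - y') by rewrite addrK.
    by apply: le_trans (normB _ _) _; rewrite (NZ _ (y - y')) gtr0_norm.
  have : tau * N (y - y') <= e * (1 - tau ^+ k).
    have h := le_trans (normB y y') (lerD (N' _ ys) (N' _ y's)).
    apply: (le_trans (ler_wpM2l (ltW tau0) h)).
    rewrite le_eqVlt; apply/orP; left; apply/eqP.
    by rewrite tauE; field; rewrite !gt_eqF//; lra.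
  have : e * tau ^+ k.+1 <= e * tau ^+ k.
    by rewrite ler_pM2l// exprS ler_piMl ?ltW.
  lra.
exists [seq x + tau *: y | x <- s, y <- s']; split.
- by rewrite size_allpairs sz expnS.
- move=> _ /allpairsP[[x y] /= [xs ys ->]].
  apply: le_trans (ND _ _) _; rewrite NZ gtr0_norm//.
  apply: (le_trans (lerD (s1 _ xs) (ler_wpM2l (ltW tau0) (N' _ ys)))).
  rewrite le_eqVlt; apply/orP; left; apply/eqP; rewrite exprS.
  by field; rewrite gt_eqF//; lra.
split.
  apply: allpairs_uniq => // -[x y] [x' y'] /= /allpairsP[[x1 y1] /= [xs ys [-> ->]]].
  move=> /allpairsP[[x2 y2] /= [x's y's [-> ->]]] exy; apply/eqP/negPn/negP => nxy.
  have := key _ _ _ _ xs ys x's y's nxy; rewrite exy subrr norm0.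
  by apply/negP; rewrite -ltNge mulr_gt0// exprn_gt0.
move=> _ _ /allpairsP[[x y] /= [xs ys ->]] /allpairsP[[x' y'] /= [x's y's ->]] nxy.
by apply: key => //; apply: contra nxy => /eqP[-> ->].
Qed.

Lemma bounded_powers_le1 (a C : R) : 0 <= a -> (forall k, a ^+ k <= C) -> a <= 1.
Proof.
move=> a0 aC; rewrite leNgt; apply/negP => a1.
have b0 : 0 < a - 1 by rewrite subr_gt0.
have C0 : 0 <= C by apply: le_trans (aC 0%N); rewrite expr0.
have := aC (Num.trunc (C / (a - 1))).+1; apply/negP; rewrite -ltNge.
have /andP[_] := truncn_itv (divr_ge0 C0 (ltW b0)).
set k := _.+1; rewrite ltr_pdivrMr// => /lt_le_trans; apply.
suff : 1 + k%:R * (a - 1) <= a ^+ k by lra.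
elim: (k) => [|j IH]; first by rewrite mul0r addr0 expr0.
rewrite exprS; apply: le_trans (ler_wpM2l a0 IH).
rewrite -natr1 -subr_ge0.
have -> : a * (1 + j%:R * (a - 1)) - (1 + (j%:R + 1) * (a - 1)) =
  j%:R * (a - 1) ^+ 2 by ring.
by rewrite mulr_ge0 ?sqr_ge0.
Qed.

(* Words over a separated set, weighted by powers of tau = e / (2 + e), are
   again separated; comparing their number with the volume of a sup-norm ball
   and letting the length tend to infinity gives the volumetric constant. *)
Lemma separated_size e (s : seq vec) : 0 < e ->
  (forall x, x \in s -> N x <= 1) -> separated e s ->
  (size s)%:R <= (1 + 2 / e) ^+ #|I|.
Proof.
move=> e0 s1 sep; pose tau := e / (2 + e).
have tau0 : 0 < tau by rewrite divr_gt0//; lra.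
have tau1 : tau < 1 by rewrite /tau ltr_pdivrMr; lra.
have -> : 1 + 2 / e = tau^-1 by rewrite /tau; field; rewrite !gt_eqF//; lra.
rewrite exprVn -[leRHS]mul1r ler_pdivlMr ?exprn_gt0//.
pose M := al^-1 * (1 - tau)^-1.
have M0 : 0 < M by rewrite /M; apply: mulr_gt0; rewrite invr_gt0//; lra.
pose C := 4 * M * be / e + 1.
have c0 : 0 <= 4 * M * be / e.
  by rewrite divr_ge0 ?(ltW e0)// mulr_ge0 ?(ltW be0)// mulr_ge0 ?(ltW M0).
apply: (@bounded_powers_le1 _ (C ^+ #|I|)) => [|k].
  by rewrite mulr_ge0// exprn_ge0 ?ltW.
have [s' [sz Ns' sep']] := separated_power k e0 erefl s1 sep.
have tk0 : 0 < tau ^+ k by rewrite exprn_gt0.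
have tk1 : tau ^+ k <= 1 by rewrite exprn_ile1 ?ltW.
have s'M x i : x \in s' -> `|x i| <= M.
  move=> xs; rewrite /M ler_pdivlMl//; apply: le_trans (Nlow x i) _.
  apply: le_trans (Ns' _ xs) _.
  rewrite -[leRHS]mul1r ler_wpM2r ?invr_ge0 ?subr_ge0 ?(ltW tau1)//.
  by rewrite gerBl ltW.
pose dl := e * tau ^+ k / (2 * be).
have dl0 : 0 < dl by rewrite divr_gt0 ?mulr_gt0.
have sep2 : separated (2 * be * dl) s'.
  by rewrite (_ : 2 * be * dl = e * tau ^+ k)// /dl; field; rewrite gt_eqF.
have := pigeonhole_separated (ltW M0) dl0 s'M sep2.
rewrite sz natrX => H; rewrite exprMn exprAC.
have tn0 : 0 < (tau ^+ k) ^+ #|I| by rewrite exprn_gt0.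
rewrite -ler_pdivlMr// -expr_div_n; apply: (le_trans H).
rewrite lerXn2r ?nnegrE//.
- by rewrite addr_ge0// divr_ge0 ?(ltW dl0)// mulr_ge0 ?(ltW M0).
- by rewrite divr_ge0 ?(ltW tk0)// addr_ge0.
rewrite /C [leRHS]mulrDl mul1r lerD//; last by rewrite -[leLHS]invr1 lef_pV2 ?posrE.
rewrite le_eqVlt; apply/orP; left; apply/eqP; rewrite /dl.
by field; rewrite !gt_eqF.
Qed.

(** A largest separated subset of [S], which exists by the size bound. Its points belong to [S], as
    needed when only part of the ball is admissible. *)
Lemma net_exists (S : set vec) e : 0 < e -> (forall x, S x -> N x <= 1) ->
  exists s : seq vec, [/\ forall x, x \in s -> S x,
    (size s)%:R <= (1 + 2 / e) ^+ #|I| &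
    forall x, S x -> exists2 y, y \in s & N (x - y) < e].
Proof.
move=> e0 S1.
pose good k := `[< exists s : seq vec, [/\ size s = k, forall x, x \in s -> S x &
  separated e s] >].
have g0 : exists k, good k.
  by exists 0%N; apply/asboolP; exists [::]; split.
have gle k : good k -> (k <= Num.trunc ((1 + 2 / e) ^+ #|I|))%N.
  move=> /asboolP[s [<- sS sep]].
  rewrite truncn_ge_nat; first by apply: separated_size => // x /sS; exact: S1.
  by rewrite exprn_ge0// addr_ge0// divr_ge0// ltW.
case: (ex_maxnP g0 gle) => k /asboolP[s [sk sS [us sep]]] kmax.
exists s; split => //; first by apply: separated_size => // x /sS; exact: S1.
move=> x Sx; apply/not_exists2P => H.
have far y : y \in s -> e <= N (x - y).
  by move=> ys; case: (H y) => // /negP; rewrite -leNgt.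
have xs : x \notin s.
  by apply/negP => xs; have := far x xs; rewrite subrr norm0 leNgt e0.
have : good k.+1.
  apply/asboolP; exists (x :: s); split.
  - by rewrite /= sk.
  - by move=> y; rewrite inE => /orP[/eqP->//|]; exact: sS.
  split; first by rewrite /= xs.
  move=> y z; rewrite !inE => /orP[/eqP->|ys] /orP[/eqP->|zs].
  - by rewrite eqxx.
  - by move=> _; exact: far.
  - by move=> _; rewrite norm_distC; exact: far.
  - exact: sep.
by move=> /kmax; rewrite ltnn.
Qed.

End packing.

(** * Chaining over finitely many nets *)

Section chaining.
Context dT (T : measurableType dT) (R : realType) (P : probability T R).
Variable I : finType.
Local Notation vec := {ffun I -> R}.
Variables (N : vec -> R) (al be c Lam t1 : R) (t : nat -> R) (e1 : R) (e : nat -> R).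
Variable Z : vec -> T -> R.
Hypotheses (al0 : 0 < al) (be0 : 0 < be) (c0 : 0 < c) (Lam0 : 0 <= Lam).
Hypothesis ND : forall a b : vec, N (a + b) <= N a + N b.
Hypothesis NZ : forall s (a : vec), N (s *: a) = `|s| * N a.
Hypothesis Nlow : forall (a : vec) i, al * `|a i| <= N a.
Hypothesis Nup : forall (a : vec) s, (forall i, `|a i| <= s) -> N a <= be * s.
Hypothesis mZ : forall a, measurable_fun setT (Z a).
Hypothesis ZL : forall a b w, Z a w - Z b w <= Lam * N (a - b).
Hypothesis tail1 : forall a, N a <= 1 ->
  (P [set w | (t1 <= Z a w)%R] <= e1%:E)%E.
Hypothesis tail : forall i a b, N a <= 1 -> N b <= 1 ->
  N (a - b) <= (2 ^+ i.+1 * c)^-1 ->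
  (P [set w | (t i <= Z a w - Z b w)%R] <= (e i)%:E)%E.

Let mge (f : T -> R) s : measurable_fun setT f ->
  measurable [set w | (s <= f w)%R].
Proof.
move=> mf; have := mf measurableT _ (measurable_itv `[s, +oo[).
rewrite setTI; congr measurable; apply/seteqP; split => w /=;
  by rewrite in_itv/= andbT.
Qed.

Let seq_union (A : vec -> set T) (s : seq vec) (p : R) :
  (forall a, measurable (A a)) -> (forall a, a \in s -> (P (A a) <= p%:E)%E) ->
  let B := \big[setU/set0]_(a <- s) A a in
  [/\ measurable B, (P B <= ((size s)%:R * p)%:E)%E &
      forall w, ~ B w -> forall a, a \in s -> ~ A a w].
Proof.
move=> mA; elim: s => [|a s IH] As /=.
  by rewrite big_nil measure0 mul0r; split.
rewrite big_cons; have [|mB PB nB] := IH.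
  by move=> b bs; apply: As; rewrite inE bs orbT.
split; first exact: measurableU.
  apply: le_trans; first exact: (measureU2 P (mA a) mB).
  rewrite -natr1 mulrDl mul1r EFinD addeC; apply: leeD => //.
  by apply: As; rewrite mem_head.
move=> w nw b; rewrite inE => /orP[/eqP->|bs]; first by move=> Aw; apply: nw; left.
by apply: nB => // Bw; apply: nw; right.
Qed.

(** The nets have radii [1 / (2^(l+1) c)], so the first has at most [(1 + 4c)^#|I|] points. A point
    of one net is compared with a single chosen point of the preceding net, so the union bound pays
    for one net per level. Below the last level the Lipschitz constant [Lam] replaces an infinite
    chain. *)
Lemma chaining (L : nat) : exists Bad : set T, [/\ measurable Bad,
  (P Bad <= ((1 + 4 * c) ^+ #|I| * e1 +
     \sum_(i < L) (1 + 2 ^+ i.+3 * c) ^+ #|I| * e i)%:E)%E &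
  forall w, ~ Bad w -> forall a, N a <= 1 ->
    Z a w <= t1 + \sum_(i < L) t i + Lam * (2 ^+ L.+1 * c)^-1].
Proof.
have rad l : 0 < (2 ^+ l.+1 * c)^-1 by rewrite invr_gt0 mulr_gt0// exprn_gt0.
have radE l : 1 + 2 / (2 ^+ l.+1 * c)^-1 = 1 + 2 ^+ l.+2 * c.
  by rewrite invrK mulrA -exprS.
have N1 (x : vec) : [set x | N x <= 1] x -> N x <= 1 by [].
have e10 : 0 <= e1.
  rewrite -lee_fin; apply: le_trans (tail1 (a := 0) _) => //.
  by rewrite (norm0 NZ).
suff [s [Bad [s1 sz mB PB HB]]] : exists (s : seq vec) (Bad : set T),
  [/\ forall x, x \in s -> N x <= 1,
    forall x, N x <= 1 -> exists2 y, y \in s & N (x - y) < (2 ^+ L.+1 * c)^-1,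
    measurable Bad,
    (P Bad <= ((1 + 4 * c) ^+ #|I| * e1 +
       \sum_(i < L) (1 + 2 ^+ i.+3 * c) ^+ #|I| * e i)%:E)%E &
    forall w, ~ Bad w -> forall a, a \in s -> Z a w <= t1 + \sum_(i < L) t i].
  exists Bad; split => // w nw a a1; have [b bs ab] := sz a a1.
  have h1 := ZL a b w; have h2 := HB w nw b bs.
  have h3 : Lam * N (a - b) <= Lam * (2 ^+ L.+1 * c)^-1 by rewrite ler_wpM2l// ltW.
  lra.
elim: L => [|L [s [Bad [s1 sz mB PB HB]]]].
  have [s [s1 sz sn]] := net_exists al0 be0 ND NZ Nlow Nup (rad 0%N) N1.
  have [mB PB nB] := seq_union (fun a => mge t1 (mZ a)) (fun a as_ => tail1 (s1 a as_)).
  exists s, (\big[setU/set0]_(a <- s) [set w | (t1 <= Z a w)%R]); split => //.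
    rewrite big_ord0 addr0; apply: le_trans PB _; rewrite lee_fin ler_wpM2r//.
    by move: sz; rewrite radE (_ : 2 ^+ 2 = 4)// -natrX.
  by move=> w /nB H a as_; rewrite big_ord0 addr0 ltW// ltNge; apply/negP; exact: H.
have [s' [s'1 sz' sn']] := net_exists al0 be0 ND NZ Nlow Nup (rad L.+1) N1.
(* Outside the unit ball [pi] takes the default value [0]; only points of the next net are
   linked. *)
have /choice[pi piP] : forall x : vec, exists y : vec, N x <= 1 ->
    y \in s /\ N (x - y) < (2 ^+ L.+1 * c)^-1.
  move=> x; have [x1|x1] := leP (N x) 1; last by exists 0.
  by have [y ys xy] := sz x x1; exists y.
pose A a := [set w | (t L <= Z a w - Z (pi a) w)%R].
have mA a : measurable (A a) by apply: mge; exact: measurable_funB.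
have PA a : a \in s' -> (P (A a) <= (e L)%:E)%E.
  move=> /s'1 /= a1; have [ps ap] := piP a a1; apply: tail => //; first exact: s1.
  exact: ltW.
have [mB' PB' nB'] := seq_union mA PA.
have eL0 : 0 <= e L.
  rewrite -lee_fin; apply: le_trans (@tail L 0 0 _ _ _) => //;
  by rewrite ?subrr (norm0 NZ)// ltW.
exists s', (Bad `|` \big[setU/set0]_(a <- s') A a); split => //.
- exact: measurableU.
- apply: le_trans; first exact: (measureU2 P mB mB').
  rewrite big_ord_recr/= addrA EFinD.
  apply: leeD => //; apply: le_trans PB' _; rewrite lee_fin ler_wpM2r//.
  by move: sz'; rewrite radE.
- move=> w nw a as_; rewrite big_ord_recr/= addrA.
  have nA : ~ A a w by apply: nB' as_ => Bw; apply: nw; right.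
  have [ps _] := piP a (s'1 _ as_).
  have h1 : Z (pi a) w <= t1 + \sum_(i < L) t i by apply: HB ps => Bw; apply: nw; left.
  have h2 : Z a w - Z (pi a) w < t L by rewrite ltNge; apply/negP.
  lra.
Qed.

End chaining.

(** * Net sizes against tail exponents *)

Section net_sums.
Variable R : realType.
Implicit Types (c x : R) (e : nat -> R) (D L : nat).

Lemma half_powers_sum L : \sum_(i < L) (1/2 : R) ^+ i <= 2.
Proof.
suff -> : \sum_(i < L) (1/2 : R) ^+ i = 2 - 2 * (1/2) ^+ L.
  by rewrite gerBl mulr_ge0// exprn_ge0.
elim: L => [|L IH]; first by rewrite big_ord0 expr0; lra.
by rewrite big_ord_recr/= IH exprS; lra.
Qed.

Lemma expR_Nln2 (k : nat) : expR (- (k%:R * ln 2)) = (1/2 : R) ^+ k.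
Proof. by rewrite -mulrN expRM_natl expRN lnK ?posrE// div1r. Qed.

Lemma sqr_net_size c (i : nat) : 0 <= c -> 
  (1 + 2 ^+ i.+3 * c) ^+ 2 <= 4 ^+ i * (1 + 8 * c) ^+ 2.
Proof.
move=> c0; have -> : (4 : R) = 2 ^+ 2 by rewrite expr2; ring.
rewrite exprAC -exprMn; have p1 : 1 <= 2 ^+ i :> R by rewrite exprn_ege1 ?ler1n.
have p2 : 0 <= 2 ^+ i.+3 * c by rewrite mulr_ge0.
have E : 2 ^+ i.+3 * c = 2 ^+ i * (8 * c) by rewrite !exprS; ring.
rewrite lerXn2r ?nnegrE; [by []|lra| by apply: mulr_ge0; lra|].
by rewrite mulrDr mulr1 -E lerD2r.
Qed.

(** Apart from [exp (- x)] the exponent yields [2^(-(8+3i) D)]. Of this, [4^(-i D)] pays for the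
    finer net and [2^(-i D)] for the sum over levels; with [W = (2c + 1/4) (c + 1/4)],
    [(1 + 8c)^2 / 256 <= W / 8] leaves [8^(-D) <= 1 / (8D)]. At the end
    [1/4 <= 2 / (3 ln 2 ^ 2)]. *)
Lemma net_sum_small c x e D L : 0 < c -> (0 < D)%N -> 3 * ln 2 * D%:R <= x ->
  (forall i, e i <= expR (- ((11/3 + i%:R) * x))) ->
  \sum_(i < L) (1 + 2 ^+ i.+3 * c) ^+ (2 * D) * e i
  <= 2 * ((2 * c + 1/4) * (c + 1/4)) ^+ D / (3 * ln 2 ^+ 2 * D%:R) * expR (- x).
Proof.
move=> c0 D0 hx he; set W := (2 * c + 1/4) * (c + 1/4).
have W0 : 0 < W by apply: mulr_gt0; lra.
have l20 : 0 < ln (2 : R) by rewrite ln_gt0//; lra.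
have l21 : ln (2 : R) <= 1 by have := @ln_leB1 R 2 ltac:(lra); lra.
have DR : 1 <= D%:R :> R by rewrite ler1n.
apply: (@le_trans _ _ (\sum_(i < L) (W ^+ D / (8 * D%:R) * expR (- x)) * (1/2) ^+ i)).
  apply: ler_sum => i _.
  have p0 : 0 <= 1 + 2 ^+ i.+3 * c by rewrite addr_ge0// mulr_ge0// ltW.
  apply: (@le_trans _ _ ((1 + 2 ^+ i.+3 * c) ^+ (2 * D) * ((1/2) ^+ ((8 + 3 * i) * D) * expR (- x)))).
    rewrite ler_wpM2l ?exprn_ge0//; apply: le_trans (he i) _.
    rewrite -expR_Nln2 -expRD ler_expR.
    have -> : ((8 + 3 * i) * D)%:R * ln (2 : R) = (8/3 + i%:R) * (3 * ln 2 * D%:R).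
      by rewrite natrM natrD natrM; field.
    have := ler_wpM2l (_ : 0 <= 8/3 + i%:R) hx; have := ler0n R i; lra.
  rewrite mulrA -[X in X * expR _ <= _]/(_ * _).
  rewrite [leRHS]mulrAC ler_wpM2r ?expR_ge0//.
  rewrite !exprM -exprMn.
  have step : (1 + 2 ^+ i.+3 * c) ^+ 2 * (1/2) ^+ (8 + 3 * i) <= W * (1/8) * (1/2) ^+ i.
    have h0 : 0 <= (1/2 : R) ^+ (8 + 3 * i) by rewrite exprn_ge0.
    apply: le_trans (ler_wpM2r h0 (sqr_net_size i (ltW c0))) _.
    have -> : (1/2 : R) ^+ (8 + 3 * i) = 1/256 * ((1/8) ^+ i).
      by rewrite exprD exprM; congr (_ * _); last congr (_ ^+ _); rewrite !exprS expr0; field.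
    have -> : (1/8 : R) ^+ i = (1/4) ^+ i * (1/2) ^+ i by rewrite -exprMn; congr (_ ^+ _); field.
    have -> : 4 ^+ i * (1 + 8 * c) ^+ 2 * (1/256 * ((1/4) ^+ i * (1/2) ^+ i)) = (1 + 8 * c) ^+ 2 / 256 * (1/2) ^+ i * (4 * (1/4)) ^+ i.
      by rewrite (exprMn i 4); field.
    have -> : 4 * (1/4) = 1 :> R by field.
    rewrite expr1n mulr1 ler_wpM2r ?exprn_ge0//.
    rewrite /W -subr_ge0.
    have -> : (2 * c + 1/4) * (c + 1/4) * (1/8) - (1 + 8 * c) ^+ 2 / 256 = (c + 1/8) / 32 by field.
    lra.
  apply: (le_trans (lerXn2r _ _ _ step)).
  - by rewrite nnegrE mulr_ge0 ?exprn_ge0.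
  - by rewrite nnegrE; apply: mulr_ge0; rewrite ?exprn_ge0//; lra.
  have -> : (W * (1/8) * (1/2) ^+ i) ^+ D = W ^+ D * ((1/8) ^+ D * (1/2) ^+ (i * D)).
    by rewrite exprMn (exprMn D W) -exprM mulrA.
  rewrite -[leRHS]mulrA ler_wpM2l ?exprn_ge0 ?(ltW W0)//.
  apply: ler_pM; rewrite ?exprn_ge0//.
    rewrite div1r exprVn lef_pV2 ?posrE ?mulr_gt0 ?exprn_gt0 ?ltr0n//.
    rewrite -natrM -natrX ler_nat; clear -D0; case: D D0 => // D _; elim: D => // D IH.
    by rewrite expnS; lia.
  by rewrite ler_wiXn2l ?leq_pmulr//; lra.
rewrite -mulr_sumr.
apply: (@le_trans _ _ (W ^+ D / (8 * D%:R) * expR (- x) * 2)).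
  rewrite ler_wpM2l ?half_powers_sum// mulr_ge0 ?expR_ge0// divr_ge0 ?exprn_ge0 ?(ltW W0)//; lra.
rewrite mulrAC ler_wpM2r ?expR_ge0//.
have -> : W ^+ D / (8 * D%:R) * 2 = W ^+ D / D%:R * (1/4) by field; lra.
have -> : 2 * W ^+ D / (3 * ln 2 ^+ 2 * D%:R) = W ^+ D / D%:R * (2 / (3 * ln 2 ^+ 2)).
  by field; rewrite gt_eqF//; lra.
have Wp : 0 <= W ^+ D / D%:R by rewrite divr_ge0// exprn_ge0 ?ltW.
rewrite ler_wpM2l//.
rewrite ler_pdivlMr ?mulr_gt0 ?exprn_gt0//.
have : ln (2 : R) ^+ 2 <= 1 by rewrite exprn_ile1 ?(ltW l20).
lra.
Qed.

(** With [Y = (4c+1)^D], all factors are powers of [Y]: since [4^D <= Y], net [i] has at most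
    [Y^(i+3)] points, while the exponent beyond the first [x] gives [(2Y)^(-2(i+2))]. *)
Lemma net_sum_large c x e D L : 1 <= c -> (0 < D)%N -> 2 * (4 * c + 1) ^+ D <= expR x ->
  (forall i, e i <= expR (- ((5 + 2 * i%:R) * x))) ->
  \sum_(i < L) (1 + 2 ^+ i.+3 * c) ^+ (2 * D) * e i
  <= 1/2 * (4 * c + 1) ^+ D * expR (- x).
Proof.
move=> c1 D0 hx he; set Y := (4 * c + 1) ^+ D.
have Y4 : 4 ^+ D <= Y by rewrite lerXn2r ?nnegrE//; lra.
have Y1 : 1 <= Y by apply: le_trans Y4; rewrite exprn_ege1//; lra.
have Y0 : 0 < Y by lra.
apply: (@le_trans _ _ (\sum_(i < L) (1/4 * expR (- x)) * (1/2) ^+ i)); last first.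
  rewrite -mulr_sumr.
  apply: (@le_trans _ _ (1/4 * expR (- x) * 2)).
    by rewrite ler_wpM2l ?half_powers_sum// mulr_ge0 ?expR_ge0.
  by rewrite mulrAC ler_wpM2r ?expR_ge0//; lra.
apply: ler_sum => i _.
have p0 : 0 <= 1 + 2 ^+ i.+3 * c by rewrite addr_ge0// mulr_ge0//; lra.
have E : expR (- ((5 + 2 * i%:R) * x)) = expR (- x) * (expR (- x) ^+ 2) ^+ i.+2.
  rewrite -exprM -expRM_natl -expRD; congr expR.
  by rewrite mulnC natrM -!natr1; ring.
have ex : expR (- x) ^+ 2 <= (4 * Y ^+ 2)^-1.
  rewrite expRN (_ : 4 * Y ^+ 2 = (2 * Y) ^+ 2); last by ring.
  rewrite -exprVn lerXn2r ?nnegrE ?invr_ge0 ?expR_ge0//; first by apply: mulr_ge0; lra.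
  by rewrite lef_pV2 ?posrE ?expR_gt0//; lra.
have sz : (1 + 2 ^+ i.+3 * c) ^+ 2 <= 4 ^+ i.+1 * (4 * c + 1) ^+ 2.
  apply: le_trans (sqr_net_size i _) _; first lra.
  rewrite (exprS 4 i) (mulrC 4 (4 ^+ i)) -mulrA ler_wpM2l ?exprn_ge0//.
  have -> : 4 * (4 * c + 1) ^+ 2 = (8 * c + 2) ^+ 2 by ring.
  by rewrite lerXn2r ?nnegrE//; lra.
apply: (@le_trans _ _ ((4 ^+ i.+1 * (4 * c + 1) ^+ 2) ^+ D * (expR (- x) * ((4 * Y ^+ 2)^-1) ^+ i.+2))).
  apply: (@le_trans _ _ ((1 + 2 ^+ i.+3 * c) ^+ (2 * D) * expR (- ((5 + 2 * i%:R) * x)))).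
    by rewrite ler_wpM2l ?exprn_ge0.
  rewrite exprM E; apply: ler_pM.
  - by rewrite !exprn_ge0.
  - by rewrite mulr_ge0 ?expR_ge0// !exprn_ge0// expR_ge0.
  - by rewrite lerXn2r ?nnegrE ?mulr_ge0 ?exprn_ge0//; lra.
  have Yi : 0 <= (4 * Y ^+ 2)^-1 by rewrite invr_ge0 mulr_ge0// exprn_ge0// ltW.
  by rewrite ler_wpM2l ?expR_ge0// lerXn2r// nnegrE exprn_ge0// expR_ge0.
rewrite mulrCA [leRHS]mulrAC [leRHS]mulrC ler_wpM2l ?expR_ge0//.
rewrite exprMn exprAC [X in 4 ^+ D ^+ _ * X]exprAC -/Y.
rewrite exprVn ler_pdivrMr; last by rewrite exprn_gt0// mulr_gt0// exprn_gt0.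
rewrite (exprMn i.+2 4) -(exprM Y).
have h1 : (4 ^+ D) ^+ i.+1 <= Y ^+ i.+1 by rewrite lerXn2r// nnegrE ?(ltW Y0) ?exprn_ge0.
have h2 : Y ^+ i.+1 * Y ^+ 2 <= Y ^+ (2 * i.+2) by rewrite -exprD ler_weXn2l//; lia.
have h3 : 1 <= 1/4 * (1/2) ^+ i * 4 ^+ i.+2 :> R.
  have -> : 1/4 * (1/2) ^+ i * 4 ^+ i.+2 = 4 * 2 ^+ i :> R.
    have -> : (4 : R) ^+ i.+2 = 16 * (2 ^+ i * 2 ^+ i) by rewrite -exprMn (_ : 2 * 2 = 4 :> R) ?exprS; ring.
    have E2 : (1/2) ^+ i * 2 ^+ i = 1 :> R by rewrite -exprMn (_ : 1/2 * 2 = 1) ?expr1n//; field.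
    have -> : 1/4 * (1/2) ^+ i * (16 * (2 ^+ i * 2 ^+ i)) = 4 * 2 ^+ i * ((1/2) ^+ i * 2 ^+ i) :> R by field.
    by rewrite E2 mulr1.
  have : 1 <= 2 ^+ i :> R by rewrite exprn_ege1 ?ler1n.
  lra.
apply: le_trans (ler_wpM2r _ h1) _; first by rewrite exprn_ge0// ltW.
apply: le_trans h2 _; rewrite mulrA ler_peMl// exprn_ge0// ltW//.
Qed.

End net_sums.

Section deviation_exponents.
Variable R : realType.
Implicit Types (B c u eta r : R) (i : nat).

Lemma sixth_power_ge i : 1 + i%:R / 5 <= (6/5 : R) ^+ i.
Proof.
elim: i => [|i IH]; first by rewrite expr0; lra.
by rewrite exprS -natr1; have := ler0n R i; lra.
Qed.

(** Levels shrink by [3/5] while radii halve, so their ratio grows like [(6/5)^i] and so do the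
    exponents. The shares [82/100] of the first net, [7/40] of all levels and [5/1000] of the
    Lipschitz remainder add up to 1. *)
Definition level (tau : R) i := 7/100 * (3/5) ^+ i * tau.
Definition radius c i := (2 ^+ i.+1 * c)^-1.

Lemma levelE tau c i : c != 0 ->
  level tau i = 14/100 * (6/5) ^+ i * tau * c * radius c i.
Proof.
move=> c0; rewrite /level /radius.
have -> : (6/5 : R) ^+ i = 2 ^+ i * (3/5) ^+ i by rewrite -exprMn; congr (_ ^+ _); field.
by rewrite exprS; field; rewrite c0 expf_neq0.
Qed.

Lemma levels_sum tau L : 0 <= tau -> \sum_(i < L) level tau i <= 7/40 * tau.
Proof.
move=> tau0.
suff -> : \sum_(i < L) level tau i = 7/40 * tau * (1 - (3/5) ^+ L).
  by rewrite ler_piMr ?mulr_ge0// gerBl exprn_ge0.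
elim: L => [|L IH]; first by rewrite big_ord0 expr0; lra.
by rewrite big_ord_recr/= IH /level exprS; lra.
Qed.

(** The rate of the second exponential of the claim; the tail exponents are compared with its upper
    bound [eta^2 / 2000]. *)
Definition rate2 eta := eta ^+ 2 / (18 * Num.sqrt 2 * (81 + 2 * eta)).

Lemma rate2_le eta : 0 < eta -> rate2 eta <= eta ^+ 2 / (40 * 50).
Proof.
move=> e0; have D0 : 0 < 18 * Num.sqrt 2 * (81 + 2 * eta).
  by apply: mulr_gt0; [rewrite mulr_gt0 ?sqrtr_gt0|lra].
have C0 : 0 < 40 * 50 :> R by rewrite mulr_gt0.
rewrite /rate2 ler_wpM2l ?sqr_ge0// lef_pV2 ?posrE//.
have s2 : 7/5 <= Num.sqrt 2 :> R.
  have -> : 7/5 = Num.sqrt ((7/5) ^+ 2) :> R by rewrite sqrtr_sqr ger0_norm//; lra.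
  by rewrite ler_sqrt; lra.
apply: (@le_trans _ _ (18 * (7/5) * 81)); first by lra.
by apply: ler_pM => //; lra.
Qed.

Section exponents.
Variables (B c u eta : R) (i : nat).
Hypotheses (B0 : 0 < B) (c0 : 0 < c) (u1 : 1 <= u) (eta0 : 0 < eta).

Local Notation tau := (u * eta).

Let tau0 : 0 < tau. Proof. by rewrite mulr_gt0//; have := u1; lra. Qed.
Let etau : eta <= tau. Proof. by rewrite ler_peMl// ltW. Qed.

(** [(82/100)^2] just exceeds [(23/10)^2 / 8]. The exponent on the left is doubled because half of
    it pays for the first net. *)
Lemma hoeffding_first : B <= 23/10 * c ->
  2 * (eta ^+ 2 / (8 * c ^+ 2)) <= 2 * (82/100 * tau) ^+ 2 / B ^+ 2.
Proof.
move=> Bc.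
have h1 : eta ^+ 2 <= tau ^+ 2 by rewrite lerXn2r// nnegrE ltW.
have h2 : B ^+ 2 <= 529/100 * c ^+ 2.
  have -> : 529/100 * c ^+ 2 = (23/10 * c) ^+ 2 by field.
  by rewrite lerXn2r// nnegrE; have := B0; have := c0; lra.
rewrite ler_pdivlMr ?exprn_gt0//.
have c2 : 0 < c ^+ 2 by rewrite exprn_gt0.
have E : 0 <= eta ^+ 2 / (8 * c ^+ 2) by rewrite divr_ge0 ?sqr_ge0//; lra.
apply: (@le_trans _ _ (2 * (eta ^+ 2 / (8 * c ^+ 2)) * (529/100 * c ^+ 2))).
  by rewrite ler_wpM2l//; lra.
have -> : 2 * (eta ^+ 2 / (8 * c ^+ 2)) * (529/100 * c ^+ 2) = 529/400 * eta ^+ 2.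
  by field; rewrite gt_eqF.
have -> : 2 * (82/100 * tau) ^+ 2 = 2 * (82/100 * (82/100)) * tau ^+ 2 by field.
by have := sqr_ge0 eta; lra.
Qed.

Lemma hoeffding_level : B <= 23/10 * c ->
  (11/3 + i%:R) * rate2 eta <= 2 * level tau i ^+ 2 / (2 * (B * radius c i)) ^+ 2.
Proof.
move=> Bc; have i0 := ler0n R i.
apply: (@le_trans _ _ ((11/3 + i%:R) * (eta ^+ 2 / (40 * 50)))).
  by rewrite ler_wpM2l ?rate2_le//; lra.
set g := (6/5 : R) ^+ i; have g1 : 1 + i%:R / 5 <= g := sixth_power_ge i.
have r0 : 0 < radius c i by rewrite invr_gt0 mulr_gt0// exprn_gt0.
have -> : 2 * level tau i ^+ 2 / (2 * (B * radius c i)) ^+ 2 =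
   98/100 * (1/100) * g ^+ 2 * tau ^+ 2 * (c ^+ 2 / B ^+ 2).
  by rewrite (@levelE _ c) ?gt_eqF// -/g; field; rewrite !gt_eqF.
have h1 : eta ^+ 2 <= tau ^+ 2 by rewrite lerXn2r// nnegrE ltW.
have h2 : 100/529 <= c ^+ 2 / B ^+ 2.
  rewrite ler_pdivlMr ?exprn_gt0//.
  have : B ^+ 2 <= (23/10 * c) ^+ 2 by rewrite lerXn2r// nnegrE; have := B0; have := c0; lra.
  by rewrite exprMn; lra.
have h3 : 1 + 2/5 * i%:R <= g ^+ 2.
  have : (1 + i%:R / 5) ^+ 2 <= g ^+ 2 by rewrite lerXn2r// nnegrE; lra.
  by have : 0 <= (i%:R : R) ^+ 2 := sqr_ge0 _; lra.
have e2 : 0 <= eta ^+ 2 := sqr_ge0 _.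
have h4 : (1 + 2/5 * i%:R) * eta ^+ 2 <= g ^+ 2 * tau ^+ 2.
  by apply: ler_pM h3 h1 => //; lra.
have h5 : (1 + 2/5 * i%:R) * eta ^+ 2 * (100/529) <= g ^+ 2 * tau ^+ 2 * (c ^+ 2 / B ^+ 2).
  apply: ler_pM h4 h2; last by lra.
  by rewrite mulr_ge0//; lra.
have : 0 <= i%:R * eta ^+ 2 by rewrite mulr_ge0.
move: h5; rewrite -mulrA -[98/100 * _ * _ * _ * _]mulrA -[98/100 * _ * _ * _]mulrA.
set L := (1 + 2/5 * i%:R) * (eta ^+ 2 * (100/529)).
have LE : L = (100/529 + 40/529 * i%:R) * eta ^+ 2 by rewrite /L; field.
move=> h5 h6; apply: (@le_trans _ _ (98/100 * (1/100) * L)); first by rewrite LE; lra.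
by apply: ler_wpM2l => //; lra.
Qed.

Hypothesis Beta : B * eta <= 104/100 * c ^+ 2.

Let Btau r : 0 <= r -> B * (r * tau) <= 104/100 * c ^+ 2 * u * r.
Proof.
move=> r0; have -> : B * (r * tau) = r * u * (B * eta) by ring.
have -> : 104/100 * c ^+ 2 * u * r = r * u * (104/100 * c ^+ 2) by ring.
by rewrite ler_wpM2l// mulr_ge0//; have := u1; lra.
Qed.

(** The squared deviation grows like [u^2], the Bernstein denominator only like [u], so [u = 1] is
    the worst case. *)
Lemma bernstein_first : 2 * (eta ^+ 2 / (8 * c ^+ 2)) <=
  (82/100 * tau) ^+ 2 / (2 * (104/100 * c ^+ 2 * u + B * (82/100 * tau) / 3)).
Proof.
have c2 : 0 < c ^+ 2 by rewrite exprn_gt0.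
have u0 : 0 < u by have := u1; lra.
have cu : 0 < c ^+ 2 * u by rewrite mulr_gt0.
have Bt : 0 < B * (82/100 * tau) by apply: mulr_gt0 => //; have := tau0; lra.
have h := @Btau (82/100) ltac:(lra).
rewrite ler_pdivlMr; last by lra.
apply: (@le_trans _ _ (2 * (eta ^+ 2 / (8 * c ^+ 2)) * (2 * (104/100 * (c ^+ 2 * u) * (1 + 82/300))))).
  rewrite ler_wpM2l//; first by rewrite mulr_ge0// divr_ge0 ?sqr_ge0//; lra.
  lra.
have -> : 2 * (eta ^+ 2 / (8 * c ^+ 2)) * (2 * (104/100 * (c ^+ 2 * u) * (1 + 82/300)))
  = 104/200 * (382/300) * (u * eta ^+ 2) by field; rewrite gt_eqF.
have -> : (82/100 * tau) ^+ 2 = 82/100 * (82/100) * (u * (u * eta ^+ 2)) by field.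
have e2 : 0 <= u * eta ^+ 2 by rewrite mulr_ge0 ?sqr_ge0 ?(ltW u0).
have := ler_peMl e2 u1; lra.
Qed.

(** The linear term of the Bernstein denominator costs the factor [1 + 14/300 c]. It exceeds 2 for
    large [c], whence the separate treatment on either side of [c = 20]. *)
Lemma bernstein_level : 94/100 * (1/100) * (6/5) ^+ i * eta ^+ 2 / (1 + 14/300 * c) <=
  level tau i ^+ 2 / (2 * (104/100 * c ^+ 2 * u * radius c i ^+ 2 + B * radius c i * level tau i / 3)).
Proof.
set g := (6/5 : R) ^+ i; have g1 : 1 + i%:R / 5 <= g := sixth_power_ge i.
have i0 := ler0n R i.
have r0 : 0 < radius c i by rewrite invr_gt0 mulr_gt0// exprn_gt0.
have c0' := c0; have c2 : 0 < c ^+ 2 by rewrite exprn_gt0.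
have u0 : 0 < u by have := u1; lra.
have cu : 0 < c ^+ 2 * u by rewrite mulr_gt0.
have g0 : 0 < g by lra.
have gc : 0 <= 14/100 * g * c by rewrite mulr_ge0//; lra.
have h := Btau gc; set k := 14/100 * g * c * tau in h.
have k0 : 0 < k by rewrite /k !mulr_gt0.
have Bk : 0 < B * k by rewrite mulr_gt0.
have -> : level tau i ^+ 2 / (2 * (104/100 * c ^+ 2 * u * radius c i ^+ 2 + B * radius c i * level tau i / 3))
   = k ^+ 2 / (2 * (104/100 * (c ^+ 2 * u) + B * k / 3)).
  rewrite (@levelE _ c) ?gt_eqF// -/g -[X in X * radius c i]/(_ * _).
  have -> : 14/100 * g * tau * c = k by rewrite /k; ring.
  have p : 0 < 104 * (c ^+ 2 * u) * 3 + B * k * 100 by lra.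
  rewrite (_ : 104/100 * c ^+ 2 * u * radius c i ^+ 2 + _ =
    (104/100 * (c ^+ 2 * u) + B * k / 3) * radius c i ^+ 2); last by ring.
  by field; rewrite !gt_eqF.
have e2 : 0 <= eta ^+ 2 := sqr_ge0 _.
rewrite ler_pdivrMr; last by lra.
rewrite [leRHS]mulrAC ler_pdivlMr; last by lra.
apply: (@le_trans _ _ (94/100 * (1/100) * g * eta ^+ 2 * (2 * (104/100 * (c ^+ 2 * u) * (1 + 14/300 * g * c))))).
  apply: ler_wpM2l; last by lra.
  by apply: mulr_ge0 => //; apply: mulr_ge0; lra.
have -> : k ^+ 2 * (1 + 14/300 * c) = 196/100 * (1/100) * (c ^+ 2 * (g * (u * (u * eta ^+ 2)))) * (g + 14/300 * g * c).
  by rewrite /k; field.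
set m := c ^+ 2 * (g * (u * eta ^+ 2)).
have m0 : 0 <= m by rewrite mulr_ge0 ?(ltW c2)// mulr_ge0 ?(ltW g0)// mulr_ge0 ?(ltW u0).
have -> : 94/100 * (1/100) * g * eta ^+ 2 * (2 * (104/100 * (c ^+ 2 * u) * (1 + 14/300 * g * c)))
   = 94/100 * (1/100) * (208/100) * m * (1 + 14/300 * g * c) by rewrite /m; ring.
have -> : c ^+ 2 * (g * (u * (u * eta ^+ 2))) = u * m by rewrite /m; ring.
have um : m <= u * m by rewrite ler_peMl.
have gcp : 0 <= 14/300 * g * c by lra.
apply: ler_pM; [by lra|by lra|by lra|by lra].
Qed.

Lemma bernstein_level_small : c <= 20 -> (11/3 + i%:R) * rate2 eta <=
  level tau i ^+ 2 / (2 * (104/100 * c ^+ 2 * u * radius c i ^+ 2 + B * radius c i * level tau i / 3)).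
Proof.
move=> c20; apply: le_trans bernstein_level; have i0 := ler0n R i; have c0' := c0.
apply: (@le_trans _ _ ((11/3 + i%:R) * (eta ^+ 2 / (40 * 50)))).
  by rewrite ler_wpM2l ?rate2_le//; lra.
have g1 := sixth_power_ge i; set g := _ ^+ i in g1 *.
rewrite ler_pdivlMr; last by lra.
have e2 : 0 <= eta ^+ 2 := sqr_ge0 _.
have ie : 0 <= i%:R * eta ^+ 2 by rewrite mulr_ge0.
apply: (@le_trans _ _ ((11/3 + i%:R) * (eta ^+ 2 / (40 * 50)) * 2)).
  by rewrite ler_wpM2l//; [rewrite mulr_ge0// ?divr_ge0//; lra | lra].
have := ler_wpM2r e2 g1; lra.
Qed.

(** The reference rate is now [eta^2 / (8 c^2)], which falls like [c^(-2)], whereas the Bernstein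
    bound loses only one power of [c]. *)
Lemma bernstein_level_large : 20 <= c -> (5 + 2 * i%:R) * (eta ^+ 2 / (8 * c ^+ 2)) <=
  level tau i ^+ 2 / (2 * (104/100 * c ^+ 2 * u * radius c i ^+ 2 + B * radius c i * level tau i / 3)).
Proof.
move=> c20; apply: le_trans bernstein_level; have i0 := ler0n R i; have c0' := c0.
have g1 := sixth_power_ge i; set g := _ ^+ i in g1 *.
have c2 : 20 * c <= c ^+ 2 by rewrite expr2 ler_wpM2r//; lra.
have e2 : 0 <= eta ^+ 2 := sqr_ge0 _.
have ie : 0 <= i%:R * eta ^+ 2 by rewrite mulr_ge0.
rewrite ler_pdivlMr; last by lra.
have -> : (5 + 2 * i%:R) * (eta ^+ 2 / (8 * c ^+ 2)) * (1 + 14/300 * c)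
  = (5/8 + i%:R / 4) * eta ^+ 2 * ((1 + 14/300 * c) / c ^+ 2).
  by field; rewrite gt_eqF.
have h : (1 + 14/300 * c) / c ^+ 2 <= 1/200 by rewrite ler_pdivrMr; lra.
apply: (@le_trans _ _ ((5/8 + i%:R / 4) * eta ^+ 2 * (1/200))).
  by rewrite ler_wpM2l// mulr_ge0//; lra.
have := ler_wpM2r e2 g1; lra.
Qed.

End exponents.

End deviation_exponents.

(** * Uniform one-sided deviation *)

Section uniform_deviation.
Context dT dV (T : measurableType dT) (V : measurableType dV) (R : realType).
Variables (P : probability T R) (Q : probability V R) (J : eqType).
Variable X : J -> T -> V.
Hypothesis mX : forall j, measurable_fun setT (X j).
Hypothesis law : forall j A, measurable A -> P (X j @^-1` A) = Q A.
Hypothesis indep : mutually_independent P X.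
Variables (s : seq J) (I : finType).
Hypotheses (us : uniq s) (s0 : (0 < size s)%N).
Local Notation vec := {ffun I -> R}.
Local Notation E F := (Rintegral Q [set: V] F).
Local Notation M := ((size s)%:R : R).
Variables (N : vec -> R) (al be : R) (Psi : vec -> V -> R) (B c u eta lo : R) (D : nat).
Hypotheses (al0 : 0 < al) (be0 : 0 < be).
Hypothesis ND : forall a b : vec, N (a + b) <= N a + N b.
Hypothesis NZ : forall t (a : vec), N (t *: a) = `|t| * N a.
Hypothesis Nlow : forall (a : vec) i, al * `|a i| <= N a.
Hypothesis Nup : forall (a : vec) t, (forall i, `|a i| <= t) -> N a <= be * t.
Hypothesis bPsi : forall a, bounded_measurable (Psi a).
Hypothesis Psi_range : forall a, N a <= 1 -> forall v, lo <= Psi a v <= lo + B.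
Hypothesis Psi_lip : forall a b v, Psi a v - Psi b v <= B * N (a - b).
Hypotheses (B0 : 0 < B) (c0 : 0 < c) (u1 : 1 <= u) (eta0 : 0 < eta) (lo0 : lo <= 0).
Hypothesis tails : B <= 23/10 * c \/ (B * eta <= 104/100 * c ^+ 2 /\
  (forall a, N a <= 1 -> E (fun v => Psi a v * Psi a v) <= 104/100 * c ^+ 2 * u) /\
  (forall a b, E (fun v => (Psi a v - Psi b v) * (Psi a v - Psi b v))
     <= 104/100 * c ^+ 2 * u * N (a - b) ^+ 2)).
Hypotheses (ID : #|I| = (2 * D)%N) (D0 : (0 < D)%N).
Hypothesis x2_ge : 3 * ln 2 * D%:R <= M * rate2 eta.
Hypothesis x1_ge : 2 * (4 * c + 1) ^+ D <= expR (M * (eta ^+ 2 / (8 * c ^+ 2))).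

Local Notation x1 := (M * (eta ^+ 2 / (8 * c ^+ 2))).
Local Notation x2 := (M * rate2 eta).
Local Notation tau := (u * eta).

Let M0 : 0 < M. Proof. by rewrite ltr0n. Qed.
Let tau0 : 0 < tau. Proof. by rewrite mulr_gt0//; have := u1; lra. Qed.
Let bPsiB a b : bounded_measurable (fun v => Psi a v - Psi b v).
Proof.
have [mb [C HC]] := bPsi b.
apply: bounded_measurableD => //; split; first exact: measurableT_comp.
by exists C => x; rewrite normrN.
Qed.

Let N_distC a b : N (a - b) = N (b - a). Proof. by rewrite -opprB -scaleN1r NZ normrN1 mul1r. Qed.

Let first_tail a : N a <= 1 ->
  (P [set w | (M * (E (Psi a) + 82/100 * tau) <= \sum_(j <- s) Psi a (X j w))%R]
   <= (expR (- (2 * x1)))%:E)%E.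
Proof.
move=> a1; have t0 : 0 < 82/100 * tau by have := tau0; lra.
have R1 := Psi_range a1.
have [Bc|[Be [V1 _]]] := tails.
  apply: le_trans (hoeffding mX law indep us (bPsi a) B0 t0 R1) _.
  rewrite lee_fin ler_expR lerN2 mulrCA ler_pM2l//.
  exact: hoeffding_first.
have c2 : 0 < 104/100 * c ^+ 2 * u.
  by apply: mulr_gt0; [apply: mulr_gt0; [lra | exact: exprn_gt0] | have := u1; lra].
have R2 v : Psi a v <= B by have /andP[_] := R1 v; have := lo0; lra.
apply: le_trans (bernstein mX law indep us (bPsi a) (ltW B0) c2 t0 R2 (V1 a a1)) _.
rewrite lee_fin ler_expR lerN2 mulrCA ler_pM2l//.
exact: bernstein_first.
Qed.

Let N_ge0 a : 0 <= N a.
Proof.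
have N0 : N 0 = 0 by rewrite -(scale0r 0) NZ normr0 mul0r.
by have := ND a (- a); rewrite subrr -scaleN1r NZ normrN1 mul1r N0; lra.
Qed.

Let variance_bound := forall a b, E (fun v => (Psi a v - Psi b v) * (Psi a v - Psi b v))
     <= 104/100 * c ^+ 2 * u * N (a - b) ^+ 2.

Let level_tail (rate : nat -> R) :
  (forall i, rate i <= 2 * level tau i ^+ 2 / (2 * (B * radius c i)) ^+ 2) \/
  (variance_bound /\ forall i, rate i <= level tau i ^+ 2 / (2 * (104/100 * c ^+ 2 * u * radius c i ^+ 2 + B * radius c i * level tau i / 3))) ->
  forall i a b, N (a - b) <= radius c i ->
  (P [set w | (M * (E (fun v => Psi a v - Psi b v) + level tau i) <=
       \sum_(j <- s) (Psi a (X j w) - Psi b (X j w)))%R]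
   <= (expR (- (M * rate i)))%:E)%E.
Proof.
move=> hr i a b ab.
have r0 : 0 < radius c i by rewrite invr_gt0 mulr_gt0// exprn_gt0.
have t0 : 0 < level tau i by rewrite /level mulr_gt0// mulr_gt0// ?exprn_gt0//; lra.
have Br : 0 < B * radius c i by rewrite mulr_gt0.
have up (a' b' : vec) v : N (a' - b') <= radius c i -> Psi a' v - Psi b' v <= B * radius c i.
  by move=> h; apply: le_trans (Psi_lip _ _ _) _; rewrite ler_wpM2l// ltW.
have R1 v : - (B * radius c i) <= Psi a v - Psi b v <= - (B * radius c i) + 2 * (B * radius c i).
  have := up a b v ab; have := up b a v; rewrite N_distC => /(_ ab); lra.
case: hr => [h1|[V1 h2]].
  have b0 : 0 < 2 * (B * radius c i) by lra.
  apply: le_trans (hoeffding mX law indep us (bPsiB a b) b0 t0 R1) _.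
  by rewrite lee_fin ler_expR lerN2 ler_pM2l.
have c2u : 0 < 104/100 * c ^+ 2 * u.
  by apply: mulr_gt0; [apply: mulr_gt0; [lra | exact: exprn_gt0] | have := u1; lra].
have c2 : 0 < 104/100 * c ^+ 2 * u * radius c i ^+ 2 by apply: mulr_gt0; last exact: exprn_gt0.
have R2 v : Psi a v - Psi b v <= B * radius c i by exact: up.
have V2 : E (fun v => (Psi a v - Psi b v) * (Psi a v - Psi b v)) <= 104/100 * c ^+ 2 * u * radius c i ^+ 2.
  apply: le_trans (V1 a b) _; apply: ler_wpM2l; first exact: ltW.
  by rewrite lerXn2r// nnegrE ?N_ge0 ?(ltW r0).
apply: le_trans (bernstein mX law indep us (bPsiB a b) (ltW Br) c2 t0 R2 V2) _.
by rewrite lee_fin ler_expR lerN2 ler_pM2l.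
Qed.

(** The first net has tails [exp (- 2 x1)], and [x1_ge] reduces its cost to half of the first term
    of the bound. The later nets are charged to the [x2] term under Hoeffding, or under Bernstein
    with [c <= 20], and to the other half of the first term when [c > 20]. *)
Lemma uniform_deviation : exists Bad : set T, [/\ measurable Bad,
  (P Bad <= ((4 * c + 1) ^+ D * expR (- x1) +
     2 * ((2 * c + 1/4) * (c + 1/4)) ^+ D / (3 * ln 2 ^+ 2 * D%:R) * expR (- x2))%:E)%E &
  forall w, ~ Bad w -> forall a, N a <= 1 ->
    \sum_(j <- s) Psi a (X j w) <= M * (E (Psi a) + tau)].
Proof.
pose Z (a : vec) w := M^-1 * \sum_(j <- s) Psi a (X j w) - E (Psi a).
have EB a b : E (fun v => Psi a v - Psi b v) = E (Psi a) - E (Psi b).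
  rewrite (_ : (fun v => _) = (fun v => Psi a v + -1 * Psi b v)); last first.
    by apply/funext => v; rewrite mulN1r.
  rewrite meanD//; last by apply: bounded_measurableM => //; exact: bounded_measurable_cst.
  by rewrite meanZ// mulN1r.
have mZ a : measurable_fun setT (Z a).
  apply: measurable_funB => //; apply: measurable_funM => //.
  exact: measurable_sum_sample.
have L0 : 0 <= 2 * B by have := B0; lra.
have ZL a b w : Z a w - Z b w <= (2 * B) * N (a - b).
  have h1 : M^-1 * \sum_(j <- s) Psi a (X j w) - M^-1 * \sum_(j <- s) Psi b (X j w) <= B * N (a - b).
    rewrite -mulrBr ler_pdivrMl// -sumrB.
    apply: (@le_trans _ _ (\sum_(j <- s) B * N (a - b))); first by apply: ler_sum => j _; exact: Psi_lip.
    by rewrite big_const_seq count_predT iter_addr_0 mulr_natl.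
  have h2 : E (Psi b) - E (Psi a) <= B * N (a - b).
    rewrite -EB -(mean_cst Q (B * N (a - b))); apply: le_mean => //; first exact: bounded_measurable_cst.
    by move=> v; rewrite N_distC; exact: Psi_lip.
  by rewrite /Z; lra.
have setE1 a t : [set w | (t <= Z a w)%R] = [set w | (M * (E (Psi a) + t) <= \sum_(j <- s) Psi a (X j w))%R].
  apply/seteqP; split => w /=; rewrite /Z lerBrDr ler_pdivlMl// addrC; exact.
have setE2 a b t : [set w | (t <= Z a w - Z b w)%R] =
    [set w | (M * (E (fun v => Psi a v - Psi b v) + t) <= \sum_(j <- s) (Psi a (X j w) - Psi b (X j w)))%R].
  apply/seteqP; split => w /=; rewrite /Z EB sumrB -ler_pdivlMl// mulrBr => h; lra.
have t1P a : N a <= 1 -> (P [set w | (82/100 * tau <= Z a w)%R] <= (expR (- (2 * x1)))%:E)%E.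
  by move=> a1; rewrite setE1; exact: first_tail.
have x1D : (1 + 4 * c) ^+ #|I| * expR (- (2 * x1)) <= 1/2 * (4 * c + 1) ^+ D * expR (- x1).
  rewrite ID exprM (addrC 1) exprAC.
  have -> : - (2 * x1) = - x1 + - x1 by ring.
  have hY := x1_ge; rewrite expRD expr2; set Y := (4 * c + 1) ^+ D in hY *.
  have Y0 : 0 <= Y by rewrite exprn_ge0//; have := c0; lra.
  have ex : Y * expR (- x1) <= 1/2.
    by rewrite expRN ler_pdivrMr ?expR_gt0//; lra.
  have := ler_wpM2l (mulr_ge0 Y0 (expR_ge0 (- x1))) ex; lra.
have [L HL] : exists L, 2 * B * (2 ^+ L.+1 * c)^-1 <= 5/1000 * tau.
  pose k := 2 * B / c / (5/1000 * tau); exists (Num.truncn k).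
  have t5 : 0 < 5/1000 * tau by have := tau0; lra.
  have h1 : k <= 2 ^+ (Num.truncn k).+1.
    apply: ltW; apply: lt_le_trans (truncnS_gt k) _.
    by rewrite -natrX ler_nat ltnW// ltn_expl.
  rewrite invfM mulrA mulrAC ler_pdivrMr ?exprn_gt0//.
  rewrite /k ler_pdivrMr// in h1; lra.
have lev : exists e : nat -> R, (forall i a b, N (a - b) <= radius c i ->
     (P [set w | (level tau i <= Z a w - Z b w)%R] <= (e i)%:E)%E) /\
   (\sum_(i < L) (1 + 2 ^+ i.+3 * c) ^+ (2 * D) * e i <=
     1/2 * (4 * c + 1) ^+ D * expR (- x1) + 
     2 * ((2 * c + 1/4) * (c + 1/4)) ^+ D / (3 * ln 2 ^+ 2 * D%:R) * expR (- x2)).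
  have p1 : 0 <= 1/2 * (4 * c + 1) ^+ D * expR (- x1).
    by rewrite mulr_ge0 ?expR_ge0// mulr_ge0 ?exprn_ge0//; have := c0; lra.
  have p2 : 0 <= 2 * ((2 * c + 1/4) * (c + 1/4)) ^+ D / (3 * ln 2 ^+ 2 * D%:R) * expR (- x2).
    rewrite mulr_ge0 ?expR_ge0// divr_ge0//.
      by rewrite mulr_ge0// exprn_ge0// mulr_ge0//; have := c0; lra.
    by rewrite mulr_ge0// mulr_ge0// sqr_ge0.
  have c0' := c0.
  pose small i := (11/3 + i%:R) * rate2 eta.
  pose large i := (5 + 2 * i%:R) * (eta ^+ 2 / (8 * c ^+ 2)).
  have use (rate : nat -> R) : 
    ((forall i, rate i <= 2 * level tau i ^+ 2 / (2 * (B * radius c i)) ^+ 2) \/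
     (variance_bound /\ forall i, rate i <= level tau i ^+ 2 / (2 * (104/100 * c ^+ 2 * u * radius c i ^+ 2 + B * radius c i * level tau i / 3)))) ->
    forall i a b, N (a - b) <= radius c i ->
     (P [set w | (level tau i <= Z a w - Z b w)%R] <= (expR (- (M * rate i)))%:E)%E.
    by move=> H i a b ab; rewrite setE2; exact: level_tail.
  have small_sum : \sum_(i < L) (1 + 2 ^+ i.+3 * c) ^+ (2 * D) * expR (- (M * small i)) <=
     1/2 * (4 * c + 1) ^+ D * expR (- x1) + 
     2 * ((2 * c + 1/4) * (c + 1/4)) ^+ D / (3 * ln 2 ^+ 2 * D%:R) * expR (- x2).
    rewrite -[leLHS]add0r; apply: lerD => //.
    apply: (@net_sum_small R c x2 (fun i => expR (- (M * small i)))) => // i.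
    by rewrite ler_expR lerN2 /small mulrCA.
  have [Bc|[Be [_ V1]]] := tails.
    exists (fun i => expR (- (M * small i))); split => //.
    by apply: use; left => i; exact: hoeffding_level.
  have [c20|c20] := leP c 20.
    exists (fun i => expR (- (M * small i))); split => //.
    by apply: use; right; split => // i; exact: bernstein_level_small.
  exists (fun i => expR (- (M * large i))); split.
    by apply: use; right; split => // i; apply: bernstein_level_large => //; exact: ltW.
  rewrite -[leLHS]addr0; apply: lerD => //.
  apply: (@net_sum_large R c x1 (fun i => expR (- (M * large i)))) => //; first by lra.
  by move=> i; rewrite ler_expR lerN2 /large mulrCA.
have [e [He Hs]] := lev.
have [Bad [mBad PBad HBad]] := @chaining _ _ _ P I N al be c (2 * B) (82/100 * tau) (level tau)
  (expR (- (2 * x1))) e Z al0 be0 c0 L0 ND NZ Nlow Nup mZ ZL t1P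
  (fun i a b _ _ ab => He i a b ab) L.
exists Bad; split => //.
  apply: le_trans PBad _; rewrite lee_fin; move: Hs; rewrite -ID => Hs; lra.
move=> w /HBad H a /H; rewrite /Z => h.
have hs := levels_sum L (ltW tau0).
have h2 : M^-1 * \sum_(j <- s) Psi a (X j w) <= E (Psi a) + tau by lra.
by rewrite ler_pdivrMl in h2.
Qed.

End uniform_deviation.

(** * Mixed norms and shift-invariant combinations *)

Section ge0_norms.
Context d (T : measurableType d) (R : realType) (mu : {measure set T -> \bar R}).
Implicit Types (p : R) (u v : T -> \bar R).
Local Open Scope ereal_scope.

Lemma measurable_abse_poweR p u : measurable_fun setT u ->
  measurable_fun setT (fun x => `|u x| `^ p).
Proof. by move=> mu_; apply: (measurableT_comp (measurable_poweR _)); exact: measurableT_comp. Qed.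

Lemma le_Lnorm_ge0 p u v : (0 < p)%R -> measurable_fun setT u -> measurable_fun setT v ->
  (forall x, 0 <= u x) -> (forall x, u x <= v x) ->
  'N[mu]_p%:E[u] <= 'N[mu]_p%:E[v].
Proof.
move=> p0 mu_ mv u0 uv; rewrite unlock.
have v0 x : 0 <= v x by exact: le_trans (u0 x) (uv x).
apply: gt0_ler_poweR; rewrite ?invr_ge0 ?(ltW p0)//.
- by rewrite in_itv/= leey integral_ge0// => x _; exact: poweR_ge0.
- by rewrite in_itv/= leey integral_ge0// => x _; exact: poweR_ge0.
apply: ge0_le_integral => //.
- by move=> x _; exact: poweR_ge0.
- exact: measurable_abse_poweR.
- exact: measurable_abse_poweR.
move=> x _; rewrite !gee0_abs//; apply: gt0_ler_poweR; rewrite ?(ltW p0)// in_itv/= ?leey ?andbT//.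
Qed.

(** Norms of slices may be infinite at some points. If the outer norm is finite this happens on a
    null set only, so [fine] changes nothing and real-valued inequalities become available. *)
Lemma Lnorm_lty_fine p u : (0 < p)%R -> measurable_fun setT u -> (forall x, 0 <= u x) ->
  'N[mu]_p%:E[u] < +oo ->
  'N[mu]_p%:E[EFin \o (fine \o u)] = 'N[mu]_p%:E[u] /\ {ae mu, forall x, (fine (u x))%:E = u x}.
Proof.
move=> p0 mu_ u0; rewrite unlock => H.
have H' : \int[mu]_x (`|u x| `^ p) < +oo.
  by apply: lty_poweRy H; rewrite invr_eq0 gt_eqF.
have mup : measurable_fun setT (fun x => `|u x| `^ p).
  exact: measurable_abse_poweR.
have ip : mu.-integrable setT (fun x => `|u x| `^ p).
  apply/integrableP; split => //.
  by under eq_integral do rewrite gee0_abs ?poweR_ge0//.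
have ae : {ae mu, forall x, (fine (u x))%:E = u x}.
  have := integrable_ae measurableT ip; apply: filterS => x /(_ I) h /=.
  rewrite fineK// fin_numElt (lt_le_trans _ (u0 x))//=.
  have : `|u x| < +oo.
    have pn0 : (p != 0)%R by rewrite gt_eqF.
    by apply: (lty_poweRy pn0); rewrite -ge0_fin_numE ?poweR_ge0.
  by rewrite gee0_abs.
split => //; congr (_ `^ _); apply: ge0_ae_eq_integral => //.
- apply: measurable_abse_poweR.
  by apply/measurable_EFinP; exact: measurableT_comp.
- by move=> x _; exact: poweR_ge0.
- by move=> x _; exact: poweR_ge0.
- by rewrite /ae_eq; move: ae; apply: filterS => x /= h _; rewrite -[in RHS]h.
Qed.

Lemma ge0_minkowski p u v : (1 <= p)%R -> measurable_fun setT u -> measurable_fun setT v ->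
  (forall x, 0 <= u x) -> (forall x, 0 <= v x) ->
  'N[mu]_p%:E[u \+ v] <= 'N[mu]_p%:E[u] + 'N[mu]_p%:E[v].
Proof.
move=> p1 mu_ mv u0 v0; have p0 : (0 < p)%R by exact: lt_le_trans p1.
have [uoo|uoo] := eqVneq ('N[mu]_p%:E[u]) +oo.
  by rewrite uoo addye ?leey// -ltNye (lt_le_trans _ (Lnorm_ge0 _ _ _)).
have [voo|voo] := eqVneq ('N[mu]_p%:E[v]) +oo.
  by rewrite voo addey ?leey// -ltNye (lt_le_trans _ (Lnorm_ge0 _ _ _)).
rewrite -!ltey in uoo voo.
have [<- aeu] := Lnorm_lty_fine p0 mu_ u0 uoo.
have [<- aev] := Lnorm_lty_fine p0 mv v0 voo.
have mfu : measurable_fun setT (fine \o u) by exact: measurableT_comp.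
have mfv : measurable_fun setT (fine \o v) by exact: measurableT_comp.
apply: le_trans (minkowski_EFin mu mfu mfv p1).
rewrite le_eqVlt; apply/orP; left; apply/eqP; rewrite unlock; congr (_ `^ _).
apply: ge0_ae_eq_integral => //.
- apply: measurable_abse_poweR.
  exact: emeasurable_funD.
- apply: measurable_abse_poweR.
  by apply/measurable_EFinP; exact: measurable_funD.
- by move=> x _; exact: poweR_ge0.
- by move=> x _; exact: poweR_ge0.
- by rewrite /ae_eq; move: aeu aev; apply: filterS2 => x /= h h' _; rewrite -h -h'.
Qed.

Lemma ge0_hoelder p q u (g : T -> R) : (0 < p)%R -> (0 < q)%R -> (p^-1 + q^-1 = 1)%R ->
  measurable_fun setT u -> (forall x, 0 <= u x) ->
  measurable_fun setT g -> (forall x, 0 <= g x)%R ->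
  0 < 'N[mu]_q%:E[EFin \o g] ->
  \int[mu]_x (u x * (g x)%:E) <= 'N[mu]_p%:E[u] * 'N[mu]_q%:E[EFin \o g].
Proof.
move=> p0 q0 pq mu_ u0 mg g0 Ng.
have [uoo|uoo] := eqVneq ('N[mu]_p%:E[u]) +oo; first by rewrite uoo gt0_mulye// leey.
rewrite -ltey in uoo.
have [<- aeu] := Lnorm_lty_fine p0 mu_ u0 uoo.
have mfu : measurable_fun setT (fine \o u) by exact: measurableT_comp.
apply: le_trans (hoelder mu mfu mg p0 q0 pq).
rewrite Lnorm1 le_eqVlt; apply/orP; left; apply/eqP.
apply: ge0_ae_eq_integral => //.
- by apply: emeasurable_funM => //; exact/measurable_EFinP.
- by apply: measurableT_comp => //; apply/measurable_EFinP; exact: measurable_funM.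
- by move=> x _; rewrite mule_ge0// lee_fin.
rewrite /ae_eq; move: aeu; apply: filterS => x /= h _.
by rewrite -h /= ger0_norm// mulr_ge0// fine_ge0.
Qed.

End ge0_norms.

(** * Translation invariance *)

Section translation_invariance.
Variable R : realType.
Local Open Scope ereal_scope.

Lemma lebesgue_measure_shift (a : R) (A : set (measurableTypeR R)) : measurable A ->
  pushforward (@lebesgue_measure R) (fun x : measurableTypeR R => (x - a)%R : measurableTypeR R) A
  = lebesgue_measure A.
Proof.
have msub : measurable_fun setT (fun x : measurableTypeR R => (x - a)%R : measurableTypeR R).
  exact: measurable_funB.
move=> mA; pose nu : {measure set (measurableTypeR R) -> \bar R} :=
  measure_function_pushforward__canonical__measure_function_Measure (@lebesgue_measure R) msub.
rewrite -[LHS]/(nu A); apply/esym/lebesgue_measure_unique => //= _ [[b c]] _ <-.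
rewrite /= /pushforward.
have -> : (fun x : measurableTypeR R => (x - a)%R : measurableTypeR R) @^-1` `]b, c] = `](b + a)%R, (c + a)%R]%classic.
  by apply/seteqP; split => x /=; rewrite !in_itv/= ltrBrDr lerBlDr.
rewrite !lebesgue_measure_itv/= !lte_fin ltrD2r.
by rewrite -!EFinB opprD addrACA subrr addr0.
Qed.

Lemma ge0_integral_shift (f : R -> \bar R) (a : R) :
  measurable_fun setT (f : measurableTypeR R -> \bar R) -> (forall x, 0 <= f x) ->
  \int[lebesgue_measure]_x f (x - a)%R = \int[lebesgue_measure]_x f x.
Proof.
have msub : measurable_fun setT (fun x : measurableTypeR R => (x - a)%R : measurableTypeR R).
  exact: measurable_funB.
move=> mf f0.
transitivity (\int[pushforward (@lebesgue_measure R) (fun x : measurableTypeR R => (x - a)%R : measurableTypeR R)]_x f x).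
  by rewrite (ge0_integral_pushforward msub) ?preimage_setT.
by apply: eq_measure_integral => A mA _; exact: lebesgue_measure_shift.
Qed.

Lemma ge0_integral_rVS d (f : 'rV[R]_d.+1 -> \bar R) :
  measurable_fun setT f -> (forall x, 0 <= f x) ->
  \int[lebesgue_rV]_y f y =
  \int[lebesgue_measure]_t \int[@lebesgue_rV R d]_y f (cons_rV (t, y)).
Proof.
move=> mf f0; have -> : @lebesgue_rV R d.+1 =
    pushforward (lebesgue_measure \x @lebesgue_rV R d) (@cons_rV R d) by [].
rewrite (ge0_integral_pushforward (@measurable_cons_rV R d))// preimage_setT.
rewrite fubini_tonelli1//=.
exact: (measurableT_comp mf (@measurable_cons_rV R d)).
Qed.

Lemma cons_rV_sub d (z : measurableTypeR R * 'rV[R]_d) (w : 'rV[R]_d.+1) :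
  (cons_rV z - w)%R = cons_rV ((z.1 - w ord0 ord0)%R, (z.2 - (uncons_rV w).2)%R).
Proof.
apply/rowP => i; rewrite mxE; case: (unliftP ord0 i) => [j|] ->.
  by rewrite !cons_rVS !mxE.
by rewrite !cons_rV0 !mxE.
Qed.

Lemma ge0_integral_rV_shift d (f : 'rV[R]_d -> \bar R) (w : 'rV[R]_d) :
  measurable_fun setT f -> (forall x, 0 <= f x) ->
  \int[lebesgue_rV]_y f (y - w)%R = \int[lebesgue_rV]_y f y.
Proof.
elim: d f w => [|d IH] f w mf f0.
  by apply: eq_integral => y _; congr f; apply/rowP => -[].
have mc := @measurable_cons_rV R d.
have mfw := measurableT_comp mf (measurable_rV_sub w).
apply: etrans (ge0_integral_rVS mfw (fun y => f0 (y - w)%R)) _.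
apply: etrans (esym (ge0_integral_rVS mf f0)).
transitivity (\int[lebesgue_measure]_t (fun u => \int[@lebesgue_rV R d]_y f (cons_rV (u, y))) (t - w ord0 ord0)%R).
  apply: eq_integral => t _ /=.
  transitivity (\int[@lebesgue_rV R d]_y (fun y' => f (cons_rV ((t - w ord0 ord0)%R, y'))) (y - (uncons_rV w).2)%R).
    by apply: eq_integral => y _; rewrite cons_rV_sub.
  apply: IH => // ; apply: (measurableT_comp mf); apply: (measurableT_comp mc).
  exact: measurable_fun_pair.
rewrite (@ge0_integral_shift (fun u => \int[@lebesgue_rV R d]_y f (cons_rV (u, y))))//.
  apply: (@measurable_fun_fubini_tonelli_F _ _ _ _ _ (@lebesgue_rV R d) (fun z => f (cons_rV z))) => //.
  exact: measurableT_comp.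
by move=> u; exact: integral_ge0.
Qed.

End translation_invariance.

(** * The mixed norm as an iterated norm *)

Section mixed_norms.
Variables (R : realType) (d : nat).
Local Notation plane := (measurableTypeR R * 'rV[R]_d)%type.
Implicit Types (F G : plane -> R) (p q : R).
Local Open Scope ereal_scope.

Definition slice_norm q F (x : measurableTypeR R) : \bar R :=
  'N[@lebesgue_rV R d]_q%:E[EFin \o (fun y => F (x, y))].

(** Two nested norms, so that one-variable inequalities can be applied in each variable; on moduli
    it is [mixed_norm], by [mixed_normE]. *)
Definition ge0_mixed_norm p q F : \bar R := 'N[lebesgue_measure]_p%:E[slice_norm q F].

Lemma slice_norm_ge0 q F x : 0 <= slice_norm q F x.
Proof. exact: Lnorm_ge0. Qed.

Lemma measurable_slice F x : measurable_fun setT F -> measurable_fun setT (fun y => F (x, y)).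
Proof. by move=> mF; apply: (measurableT_comp mF); exact: measurable_fun_pair. Qed.

Lemma slice_normE q F x : (forall z, 0 <= F z)%R ->
  slice_norm q F x = (\int[@lebesgue_rV R d]_y (F (x, y) `^ q)%:E) `^ q^-1.
Proof.
move=> F0; rewrite /slice_norm Lnorm.unlock /=; apply: (congr1 (fun t => poweR t q^-1%R)).
by apply: eq_integral => y _; rewrite /= ger0_norm.
Qed.

Lemma measurable_slice_norm q F : measurable_fun setT F -> (forall z, 0 <= F z)%R ->
  measurable_fun setT (slice_norm q F).
Proof.
move=> mF F0; rewrite (_ : slice_norm q F = fun x => (\int[@lebesgue_rV R d]_y (F (x, y) `^ q)%:E) `^ q^-1); last first.
  by apply/funext => x; rewrite slice_normE.
apply: (measurableT_comp (measurable_poweR _)).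
apply: (@measurable_fun_fubini_tonelli_F _ _ _ _ _ (@lebesgue_rV R d) (fun z => (F z `^ q)%:E)).
  by apply/measurable_EFinP; exact: (measurableT_comp (measurable_powR _)).
by move=> z; rewrite lee_fin powR_ge0.
Qed.

Lemma le_ge0_mixed_norm p q F G : (0 < p)%R -> (0 < q)%R ->
  measurable_fun setT F -> measurable_fun setT G -> (forall z, 0 <= F z <= G z)%R ->
  ge0_mixed_norm p q F <= ge0_mixed_norm p q G.
Proof.
move=> p0 q0 mF mG FG.
have F0 z : (0 <= F z)%R by have /andP[] := FG z.
have G0 z : (0 <= G z)%R by have /andP[] := FG z; exact: le_trans.
apply: le_Lnorm_ge0 => //; [exact: measurable_slice_norm|exact: measurable_slice_norm|exact: slice_norm_ge0|].
move=> x; apply: le_Lnorm_ge0 => //.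
- by apply/measurable_EFinP; exact: measurable_slice.
- by apply/measurable_EFinP; exact: measurable_slice.
- by move=> y; rewrite lee_fin.
- by move=> y; rewrite lee_fin; have /andP[] := FG (x, y).
Qed.

Lemma ge0_mixed_normD p q F G : (1 <= p)%R -> (1 <= q)%R ->
  measurable_fun setT F -> measurable_fun setT G ->
  (forall z, 0 <= F z)%R -> (forall z, 0 <= G z)%R ->
  ge0_mixed_norm p q (fun z => F z + G z)%R <= ge0_mixed_norm p q F + ge0_mixed_norm p q G.
Proof.
move=> p1 q1 mF mG F0 G0.
have mS := measurable_slice_norm q mF F0; have mS' := measurable_slice_norm q mG G0.
apply: le_trans (ge0_minkowski _ p1 mS mS' (slice_norm_ge0 q F) (slice_norm_ge0 q G)).
apply: le_Lnorm_ge0 => //; first by exact: lt_le_trans p1.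
- apply: measurable_slice_norm; first exact: measurable_funD.
  by move=> z; rewrite addr_ge0.
- exact: emeasurable_funD.
- exact: slice_norm_ge0.
move=> x; apply: minkowski_EFin => //; exact: measurable_slice.
Qed.

Lemma ge0_mixed_normZ p q F (k : R) : (0 < p)%R -> (0 < q)%R ->
  measurable_fun setT F -> (forall z, 0 <= F z)%R -> (0 <= k)%R ->
  ge0_mixed_norm p q (fun z => k * F z)%R = k%:E * ge0_mixed_norm p q F.
Proof.
move=> p0 q0 mF F0 k0.
have H d' (T : measurableType d') (mu : {measure set T -> \bar R}) (r : R) (u : T -> \bar R) :
    (0 < r)%R -> measurable_fun setT u -> (forall x, 0 <= u x) ->
    Lnorm mu r%:E (fun x => k%:E * u x) = k%:E * 'N[mu]_r%:E[u].
  move=> r0 mu_ u0; rewrite unlock.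
  transitivity ((\int[mu]_x ((k `^ r)%:E * `|u x| `^ r)) `^ r^-1).
    congr (_ `^ _); apply: eq_integral => x _.
    by rewrite !gee0_abs ?mule_ge0 ?lee_fin// poweRM ?lee_fin// poweR_EFin.
  rewrite ge0_integralZl//; last 3 first.
  - exact: measurable_abse_poweR.
  - by move=> x _; exact: poweR_ge0.
  - by rewrite lee_fin powR_ge0.
  rewrite poweRM ?lee_fin ?powR_ge0//; last by apply: integral_ge0 => x _; exact: poweR_ge0.
  by rewrite poweR_EFin -powRrM mulfV ?gt_eqF// powRr1.
rewrite /ge0_mixed_norm -H//; last 2 first.
- exact: measurable_slice_norm.
- exact: slice_norm_ge0.
apply: eq_Lnorm => x; rewrite /slice_norm -H//.
- by apply/measurable_EFinP; exact: measurable_slice.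
- by move=> y; rewrite lee_fin.
Qed.

Lemma ge0_mixed_norm_shift p q F (w : plane) : measurable_fun setT F -> (forall z, 0 <= F z)%R ->
  ge0_mixed_norm p q (fun z => F (z - w)%R) = ge0_mixed_norm p q F.
Proof.
move=> mF F0.
have sliceE x : slice_norm q (fun z => F (z - w)%R) x = slice_norm q F (x - w.1)%R.
  rewrite /slice_norm Lnorm.unlock /=; apply: (congr1 (fun t => poweR t q^-1%R)).
  pose f y := `|(F ((x - w.1)%R, y))%:E| `^ q.
  have mf : measurable_fun setT f.
    by apply: measurable_abse_poweR; apply/measurable_EFinP; exact: measurable_slice.
  exact: etrans (ge0_integral_rV_shift w.2 mf (fun y => poweR_ge0 _ _)).
rewrite /ge0_mixed_norm (_ : slice_norm q _ = fun x => slice_norm q F (x - w.1)%R); last exact/funext.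
rewrite Lnorm.unlock /=; apply: (congr1 (fun t => poweR t p^-1%R)).
have mf : measurable_fun setT (fun x => `|slice_norm q F x| `^ p).
  by apply: measurable_abse_poweR; exact: measurable_slice_norm.
exact: etrans (ge0_integral_shift w.1 mf (fun y => poweR_ge0 _ _)).
Qed.

Lemma Lnorm_box_hoelder d' (T : measurableType d') (mu : {measure set T -> \bar R}) (A : set T)
    p (u : T -> \bar R) (b : T -> R) (C : R) : (1 < p)%R -> measurable A ->
  measurable_fun setT u -> (forall x, 0 <= u x) ->
  measurable_fun setT b -> (forall x, 0 <= b x)%R -> (0 < C)%R ->
  \int[mu]_(x in A) (b x `^ (p / (p - 1)))%:E <= C%:E ->
  \int[mu]_(x in A) (u x * (b x)%:E) <= 'N[mu]_p%:E[u] * (C `^ ((p - 1) / p))%:E.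
Proof.
move=> p1 mA mu_ u0 mb b0 C0 bC; pose p' := (p / (p - 1))%R.
have p0 : (0 < p)%R by exact: lt_trans p1.
have p'0 : (0 < p')%R by rewrite divr_gt0 ?subr_gt0.
pose g x := (b x * \1_A x)%R.
have mg : measurable_fun setT g by apply: measurable_funM => //; exact: measurable_indic.
have g0 x : (0 <= g x)%R by rewrite mulr_ge0.
have gN : 'N[mu]_p'%:E[EFin \o g] <= (C `^ ((p - 1) / p))%:E.
  rewrite unlock -poweR_EFin invf_div; apply: gt0_ler_poweR.
  - by rewrite divr_ge0 ?subr_ge0 ?ltW.
  - by rewrite in_itv/= leey integral_ge0// => x _; exact: poweR_ge0.
  - by rewrite in_itv/= leey lee_fin ltW.
  apply: le_trans bC; rewrite [leRHS]integral_mkcond le_eqVlt; apply/orP; left; apply/eqP.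
  apply: eq_integral => x _; rewrite /patch /g /= indicE; case: ifPn => xA.
    by rewrite mulr1 ger0_norm.
  by rewrite mulr0 normr0 powR0// gt_eqF.
have -> : \int[mu]_(x in A) (u x * (b x)%:E) = \int[mu]_x (u x * (g x)%:E).
  rewrite integral_mkcond; apply: eq_integral => x _; rewrite /patch /g indicE.
  by case: ifPn => xA; rewrite ?mulr1// mulr0 mule0.
(* A vanishing dual norm is set apart because the norm of [u] may be infinite; then [b] vanishes
   almost everywhere on [A] and so does the integrand. *)
have [N0|N0] := eqVneq ('N[mu]_p'%:E[EFin \o g]) 0; last first.
  apply: (@le_trans _ _ ('N[mu]_p%:E[u] * 'N[mu]_p'%:E[EFin \o g])).
    apply: ge0_hoelder => //; last by rewrite lt0e N0 Lnorm_ge0.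
    by rewrite /p' invf_div -{1}[p^-1%R]mul1r -mulrDl addrC subrK mulfV// gt_eqF.
  by rewrite lee_wpmul2l// Lnorm_ge0.
have ae0 := @Lnorm_eq0_eq0 _ _ _ mu (EFin \o g) p'%:E (proj2 (measurable_EFinP _ _) mg) p'0 N0.
apply: le_trans (_ : 0 <= _); last by rewrite mule_ge0 ?Lnorm_ge0// lee_fin powR_ge0.
rewrite le_eqVlt; apply/orP; left; apply/eqP.
rewrite -[RHS](integral0 mu setT); apply: ge0_ae_eq_integral => //.
- by apply: emeasurable_funM => //; exact/measurable_EFinP.
- by move=> x _; rewrite mule_ge0// lee_fin.
rewrite /ae_eq; move: ae0; apply: filterS => x /(_ I) /= -> _.
by rewrite mule0.
Qed.

End mixed_norms.

(** * Integrals over the box *)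

Section boxes.
Variables (R : realType) (d : nat) (K1 K2 : R).
Local Notation plane := (measurableTypeR R * 'rV[R]_d)%type.
Local Notation CK := (box K1 K2 : set plane).
Local Open Scope ereal_scope.

Lemma boxE : CK = sym_itv K1 `*` rV_box K2.
Proof.
by apply/seteqP; split => -[x y] /= [h1 h2]; split => //=; move: h1; rewrite /sym_itv/= in_itv.
Qed.

Lemma measurable_box : measurable CK.
Proof.
by rewrite boxE; apply: measurableX; [exact: measurable_sym_itv|exact: measurable_rV_box].
Qed.

Lemma integral_box (g : plane -> \bar R) : measurable_fun setT g -> (forall z, 0 <= g z) ->
  \int[@lebesgue_plane R d]_(z in CK) g z =
  \int[lebesgue_measure]_(x in sym_itv K1) \int[@lebesgue_rV R d]_(y in rV_box K2) g (x, y).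
Proof.
move=> mg g0; have mC := measurable_box.
have mr : measurable_fun setT (g \_ CK).
  by apply/(measurable_restrictT _ mC); exact: measurable_funTS.
have r0 z : 0 <= (g \_ CK) z by rewrite /patch; case: ifPn.
rewrite [LHS]integral_mkcond [RHS]integral_mkcond.
apply: etrans (@fubini_tonelli1 _ _ _ _ R lebesgue_measure (@lebesgue_rV R d) _ mr r0) _.
apply: eq_integral => x _; rewrite /fubini_F /patch.
case: ifPn => [xK|xK].
  rewrite [RHS]integral_mkcond.
  apply: eq_integral => y _; rewrite /patch boxE in_setX /= xK /=.
  by [].
apply: integral0_eq => y _ /=; rewrite boxE in_setX /= (negbTE xK).
by [].
Qed.

Hypotheses (K10 : (0 < K1)%R) (K20 : (0 < K2)%R).

(** Hoelder in [y] against the weight [b], then in [x] against the constant [1], whose dual norm on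
    the interval is the power of [2 * K1]. *)
Lemma box_hoelder (p q C : R) (F : plane -> R) (b : 'rV[R]_d -> R) :
  (1 < p)%R -> (1 < q)%R -> (0 < C)%R ->
  measurable_fun setT F -> (forall z, 0 <= F z)%R ->
  measurable_fun setT b -> (forall y, 0 <= b y)%R ->
  \int[@lebesgue_rV R d]_(y in rV_box K2) (b y `^ (q / (q - 1)))%:E <= C%:E ->
  \int[@lebesgue_plane R d]_(z in CK) (F z * b z.2)%:E <=
    ge0_mixed_norm p q F * ((2 * K1) `^ ((p - 1) / p) * C `^ ((q - 1) / q))%:E.
Proof.
move=> p1 q1 C0 mF F0 mb b0 bC.
have mFb : measurable_fun setT (fun z : plane => (F z * b z.2)%:E).
  by apply/measurable_EFinP; apply: measurable_funM => //; exact: (measurableT_comp mb).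
have Fb0 (z : plane) : 0 <= (F z * b z.2)%:E by rewrite lee_fin mulr_ge0.
apply: (le_trans (_ : _ <= _)); first by rewrite (integral_box mFb Fb0); exact: lexx.
have mI := measurable_sym_itv K1.
set k := (C `^ ((q - 1) / q))%R.
have k0 : (0 <= k)%R by exact: powR_ge0.
have mS := measurable_slice_norm q mF F0.
apply: (@le_trans _ _ (\int[lebesgue_measure]_(x in sym_itv K1) (k%:E * slice_norm q F x))).
  apply: ge0_le_integral => //.
  - by move=> x _; apply: integral_ge0 => y _; exact: Fb0.
  - apply: measurable_funTS.
    have mb1 : measurable_fun setT (fun z : plane => (F z * b z.2 * \1_(rV_box K2) z.2)%:E).
      apply/measurable_EFinP; apply: measurable_funM; first exact/measurable_EFinP.
      have mi : measurable_fun setT (\1_(rV_box K2) : 'rV[R]_d -> R).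
        by apply: measurable_indic; exact: measurable_rV_box.
      exact: (measurableT_comp mi measurable_snd).
    have b10 (z : plane) : 0 <= (F z * b z.2 * \1_(rV_box K2) z.2)%:E.
      by rewrite lee_fin !mulr_ge0.
    have := @measurable_fun_fubini_tonelli_F _ _ _ _ R (@lebesgue_rV R d) _ mb1 b10.
    congr measurable_fun; apply/funext => x; rewrite [RHS]integral_mkcond.
    apply: eq_integral => y _; rewrite /patch indicE/=.
    by case: ifPn => _; rewrite ?mulr1 ?mulr0.
  - by apply: measurable_funTS; exact: emeasurable_funM.
  move=> x _; rewrite muleC; apply: le_trans (Lnorm_box_hoelder q1 _ _ _ mb b0 C0 bC).
  - by rewrite le_eqVlt; apply/orP; left; apply/eqP; apply: eq_integral => y _; rewrite EFinM.
  - exact: measurable_rV_box.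
  - by apply/measurable_EFinP; exact: measurable_slice.
  - by move=> y; rewrite lee_fin.
rewrite ge0_integralZl//; last 2 first.
- exact: measurable_funTS.
- by move=> x _; exact: slice_norm_ge0.
rewrite [in leRHS]mulrC EFinM muleA muleAC muleC lee_wpmul2r ?lee_fin//.
apply: le_trans (Lnorm_box_hoelder (b := fun=> 1%R) p1 mI mS (slice_norm_ge0 q F) _ _ _ _).
- by rewrite le_eqVlt; apply/orP; left; apply/eqP; apply: eq_integral => x _; rewrite mule1.
- exact: measurable_cst.
- by [].
- by rewrite mulr_gt0.
under eq_integral do rewrite powR1.
rewrite integral_cst// mul1e le_eqVlt; apply/orP; left; apply/eqP.
exact: lebesgue_sym_itv.
Qed.

End boxes.

Section finite_hoelder.
Variable R : realType.
Implicit Types (p q : R).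

(** Young's inequality for the terms divided by their norms; a vanishing norm forces all terms to
    vanish. *)
Lemma sum_hoelder (I : finType) (u v : I -> R) p : 1 < p ->
  (forall i, 0 <= u i) -> (forall i, 0 <= v i) ->
  \sum_i u i * v i <= (\sum_i u i `^ p) `^ p^-1 *
    (\sum_i v i `^ (p / (p - 1))) `^ ((p - 1) / p).
Proof.
move=> p1 u0 v0; have p0 : 0 < p by apply: lt_trans p1.
set p' := p / (p - 1); have p'0 : 0 < p' by rewrite divr_gt0 ?subr_gt0.
have -> : (p - 1) / p = p'^-1 by rewrite /p' invf_div.
have pp : p^-1 + p'^-1 = 1.
  by rewrite /p' invf_div -{1}[p^-1]mul1r -mulrDl addrC subrK mulfV// gt_eqF.
have vanish (w : I -> R) (r : R) : 0 < r -> (forall i, 0 <= w i) -> \sum_i w i `^ r = 0 -> forall i, w i = 0.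
  move=> r0 w0 h i; have : w i `^ r = 0 by exact: (psumr_eq0P (fun i _ => powR_ge0 (w i) r) h).
  exact: powR_eq0_eq0.
set A := \sum_i u i `^ p; set B := \sum_i v i `^ p'.
have A0 : 0 <= A by apply: sumr_ge0 => i _; exact: powR_ge0.
have B0 : 0 <= B by apply: sumr_ge0 => i _; exact: powR_ge0.
have [/vanish uz|An] := eqVneq A 0.
  rewrite big1 ?mulr_ge0 ?powR_ge0// => i _.
  by rewrite uz// mul0r.
have [/vanish vz|Bn] := eqVneq B 0.
  rewrite big1 ?mulr_ge0 ?powR_ge0// => i _.
  by rewrite vz// mulr0.
have root (r C : R) : 0 < r -> 0 <= C -> C != 0 -> exists al, [/\ al = C `^ r^-1, 0 < al & al `^ r = C].
  move=> r0 C0 Cn; exists (C `^ r^-1); split => //; first by rewrite powR_gt0// lt0r Cn.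
  by rewrite -powRrM mulVf ?gt_eqF// powRr1.
have [al [<- al0 alE]] := root p A p0 A0 An.
have [be [<- be0 beE]] := root p' B p'0 B0 Bn.
have scale (r C x ga : R) : 0 < ga -> ga `^ r = C -> 0 <= x -> (x / ga) `^ r = x `^ r / C.
  move=> ga0 <- x0; apply: (mulIf (lt0r_neq0 (powR_gt0 r ga0))).
  rewrite -powRM ?divr_ge0 ?(ltW ga0)// divfK ?gt_eqF// divfK// gt_eqF// powR_gt0//.
have key i : u i * v i <= al * be * (p^-1 * (u i `^ p / A) + p'^-1 * (v i `^ p' / B)).
  have -> : u i * v i = al * be * ((u i / al) * (v i / be)).
    by field; rewrite !gt_eqF.
  rewrite ler_wpM2l ?mulr_ge0 ?(ltW al0) ?(ltW be0)//.
  have ua : 0 <= u i / al by rewrite divr_ge0 ?(ltW al0).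
  have vb : 0 <= v i / be by rewrite divr_ge0 ?(ltW be0).
  apply: le_trans (conjugate_powR ua vb p0 p'0 pp) _.
  by rewrite (scale _ _ _ _ al0 alE (u0 i)) (scale _ _ _ _ be0 beE (v0 i)) (mulrC p^-1) (mulrC p'^-1).
apply: (le_trans (ler_sum _ (fun i _ => key i))).
rewrite -mulr_sumr big_split/= -!mulr_sumr -!mulr_suml !mulfV// !mulr1 pp mulr1.
exact: lexx.
Qed.

Lemma mixed_sum_hoelder (I1 I2 : finType) (c : I1 -> I2 -> R) (a : I1 -> R) (b : I2 -> R) p q :
  1 < p -> 1 < q -> (forall i j, 0 <= c i j) -> (forall i, 0 <= a i) -> (forall j, 0 <= b j) ->
  \sum_i \sum_j c i j * (a i * b j) <=
    (\sum_i (\sum_j c i j `^ q) `^ (p / q)) `^ p^-1 *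
    ((\sum_i a i `^ (p / (p - 1))) `^ ((p - 1) / p) *
     (\sum_j b j `^ (q / (q - 1))) `^ ((q - 1) / q)).
Proof.
move=> p1 q1 c0 a0 b0.
set Bn := (\sum_j b j `^ _) `^ _; have Bn0 : 0 <= Bn by exact: powR_ge0.
pose n i := (\sum_j c i j `^ q) `^ q^-1.
apply: (@le_trans _ _ (\sum_i n i * a i * Bn)).
  apply: ler_sum => i _; rewrite (mulrAC (n i)) -[leRHS]mulrC.
  rewrite (eq_bigr (fun j => a i * (c i j * b j))); last by move=> j _; rewrite mulrCA.
  by rewrite -mulr_sumr ler_wpM2l// sum_hoelder.
rewrite -mulr_suml mulrA ler_wpM2r//.
apply: le_trans (sum_hoelder p1 (fun i => powR_ge0 _ _) a0) _.
apply: ler_wpM2r; first exact: powR_ge0.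
rewrite le_eqVlt; apply/orP; left; apply/eqP; apply: (congr1 (fun t => t `^ p^-1)).
by apply: eq_bigr => i _; rewrite -powRrM mulrC.
Qed.

Lemma le_mixed_sum (I1 I2 : finType) (c : I1 -> I2 -> R) p q i j :
  0 < p -> 0 < q -> (forall i j, 0 <= c i j) ->
  c i j <= (\sum_i (\sum_j c i j `^ q) `^ (p / q)) `^ p^-1.
Proof.
move=> p0 q0 c0.
have le_one (I : finType) (w : I -> R) (r : R) k : 0 < r -> (forall i, 0 <= w i) -> w k <= (\sum_i w i `^ r) `^ r^-1.
  move=> r0 w0; rewrite -[leLHS](powRr1 (w0 k)) -(mulfV (lt0r_neq0 r0)) powRrM.
  rewrite ge0_ler_powR ?invr_ge0 ?(ltW r0)// ?nnegrE ?powR_ge0//.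
    by apply: sumr_ge0 => l _; exact: powR_ge0.
  by rewrite (bigD1 k)//= lerDl sumr_ge0// => l _; exact: powR_ge0.
apply: le_trans (le_one _ (c i) q j q0 (c0 i)) _.
apply: le_trans (le_one _ (fun i => (\sum_j c i j `^ q) `^ q^-1) p i p0 _) _.
  by move=> k; exact: powR_ge0.
rewrite le_eqVlt; apply/orP; left; apply/eqP; apply: (congr1 (fun t => t `^ p^-1)).
by apply: eq_bigr => k _; rewrite -powRrM mulrC.
Qed.

End finite_hoelder.

(** * Finitely supported coefficients and their combinations *)

Section finite_families.
Variable R : realType.
Variables (I : finType) (T : choiceType) (e : I -> T).
Hypothesis ie : injective e.

Lemma esum_range (u : T -> \bar R) : (forall t, (0 <= u t)%E) ->
  (forall t, ~ range e t -> u t = 0%E) ->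
  (\esum_(t in [set: T]) u t = \sum_i u (e i))%E.
Proof.
move=> u0 uz.
transitivity (\esum_(t in range e) u t)%E.
  rewrite [RHS]esum_mkcond; apply: eq_esum => t _.
  by case: ifPn => // /negP; rewrite inE => /uz.
rewrite esum_fset//; last by apply: finite_image; exact: finite_finset.
by rewrite fsbig_range.
Qed.

Lemma family_sum_range (u : T -> R) : (forall t, ~ range e t -> u t = 0) ->
  family_sum u = \sum_i u (e i).
Proof.
move=> uz; rewrite /family_sum !esum_range; last 4 first.
- by move=> t; rewrite lee_fin le_max lexx orbT.
- by move=> t /uz ->; rewrite oppr0 maxxx.
- by move=> t; rewrite lee_fin le_max lexx orbT.
- by move=> t /uz ->; rewrite maxxx.
rewrite !sumEFin/= -sumrB; apply: eq_bigr => i _.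
case: (leP (u (e i)) 0) => h.
  by rewrite max_l ?oppr_ge0// sub0r opprK.
by rewrite max_r ?subr0// oppr_le0 ltW.
Qed.

Lemma cfamily_sum_range (u : T -> R[i]) : (forall t, ~ range e t -> u t = 0) ->
  cfamily_sum u = \sum_i u (e i).
Proof.
move=> uz; rewrite /cfamily_sum !family_sum_range; last 2 first.
- by move=> t /uz ->.
- by move=> t /uz ->.
by apply/eqP; rewrite eq_complex /= !raddf_sum/= !eqxx.
Qed.

End finite_families.

Section complex_modulus.
Variable R : realType.
Implicit Types z w : R[i].

Lemma normc_ge0 z : 0 <= normc z.
Proof. by case: z => a b; exact: sqrtr_ge0. Qed.

Lemma normc_Re z : `|complex.Re z| <= normc z.
Proof.
case: z => a b /=; rewrite -sqrtr_sqr ler_sqrt ?addr_ge0 ?sqr_ge0//.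
by rewrite lerDl sqr_ge0.
Qed.

Lemma normc_Im z : `|complex.Im z| <= normc z.
Proof.
case: z => a b /=; rewrite -sqrtr_sqr ler_sqrt ?addr_ge0 ?sqr_ge0//.
by rewrite lerDr sqr_ge0.
Qed.

Lemma normc_real (t : R) : normc (Complex t 0) = `|t|.
Proof. by rewrite /normc expr0n addr0 sqrtr_sqr. Qed.

Lemma le_normc_sum (I : finType) (F : I -> R[i]) : normc (\sum_i F i) <= \sum_i normc (F i).
Proof.
elim/big_ind2: _ => [|a a' b b' h h'|//]; first by rewrite normc0.
by apply: le_trans (le_normcD _ _) _; exact: lerD.
Qed.

End complex_modulus.

Section shift_combinations.
Variables (R : realType) (d r N : nat).
Local Notation plane := (measurableTypeR R * 'rV[R]_d)%type.
Local Notation lattice := (int * 'rV[int]_d)%type.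

Definition lat_index := ('I_(N.*2.+1) * {ffun 'I_d -> 'I_(N.*2.+1)})%type.
Definition lat (j : lat_index) : lattice := (int_point j.1, int_box j.2).
(** The boolean selects real or imaginary parts: nets live in a real vector space, here of dimension
    [2 r (2N+1)^(d+1)]. *)
Definition coef_index := ('I_r * lat_index * bool)%type.
Local Notation vec := {ffun coef_index -> R}.

Definition coef (a : vec) (i : 'I_r) (j : lat_index) : R[i] :=
  Complex (a (i, j, true)) (a (i, j, false)).

Lemma lat_inj : injective lat.
Proof. by move=> [n k] [n' k'] [] /int_point_inj -> /int_box_inj ->. Qed.

Lemma range_lat : range lat = lattice_ball R N.
Proof.
have absE (z : int) : (`|z%:~R| <= N%:R :> R) = (`|z| <= N)%N.
  by rewrite -intr_norm -[N%:R]/(N%:Z%:~R) ler_int -abszE lez_nat.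
have rVE (v : 'rV[int]_d) : (`|map_mx intr v : 'rV[R]_d| <= N%:R) = [forall i, (`|v ord0 i| <= N)%N].
  by rewrite rV_norm_le//; apply: eq_forallb => i; rewrite mxE absE.
apply/seteqP; split => [_ [[n k] _ <-]|[z v]] /=.
  rewrite /lattice_point /lattice_ball/= absE rVE; split.
    by rewrite /int_point; have := ltn_ord n; lia.
  by apply/forallP => i; rewrite /int_box mxE /int_point; have := ltn_ord (k i); lia.
rewrite /lattice_ball/= absE rVE => -[/int_pointP[n nE] /forallP/int_boxP[k kE]].
by exists (n, k); rewrite // /lat/= nE kE.
Qed.

Variable Phi : 'I_r -> R * 'rV[R]_d -> R[i].

Definition combination (a : vec) (z : R * 'rV[R]_d) : R[i] :=
  \sum_(i < r) \sum_j coef a i j * Phi i (z - lattice_point R (lat j)).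

Lemma coefD a b i j : coef (a + b) i j = coef a i j + coef b i j.
Proof. by rewrite /coef !ffunE. Qed.

Lemma coefZ t a i j : coef (t *: a) i j = Complex t 0 * coef a i j.
Proof. by rewrite /coef !ffunE; simpc. Qed.

Lemma combinationD a b z : combination (a + b) z = combination a z + combination b z.
Proof.
rewrite -big_split/=; apply: eq_bigr => i _; rewrite -big_split/=; apply: eq_bigr => j _.
by rewrite coefD mulrDl.
Qed.

Lemma combinationZ t a z : combination (t *: a) z = Complex t 0 * combination a z.
Proof.
rewrite mulr_sumr; apply: eq_bigr => i _; rewrite mulr_sumr; apply: eq_bigr => j _.
by rewrite coefZ mulrA.
Qed.

Lemma shift_space_combination f :
  shift_space N Phi f <-> exists a, f = combination a.
Proof.
split=> [[c ->]|[a ->]].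
  exists [ffun k => if k.2 then complex.Re (c k.1.1 (lat k.1.2)) else complex.Im (c k.1.1 (lat k.1.2))].
  apply/funext => z; apply: eq_bigr => i _; rewrite -range_lat fsbig_range; last exact: lat_inj.
  by apply: eq_bigr => j _; rewrite /coef !ffunE/=; case: (c i (lat j)).
exists (fun i k => \sum_(j | lat j == k) coef a i j).
apply/funext => z; apply: eq_bigr => i _; rewrite -range_lat fsbig_range; last exact: lat_inj.
by apply: eq_bigr => j _; rewrite (big_pred1 j)// => j'; rewrite (inj_eq lat_inj).
Qed.

(** Extension by zero to the whole lattice; the sum over preimages avoids choosing an inverse of
    [lat]. *)
Definition coef_seq a i (k : lattice) : R[i] := \sum_(j | lat j == k) coef a i j.

Lemma coef_seq_lat a i j : coef_seq a i (lat j) = coef a i j.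
Proof. by rewrite /coef_seq (big_pred1 j)// => j'; rewrite (inj_eq lat_inj). Qed.

Lemma coef_seq_out a i k : ~ range lat k -> coef_seq a i k = 0.
Proof.
move=> nk; rewrite /coef_seq big1// => j /eqP jk.
by exfalso; apply: nk; exists j.
Qed.

Lemma shift_series_combination a : shift_series Phi (coef_seq a) = combination a.
Proof.
apply/funext => z; rewrite /shift_series (cfamily_sum_range lat_inj); last first.
  by move=> k /coef_seq_out h; rewrite big1// => i _; rewrite h mul0r.
rewrite /combination exchange_big/=; apply: eq_bigr => i _; apply: eq_bigr => j _.
by rewrite coef_seq_lat.
Qed.

Definition coef_norm p q (a : vec) (i : 'I_r) : R :=
  (\sum_n (\sum_k normc (coef a i (n, k)) `^ q) `^ (p / q)) `^ p^-1.

Lemma seq_norm_coef p q a i : 0 < p -> 0 < q ->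
  seq_norm p q (coef_seq a i) = (coef_norm p q a i)%:E.
Proof.
move=> p0 q0; rewrite /seq_norm /coef_norm.
have inner (k1 : int) : (\esum_(k2 in [set: 'rV[int]_d]) (normc (coef_seq a i (k1, k2)) `^ q)%:E =
    \sum_(k : {ffun 'I_d -> 'I_(N.*2.+1)}) (normc (coef_seq a i (k1, int_box k)) `^ q)%:E)%E.
  apply: (esum_range (@int_box_inj d N) (u := fun k2 => (normc (coef_seq a i (k1, k2)) `^ q)%:E)).
    by move=> k2; rewrite lee_fin powR_ge0.
  move=> k2 nk; rewrite coef_seq_out ?normc0 ?powR0 ?gt_eqF//.
  by move=> [[n k] _ [_ kE]]; apply: nk; exists k.
under eq_esum do rewrite inner.
rewrite (esum_range (@int_point_inj N)).
- under eq_bigr => n _.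
    rewrite sumEFin poweR_EFin.
    under eq_bigr do rewrite -/(lat (n, _)) coef_seq_lat.
    over.
  by rewrite sumEFin poweR_EFin.
- by move=> k1; exact: poweR_ge0.
- move=> k1 nk; rewrite big1 ?poweR0r ?mulf_neq0 ?invr_eq0 ?gt_eqF// => k _.
  rewrite coef_seq_out ?normc0 ?powR0 ?gt_eqF//.
  by move=> [[n k'] _ [nE _]]; apply: nk; exists n.
Qed.

Lemma coef_norm_ge0 p q a i : 0 <= coef_norm p q a i.
Proof. exact: powR_ge0. Qed.

Lemma vseq_norm_coef p q a : 0 < p -> 0 < q ->
  vseq_norm p q (coef_seq a) = (\sum_i coef_norm p q a i)%:E.
Proof.
by move=> p0 q0; rewrite /vseq_norm -sumEFin; apply: eq_bigr => i _; exact: seq_norm_coef.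
Qed.

Lemma le_coef_norm p q (a : vec) k : 0 < p -> 0 < q -> `|a k| <= \sum_i coef_norm p q a i.
Proof.
move=> p0 q0; case: k => -[i [n k]] b.
apply: (@le_trans _ _ (coef_norm p q a i)); last first.
  by rewrite (bigD1 i)//= lerDl sumr_ge0// => i' _; exact: coef_norm_ge0.
apply: (@le_trans _ _ (normc (coef a i (n, k)))).
  by case: b; [exact: (normc_Re (coef a i (n, k)))|exact: (normc_Im (coef a i (n, k)))].
exact: (le_mixed_sum (c := fun n k => normc (coef a i (n, k))) n k p0 q0 (fun _ _ => normc_ge0 _)).
Qed.

End shift_combinations.

Section complex_measurability.
Variables (R : realType) (d : nat).
Local Notation plane := (measurableTypeR R * 'rV[R]_d)%type.
Implicit Types f g : R * 'rV[R]_d -> R[i].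

Lemma measurable_plane_sub (w : plane) : measurable_fun setT (fun z : plane => z - w : plane).
Proof.
apply: measurable_fun_pair.
  by apply: measurable_funB => //; exact: measurable_fst.
exact: (measurableT_comp (measurable_rV_sub w.2) measurable_snd).
Qed.

Lemma measurable_plane_rsub (z : plane) : measurable_fun setT (fun w : plane => z - w : plane).
Proof.
apply: measurable_fun_pair.
  by apply: measurable_funB => //; exact: measurable_fst.
apply: measurable_fun_rV => i.
under [X in measurable_fun _ X]eq_fun do rewrite !mxE.
apply: measurable_funB => //; exact: (measurableT_comp (measurable_coord i) measurable_snd).
Qed.

Lemma measurable_plane_diff : measurable_fun setT (fun u : plane * plane => u.1 - u.2 : plane).
Proof.
apply: measurable_fun_pair.
  apply: measurable_funB.
    exact: (measurableT_comp measurable_fst measurable_fst).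
  exact: (measurableT_comp measurable_fst measurable_snd).
apply: measurable_fun_rV => i.
under [X in measurable_fun _ X]eq_fun do rewrite !mxE.
apply: measurable_funB.
  exact: (measurableT_comp (measurable_coord i) (measurableT_comp measurable_snd measurable_fst)).
exact: (measurableT_comp (measurable_coord i) (measurableT_comp measurable_snd measurable_snd)).
Qed.

Lemma cmeasurableM f g : cmeasurable f -> cmeasurable g -> cmeasurable (fun z => f z * g z).
Proof.
move=> [f1 f2] [g1 g2]; split.
  rewrite (_ : (fun z => _) = (fun z => complex.Re (f z) * complex.Re (g z) - complex.Im (f z) * complex.Im (g z))).
    by apply: measurable_funB; exact: measurable_funM.
  by apply/funext => z; case: (f z) => a b; case: (g z).
rewrite (_ : (fun z => _) = (fun z => complex.Re (f z) * complex.Im (g z) + complex.Im (f z) * complex.Re (g z))).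
  by apply: measurable_funD; exact: measurable_funM.
by apply/funext => z; case: (f z) => a b; case: (g z).
Qed.

Lemma cmeasurable_cst c : cmeasurable (fun _ : R * 'rV[R]_d => c : R[i]).
Proof. by split; exact: measurable_cst. Qed.

Lemma cmeasurable_sum (I : finType) (F : I -> R * 'rV[R]_d -> R[i]) :
  (forall i, cmeasurable (F i)) -> cmeasurable (fun z => \sum_i F i z).
Proof.
move=> mF; split.
  under [X in measurable_fun _ X]eq_fun do rewrite raddf_sum.
  by apply: measurable_sum => i; have [] := mF i.
under [X in measurable_fun _ X]eq_fun do rewrite raddf_sum.
by apply: measurable_sum => i; have [] := mF i.
Qed.

Lemma cmeasurable_shift f (w : plane) : cmeasurable f -> cmeasurable (fun z => f (z - w)).
Proof.
by move=> [f1 f2]; split; [exact: (measurableT_comp f1 (measurable_plane_sub w))|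
  exact: (measurableT_comp f2 (measurable_plane_sub w))].
Qed.

Lemma measurable_normc f : cmeasurable f -> measurable_fun setT (fun z : plane => normc (f z)).
Proof.
move=> [f1 f2].
rewrite (_ : (fun z => _) = (fun z => Num.sqrt (complex.Re (f z) ^+ 2 + complex.Im (f z) ^+ 2))).
  apply: (measurableT_comp (@continuous_measurable_fun R Num.sqrt (@sqrt_continuous R))).
  by apply: measurable_funD; exact: measurable_funX.
by apply/funext => z; case: (f z).
Qed.

Lemma mixed_normE p q f : cmeasurable f -> 0 < p -> 0 < q ->
  mixed_norm p q f = ge0_mixed_norm p q (fun z : plane => normc (f z)).
Proof.
move=> mf p0 q0; rewrite /mixed_norm /ge0_mixed_norm Lnorm.unlock /=.
apply: (congr1 (fun t => poweR t p^-1)); apply: eq_integral => x _.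
rewrite gee0_abs ?slice_norm_ge0// slice_normE; last by move=> z; exact: normc_ge0.
by rewrite -poweRrM mulrC.
Qed.

End complex_measurability.

(** * The function norm on coefficients *)

Section combination_norm.
Variables (R : realType) (d r N : nat) (p q : R).
Local Notation plane := (measurableTypeR R * 'rV[R]_d)%type.
Local Notation vec := {ffun @coef_index d r N -> R}.
Variables (Phi : 'I_r -> R * 'rV[R]_d -> R[i]) (alpha1 alpha2 : R).
Hypotheses (p1 : 1 < p) (q1 : 1 < q).
Hypothesis PhiL : forall i, in_Lpq p q (Phi i).
Hypotheses (a1 : 0 < alpha1) (stable : stable_shifts p q alpha1 alpha2 Phi).

Let p0 : 0 < p. Proof. exact: lt_trans p1. Qed.
Let q0 : 0 < q. Proof. exact: lt_trans q1. Qed.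

Local Notation fn a := (@combination R d r N Phi a).
(** Finite by the upper stability bound, so [fine] loses nothing; the lower stability bound makes it
    dominate the maximum norm. *)
Definition nrm (a : vec) : R := fine (mixed_norm p q (fn a)).

Lemma cmeasurable_combination (a : vec) : cmeasurable (fn a).
Proof.
apply: cmeasurable_sum => i; apply: cmeasurable_sum => j; apply: cmeasurableM.
  exact: cmeasurable_cst.
by apply: cmeasurable_shift; have [] := PhiL i.
Qed.

Let stable_coef (a : vec) :
  (alpha1%:E * (\sum_i coef_norm p q a i)%:E <= mixed_norm p q (fn a))%E /\
  (mixed_norm p q (fn a) <= alpha2%:E * (\sum_i coef_norm p q a i)%:E)%E.
Proof.
rewrite -(vseq_norm_coef a p0 q0) -shift_series_combination; apply: stable => i.
by rewrite seq_norm_coef// ltry.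
Qed.

Lemma mixed_norm_combination (a : vec) : mixed_norm p q (fn a) = (nrm a)%:E.
Proof.
rewrite fineK// ge0_fin_numE; last exact: poweR_ge0.
by have [_ /le_lt_trans] := stable_coef a; apply; rewrite ltry.
Qed.

Lemma nrm_ge0 (a : vec) : 0 <= nrm a.
Proof. by rewrite fine_ge0// poweR_ge0. Qed.

Lemma nrm_coef (a : vec) : alpha1 * \sum_i coef_norm p q a i <= nrm a.
Proof. by have [h _] := stable_coef a; move: h; rewrite mixed_norm_combination -EFinM lee_fin. Qed.

Lemma nrm_low (a : vec) k : alpha1 * `|a k| <= nrm a.
Proof. by apply: le_trans (nrm_coef a); rewrite ler_pM2l// le_coef_norm. Qed.

Let mn (a : vec) := measurable_normc (cmeasurable_combination a).
Let n0 (a : vec) (z : plane) : 0 <= normc (fn a z) := normc_ge0 _.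

Lemma nrmE (a : vec) : (nrm a)%:E = ge0_mixed_norm p q (fun z : plane => normc (fn a z)).
Proof. by rewrite -mixed_norm_combination mixed_normE//; exact: cmeasurable_combination. Qed.

Lemma nrmD (a b : vec) : nrm (a + b) <= nrm a + nrm b.
Proof.
have := nrmE a; have := nrmE b; have := nrmE (a + b).
move: (nrm (a + b)) (nrm a) (nrm b) => x y y' e1 e3 e2.
rewrite -lee_fin EFinD e3 e2 e1.
apply: le_trans (ge0_mixed_normD (ltW p1) (ltW q1) (mn a) (mn b) (n0 a) (n0 b)).
apply: le_ge0_mixed_norm => //; first exact: measurable_funD.
by move=> z; rewrite normc_ge0/= combinationD; exact: le_normcD.
Qed.

Lemma nrmZ t (a : vec) : nrm (t *: a) = `|t| * nrm a.
Proof.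
have := nrmE a; have := nrmE (t *: a).
move: (nrm (t *: a)) (nrm a) => x y e1 e2.
apply: EFin_inj; rewrite EFinM e2 e1 -ge0_mixed_normZ//.
apply: (congr1 (ge0_mixed_norm p q)); apply/funext => z.
by rewrite combinationZ normcM normc_real.
Qed.

(** Expansion in the standard basis. The size of the constant is immaterial, since the volumetric
    bound for nets does not contain it. *)
Lemma nrm_up : (0 < r)%N -> exists2 be, 0 < be & forall (a : vec) t, (forall k, `|a k| <= t) -> nrm a <= be * t.
Proof.
move=> r0; pose e k : vec := [ffun k' => (k' == k)%:R].
exists (1 + \sum_k nrm (e k)).
  by rewrite ltr_pwDl// sumr_ge0// => k _; exact: nrm_ge0.
move=> a t at_.
(* A coefficient exists because [0 < r]; it shows [0 <= t]. *)
pose k : @coef_index d r N := (Ordinal r0, (ord0, [ffun=> ord0]), true).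
have t0 : 0 <= t by apply: le_trans (at_ k).
have aE : a = \sum_k a k *: e k.
  apply/ffunP => k'; rewrite sum_ffunE (bigD1 k')//= big1 => [|k'' kk].
    by rewrite !ffunE eqxx addr0 [RHS]mulr1.
  by rewrite !ffunE eq_sym (negbTE kk) [LHS]mulr0.
have le_sum (J : Type) (s : seq J) (F : J -> vec) : nrm (\sum_(j <- s) F j) <= \sum_(j <- s) nrm (F j).
  elim/big_ind2: _ => [|b b' u u' h h'|//].
    by rewrite -(scale0r 0) nrmZ normr0 mul0r.
  by apply: le_trans (nrmD _ _) _; exact: lerD.
rewrite {1}aE; apply: le_trans (le_sum _ _ _) _.
rewrite mulrDl mul1r mulr_suml; apply: ler_wpDl => //.
apply: ler_sum => k' _; rewrite nrmZ mulrC.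
by apply: ler_wpM2l; [exact: nrm_ge0|exact: at_].
Qed.

End combination_norm.

(** * The pointwise bound *)

Section pointwise_bound.
Variables (R : realType) (d r N : nat) (p q : R).
Local Notation plane := (measurableTypeR R * 'rV[R]_d)%type.
Local Notation vec := {ffun @coef_index d r N -> R}.
Variables (Phi : 'I_r -> R * 'rV[R]_d -> R[i]) (alpha1 alpha2 ct s1 s2 : R).
Hypotheses (p1 : 1 < p) (q1 : 1 < q).
Hypotheses (a1 : 0 < alpha1) (stable : stable_shifts p q alpha1 alpha2 Phi).
Hypotheses (ct0 : 0 < ct) (dec : forall i, decaying ct s1 s2 (Phi i)).

Local Notation sig1 := (s1 * p / (p - 1)).
Local Notation sig2 := (s2 * q / (q - 1)).
Hypothesis sig1_gt : 1 < sig1.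

(** The factor of [cstar] that does not involve the second variable, including the factor [2] of the
    integer sum. *)
Definition profile_const : R := ct / alpha1 * (2 * int_total sig1) `^ ((p - 1) / p).

Lemma profile_const_gt0 : 0 < profile_const.
Proof.
by rewrite /profile_const mulr_gt0 ?divr_gt0// powR_gt0// mulr_gt0// int_total_gt0.
Qed.

Let decay_term (i : 'I_r) (z : R * 'rV[R]_d) (j : lat_index d N) :
  normc (Phi i (z - lattice_point R (lat j))) <=
  ct * ((1 + `|z.1 - (j.1%:R - N%:R)|) `^ (- s1) * (1 + `|z.2 - box_point R j.2|) `^ (- s2)).
Proof.
apply: le_trans (dec i _) _; rewrite ler_pM2l// /lattice_point/= int_pointE int_boxE.
by rewrite !powRN invfM.
Qed.

(** Mixed Hoelder of the coefficients against the decay. The first variable is bounded uniformly,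
    while the lattice sum in the second is kept as a function of [z.2], because its mean is needed
    as well as its supremum. *)
Lemma combination_le (a : vec) (z : R * 'rV[R]_d) : normc (combination Phi a z) <=
  profile_const * nrm p q Phi a * lattice_sum N sig2 z.2 `^ ((q - 1) / q).
Proof.
have p0 : 0 < p by exact: lt_trans p1.
have q0 : 0 < q by exact: lt_trans q1.
have pm : p - 1 != 0 by rewrite subr_eq0 gt_eqF.
have qm : q - 1 != 0 by rewrite subr_eq0 gt_eqF.
pose A (n : 'I_(N.*2.+1)) := (1 + `|z.1 - (n%:R - N%:R)|) `^ (- s1).
pose B (k : {ffun 'I_d -> 'I_(N.*2.+1)}) := (1 + `|z.2 - box_point R k|) `^ (- s2).
apply: (@le_trans _ _ (\sum_i ct * (coef_norm p q a i * ((2 * int_total sig1) `^ ((p - 1) / p) *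
    lattice_sum N sig2 z.2 `^ ((q - 1) / q))))).
  apply: le_trans (le_normc_sum _) _; apply: ler_sum => i _.
  apply: le_trans (le_normc_sum _) _.
  apply: (@le_trans _ _ (ct * \sum_n \sum_k normc (coef a i (n, k)) * (A n * B k))).
    rewrite pair_bigA mulr_sumr /=; apply: ler_sum => -[n k] _ /=.
    rewrite normcM mulrCA; apply: ler_wpM2l; first exact: normc_ge0.
    exact: (decay_term i z (n, k)).
  rewrite ler_pM2l//.
  have A0 n : 0 <= A n by exact: powR_ge0.
  have B0 k : 0 <= B k by exact: powR_ge0.
  apply: le_trans (mixed_sum_hoelder p1 q1 (fun n k => normc_ge0 (coef a i (n, k))) A0 B0) _.
  apply: ler_wpM2l; first exact: powR_ge0.
  apply: ler_pM; [exact: powR_ge0|exact: powR_ge0| |].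
    apply: ge0_ler_powR.
    - by rewrite divr_ge0 ?(ltW p0)// subr_ge0 ltW.
    - by rewrite nnegrE sumr_ge0// => n _; exact: powR_ge0.
    - by rewrite nnegrE mulr_ge0// ltW// int_total_gt0.
    apply: le_trans (int_window_le sig1_gt N z.1).
    apply: ler_sum => n _; rewrite /A -powRrM mulNr mulrA; exact: lexx.
  rewrite le_eqVlt; apply/orP; left; apply/eqP.
  apply: (congr1 (fun t => t `^ ((q - 1) / q))); apply: eq_bigr => k _.
  by rewrite /B -powRrM mulNr mulrA.
rewrite -mulr_sumr -mulr_suml.
rewrite /profile_const.
set L := lattice_sum _ _ _ `^ _; set S := _ `^ ((p - 1) / p).
have L0 : 0 <= L by exact: powR_ge0.
have S0 : 0 <= S by exact: powR_ge0.
have h := nrm_coef p1 q1 stable a.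
have -> : ct * ((\sum_i coef_norm p q a i) * (S * L)) = ct / alpha1 * (S * L) * (alpha1 * \sum_i coef_norm p q a i).
  by field; rewrite gt_eqF.
have -> : ct / alpha1 * S * nrm p q Phi a * L = ct / alpha1 * (S * L) * nrm p q Phi a by ring.
by rewrite ler_wpM2l// !mulr_ge0 ?invr_ge0 ?(ltW ct0) ?(ltW a1).
Qed.

End pointwise_bound.

(** * Convolution with psi *)

Section complex_convolution.
Variables (R : realType) (d : nat).
Local Notation plane := (measurableTypeR R * 'rV[R]_d)%type.
Local Notation leb := (@lebesgue_plane R d).
Implicit Types f g psi h : R * 'rV[R]_d -> R[i].

Lemma integrable_Re h : cmeasurable h -> (\int[leb]_z (normc (h z))%:E < +oo)%E ->
  leb.-integrable setT (EFin \o (fun z => complex.Re (h z))).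
Proof.
move=> mh hoo; have [m1 m2] := mh; apply/integrableP; split; first exact/measurable_EFinP.
apply: le_lt_trans hoo; apply: ge0_le_integral => //.
- by apply/measurable_EFinP; exact: measurableT_comp.
- by apply/measurable_EFinP; exact: measurable_normc.
- by move=> z _ /=; rewrite lee_fin; exact: normc_Re.
Qed.

Lemma integrable_Im h : cmeasurable h -> (\int[leb]_z (normc (h z))%:E < +oo)%E ->
  leb.-integrable setT (EFin \o (fun z => complex.Im (h z))).
Proof.
move=> mh hoo; have [m1 m2] := mh; apply/integrableP; split; first exact/measurable_EFinP.
apply: le_lt_trans hoo; apply: ge0_le_integral => //.
- by apply/measurable_EFinP; exact: measurableT_comp.
- by apply/measurable_EFinP; exact: measurable_normc.
- by move=> z _ /=; rewrite lee_fin; exact: normc_Im.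
Qed.

(** If [A + iB] is the integral and [n] its modulus, then [n^2] is the integral of
    [A Re h + B Im h], which Cauchy-Schwarz bounds pointwise by [n * normc (h z)]. *)
Lemma le_normc_cintegral h : cmeasurable h ->
  ((normc (cintegral h))%:E <= \int[leb]_z (normc (h z))%:E)%E.
Proof.
move=> mh; have [hoo|] := ltP (\int[leb]_z (normc (h z))%:E)%E +oo%E; last first.
  by rewrite leye_eq => /eqP ->; exact: leey.
have iR := integrable_Re mh hoo; have iI := integrable_Im mh hoo.
set A := Rintegral leb setT (fun z => complex.Re (h z)).
set B := Rintegral leb setT (fun z => complex.Im (h z)).
have -> : cintegral h = Complex A B by [].
set n := normc (Complex A B).
have ih : leb.-integrable setT (EFin \o (fun z => normc (h z))).
  apply/integrableP; split; first by apply/measurable_EFinP; exact: measurable_normc.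
  by under eq_integral do rewrite /= ger0_norm ?normc_ge0//.
have -> : (\int[leb]_z (normc (h z))%:E = (Rintegral leb setT (fun z => normc (h z)))%:E)%E.
  by rewrite /Rintegral fineK//; exact: integrable_fin_num ih.
rewrite lee_fin; set I := Rintegral _ _ _.
have n2 : n * n = A * A + B * B.
  by rewrite /n /normc -expr2 sqr_sqrtr ?addr_ge0 ?sqr_ge0// !expr2.
have n0 : 0 <= n by exact: normc_ge0.
have [->|nn] := eqVneq n 0.
  by apply: Rintegral_ge0 => z _; exact: normc_ge0.
have npos : 0 < n by rewrite lt0r nn.
rewrite -(ler_pM2l npos) n2.
have iAR : leb.-integrable setT (EFin \o (fun z => A * complex.Re (h z))).
  exact: (integrableZl measurableT A iR).
have iBI : leb.-integrable setT (EFin \o (fun z => B * complex.Im (h z))).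
  exact: (integrableZl measurableT B iI).
have -> : A * A + B * B = Rintegral leb setT (fun z => A * complex.Re (h z) + B * complex.Im (h z)).
  by rewrite RintegralD// RintegralZl// RintegralZl.
have -> : n * I = Rintegral leb setT (fun z => n * normc (h z)) by rewrite RintegralZl.
apply: le_Rintegral => //.
- exact: (integrableD measurableT iAR iBI).
- exact: (integrableZl measurableT n ih).
move=> z _; rewrite /n; case: (h z) => a b /=.
rewrite -sqrtrM ?addr_ge0 ?sqr_ge0//; apply: le_trans (ler_norm _) _.
rewrite -sqrtr_sqr ler_sqrt ?mulr_ge0 ?addr_ge0 ?sqr_ge0//.
rewrite -subr_ge0; have -> : (A ^+ 2 + B ^+ 2) * (a ^+ 2 + b ^+ 2) - (A * a + B * b) ^+ 2 = (A * b - B * a) ^+ 2 by ring.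
exact: sqr_ge0.
Qed.

Lemma cintegralD f g : cmeasurable f -> cmeasurable g ->
  (\int[leb]_z (normc (f z))%:E < +oo)%E -> (\int[leb]_z (normc (g z))%:E < +oo)%E ->
  cintegral (fun z => f z + g z) = cintegral f + cintegral g.
Proof.
move=> mf mg foo goo; rewrite /cintegral; simpc; congr Complex.
  rewrite -RintegralD//; [|exact: integrable_Re|exact: integrable_Re].
  by apply: eq_Rintegral => z _; rewrite raddfD.
rewrite -RintegralD//; [|exact: integrable_Im|exact: integrable_Im].
by apply: eq_Rintegral => z _; rewrite raddfD.
Qed.

Lemma cintegralZ t f : cmeasurable f -> (\int[leb]_z (normc (f z))%:E < +oo)%E ->
  cintegral (fun z => Complex t 0 * f z) = Complex t 0 * cintegral f.
Proof.
move=> mf foo; rewrite /cintegral; simpc; congr Complex.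
  rewrite -RintegralZl//; last exact: integrable_Re.
  by apply: eq_Rintegral => z _; case: (f z) => a b; simpc.
rewrite -RintegralZl//; last exact: integrable_Im.
by apply: eq_Rintegral => z _; case: (f z) => a b; simpc.
Qed.

Variable psi : R * 'rV[R]_d -> R[i].
Hypothesis psiL : in_L1 psi.

Definition bounded_by f (C : R) := forall z, normc (f z) <= C.

Definition conv_kernel f (z w : R * 'rV[R]_d) := f (z - w) * psi w.

Lemma cmeasurable_conv_kernel f z : cmeasurable f -> cmeasurable (conv_kernel f z).
Proof.
move=> [f1 f2]; apply: cmeasurableM; last by have [] := psiL.
by split; [exact: (measurableT_comp f1 (measurable_plane_rsub z))|
  exact: (measurableT_comp f2 (measurable_plane_rsub z))].
Qed.

Lemma L1norm_setT_fin : L1norm setT psi = (fine (L1norm setT psi))%:E.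
Proof.
rewrite fineK// ge0_fin_numE; first by have [] := psiL.
by apply: integral_ge0 => z _; rewrite lee_fin normc_ge0.
Qed.

Lemma conv_kernel_fin f C z : cmeasurable f -> bounded_by f C ->
  (\int[leb]_w (normc (conv_kernel f z w))%:E < +oo)%E.
Proof.
move=> mf fC; have [mpsi psioo] := psiL.
have C0 : 0 <= C by apply: le_trans (fC 0); exact: normc_ge0.
apply: (@le_lt_trans _ _ (C%:E * L1norm setT psi)%E); last first.
  by rewrite L1norm_setT_fin -EFinM ltry.
rewrite /L1norm -ge0_integralZl//; last 2 first.
- by apply/measurable_EFinP; exact: measurable_normc.
- by move=> w _; rewrite lee_fin normc_ge0.
apply: ge0_le_integral => //.
- by move=> w _; rewrite lee_fin normc_ge0.
- by apply/measurable_EFinP; apply: measurable_normc; exact: cmeasurable_conv_kernel.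
- by apply: emeasurable_funM => //; apply/measurable_EFinP; exact: measurable_normc.
- move=> w _; rewrite -EFinM lee_fin /conv_kernel normcM ler_wpM2r ?normc_ge0//.
Qed.

Lemma convolutionD f g C C' z : cmeasurable f -> cmeasurable g ->
  bounded_by f C -> bounded_by g C' ->
  convolution (fun z => f z + g z) psi z = convolution f psi z + convolution g psi z.
Proof.
move=> mf mg fC gC; rewrite /convolution -(@cintegralD (conv_kernel f z) (conv_kernel g z)).
- by congr cintegral; apply/funext => w; rewrite /conv_kernel mulrDl.
- exact: cmeasurable_conv_kernel.
- exact: cmeasurable_conv_kernel.
- exact: conv_kernel_fin fC.
- exact: conv_kernel_fin gC.
Qed.

Lemma convolutionZ t f C z : cmeasurable f -> bounded_by f C ->
  convolution (fun z => Complex t 0 * f z) psi z = Complex t 0 * convolution f psi z.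
Proof.
move=> mf fC; rewrite /convolution -(@cintegralZ t (conv_kernel f z)).
- by congr cintegral; apply/funext => w; rewrite /conv_kernel mulrA.
- exact: cmeasurable_conv_kernel.
- exact: conv_kernel_fin fC.
Qed.

(** Positive and negative parts are integrated separately by Tonelli, so the measurable dependence
    on the point is obtained without integrability. *)
Lemma cmeasurable_convolution f : cmeasurable f -> cmeasurable (convolution f psi).
Proof.
move=> mf; have [mpsi _] := psiL.
have param (k : plane * plane -> R) : measurable_fun setT k ->
    measurable_fun setT (fun z => Rintegral leb setT (fun w => k (z, w))).
  move=> mk; rewrite /Rintegral; apply: (measurableT_comp (@fine_measurable R setT measurableT)).
  rewrite (_ : (fun z => _) = (fun z => (\int[leb]_w ((EFin \o k)^\+ (z, w)) - \int[leb]_w ((EFin \o k)^\- (z, w)))%E)); last first.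
    apply/funext => z; apply: (etrans (integralE leb setT (fun w => (k (z, w))%:E))).
    by apply: (congr2 (fun a b => (a - b)%E)); apply: eq_integral => w _; rewrite ?funeposE ?funenegE.
  have mk' : measurable_fun setT (EFin \o k) by exact/measurable_EFinP.
  apply: emeasurable_funB.
    apply: (@measurable_fun_fubini_tonelli_F _ _ _ _ R leb (EFin \o k)^\+%E).
      exact: measurable_funepos.
    by move=> u; exact: funepos_ge0.
  apply: (@measurable_fun_fubini_tonelli_F _ _ _ _ R leb (EFin \o k)^\-%E).
    exact: measurable_funeneg.
  by move=> u; exact: funeneg_ge0.
have [f1 f2] := mf; have [p1 p2] := mpsi.
have md := @measurable_plane_diff R d.
have m1 := measurableT_comp f1 md; have m2 := measurableT_comp f2 md.
have m3 : measurable_fun setT (fun u : plane * plane => complex.Re (psi u.2)) := measurableT_comp p1 measurable_snd.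
have m4 : measurable_fun setT (fun u : plane * plane => complex.Im (psi u.2)) := measurableT_comp p2 measurable_snd.
pose k1 (u : plane * plane) :=
  complex.Re (f (u.1 - u.2)) * complex.Re (psi u.2) - complex.Im (f (u.1 - u.2)) * complex.Im (psi u.2).
pose k2 (u : plane * plane) :=
  complex.Re (f (u.1 - u.2)) * complex.Im (psi u.2) + complex.Im (f (u.1 - u.2)) * complex.Re (psi u.2).
split.
  rewrite (_ : (fun z => _) = (fun z => Rintegral leb setT (fun w => k1 (z, w)))).
    by apply: (param k1); apply: measurable_funB; exact: measurable_funM.
  apply/funext => z; apply: eq_Rintegral => w _ /=.
  by rewrite /k1/=; case: (f (z - w)) => a b; case: (psi w).
rewrite (_ : (fun z => _) = (fun z => Rintegral leb setT (fun w => k2 (z, w)))).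
  by apply: (param k2); apply: measurable_funD; exact: measurable_funM.
apply/funext => z; apply: eq_Rintegral => w _ /=.
by rewrite /k2/=; case: (f (z - w)) => a b; case: (psi w).
Qed.

End complex_convolution.

(** * Pointwise and mean bounds for a convolution *)

Section convolution_bounds.
Variables (R : realType) (d : nat).
Local Notation plane := (measurableTypeR R * 'rV[R]_d)%type.
Local Notation leb := (@lebesgue_plane R d).
Variables (psi f : R * 'rV[R]_d -> R[i]) (D : set plane) (H : R).
Hypotheses (psiL : in_L1 psi) (mf : cmeasurable f) (H0 : 0 <= H).
Hypothesis psiD : {ae leb, forall w, ~ D w -> psi w = 0}.

Local Notation Lpsi := (fine (L1norm setT psi)).

Let mpsi : measurable_fun setT (fun w : plane => normc (psi w)).
Proof. by apply: measurable_normc; have [] := psiL. Qed.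

Let HL : (\int[leb]_w (H * normc (psi w))%:E = (H * Lpsi)%:E)%E.
Proof.
rewrite EFinM -(L1norm_setT_fin psiL) /L1norm -ge0_integralZl//.
- exact/measurable_EFinP.
- by move=> w _; rewrite lee_fin normc_ge0.
Qed.

Lemma le_convolution (z : plane) : (forall w, D w -> normc (f (z - w)) <= H) ->
  normc (convolution f psi z) <= H * Lpsi.
Proof.
move=> fH; rewrite -lee_fin -HL.
have mk := cmeasurable_conv_kernel psiL z mf.
apply: le_trans (le_normc_cintegral mk) _.
apply: ae_ge0_le_integral => //.
- by move=> w _; rewrite lee_fin normc_ge0.
- by apply/measurable_EFinP; exact: measurable_normc.
- by move=> w _; rewrite lee_fin mulr_ge0 ?normc_ge0.
- by apply/measurable_EFinP; exact: measurable_funM.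
move: psiD; apply: filterS => w hw _; rewrite lee_fin normcM.
have [Dw|/hw ->] := pselect (D w); last by rewrite normc0 !mulr0.
by rewrite ler_wpM2r ?normc_ge0 ?fH.
Qed.

(** Tonelli moves the mean inside: a bound on the means of all translates by points of [D] passes to
    the convolution at the cost of the norm of [psi]. *)
Lemma integral_convolution_le (kap : plane -> R) :
  measurable_fun setT kap -> (forall z, 0 <= kap z) ->
  (forall w, D w -> (\int[leb]_z (kap z * normc (f (z - w)))%:E <= H%:E)%E) ->
  (\int[leb]_z (kap z * normc (convolution f psi z))%:E <= (H * Lpsi)%:E)%E.
Proof.
move=> mk k0 kH.
have mnf : measurable_fun setT (fun u : plane * plane => normc (f (u.1 - u.2))).
  exact: (measurableT_comp (measurable_normc mf) (@measurable_plane_diff R d)).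
pose F (u : plane * plane) : \bar R := (kap u.1 * (normc (f (u.1 - u.2)) * normc (psi u.2)))%:E.
have mF : measurable_fun setT F.
  apply/measurable_EFinP; apply: measurable_funM; first exact: (measurableT_comp mk measurable_fst).
  apply: measurable_funM => //; exact: (measurableT_comp mpsi measurable_snd).
have F0 u : (0 <= F u)%E by rewrite lee_fin !mulr_ge0 ?normc_ge0.
have mconv := measurable_normc (cmeasurable_convolution psiL mf).
apply: (@le_trans _ _ (\int[leb]_z fubini_F leb F z)%E).
  apply: ge0_le_integral => //.
  - by move=> z _; rewrite lee_fin mulr_ge0 ?normc_ge0.
  - by apply/measurable_EFinP; exact: measurable_funM.
  - exact: (@measurable_fun_fubini_tonelli_F _ _ _ _ R leb F mF F0).
  move=> z _; rewrite /fubini_F.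
  have -> : (\int[leb]_w F (z, w) = (kap z)%:E * \int[leb]_w (normc (conv_kernel psi f z w))%:E)%E.
    rewrite -ge0_integralZl//.
    - by apply: eq_integral => w _; rewrite /F/= -EFinM normcM.
    - by apply/measurable_EFinP; apply: measurable_normc; exact: cmeasurable_conv_kernel.
    - by move=> w _; rewrite lee_fin normc_ge0.
    - by rewrite lee_fin.
  rewrite (EFinM (kap z)) lee_wpmul2l ?lee_fin//.
  by apply: le_normc_cintegral; exact: cmeasurable_conv_kernel.
have := @fubini_tonelli _ _ _ _ R leb leb F mF F0; rewrite /fubini_F => ->.
rewrite -HL; apply: ae_ge0_le_integral => //.
- by move=> w _; apply: integral_ge0 => z _; exact: F0.
- exact: (@measurable_fun_fubini_tonelli_G _ _ _ _ R leb F mF F0).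
- by move=> w _; rewrite lee_fin mulr_ge0 ?normc_ge0.
- by apply/measurable_EFinP; exact: measurable_funM.
move: psiD; apply: filterS => w hw _.
have -> : (\int[leb]_z F (z, w) = (normc (psi w))%:E * \int[leb]_z (kap z * normc (f (z - w)))%:E)%E.
  rewrite -ge0_integralZl//.
  - by apply: eq_integral => z _; rewrite /F/= -EFinM; congr EFin; ring.
  - apply/measurable_EFinP; apply: measurable_funM => //.
    exact: (measurableT_comp (measurable_normc mf) (measurable_plane_sub w)).
  - by move=> z _; rewrite lee_fin mulr_ge0 ?normc_ge0.
  - by rewrite lee_fin normc_ge0.
have [Dw|/hw ->] := pselect (D w); last by rewrite normc0 mul0e mulr0.
by rewrite mulrC EFinM lee_wpmul2l ?lee_fin ?normc_ge0// kH.
Qed.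

End convolution_bounds.

Section essential_support.
Variables (R : realType) (d : nat).
Local Notation plane := (measurableTypeR R * 'rV[R]_d)%type.
Local Notation leb := (@lebesgue_plane R d).

Definition rational_ball (i : rat * 'rV[rat]_d * nat) : set (R * 'rV[R]_d) :=
  [set z : R * 'rV[R]_d | `|ratr i.1.1 - z.1| < i.2.+1%:R^-1 /\
           forall k, `|ratr (i.1.2 ord0 k) - z.2 ord0 k| < i.2.+1%:R^-1].

Lemma rational_ball_exists (z : R * 'rV[R]_d) (U : set (R * 'rV[R]_d)) : nbhs z U ->
  exists i, rational_ball i z /\ rational_ball i `<=` U.
Proof.
move=> /nbhs_ballP[e /= e0 eU].
pose n := Num.truncn (2 / e).
have [ep [epE ep0 ne]] : exists ep, [/\ ep = n.+1%:R^-1, 0 < ep & 2 * ep < e].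
  exists n.+1%:R^-1; split; rewrite ?invr_gt0//.
  by rewrite ltr_pdivrMr// mulrC -ltr_pdivrMr// truncnS_gt.
have dense (t : R) : exists c : rat, `|ratr c - t| < ep.
  have : t - ep < t + ep by lra.
  move=> /rat_in_itvoo[c]; rewrite in_itv/= => /andP[h1 h2].
  by exists c; rewrite ltr_norml; apply/andP; split; lra.
have [c1 hc1] := dense z.1.
have /choice[c2 hc2] : forall k : 'I_d, exists c : rat, `|ratr c - z.2 ord0 k| < ep.
  by move=> k; exact: dense.
exists (c1, \row_k c2 k, n); split.
  by rewrite /rational_ball/= -epE; split => //= k; rewrite mxE.
move=> u; rewrite /rational_ball/= -epE => -[h1 h2]; apply: eU.
have close (a b c : R) : `|c - a| < ep -> `|c - b| < ep -> `|a - b| < e.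
  by rewrite !ltr_norml => /andP[? ?] /andP[? ?]; apply/andP; split; lra.
split.
  exact: close hc1 h1.
split => // i j; rewrite (ord1 i); apply: close (hc2 j) _.
by have := h2 j; rewrite mxE.
Qed.

(** The complement of the support is covered by the countably many rational balls on which [psi]
    vanishes almost everywhere, so the exceptional sets unite to a null set. *)
Lemma ess_support_ae (psi : R * 'rV[R]_d -> R[i]) (D : set (R * 'rV[R]_d)) :
  ess_support psi `<=` D -> {ae leb, forall w, ~ D w -> psi w = 0}.
Proof.
move=> sD.
pose good i := `[< {ae leb, forall w, rational_ball i w -> psi w = 0} >].
pose P (n : nat) (w : plane) := forall i, unpickle n = Some i -> good i -> rational_ball i w -> psi w = 0.
have aeP n : {ae leb, forall w, P n w}.
  rewrite /P; case: (unpickle n) => [i|]; last by apply: aeW => w i.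
  have [/asboolP gi|ngi] := boolP (good i); last by apply: aeW => w j [<-] /(negP ngi).
  by apply: (@filterS _ (almost_everywhere leb) _ _ _ _ gi) => w hw j [<-] _.
have : {ae leb, forall w, forall n, P n w} by exact: ae_foralln.
apply: filterS => w Pw Dw.
have : ~ ess_support psi w by move=> /sD.
rewrite /ess_support/= => /existsNP[U] /not_implyP[[oU Uw]] /contrapT aeU.
have [i [iw iU]] := @rational_ball_exists w U (open_nbhs_nbhs (conj oU Uw)).
apply: (Pw (pickle i) i) => //; first exact: pickleK.
apply/asboolP.
by apply: (@filterS _ (almost_everywhere leb) _ _ _ _ aeU) => v hv /iU; exact: hv.
Qed.

End essential_support.

(** * Suprema and means over the sampling window *)

Section window_bounds.
Variables (R : realType) (d r N : nat) (p q : R) (K1 K2 : R).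
Local Notation plane := (measurableTypeR R * 'rV[R]_d)%type.
Local Notation leb := (@lebesgue_plane R d).
Local Notation CK := (box K1 K2 : set plane).
Local Notation vec := {ffun @coef_index d r N -> R}.
Variables (Phi : 'I_r -> R * 'rV[R]_d -> R[i]) (alpha1 alpha2 ct s1 s2 : R).
Hypotheses (p1 : 1 < p) (q1 : 1 < q) (d0 : (0 < d)%N) (K10 : 0 < K1) (K20 : 0 < K2).
Hypothesis PhiL : forall i, in_Lpq p q (Phi i).
Hypotheses (a1 : 0 < alpha1) (stable : stable_shifts p q alpha1 alpha2 Phi).
Hypotheses (ct0 : 0 < ct) (dec : forall i, decaying ct s1 s2 (Phi i)).
Local Notation sig1 := (s1 * p / (p - 1)).
Local Notation sig2 := (s2 * q / (q - 1)).
Hypotheses (sig1_gt : 1 < sig1) (sig2_gt : d%:R < sig2).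

Local Notation fn a := (@combination R d r N Phi a).
Local Notation nrm := (@nrm R d r N p q Phi).
Local Notation kap := (@profile_const R p alpha1 ct s1).
Local Notation S y := (lattice_sum N sig2 y).
Local Notation th := ((q - 1) / q).

Let p0 : 0 < p. Proof. exact: lt_trans p1. Qed.
Let q0 : 0 < q. Proof. exact: lt_trans q1. Qed.
Let th0 : 0 < th. Proof. by rewrite divr_gt0 ?subr_gt0. Qed.
Let th1 : th < 1. Proof. by rewrite ltr_pdivrMr// mul1r gtrBl. Qed.
Let kap0 : 0 < kap. Proof. exact: (profile_const_gt0 (p := p) a1 ct0 sig1_gt). Qed.

Lemma lattice_sum_ge0 (y : 'rV[R]_d) : 0 <= S y.
Proof. by rewrite sumr_ge0// => k _; exact: powR_ge0. Qed.

Lemma combination_bounded (a : vec) : exists C, bounded_by (fn a) C.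
Proof.
have [B hB] := lattice_sum_bounded d0 sig2_gt.
exists (kap * nrm a * B `^ th) => z.
apply: le_trans (combination_le p1 q1 a1 stable ct0 dec sig1_gt a z) _.
apply: ler_wpM2l; first by rewrite mulr_ge0 ?(ltW kap0) ?nrm_ge0.
apply: ge0_ler_powR; rewrite ?nnegrE ?lattice_sum_ge0 ?(ltW th0)//.
exact: le_trans (lattice_sum_ge0 0) (hB N 0).
Qed.

Lemma box_sub_norm (z w : plane) : CK z -> CK w -> `|z.2 - w.2| <= 2 * K2.
Proof.
move=> [_ zK] [_ wK]; rewrite rV_norm_le; last by rewrite mulr_ge0 ?ltW.
apply/forallP => i; rewrite !mxE ler_norml.
by have := zK i; have := wK i => /andP[? ?] /andP[? ?]; apply/andP; split; lra.
Qed.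

Lemma combination_sup (U : R) (a : vec) (z w : plane) :
  (forall y : 'rV[R]_d, `|y| <= 2 * K2 -> S y <= U) -> CK z -> CK w ->
  normc (fn a (z - w)) <= kap * U `^ th * nrm a.
Proof.
move=> SU zK wK; apply: le_trans (combination_le p1 q1 a1 stable ct0 dec sig1_gt a _) _.
rewrite [leRHS]mulrAC; apply: ler_wpM2l; first by rewrite mulr_ge0 ?(ltW kap0) ?nrm_ge0.
have h := SU _ (box_sub_norm zK wK).
apply: ge0_ler_powR; rewrite ?nnegrE ?lattice_sum_ge0 ?(ltW th0)//.
exact: le_trans (lattice_sum_ge0 _) h.
Qed.

(** The tangent at [1] of a concave power, obtained as a case of Young's inequality. *)
Lemma powR_tangent (t : R) : 0 <= t -> t `^ th <= th * t + (1 - th).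
Proof.
move=> t0; have h : 0 <= t `^ th by exact: powR_ge0.
have qq : th^-1 = q / (q - 1) by rewrite invf_div.
have conj : th^-1^-1 + q^-1 = 1.
  by rewrite invrK -{2}[q^-1]mul1r -mulrDl subrK mulfV// gt_eqF.
have := @conjugate_powR R (t `^ th) 1 th^-1 q h ler01 _ q0 conj.
rewrite invr_gt0 mulr1 powR1 -powRrM mulfV ?gt_eqF// powRr1// invrK => /(_ th0).
have -> : 1 - th = 1 / q by field; rewrite gt_eqF.
by rewrite (mulrC th).
Qed.

Let vol : R := 2 * K1 * (2 * K2) ^+ d.

Lemma integral_box_snd (g : 'rV[R]_d -> R) (C : R) : measurable_fun setT g -> (forall y, 0 <= g y) ->
  (\int[@lebesgue_rV R d]_(y in rV_box K2) (g y)%:E <= C%:E)%E ->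
  (\int[leb]_(z in CK) (g z.2)%:E <= (2 * K1 * C)%:E)%E.
Proof.
move=> mg g0 gC; have mg2 : measurable_fun setT (fun z : plane => (g z.2)%:E).
  by apply/measurable_EFinP; exact: (measurableT_comp mg measurable_snd).
apply: (le_trans (_ : _ <= \int[lebesgue_measure]_(x in sym_itv K1) (cst C%:E x))%E).
  have E := @integral_box R d K1 K2 (fun z : plane => (g z.2)%:E) mg2 (fun z => g0 z.2).
  rewrite E; set I := (\int[lebesgue_rV]_(y in rV_box K2) (g y)%:E)%E in gC.
  rewrite -[X in (X <= _)%E]/(\int[lebesgue_measure]_(x in sym_itv K1) (cst I x))%E.
  apply: ge0_le_integral.
  - exact: measurable_sym_itv.
  - by move=> x _; apply: integral_ge0 => y _; rewrite lee_fin.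
  - exact: measurable_cst.
  - exact: measurable_cst.
  - by move=> x _; exact: gC.
rewrite integral_cst; last exact: measurable_sym_itv.
have := lebesgue_sym_itv K10 => h; rewrite [X in (_ * X)%E](_ : _ = (2 * K1)%:E); last exact: h.
by rewrite -EFinM mulrC.
Qed.

Variables (kappa : plane -> R) (C1 C2 : R).
Hypotheses (mk : measurable_fun setT kappa) (C10 : 0 < C1) (C20 : 0 < C2).
Hypothesis kappa_le : forall z, 0 <= kappa z <= C2 * \1_CK z.
Hypothesis kappa_ge : forall z, C1 * \1_CK z <= kappa z.
Hypothesis kappa1 : (\int[leb]_z (kappa z)%:E = 1)%E.

Let k0 z : 0 <= kappa z. Proof. by have /andP[] := kappa_le z. Qed.

Let mCK : measurable CK. Proof. exact: measurable_box. Qed.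

Let m1CK : measurable_fun setT (\1_CK : plane -> R). Proof. exact: measurable_indic. Qed.

Let integral_CK (g : plane -> R) : (\int[leb]_(z in CK) (g z)%:E = \int[leb]_z (\1_CK z * g z)%:E)%E.
Proof.
rewrite [LHS]integral_mkcond; apply: eq_integral => z _; rewrite /patch indicE.
by case: ifPn => _; rewrite ?mul1r ?mul0r.
Qed.

Let integral_cst_rV_box (c : R) :
  (\int[@lebesgue_rV R d]_(y in rV_box K2) c%:E = (c * (2 * K2) ^+ d)%:E)%E.
Proof.
apply: (etrans (integral_cst _ (@measurable_rV_box R d K2) _)).
by rewrite EFinM; congr (_ * _)%E; exact: lebesgue_rV_box.
Qed.

(** A density of total mass [1] lies above the constant [C1] on the box. *)
Lemma C1_vol : C1 * vol <= 1.
Proof.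
have volE : (\int[leb]_(z in CK) (1 : R)%:E = vol%:E)%E.
  have E := @integral_box R d K1 K2 (fun z : plane => 1%:E) (measurable_cst _) (fun z => lee01).
  rewrite E.
  have H : (\int[@lebesgue_rV R d]_(y in rV_box K2) (1 : R)%:E = ((2 * K2) ^+ d)%:E)%E.
    by rewrite integral_cst_rV_box mul1r.
  under eq_integral do rewrite H.
  rewrite integral_cst; last exact: measurable_sym_itv.
  rewrite [X in (_ * X)%E](_ : _ = (2 * K1)%:E); last exact: (lebesgue_sym_itv K10).
  by rewrite -EFinM mulrC.
rewrite -lee_fin EFinM -volE -[X in (_ <= X)%E]kappa1 integral_CK -ge0_integralZl//.
- apply: ge0_le_integral => //.
  + by move=> z _; rewrite mule_ge0 ?lee_fin ?(ltW C10)// mulr1.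
  + by apply: emeasurable_funM => //; apply/measurable_EFinP; exact: measurable_funM.
  + exact/measurable_EFinP.
  + by move=> z _; rewrite -EFinM lee_fin mulr1.
- by apply/measurable_EFinP; exact: measurable_funM.
- by rewrite lee_fin ltW.
Qed.

Let mS (w : plane) : measurable_fun setT (fun y : 'rV[R]_d => S (y - w.2)).
Proof. exact: measurable_lattice_sum. Qed.

Let mfn (a : vec) (w : plane) : measurable_fun setT (fun z : plane => normc (fn a (z - w))).
Proof. by apply: measurable_normc; apply: cmeasurable_shift; exact: cmeasurable_combination PhiL a. Qed.


(** Jensen's inequality, linearised at [A]: [S^th <= A^th (th S / A + 1 - th)], and the mean of the
    bracket over the window is at most 1. [C1_vol] then absorbs the volume. *)
Lemma mean_first_moment (A : R) (a : vec) (w : plane) : 0 < A ->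
  (\int[@lebesgue_rV R d]_(y in rV_box K2) (S (y - w.2))%:E <= (A * (2 * K2) ^+ d)%:E)%E ->
  (\int[leb]_z (C1 * \1_CK z * normc (fn a (z - w)))%:E <= (kap * A `^ th * nrm a)%:E)%E.
Proof.
move=> A0 SA; have n0 : 0 <= nrm a by exact: nrm_ge0.
pose g (y : 'rV[R]_d) := th / A * S (y - w.2) + (1 - th).
have thA : 0 <= th / A by rewrite divr_ge0 ?(ltW th0) ?(ltW A0).
have mg : measurable_fun setT g.
  by apply: measurable_funD => //; apply: measurable_funM => //; exact: mS.
have g0 y : 0 <= g y.
  rewrite /g; apply: addr_ge0; last by rewrite subr_ge0 ltW.
  by apply: mulr_ge0 => //; exact: lattice_sum_ge0.
have gI : (\int[@lebesgue_rV R d]_(y in rV_box K2) (g y)%:E <= ((2 * K2) ^+ d)%:E)%E.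
  have mD := @measurable_rV_box R d K2.
  have -> : (\int[@lebesgue_rV R d]_(y in rV_box K2) (g y)%:E =
     (th / A)%:E * \int[@lebesgue_rV R d]_(y in rV_box K2) (S (y - w.2))%:E + (1 - th)%:E * ((2 * K2) ^+ d)%:E)%E.
    have -> : (\int[@lebesgue_rV R d]_(y in rV_box K2) (g y)%:E =
      \int[@lebesgue_rV R d]_(y in rV_box K2) ((th / A * S (y - w.2))%:E + (1 - th)%:E))%E by [].
    rewrite ge0_integralD//.
    - rewrite -ge0_integralZl//; last 2 first.
      + by apply/measurable_EFinP; apply: measurable_funTS; exact: mS.
      + by move=> y _; rewrite lee_fin lattice_sum_ge0.
      by rewrite integral_cst_rV_box EFinM.
    - by move=> y _; rewrite lee_fin mulr_ge0 ?lattice_sum_ge0.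
    - by apply/measurable_EFinP; apply: measurable_funTS; apply: measurable_funM => //; exact: mS.
    - by move=> y _; rewrite lee_fin subr_ge0 ltW.
  apply: (@le_trans _ _ ((th / A)%:E * (A * (2 * K2) ^+ d)%:E + (1 - th)%:E * ((2 * K2) ^+ d)%:E)%E).
    by rewrite leeD2r// lee_wpmul2l ?lee_fin.
  rewrite -!EFinM -EFinD lee_fin le_eqVlt; apply/orP; left; apply/eqP; field.
  by rewrite !gt_eqF.
have gCK := integral_box_snd mg g0 gI.
rewrite -/vol integral_CK in gCK.
have coef0 : 0 <= C1 * (kap * A `^ th * nrm a).
  by rewrite mulr_ge0 ?(ltW C10)// mulr_ge0// mulr_ge0 ?powR_ge0 ?(ltW kap0).
apply: (@le_trans _ _ ((C1 * (kap * A `^ th * nrm a))%:E * \int[leb]_z (\1_CK z * g z.2)%:E)%E); last first.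
  apply: (@le_trans _ _ ((C1 * (kap * A `^ th * nrm a))%:E * vol%:E)%E).
    by rewrite lee_wpmul2l ?lee_fin.
  rewrite -EFinM lee_fin mulrAC mulrC -[leRHS]mulr1.
  apply: ler_wpM2l; last exact: C1_vol.
  by rewrite mulr_ge0// mulr_ge0 ?powR_ge0 ?(ltW kap0).
have mg2 : measurable_fun setT (fun z : plane => \1_CK z * g z.2).
  exact: (measurable_funM m1CK (measurableT_comp mg measurable_snd)).
rewrite -ge0_integralZl//.
- apply: ge0_le_integral => //.
  + by move=> z _; rewrite lee_fin mulr_ge0 ?normc_ge0// mulr_ge0 ?(ltW C10).
  + apply/measurable_EFinP; apply: measurable_funM; last exact: mfn.
    exact: measurable_funM.
  + by apply: emeasurable_funM => //; exact/measurable_EFinP.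
  move=> z _; rewrite -EFinM lee_fin mulrA -[leRHS]mulrAC -[leRHS]mulrA mulrAC -[leLHS]mulrA.
  rewrite [leRHS](_ : _ = C1 * (\1_CK z * (kap * A `^ th * nrm a * g z.2))); last by ring.
  rewrite [leLHS](_ : _ = C1 * (\1_CK z * normc (fn a (z - w)))); last by ring.
  apply: ler_wpM2l; first exact: ltW.
  apply: ler_wpM2l => //.
  apply: le_trans (combination_le p1 q1 a1 stable ct0 dec sig1_gt a _) _.
  have St : S (z.2 - w.2) `^ th <= A `^ th * g z.2.
    have SE : S (z.2 - w.2) = A * (S (z.2 - w.2) / A) by field; rewrite gt_eqF.
    have SA0 : 0 <= S (z.2 - w.2) / A by rewrite divr_ge0 ?lattice_sum_ge0 ?(ltW A0).
    rewrite {1}SE powRM ?(ltW A0)//; apply: ler_wpM2l; first exact: powR_ge0.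
    by apply: le_trans (powR_tangent SA0) _; rewrite /g mulrA mulrAC.
  have kn : 0 <= kap * nrm a by rewrite mulr_ge0 ?(ltW kap0).
  by apply: le_trans (ler_wpM2l kn St) _; rewrite le_eqVlt; apply/orP; left; apply/eqP; ring.
- exact/measurable_EFinP.
- by move=> z _; rewrite lee_fin mulr_ge0.
Qed.

(** The constant of the upper sampling inequality without [eta]. *)
Definition top_const : R := C2 * (2 * K1) `^ ((p - 1) / p) * (2 * K2) `^ (d%:R * (q - 1) / q).

Let mixed_shift (a : vec) (w : plane) :
  ge0_mixed_norm p q (fun z : plane => normc (fn a (z - w))) = (nrm a)%:E.
Proof.
have mf := measurable_normc (cmeasurable_combination PhiL a).
rewrite (ge0_mixed_norm_shift p q w mf (fun z => normc_ge0 _)).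
by rewrite -(nrmE p1 q1 PhiL stable a).
Qed.

Let weighted_hoelder (a : vec) (w : plane) (b : 'rV[R]_d -> R) (C : R) : 0 < C ->
  measurable_fun setT b -> (forall y, 0 <= b y) ->
  (\int[@lebesgue_rV R d]_(y in rV_box K2) (b y `^ (q / (q - 1)))%:E <= (C * (2 * K2) ^+ d)%:E)%E ->
  (\int[leb]_z (kappa z * (normc (fn a (z - w)) * b z.2))%:E <= (top_const * C `^ th * nrm a)%:E)%E.
Proof.
move=> C0 mb b0 bC.
have V0 : 0 < (2 * K2) ^+ d by rewrite exprn_gt0// mulr_gt0.
have CV : 0 < C * (2 * K2) ^+ d by rewrite mulr_gt0.
have := box_hoelder K10 p1 q1 CV (mfn a w) (fun z => normc_ge0 _) mb b0 bC.
rewrite mixed_shift integral_CK => H.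
have mb2 : measurable_fun setT (fun z : plane => normc (fn a (z - w)) * b z.2).
  exact: (measurable_funM (mfn a w) (measurableT_comp mb measurable_snd)).
have nb0 (z : plane) : 0 <= normc (fn a (z - w)) * b z.2 by rewrite mulr_ge0 ?normc_ge0.
apply: (@le_trans _ _ (C2%:E * \int[leb]_z (\1_CK z * (normc (fn a (z - w)) * b z.2))%:E)%E).
  rewrite -ge0_integralZl//.
  - apply: ge0_le_integral => //.
    + by move=> z _; rewrite lee_fin mulr_ge0.
    + by apply/measurable_EFinP; exact: measurable_funM.
    + by apply: emeasurable_funM => //; apply/measurable_EFinP; exact: measurable_funM.
    move=> z _; rewrite -EFinM lee_fin [leRHS]mulrA ler_wpM2r//.
    by have /andP[] := kappa_le z.
  - by apply/measurable_EFinP; exact: measurable_funM.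
  - by move=> z _; rewrite lee_fin mulr_ge0.
  - by rewrite lee_fin ltW.
apply: le_trans (lee_wpmul2l _ H) _; first by rewrite lee_fin ltW.
rewrite -!EFinM lee_fin le_eqVlt; apply/orP; left; apply/eqP.
rewrite (powRM _ (ltW C0) (ltW V0)) -powR_mulrn; last by rewrite mulr_ge0 ?ltW.
rewrite -powRrM /top_const mulrA (mulrA d%:R).
by ring.
Qed.

Lemma mean_top (a : vec) (w : plane) :
  (\int[leb]_z (kappa z * normc (fn a (z - w)))%:E <= (top_const * nrm a)%:E)%E.
Proof.
have P1 : (\int[@lebesgue_rV R d]_(y in rV_box K2) (1 `^ (q / (q - 1)) : R)%:E <= (1 * (2 * K2) ^+ d)%:E)%E.
  by rewrite powR1 integral_cst_rV_box.
have := @weighted_hoelder a w (fun=> 1) 1 ltr01 (measurable_cst _) (fun=> ler01) P1.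
by rewrite powR1 mulr1; under eq_integral do rewrite mulr1.
Qed.

(** Cauchy-Schwarz between two bounds: with [t] the modulus and [b = S^th], the pointwise bound
    gives [t^2 <= kap * nrm a * b * t], and Hoelder bounds the mean of [b * t] under [kappa] through
    [top_const]. *)
Lemma mean_sqrt_top (A : R) (a : vec) (w : plane) : 0 < A ->
  (\int[@lebesgue_rV R d]_(y in rV_box K2) (S (y - w.2))%:E <= (A * (2 * K2) ^+ d)%:E)%E ->
  (\int[leb]_z (kappa z * normc (fn a (z - w)))%:E <=
     (Num.sqrt (top_const * (kap * A `^ th)) * nrm a)%:E)%E.
Proof.
move=> A0 SA; have n0 : 0 <= nrm a by exact: nrm_ge0.
pose b (y : 'rV[R]_d) := S (y - w.2) `^ th.
have mb : measurable_fun setT b by exact: (measurableT_comp (measurable_powR _) (mS w)).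
have b0 y : 0 <= b y by exact: powR_ge0.
have bA : (\int[@lebesgue_rV R d]_(y in rV_box K2) (b y `^ (q / (q - 1)))%:E <= (A * (2 * K2) ^+ d)%:E)%E.
  have bE y : b y `^ (q / (q - 1)) = S (y - w.2).
    rewrite /b -powRrM (_ : th * (q / (q - 1)) = 1); last by field; rewrite !gt_eqF ?subr_gt0.
    exact: powRr1 (lattice_sum_ge0 _).
  under eq_integral do rewrite bE.
  exact: SA.
have hH := @weighted_hoelder a w b A A0 mb b0 bA.
have T0 : 0 < top_const.
  by rewrite /top_const !mulr_gt0// powR_gt0// mulr_gt0.
have h0 : 0 < kap * A `^ th by rewrite mulr_gt0// powR_gt0.
set s := Num.sqrt (top_const * (kap * A `^ th)) * nrm a.
have point (z : plane) : normc (fn a (z - w)) <= kap * nrm a * b z.2.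
  exact: (combination_le p1 q1 a1 stable ct0 dec sig1_gt a (z - w)).
have [nz|nn] := eqVneq (nrm a) 0.
  rewrite /s nz mulr0 integral0_eq// => z _.
  have := point z; rewrite nz mulr0 mul0r => h.
  have -> : normc (fn a (z - w)) = 0 by apply/eqP; rewrite eq_le h normc_ge0.
  by rewrite mulr0.
have npos : 0 < nrm a by rewrite lt0r nn.
have s0 : 0 < s by rewrite /s mulr_gt0// sqrtr_gt0 mulr_gt0.
have ssE : s * s = top_const * (kap * A `^ th) * nrm a ^+ 2.
  by rewrite /s mulrACA -!expr2 sqr_sqrtr// ltW// mulr_gt0.
have c0 : 0 <= kap * nrm a / (2 * s).
  by apply: divr_ge0; [rewrite mulr_ge0 ?(ltW kap0)|lra].
pose X (z : plane) := kappa z * (normc (fn a (z - w)) * b z.2).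
have mX : measurable_fun setT X.
  exact: (measurable_funM mk (measurable_funM (mfn a w) (measurableT_comp mb measurable_snd))).
have X0 z : 0 <= X z by rewrite /X !mulr_ge0 ?normc_ge0.
apply: (@le_trans _ _ ((kap * nrm a / (2 * s))%:E * \int[leb]_z (X z)%:E + (s / 2)%:E * \int[leb]_z (kappa z)%:E)%E).
  have Zl (c : R) (g : plane -> R) : 0 <= c -> measurable_fun setT g -> (forall z, 0 <= g z) ->
      (c%:E * \int[leb]_z (g z)%:E = \int[leb]_z (c * g z)%:E)%E.
    move=> cc mg g0; rewrite -ge0_integralZl//; first exact/measurable_EFinP.
    by move=> z _; rewrite lee_fin.
  have s20 : 0 <= s / 2 by lra.
  rewrite (Zl _ _ c0 mX X0) (Zl _ _ s20 mk k0).
  have m1 : measurable_fun setT (fun z => (kap * nrm a / (2 * s) * X z)%:E).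
    by apply/measurable_EFinP; exact: measurable_funM.
  have m2 : measurable_fun setT (fun z => (s / 2 * kappa z)%:E).
    by apply/measurable_EFinP; exact: measurable_funM.
  rewrite -ge0_integralD//; last 2 first.
  - by move=> z _; rewrite lee_fin mulr_ge0.
  - by move=> z _; rewrite lee_fin mulr_ge0.
  apply: ge0_le_integral => //.
  - by move=> z _; rewrite lee_fin mulr_ge0 ?normc_ge0.
  - by apply/measurable_EFinP; exact: (measurable_funM mk (mfn a w)).
  - exact: emeasurable_funD.
  move=> z _; rewrite -EFinD lee_fin /X.
  set t := normc _; have t0 : 0 <= t by exact: normc_ge0.
  (* [2 s t <= t^2 + s^2]; since [kappa] has mass 1, the constant [s / 2] is its own mean. *)
  have key : t <= kap * nrm a / (2 * s) * (t * b z.2) + s / 2.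
    have h1 : t * t <= t * (kap * nrm a * b z.2) by apply: ler_wpM2l => //; exact: point.
    rewrite -(ler_pM2l s0).
    have -> : s * (kap * nrm a / (2 * s) * (t * b z.2) + s / 2) = (t * (kap * nrm a * b z.2) + s * s) / 2.
      by field; rewrite gt_eqF.
    have h2 : 0 <= (t - s) * (t - s) by rewrite -expr2 sqr_ge0.
    lra.
  have := ler_wpM2l (k0 z) key.
  rewrite mulrDr => /le_trans; apply.
  by rewrite le_eqVlt; apply/orP; left; apply/eqP; ring.
rewrite kappa1 mule1.
apply: (@le_trans _ _ ((kap * nrm a / (2 * s))%:E * (top_const * A `^ th * nrm a)%:E + (s / 2)%:E)%E).
  by rewrite leeD2r// lee_wpmul2l ?lee_fin.
rewrite -EFinM -EFinD lee_fin.
have -> : kap * nrm a / (2 * s) * (top_const * A `^ th * nrm a) = s * s / (2 * s).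
  by rewrite ssE; field; rewrite gt_eqF.
rewrite le_eqVlt; apply/orP; left; apply/eqP; field.
by rewrite gt_eqF.
Qed.

End window_bounds.

(** * Sampling *)

Section window_dichotomy.
Variables (R : realType) (d N : nat) (s K : R).
Hypotheses (d0 : (0 < d)%N) (ds : d%:R < s) (K0 : 0 < K).

Local Notation S y := (@lattice_sum R d N s y).
Local Notation S0 := (lattice_total d s).

Let s0 : 0 < s. Proof. by apply: le_lt_trans ds. Qed.

Let sup_half (y : 'rV[R]_d) J : S y <= \sum_(k < J) sup_term d s (1/2) k
                   + #|{: {ffun 'I_d -> 'I_(N.*2.+1)}}|%:R * J.+1%:R `^ (- s).
Proof.
have half0 : 0 < 1/2 :> R by lra.
have half1 : 1/2 < 1 :> R by lra.
apply: (lattice_sum_sup s0 J half0 half1) => i k; apply: (@near_count_le R N _ _ k.*2.+1); rewrite -[k.*2.+1%:R]natr1 -mul2n natrM; lra.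
Qed.

(** If [2 * K < 9/20], all differences of points of the window lie within [9/20] of the origin,
    where no spike occurs; otherwise the window is long enough for the mean counts. The value [9/20]
    meets both requirements. *)
Lemma window_dichotomy : exists2 U : R, 0 < U &
  (forall y : 'rV[R]_d, `|y| <= 2 * K -> S y <= U) /\
  (U <= 23/10 * (2 * S0) \/
   exists2 A : R, 0 < A & U * A <= 104/100 * (2 * S0) ^+ 2 /\
     forall w : 'rV[R]_d,
     (\int[lebesgue_rV]_(y in rV_box K) (S (y - w))%:E <= (A * (2 * K) ^+ d)%:E)%E).
Proof.
have S0p : 0 < S0 by exact: lattice_total_gt0.
have shells := lattice_total_shells d0 ds.
have [Kw|Kn] := leP (9/20) (2 * K); last first.
  exists (3 * S0); first by lra.
  split; last by left; lra.
  move=> y yK; apply: (@le_add_powRN _ s s0 _ _ #|{: {ffun 'I_d -> 'I_(N.*2.+1)}}|%:R) => J.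
  apply: (@le_trans _ _ (\sum_(k < J) sup_term d s (11/20) k
                   + #|{: {ffun 'I_d -> 'I_(N.*2.+1)}}|%:R * J.+1%:R `^ (- s))).
    have sp0 : 0 < 11/20 :> R by lra.
    have sp1 : 11/20 < 1 :> R by lra.
    apply: (lattice_sum_sup s0 J sp0 sp1) => i k; apply: near_count_narrow.
    have y9 : `|y| <= 9/20 by lra.
    have k0 : 0 <= 9/20 :> R by lra.
    by move: y9; rewrite (rV_norm_le _ k0) => /forallP/(_ i).
  by rewrite lerD2r; apply: sup_term_narrow.
have [small|prod] := lattice_dichotomy d0 ds shells.
  exists (23/5 * S0); first by lra.
  split; last by left; lra.
  move=> y _; apply: (@le_add_powRN _ s s0 _ _ #|{: {ffun 'I_d -> 'I_(N.*2.+1)}}|%:R) => J.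
  by apply: le_trans (sup_half y J) _; rewrite lerD2r.
(* [U] is the supremum of the partial sums rather than of [S] itself, so that the product bound of
   the dichotomy passes to it. *)
pose E := [set x | exists M : nat, x = \sum_(k < M) sup_term d s (1/2) k].
have [B hB] := @shell_sum_bounded R d s d0 ds.
have supE : has_sup E.
  split; first by exists (\sum_(k < 0) sup_term d s (1/2) k); exists 0%N.
  exists (2 ^+ d * B) => _ [M ->].
  apply: (@le_trans _ _ (2 ^+ d * \sum_(k < M) shell_term d s k)).
    by rewrite mulr_sumr; apply: ler_sum => k _; exact: sup_term_half_le.
  by rewrite ler_wpM2l// exprn_ge0.
have Ege M : \sum_(k < M) sup_term d s (1/2) k <= sup E.
  by apply: ub_le_sup; [case: supE|exists M].
have SU (y : 'rV[R]_d) : S y <= sup E.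
  apply: (@le_add_powRN _ s s0 _ _ #|{: {ffun 'I_d -> 'I_(N.*2.+1)}}|%:R) => J.
  by apply: le_trans (sup_half y J) _; rewrite lerD2r.
have U1 : 1 <= sup E.
  apply: le_trans (SU 0).
  have hN : (N < N.*2.+1)%N by lia.
  rewrite /lattice_sum (bigD1 [ffun=> Ordinal hN])//=.
  have -> : box_point R [ffun=> Ordinal hN] = 0 :> 'rV[R]_d.
    by apply/rowP => i; rewrite !mxE ffunE subrr.
  by rewrite subrr normr0 addr0 powR1 lerDl sumr_ge0// => k _; exact: powR_ge0.
have U0 : 0 < sup E by lra.
exists (sup E) => //; split => //; right.
(* [A] is the largest value the product bound admits; every partial sum of averages lies below
   it. *)
exists (104/100 * (2 * S0) ^+ 2 / sup E).
  apply: divr_gt0 => //; apply: mulr_gt0; first by lra.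
  by apply: exprn_gt0; lra.
split; first by rewrite mulrCA mulfV ?gt_eqF// mulr1.
move=> w; apply: integral_lattice_sum => // J.
rewrite ler_pdivlMr// mulrC; have [A0|A0] := leP (\sum_(j < J) avg_term d s j) 0.
  apply: (@le_trans _ _ 0); first by rewrite mulr_ge0_le0// ltW.
  by rewrite mulr_ge0// ?sqr_ge0//; lra.
rewrite -ler_pdivlMr//; apply: ge_sup; first by case: supE.
by move=> _ [M ->]; rewrite ler_pdivlMr.
Qed.

End window_dichotomy.

(** * Two-sided deviation *)

Section two_sided_deviation.
Context dT dV (T : measurableType dT) (V : measurableType dV) (R : realType).
Variables (P : probability T R) (Q : probability V R) (J : eqType).
Variable X : J -> T -> V.
Hypothesis mX : forall j, measurable_fun setT (X j).
Hypothesis law : forall j A, measurable A -> P (X j @^-1` A) = Q A.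
Hypothesis indep : mutually_independent P X.
Variables (s : seq J) (I : finType).
Hypotheses (us : uniq s) (s0 : (0 < size s)%N).
Local Notation vec := {ffun I -> R}.
Local Notation E F := (Rintegral Q [set: V] F).
Local Notation M := ((size s)%:R : R).
Variables (N : vec -> R) (al be : R) (Psi : vec -> V -> R) (om : V -> R) (B c eta Top : R) (D : nat).
Hypotheses (al0 : 0 < al) (be0 : 0 < be).
Hypothesis ND : forall a b : vec, N (a + b) <= N a + N b.
Hypothesis NZ : forall t (a : vec), N (t *: a) = `|t| * N a.
Hypothesis Nlow : forall (a : vec) i, al * `|a i| <= N a.
Hypothesis Nup : forall (a : vec) t, (forall i, `|a i| <= t) -> N a <= be * t.
Hypothesis mPsi : forall a, measurable_fun setT (Psi a).
Hypothesis Psi0 : forall a v, 0 <= Psi a v.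
Hypothesis PsiB : forall a v, Psi a v <= B * N a.
Hypothesis PsiD : forall a b v, `|Psi a v - Psi b v| <= Psi (a - b) v.
Hypotheses (mom : measurable_fun setT om) (om01 : forall v, 0 <= om v <= 1).
Hypotheses (B0 : 0 < B) (c0 : 0 < c) (eta0 : 0 < eta) (Top0 : 0 < Top).
Hypothesis ETop : forall a, E (Psi a) <= Top * N a.
Hypothesis cases : B <= 23/10 * c \/ exists h, [/\ 0 < h, B * h <= 104/100 * c ^+ 2, eta <= h,
  forall a, E (Psi a) <= Num.sqrt (Top * h) * N a &
  forall a, E (fun v => om v * Psi a v) <= h * N a].
Hypotheses (ID : #|I| = (2 * D)%N) (D0 : (0 < D)%N).
Hypothesis x2_ge : 3 * ln 2 * D%:R <= M * rate2 eta.
Hypothesis x1_ge : 2 * (4 * c + 1) ^+ D <= expR (M * (eta ^+ 2 / (8 * c ^+ 2))).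

Local Notation x1 := (M * (eta ^+ 2 / (8 * c ^+ 2))).
Local Notation x2 := (M * rate2 eta).
Local Notation fail := ((4 * c + 1) ^+ D * expR (- x1) +
     2 * ((2 * c + 1/4) * (c + 1/4)) ^+ D / (3 * ln 2 ^+ 2 * D%:R) * expR (- x2)).

Let N_ge0 a : 0 <= N a.
Proof.
have N0 : N 0 = 0 by rewrite -(scale0r 0) NZ normr0 mul0r.
by have := ND a (- a); rewrite subrr -scaleN1r NZ normrN1 mul1r N0; lra.
Qed.

Let bPsi a : bounded_measurable (Psi a).
Proof. by split => //; exists (B * N a) => v; rewrite ger0_norm. Qed.

Let omPsi a v := - (om v * Psi a v).

Let om_le a v : om v * Psi a v <= Psi a v.
Proof. by have /andP[_ h] := om01 v; rewrite ler_piMl. Qed.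

Let om_ge0 a v : 0 <= om v * Psi a v.
Proof. by have /andP[h _] := om01 v; rewrite mulr_ge0. Qed.

Let bom a : bounded_measurable (fun v => om v * Psi a v).
Proof.
split; first exact: measurable_funM.
by exists (B * N a) => v; rewrite ger0_norm//; exact: le_trans (om_le a v) (PsiB a v).
Qed.

Let bomPsi a : bounded_measurable (omPsi a).
Proof.
have [m [C hC]] := bom a; split; first exact: measurableT_comp.
by exists C => v; rewrite normrN.
Qed.

Let second_moment (F : V -> R) a : measurable_fun setT F -> (forall v, `|F v| <= Psi a v) ->
  E (fun v => F v * F v) <= B * N a * E (fun v => `|F v|).
Proof.
move=> mF FP; have bF : bounded_measurable F.
  by split => //; exists (B * N a) => v; exact: le_trans (FP v) (PsiB a v).
have bnF : bounded_measurable (fun v => `|F v|).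
  by split; [exact: measurableT_comp|exists (B * N a) => v; rewrite normr_id; exact: le_trans (FP v) (PsiB a v)].
rewrite -meanZ//; apply: le_mean => [||v].
- exact: bounded_measurableM.
- by apply: bounded_measurableM => //; exact: bounded_measurable_cst.
rewrite -[leLHS]ger0_norm; last by rewrite -expr2 sqr_ge0.
by rewrite normrM ler_wpM2r//; exact: le_trans (FP v) (PsiB a v).
Qed.

Let second_moment_diff (F : V -> R) (W : vec -> V -> R) (k : R) a : bounded_measurable F ->
  (forall v, `|F v| <= W a v) -> (forall v, W a v <= Psi a v) -> bounded_measurable (W a) ->
  E (W a) <= k * N a -> E (fun v => F v * F v) <= B * k * N a ^+ 2.
Proof.
move=> [mF [C hC]] FW WP bW Ek.
have FP v : `|F v| <= Psi a v by exact: le_trans (FW v) (WP v).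
apply: le_trans (second_moment mF FP) _.
have bnF : bounded_measurable (fun v => `|F v|).
  by split; [exact: measurableT_comp|exists C => v; rewrite normr_id].
have h := le_trans (le_mean Q bnF bW FW) Ek.
have -> : B * k * N a ^+ 2 = B * N a * (k * N a) by rewrite expr2; ring.
by apply: ler_wpM2l => //; rewrite mulr_ge0// ltW.
Qed.

(** When [Top > h], put [u = sqrt (Top / h)]: the mean is at most [sqrt (Top * h) = u h], while the
    claim allows [Top = u^2 h]. As [eta <= h], the gap [u (u-1) h] is at least [(u-1) eta], so a
    deviation [u eta] is affordable, matching a second moment of order [B u h]. *)
Let upper : exists Bad : set T, [/\ measurable Bad, (P Bad <= fail%:E)%E &
  forall w, ~ Bad w -> forall a, N a = 1 -> \sum_(j <- s) Psi a (X j w) <= M * (Top + eta)].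
Proof.
have lo0 : 0 <= 0 :> R by [].
have rg (a : vec) : N a <= 1 -> forall v, 0 <= Psi a v <= 0 + B.
  move=> a1 v; rewrite Psi0 add0r; apply: le_trans (PsiB a v) _.
  by rewrite ler_piMr// ltW.
have lip a b v : Psi a v - Psi b v <= B * N (a - b).
  by apply: le_trans (ler_norm _) _; exact: le_trans (PsiD a b v) (PsiB _ v).
pose good u := 1 <= u /\ (forall a, N a = 1 -> E (Psi a) + u * eta <= Top + eta) /\
  (B <= 23/10 * c \/ (B * eta <= 104/100 * c ^+ 2 /\
  (forall a, N a <= 1 -> E (fun v => Psi a v * Psi a v) <= 104/100 * c ^+ 2 * u) /\
  (forall a b, E (fun v => (Psi a v - Psi b v) * (Psi a v - Psi b v))
     <= 104/100 * c ^+ 2 * u * N (a - b) ^+ 2))).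
suff [u [u1 [uE tails]]] : exists u, good u.
  have [Bad [mBad PBad HBad]] := uniform_deviation mX law indep us s0 al0 be0 ND NZ Nlow Nup
    bPsi rg lip B0 c0 u1 eta0 lo0 tails ID D0 x2_ge x1_ge.
  exists Bad; split => // w nw a a1.
  apply: le_trans (HBad w nw a _) _; first by rewrite a1.
  by rewrite ler_wpM2l// uE.
case: cases => [Bc|[h [h0 Bh eh ES Eom]]].
  exists 1; split => //; split; last by left.
  by move=> a a1; have := ETop a; rewrite a1; lra.
have second u a (F : V -> R) : bounded_measurable F -> (forall v, `|F v| <= Psi a v) ->
    E (Psi a) <= u * h * N a -> 0 <= u -> E (fun v => F v * F v) <= 104/100 * c ^+ 2 * u * N a ^+ 2.
  move=> bF FP EP u0; apply: le_trans (second_moment_diff (W := Psi) bF FP (fun v => lexx _) (bPsi a) EP) _.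
  rewrite ler_wpM2r ?sqr_ge0//; have := ler_wpM2r u0 Bh; lra.
have bdiff a b : bounded_measurable (fun v => Psi a v - Psi b v).
  have [mb [C hC]] := bPsi b.
  apply: bounded_measurableD => //; split; first exact: measurableT_comp.
  by exists C => x; rewrite normrN.
have Beta : B * eta <= 104/100 * c ^+ 2.
  by apply: le_trans Bh; rewrite ler_wpM2l// ltW.
have goodE u : 1 <= u -> (forall a, E (Psi a) <= u * h * N a) ->
    (forall a, N a = 1 -> E (Psi a) + u * eta <= Top + eta) -> good u.
  move=> u1 Eu uE; split => //; split => //; right; split => //; split.
    move=> a a1; apply: (@le_trans _ _ (104/100 * c ^+ 2 * u * N a ^+ 2)).
      apply: second => //; last by lra.
      by move=> v; rewrite ger0_norm.
    have cu : 0 <= 104/100 * c ^+ 2 * u.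
      by apply: mulr_ge0; [apply: mulr_ge0; [lra|exact: sqr_ge0]|lra].
    by rewrite ler_piMr// exprn_ile1.
  by move=> a b; apply: second => //; lra.
have [Th|hT] := leP Top h.
  exists 1; apply: goodE => // a.
    by rewrite mul1r; apply: le_trans (ETop a) _; rewrite ler_wpM2r.
  by move=> a1; have := ETop a; rewrite a1; lra.
pose u := Num.sqrt (Top / h).
have u2 : u * u = Top / h by rewrite -expr2 sqr_sqrtr// divr_ge0// ltW.
have q1 : 1 <= Top / h by rewrite ler_pdivlMr// mul1r ltW.
have u1 : 1 <= u by have := ler_wsqrtr q1; rewrite sqrtr1.
have hu : Num.sqrt (Top * h) = u * h.
  transitivity (u * Num.sqrt (h ^+ 2)); last by rewrite sqrtr_sqr ger0_norm// ltW.
  rewrite /u -sqrtrM; last by rewrite divr_ge0// ltW.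
  by congr Num.sqrt; field; rewrite gt_eqF.
exists u; apply: goodE => // a; first by rewrite -hu.
move=> a1; have := ES a; rewrite a1 hu.
have TE : Top = u * u * h by rewrite u2; field; rewrite gt_eqF.
have : 0 <= (u - 1) * (u * h - eta).
  apply: mulr_ge0; first by lra.
  by rewrite subr_ge0; apply: le_trans eh _; rewrite ler_peMl// ltW.
lra.
Qed.

(** The weighted samples have means at most [h], so [u = 1] suffices for [- om * Psi]; since
    [om <= 1], the bound passes to the unweighted sum. *)
Let lower : exists Bad : set T, [/\ measurable Bad, (P Bad <= fail%:E)%E &
  forall w, ~ Bad w -> forall a, N a = 1 ->
    M * (E (fun v => om v * Psi a v) - eta) <= \sum_(j <- s) Psi a (X j w)].
Proof.
have lo0 : - B <= 0 by rewrite oppr_le0 ltW.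
have rg (a : vec) : N a <= 1 -> forall v, - B <= omPsi a v <= - B + B.
  move=> a1 v; rewrite addNr /omPsi lerN2 oppr_le0 om_ge0 andbT.
  apply: le_trans (om_le a v) _; apply: le_trans (PsiB a v) _.
  by rewrite ler_piMr// ltW.
have dif a b v : `|omPsi a v - omPsi b v| <= om v * Psi (a - b) v.
  have /andP[h _] := om01 v.
  have -> : omPsi a v - omPsi b v = - (om v * (Psi a v - Psi b v)) by rewrite /omPsi; ring.
  by rewrite normrN normrM (ger0_norm h) ler_wpM2l.
have lip a b v : omPsi a v - omPsi b v <= B * N (a - b).
  apply: le_trans (ler_norm _) _; apply: le_trans (dif a b v) _.
  exact: le_trans (om_le _ v) (PsiB _ v).
have tails : B <= 23/10 * c \/ (B * eta <= 104/100 * c ^+ 2 /\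
  (forall a, N a <= 1 -> E (fun v => omPsi a v * omPsi a v) <= 104/100 * c ^+ 2 * 1) /\
  (forall a b, E (fun v => (omPsi a v - omPsi b v) * (omPsi a v - omPsi b v))
     <= 104/100 * c ^+ 2 * 1 * N (a - b) ^+ 2)).
  case: cases => [Bc|[h [h0 Bh eh ES Eom]]]; [by left|right].
  split; first by apply: le_trans Bh; rewrite ler_wpM2l// ltW.
  have second a (F : V -> R) : bounded_measurable F -> (forall v, `|F v| <= om v * Psi a v) ->
    E (fun v => F v * F v) <= 104/100 * c ^+ 2 * 1 * N a ^+ 2.
    move=> bF FP; apply: le_trans (second_moment_diff (W := fun a v => om v * Psi a v) bF FP (om_le a) (bom a) (Eom a)) _ => //.
    by rewrite ler_wpM2r ?sqr_ge0//; lra.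
  split.
    move=> a a1; apply: (@le_trans _ _ (104/100 * c ^+ 2 * 1 * N a ^+ 2)).
      apply: second => // v; first by rewrite /omPsi normrN ger0_norm.
    have cu : 0 <= 104/100 * c ^+ 2 * 1.
      by rewrite mulr1; apply: mulr_ge0; [lra|exact: sqr_ge0].
    by rewrite ler_piMr// exprn_ile1.
  move=> a b; apply: second => //.
  apply: bounded_measurableD => //.
  have [mb [C hC]] := bomPsi b; split; first exact: measurableT_comp.
  by exists C => x; rewrite normrN.
have [Bad [mBad PBad HBad]] := uniform_deviation mX law indep us s0 al0 be0 ND NZ Nlow Nup
    bomPsi rg lip B0 c0 (lexx 1) eta0 lo0 tails ID D0 x2_ge x1_ge.
exists Bad; split => // w nw a a1.
have := HBad w nw a; rewrite a1 => /(_ (lexx _)).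
have -> : E (omPsi a) = - E (fun v => om v * Psi a v).
  by rewrite -mulN1r -meanZ//; apply: eq_Rintegral => v _; rewrite mulN1r.
rewrite mul1r /omPsi sumrN => h.
apply: (@le_trans _ _ (\sum_(j <- s) om (X j w) * Psi a (X j w))); first by lra.
by apply: ler_sum => j _; exact: om_le.
Qed.

Lemma two_sided_deviation : exists Bad : set T, [/\ measurable Bad, (P Bad <= (2 * fail)%:E)%E &
  forall w, ~ Bad w -> forall a, N a = 1 ->
    M * (E (fun v => om v * Psi a v) - eta) <= \sum_(j <- s) Psi a (X j w) <= M * (Top + eta)].
Proof.
have [Bu [mu Pu Hu]] := upper; have [Bl [ml Pl Hl]] := lower.
exists (Bu `|` Bl); split; first exact: measurableU.
  apply: le_trans; first exact: (measureU2 P mu ml).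
  by rewrite mulr_natl mulr2n EFinD; apply: leeD.
move=> w nw a a1; apply/andP; split.
  by apply: Hl => // h; apply: nw; right.
by apply: Hu => // h; apply: nw; left.
Qed.

End two_sided_deviation.

(** * Measurability of the uniform event *)

Section uniform_event.
Context dT (T : measurableType dT) (R : realType).
Variable I : finType.
Local Notation vec := {ffun I -> R}.
Variables (N : vec -> R) (al be Lam lo hi : R) (A : set vec) (Y : vec -> T -> R).
Hypotheses (al0 : 0 < al) (be0 : 0 < be) (Lam0 : 0 <= Lam).
Hypothesis ND : forall a b : vec, N (a + b) <= N a + N b.
Hypothesis NZ : forall s (a : vec), N (s *: a) = `|s| * N a.
Hypothesis Nlow : forall (a : vec) i, al * `|a i| <= N a.
Hypothesis Nup : forall (a : vec) s, (forall i, `|a i| <= s) -> N a <= be * s.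
Hypothesis AZ : forall t (a : vec), 0 < t -> A a -> A (t *: a).
Hypothesis mY : forall a, measurable_fun setT (Y a).
Hypothesis YZ : forall t a w, 0 < t -> Y (t *: a) w = t * Y a w.
Hypothesis YL : forall a b w, `|Y a w - Y b w| <= Lam * N (a - b).

Let N_ge0 a : 0 <= N a.
Proof.
have N0 : N 0 = 0 by rewrite -(scale0r 0) NZ normr0 mul0r.
by have := ND a (- a); rewrite subrr -scaleN1r NZ normrN1 mul1r N0; lra.
Qed.

Let N_lip a b : `|N a - N b| <= N (a - b).
Proof.
have h1 : N a <= N (a - b) + N b by apply: le_trans (ND _ _); rewrite subrK.
have h2 : N b <= N (a - b) + N a.
  rewrite -[N (a - b)]mul1r -normrN1 -NZ scaleN1r opprB.
  by apply: le_trans (ND _ _); rewrite subrK.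
by rewrite ler_norml; apply/andP; split; lra.
Qed.

Let holds a w := lo * N a <= Y a w <= hi * N a.

Let m_holds a : measurable [set w | holds a w].
Proof.
rewrite (_ : [set w | holds a w] = (Y a) @^-1` `[lo * N a, hi * N a]); last first.
  by apply/seteqP; split => w /=; rewrite in_itv.
by rewrite -[X in measurable X]setTI; apply: mY => //; exact: measurable_itv.
Qed.

(** The nets consist of admissible vectors and both sides are Lipschitz, so the conditions on
    countably many vectors imply all others. Scaling by [1 / (1 + N a)] brings any vector into the
    unit ball without dividing by [N a]. *)
Lemma measurable_uniform_event :
  measurable [set w | forall a, A a -> lo * N a <= Y a w <= hi * N a].
Proof.
pose A1 := [set a | A a /\ N a <= 1].
have k0 k : 0 < k.+1%:R^-1 :> R by rewrite invr_gt0.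
have /choice[net netP] : forall k : nat, exists s : seq vec, (forall x, x \in s -> A1 x) /\
    forall x, A1 x -> exists2 y, y \in s & N (x - y) < k.+1%:R^-1.
  move=> k; have [s [sA _ sn]] := net_exists al0 be0 ND NZ Nlow Nup (k0 k) (S := A1) (fun x h => h.2).
  by exists s.
rewrite (_ : [set w | _] = \bigcap_k \big[setI/setT]_(a <- net k) [set w | holds a w]); last first.
  apply/seteqP; split => w /=.
    move=> H k _; rewrite -bigcap_seq => a /= ak; apply: H.
    by have [/(_ a ak)[]] := netP k.
  move=> H a Aa.
  pose t := (1 + N a)^-1.
  have N1 : 0 < 1 + N a by have := N_ge0 a; lra.
  have t0 : 0 < t by rewrite invr_gt0.
  have A1a : A1 (t *: a).
    split; first exact: AZ.
    by rewrite NZ gtr0_norm// mulrC ler_pdivrMr// mul1r lerDr.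
  pose C := Lam + `|lo| + `|hi| + 1.
  have C0 : 0 < C by rewrite ltr_wpDl// !addr_ge0.
  have appr e : 0 < e -> lo * N (t *: a) <= Y (t *: a) w + e /\ Y (t *: a) w <= hi * N (t *: a) + e.
    move=> e0; pose k := Num.truncn (C / e).
    have Ck : C * k.+1%:R^-1 < e.
      by rewrite ltr_pdivrMr// mulrC -ltr_pdivrMr// truncnS_gt.
    have [_ /(_ _ A1a)[b bk ab]] := netP k.
    have := H k Logic.I; rewrite -bigcap_seq => /(_ b bk) /andP[h1 h2].
    have y1 := YL (t *: a) b w; have n1 := N_lip (t *: a) b.
    move: (N (t *: a)) (N b) (N (t *: a - b)) (Y (t *: a) w) (Y b w) (N_ge0 (t *: a - b)) ab y1 n1 h1 h2.
    move=> x y z u v z0 zk uv xy h1 h2.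
    have zC : C * z < e by apply: lt_trans Ck; rewrite ltr_pM2l.
    have l1 : `|lo * (x - y)| <= `|lo| * z by rewrite normrM ler_wpM2l.
    have l2 : `|hi * (x - y)| <= `|hi| * z by rewrite normrM ler_wpM2l.
    move: uv l1 l2; rewrite !ler_norml => /andP[? ?] /andP[? ?] /andP[? ?].
    have l0 : 0 <= `|lo| * z by rewrite mulr_ge0.
    have l3 : 0 <= `|hi| * z by rewrite mulr_ge0.
    rewrite /C in zC.
    by have L0 : 0 <= Lam * z; [rewrite mulr_ge0 | split; lra].
  have h1 : lo * N (t *: a) <= Y (t *: a) w.
    by apply/ler_addgt0Pr => e /appr[].
  have h2 : Y (t *: a) w <= hi * N (t *: a).
    by apply/ler_addgt0Pr => e /appr[].
  move: h1 h2; rewrite YZ// NZ gtr0_norm// !(mulrCA _ t) !ler_pM2l// => h1 h2.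
  by rewrite h1 h2.
apply: bigcapT_measurable => k.
by apply: bigsetI_measurable => a _; exact: m_holds.
Qed.

End uniform_event.

Section density.
Context dV (V : measurableType dV) (R : realType).
Variables (mu : {measure set V -> \bar R}) (Q : probability V R) (kappa : V -> R).
Hypotheses (mk : measurable_fun setT kappa) (k0 : forall v, 0 <= kappa v).
Hypothesis QE : forall A, measurable A -> (Q A = \int[mu]_(v in A) (kappa v)%:E)%E.

Lemma mean_density F : bounded_measurable F -> (forall v, 0 <= F v) ->
  ((Rintegral Q setT F)%:E = \int[mu]_v (kappa v * F v)%:E)%E.
Proof.
move=> bF F0.
have GQ A : measurable A -> (\int[mu]_(x in idfun @^-1` A) (kappa x)%:E = 1%:E * Q A)%E.
  by move=> mA; rewrite mul1e QE.
have mid : measurable_fun setT (idfun : V -> V) by exact: measurable_id.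
have := ge0_integral_weight mk k0 mid ler01 GQ bF.1 F0.
rewrite mul1e /= => ->; rewrite /Rintegral fineK//.
exact: integrable_fin_num (bounded_measurable_integrable Q bF).
Qed.

End density.

(** * Identification of the constants *)

Section constants.
Variables (R : realType) (d : nat) (p q alpha1 ct s1 s2 : R).
Hypotheses (p1 : 1 < p) (q1 : 1 < q) (d0 : (0 < d)%N) (a1 : 0 < alpha1) (ct0 : 0 < ct).
Local Notation sig1 := (s1 * p / (p - 1)).
Local Notation sig2 := (s2 * q / (q - 1)).
Hypotheses (sig1_gt : 1 < sig1) (sig2_gt : d%:R < sig2).
Local Notation kap := (@profile_const R p alpha1 ct s1).
Local Notation th := ((q - 1) / q).
Local Notation S2 := (lattice_total d sig2).
Local Notation cs := (cstar d p q ct alpha1 s1 s2).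

Let p0 : 0 < p. Proof. exact: lt_trans p1. Qed.
Let q0 : 0 < q. Proof. exact: lt_trans q1. Qed.
Let th0 : 0 < th. Proof. by rewrite divr_gt0 ?subr_gt0. Qed.
Let th1 : th < 1. Proof. by rewrite ltr_pdivrMr// mul1r gtrBl. Qed.
Let kap0 : 0 < kap. Proof. exact: profile_const_gt0. Qed.
Let S20 : 0 < S2. Proof. exact: lattice_total_gt0. Qed.

(** [4 / 2^((p+q)/(pq)) = 2^((p-1)/p) * 2^((q-1)/q)]: one factor [2] inside the power of each
    lattice sum. *)
Lemma cstarE : cs = kap * (2 * S2) `^ th.
Proof.
have S10 : 0 < int_total sig1 by exact: int_total_gt0.
rewrite /profile_const (powRM _ _ (ltW S10))// (powRM _ _ (ltW S20))//.
rewrite /cstar -/(int_total sig1) -/(lattice_total d sig2).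
set A := int_total sig1 `^ _; set B := lattice_total d sig2 `^ _.
have e4 : 2 `^ ((p + q) / (p * q)) * (2 `^ ((p - 1) / p) * 2 `^ th) = 4 :> R.
  have n2 : (2 : R) != 0 by rewrite pnatr_eq0.
  rewrite -!powRD ?n2 ?implybT//.
  have -> : (p + q) / (p * q) + ((p - 1) / p + th) = 2%:R.
    by field; rewrite !gt_eqF.
  by rewrite powR_mulrn// expr2; ring.
have w0 : 0 < 2 `^ ((p + q) / (p * q)) :> R by rewrite powR_gt0.
rewrite -e4; field; rewrite !gt_eqF//.
Qed.

Lemma cstar_gt0 : 0 < cs.
Proof. by rewrite cstarE mulr_gt0// powR_gt0// mulr_gt0. Qed.

(** As [0 < th < 1], a factor above 1 taken to the power [th] costs no more than itself; the same
    holds for [104/100] in the product. *)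
Lemma sup_const_small (U : R) : 0 < U -> U <= 23/10 * (2 * S2) -> kap * U `^ th <= 23/10 * cs.
Proof.
move=> U0 h; rewrite cstarE mulrCA ler_pM2l//.
have S22 : 0 <= 2 * S2 by rewrite mulr_ge0// ltW.
apply: (@le_trans _ _ ((23/10 * (2 * S2)) `^ th)).
  by apply: ge0_ler_powR => //; rewrite ?nnegrE ?(ltW th0) ?(ltW U0)//; lra.
have t0 : 0 <= 23/10 :> R by lra.
rewrite (powRM _ t0 S22); apply: ler_wpM2r; first exact: powR_ge0.
have t1 : 1 <= 23/10 :> R by lra.
by rewrite -[leRHS](powRr1 t0); apply: ler_powR => //; exact: ltW.
Qed.

Lemma sup_const_prod (U A : R) : 0 < U -> 0 < A -> U * A <= 104/100 * (2 * S2) ^+ 2 ->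
  kap * U `^ th * (kap * A `^ th) <= 104/100 * cs ^+ 2.
Proof.
move=> U0 A0 h; have S22 : 0 <= 2 * S2 by rewrite mulr_ge0// ltW.
rewrite cstarE.
have -> : kap * U `^ th * (kap * A `^ th) = kap ^+ 2 * (U * A) `^ th.
  by rewrite (powRM _ (ltW U0) (ltW A0)) expr2; ring.
have -> : 104/100 * (kap * (2 * S2) `^ th) ^+ 2 = kap ^+ 2 * (104/100 * ((2 * S2) `^ th * (2 * S2) `^ th)).
  by rewrite !expr2; ring.
apply: ler_wpM2l; first exact: sqr_ge0.
have t0 : 0 <= 104/100 :> R by lra.
have q20 : 0 <= (2 * S2) ^+ 2 by exact: sqr_ge0.
apply: (@le_trans _ _ ((104/100 * (2 * S2) ^+ 2) `^ th)).
  apply: ge0_ler_powR => //; rewrite ?nnegrE ?(ltW th0)//.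
  - by rewrite mulr_ge0 ?ltW.
  - exact: mulr_ge0.
rewrite (powRM _ t0 q20) expr2 (powRM _ S22 S22); apply: ler_wpM2r.
  by rewrite mulr_ge0 ?powR_ge0.
have t1 : 1 <= 104/100 :> R by lra.
by rewrite -[leRHS](powRr1 t0); apply: ler_powR => //; exact: ltW.
Qed.

End constants.

Section probability_constants.
Variables (R : realType) (d r N : nat) (cs eta M : R).
Hypotheses (r0 : (0 < r)%N) (cs0 : 0 < cs) (eta0 : 0 < eta) (M0 : 0 <= M).
Local Notation D := (r * (2 * N + 1) ^ d.+1)%N.

Lemma dim_gt0 : (0 < D)%N.
Proof. by rewrite muln_gt0 r0 expn_gt0 addn1. Qed.

Lemma coef_A1E : coef_A1 d r N cs = 2 * (4 * cs + 1) ^+ D.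
Proof.
have c1 : 0 < 4 * cs + 1 by have := cs0; lra.
by rewrite /coef_A1 expRM_natl lnK// posrE.
Qed.

Lemma coef_A2E : coef_A2 d r N cs =
  4 * ((2 * cs + 1/4) * (cs + 1/4)) ^+ D / (3 * ln 2 ^+ 2 * D%:R).
Proof. by rewrite /coef_A2 natrM; congr (_ / _); ring. Qed.

(** Dropping [eta] from [6 * cs + eta] gives the right-hand side. *)
Lemma rate1_le : 3 * eta ^+ 2 / (4 * cs * (6 * cs + eta)) <= eta ^+ 2 / (8 * cs ^+ 2).
Proof.
have c0 := cs0; have e0 := eta0.
have p1 : 0 < 4 * cs * (6 * cs + eta) by apply: mulr_gt0; lra.
have p2 : 0 < 8 * cs ^+ 2 by rewrite mulr_gt0// exprn_gt0.
rewrite ler_pdivrMr// mulrAC ler_pdivlMr//.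
have : 0 <= eta ^+ 2 * (cs * eta) by rewrite mulr_ge0 ?sqr_ge0// mulr_ge0 ?ltW.
have -> : 3 * eta ^+ 2 * (8 * cs ^+ 2) = eta ^+ 2 * (24 * cs ^+ 2) by ring.
have -> : eta ^+ 2 * (4 * cs * (6 * cs + eta)) = eta ^+ 2 * (24 * cs ^+ 2) + 4 * (eta ^+ 2 * (cs * eta)) by ring.
lra.
Qed.

(** Multiplying the assumed lower bound on [M] by [rate2 eta] gives [3 * ln 2 * D] exactly. *)
Lemma sample_size_rate :
  54 * r%:R * Num.sqrt 2 * ln 2 * ((2 * N + 1) ^ d.+1)%:R / eta * (2 + 81 / eta) < M ->
  3 * ln 2 * D%:R <= M * rate2 eta.
Proof.
move=> h; have s2 : 0 < Num.sqrt 2 :> R by rewrite sqrtr_gt0.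
have e0 := eta0; have e81 : 0 < 81 + 2 * eta by lra.
have rp : 0 < rate2 eta.
  by rewrite /rate2 divr_gt0 ?exprn_gt0// mulr_gt0// mulr_gt0.
move: h; rewrite -(ltr_pM2r rp) => /ltW; apply: le_trans.
rewrite le_eqVlt; apply/orP; left; apply/eqP; rewrite /rate2 natrM.
by field; rewrite !gt_eqF.
Qed.

Lemma failure_le :
  2 * ((4 * cs + 1) ^+ D * expR (- (M * (eta ^+ 2 / (8 * cs ^+ 2)))) +
     2 * ((2 * cs + 1/4) * (cs + 1/4)) ^+ D / (3 * ln 2 ^+ 2 * D%:R) * expR (- (M * rate2 eta)))
  <= coef_A1 d r N cs * expR (- (M * (3 * eta ^+ 2 / (4 * cs * (6 * cs + eta)))))
     + coef_A2 d r N cs * expR (- (M * rate2 eta)).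
Proof.
rewrite coef_A1E coef_A2E mulrDr; apply: lerD.
  rewrite mulrA; apply: ler_wpM2l.
    by rewrite mulr_ge0// exprn_ge0//; have := cs0; lra.
  by rewrite ler_expR lerN2 ler_wpM2l// rate1_le.
by rewrite le_eqVlt; apply/orP; left; apply/eqP; ring.
Qed.

Lemma coef_A2_ge0 : 0 <= coef_A2 d r N cs.
Proof.
rewrite coef_A2E divr_ge0//.
  by rewrite mulr_ge0// exprn_ge0// mulr_ge0//; have := cs0; lra.
by rewrite mulr_ge0// mulr_ge0// sqr_ge0.
Qed.

(* Below this sample size the claimed probability bound is negative. *)
Lemma trivial_failure : expR (M * (eta ^+ 2 / (8 * cs ^+ 2))) < 2 * (4 * cs + 1) ^+ D ->
  1 <= coef_A1 d r N cs * expR (- (M * (3 * eta ^+ 2 / (4 * cs * (6 * cs + eta))))).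
Proof.
move=> h; rewrite coef_A1E expRN ler_pdivlMr ?expR_gt0// mul1r.
apply: le_trans (ltW h); rewrite ler_expR ler_wpM2l//; exact: rate1_le.
Qed.

End probability_constants.

(** * The samples of the convolution *)

Section sampling.
Variables (R : realType) (p q : R) (d r N : nat) (K1 K2 : R).
Local Notation plane := (measurableTypeR R * 'rV[R]_d)%type.
Local Notation leb := (@lebesgue_plane R d).
Local Notation CK := (box K1 K2 : set plane).
Local Notation vec := {ffun @coef_index d r N -> R}.
Variables (Phi : 'I_r -> R * 'rV[R]_d -> R[i]) (alpha1 alpha2 ct s1 s2 : R).
Variables (psi : R * 'rV[R]_d -> R[i]) (rho : plane -> R) (C1 C2 : R).
Hypotheses (p1 : 1 < p) (q1 : 1 < q) (d0 : (0 < d)%N) (r0 : (0 < r)%N) (K10 : 0 < K1) (K20 : 0 < K2).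
Hypothesis PhiL : forall i, in_Lpq p q (Phi i).
Hypotheses (a1 : 0 < alpha1) (stable : stable_shifts p q alpha1 alpha2 Phi).
Hypotheses (ct0 : 0 < ct) (dec : forall i, decaying ct s1 s2 (Phi i)).
Local Notation sig1 := (s1 * p / (p - 1)).
Local Notation sig2 := (s2 * q / (q - 1)).
Hypotheses (sig1_gt : 1 < sig1) (sig2_gt : d%:R < sig2).
Hypotheses (psiL : in_L1 psi) (psiK : ess_support psi `<=` CK).
Hypothesis rhoD : prob_density CK rho.
Hypotheses (C10 : 0 < C1) (C20 : 0 < C2).
Hypothesis rhoC : forall z, CK z -> C1 <= rho z <= C2.

Local Notation fn a := (@combination R d r N Phi a).
Local Notation nrm := (@nrm R d r N p q Phi).
Local Notation Lpsi := (fine (L1norm setT psi)).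

(** Extension by zero, which turns integrals against [rho] over the box into integrals over the
    plane. *)
Definition restricted_density : plane -> R := rho \_ CK.
Local Notation kappa := restricted_density.

Lemma measurable_restricted_density : measurable_fun setT kappa.
Proof. by apply/(measurable_restrictT _ (@measurable_box R d K1 K2)); have [] := rhoD. Qed.

Lemma restricted_densityE z : CK z -> kappa z = rho z.
Proof. by move=> zK; rewrite /restricted_density /patch mem_set. Qed.

Lemma restricted_density_out z : ~ CK z -> kappa z = 0.
Proof. by move=> zK; rewrite /restricted_density /patch memNset. Qed.

Lemma restricted_density_le z : 0 <= kappa z <= C2 * \1_CK z.
Proof.
rewrite indicE; have [zK|zK] := pselect (CK z).
  rewrite restricted_densityE// mem_set// mulr1.
  by have /andP[h1 ->] := rhoC zK; rewrite andbT (le_trans _ h1)// ltW.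
by rewrite restricted_density_out// memNset// mulr0 lexx.
Qed.

Lemma restricted_density_ge z : C1 * \1_CK z <= kappa z.
Proof.
rewrite indicE; have [zK|zK] := pselect (CK z).
  by rewrite restricted_densityE// mem_set// mulr1; have /andP[] := rhoC zK.
by rewrite restricted_density_out// memNset// mulr0.
Qed.

Lemma integral_restricted_density (A : set plane) :
  (\int[leb]_(z in A) (kappa z)%:E = \int[leb]_(z in A `&` CK) (rho z)%:E)%E.
Proof.
rewrite integral_mkcond [RHS]integral_mkcond; apply: eq_integral => z _.
rewrite /patch in_setI /restricted_density /patch.
by case: (z \in A) => //=; case: ifPn.
Qed.

Let k1 : (\int[leb]_z (kappa z)%:E = 1)%E.
Proof. by rewrite integral_restricted_density setTI; have [_ []] := rhoD. Qed.

Let mk := measurable_restricted_density.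
Let k0 z : 0 <= kappa z. Proof. by have /andP[] := restricted_density_le z. Qed.

Let psiae : {ae leb, forall w, ~ CK w -> psi w = 0}. Proof. exact: ess_support_ae. Qed.

Lemma L1norm_box : L1norm CK psi = Lpsi%:E.
Proof.
have mpsi : measurable_fun setT (fun w : plane => (normc (psi w))%:E).
  by apply/measurable_EFinP; apply: measurable_normc; have [] := psiL.
rewrite -(L1norm_setT_fin psiL) /L1norm integral_mkcond.
apply: ge0_ae_eq_integral => //.
- by apply/(measurable_restrictT _ (@measurable_box R d K1 K2)); exact: measurable_funTS.
- by move=> z _; rewrite /patch; case: ifPn => // _; rewrite lee_fin normc_ge0.
- by move=> z _; rewrite lee_fin normc_ge0.
rewrite /ae_eq; apply: (@filterS _ (almost_everywhere leb) _ _ _ _ psiae) => z hz _.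
rewrite /patch; case: ifPn => // /negP zK.
by rewrite hz ?normc0// => zK'; apply: zK; rewrite inE.
Qed.

Let Lpsi0 : 0 <= Lpsi.
Proof. by rewrite fine_ge0//; apply: integral_ge0 => z _; rewrite lee_fin normc_ge0. Qed.

Definition smoothed (a : vec) (z : plane) : R := normc (convolution (fn a) psi z).
Local Notation G := smoothed.

Let mfn (a : vec) : cmeasurable (fn a) := cmeasurable_combination PhiL a.
Let bfn (a : vec) := combination_bounded p1 q1 d0 a1 stable ct0 dec sig1_gt sig2_gt a.

Lemma measurable_smoothed a : measurable_fun setT (G a).
Proof. exact: measurable_normc (cmeasurable_convolution psiL (mfn a)). Qed.

Lemma smoothed_ge0 a z : 0 <= G a z. Proof. exact: normc_ge0. Qed.

Lemma smoothedD a b z : G (a + b) z <= G a z + G b z.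
Proof.
have [C hC] := bfn a; have [C' hC'] := bfn b.
rewrite /G; have -> : combination Phi (a + b) = (fun z => fn a z + fn b z).
  by apply/funext => u; rewrite combinationD.
rewrite (convolutionD psiL z (mfn a) (mfn b) hC hC'); exact: le_normcD.
Qed.

Lemma smoothedZ t a z : G (t *: a) z = `|t| * G a z.
Proof.
have [C hC] := bfn a.
rewrite /G; have -> : combination Phi (t *: a) = (fun z => Complex t 0 * fn a z).
  by apply/funext => u; rewrite combinationZ.
by rewrite (convolutionZ psiL t z (mfn a) hC) normcM normc_real.
Qed.

Lemma smoothed_dist a b z : `|G a z - G b z| <= G (a - b) z.
Proof.
have h1 := smoothedD (a - b) b z; rewrite subrK in h1.
have h2 := smoothedD (b - a) a z; rewrite subrK in h2.
have h3 := smoothedZ (-1) (a - b) z; rewrite scaleN1r opprB normrN1 mul1r in h3.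
move: (G a z) (G b z) (G (a - b) z) (G (b - a) z) h1 h2 h3 => x y u v h1 h2 h3.
by rewrite ler_norml; apply/andP; split; lra.
Qed.

Variable U : R.
Hypotheses (U0 : 0 < U) (SU : forall y : 'rV[R]_d, `|y| <= 2 * K2 -> lattice_sum N sig2 y <= U).

Local Notation B := (@profile_const R p alpha1 ct s1 * U `^ ((q - 1) / q)).

Let B0 : 0 < B.
Proof. by rewrite mulr_gt0 ?powR_gt0//; exact: (profile_const_gt0 (p := p) a1 ct0 sig1_gt). Qed.

Lemma smoothed_le a z : CK z -> G a z <= B * nrm a * Lpsi.
Proof.
move=> zK; apply: (le_convolution (D := CK) psiL (mfn a)) => //.
  by rewrite mulr_ge0 ?(ltW B0) ?nrm_ge0.
move=> w wK; exact: (combination_sup p1 q1 K20 a1 stable ct0 dec sig1_gt a SU zK wK).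
Qed.

Variable Q : probability plane R.
Hypothesis QE : forall A, measurable A -> (Q A = \int[leb]_(z in A) (kappa z)%:E)%E.
Hypothesis Lpsi_gt0 : 0 < Lpsi.
Local Notation E F := (Rintegral Q [set: plane] F).

(** Dividing by the norm of [psi] removes it from every constant; the indicator makes the bounds
    valid off the box, where no sample falls. *)
Definition sample_value (a : vec) (v : plane) : R := G a v * \1_CK v / Lpsi.
(* Weighting the samples only lowers them, and turns their mean under the
   density into [C1] times the Lebesgue mean in which concentration is stated. *)
Definition density_weight (v : plane) : R := C1 * \1_CK v * kappa v `^ (- 1).
Local Notation Psi := sample_value.
Local Notation om := density_weight.

Let mCK : measurable CK. Proof. exact: measurable_box. Qed.
Let m1CK : measurable_fun setT (\1_CK : plane -> R). Proof. exact: measurable_indic. Qed.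

Lemma measurable_sample_value a : measurable_fun setT (Psi a).
Proof.
apply: measurable_funM => //; exact: (measurable_funM (measurable_smoothed a) m1CK).
Qed.

Lemma sample_value_ge0 a v : 0 <= Psi a v.
Proof. by rewrite /sample_value divr_ge0// mulr_ge0// smoothed_ge0. Qed.

Lemma sample_value_le a v : Psi a v <= B * nrm a.
Proof.
rewrite /sample_value ler_pdivrMr// indicE; have [vK|vK] := pselect (CK v).
  by rewrite mem_set// mulr1; exact: smoothed_le.
rewrite memNset// mulr0 mulr_ge0// mulr_ge0 ?nrm_ge0//; exact: ltW.
Qed.

Lemma sample_value_dist a b v : `|Psi a v - Psi b v| <= Psi (a - b) v.
Proof.
have h := smoothed_dist a b v; rewrite /sample_value.
move: (G a v) (G b v) (G (a - b) v) h => x y u h.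
rewrite -mulrBl -mulrBl normrM normrM (ger0_norm (x := \1_CK v))//.
rewrite (ger0_norm (x := Lpsi^-1)) ?invr_ge0//.
by rewrite ler_wpM2r ?invr_ge0// ler_wpM2r.
Qed.

Lemma measurable_density_weight : measurable_fun setT om.
Proof.
apply: measurable_funM; first exact: measurable_funM.
exact: (measurableT_comp (measurable_powR (- 1)) mk).
Qed.

Lemma density_weightE v : CK v -> om v * kappa v = C1.
Proof.
move=> vK; have kp : 0 < kappa v.
  by rewrite restricted_densityE//; have /andP[h _] := rhoC vK; exact: lt_le_trans h.
by rewrite /density_weight indicE mem_set// mulr1 powR_inv1 ?(ltW kp)// divfK// gt_eqF.
Qed.

Lemma density_weight01 v : 0 <= om v <= 1.
Proof.
have [vK|vK] := pselect (CK v); last first.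
  by rewrite /density_weight indicE memNset// mulr0 mul0r lexx ler01.
have kp : 0 < kappa v.
  by rewrite restricted_densityE//; have /andP[h _] := rhoC vK; exact: lt_le_trans h.
have h := density_weightE vK.
have Ck : C1 <= kappa v.
  by have := restricted_density_ge v; rewrite indicE mem_set// mulr1.
have -> : om v = C1 / kappa v by rewrite -h mulfK// gt_eqF.
by rewrite divr_ge0 ?(ltW kp) ?(ltW C10)//= ler_pdivrMr// mul1r.
Qed.

Let bPsi a : bounded_measurable (Psi a).
Proof.
split; first exact: measurable_sample_value.
by exists (B * nrm a) => v; rewrite ger0_norm ?sample_value_ge0// sample_value_le.
Qed.

Let bom a : bounded_measurable (fun v => om v * Psi a v).
Proof.
split; first exact: (measurable_funM measurable_density_weight (measurable_sample_value a)).
exists (B * nrm a) => v; have /andP[h1 h2] := density_weight01 v.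
rewrite ger0_norm; last by rewrite mulr_ge0// sample_value_ge0.
by apply: le_trans (sample_value_le a v); rewrite ler_piMl// sample_value_ge0.
Qed.

Let om_ge0 a v : 0 <= om v * Psi a v.
Proof. by have /andP[h1 h2] := density_weight01 v; rewrite mulr_ge0// sample_value_ge0. Qed.

Lemma mean_sample_value (H : R) a : 0 <= H ->
  (forall w, CK w -> (\int[leb]_z (kappa z * normc (fn a (z - w)))%:E <= (H * nrm a)%:E)%E) ->
  E (Psi a) <= H * nrm a.
Proof.
move=> H0 HH; rewrite -lee_fin.
rewrite (mean_density mk k0 QE (bPsi a) (sample_value_ge0 a)).
have n0 : 0 <= H * nrm a by rewrite mulr_ge0// nrm_ge0.
have h := integral_convolution_le psiL (mfn a) n0 psiae mk k0 HH.
have L1 : (0 <= (Lpsi^-1)%:E)%E by rewrite lee_fin invr_ge0.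
have -> : (\int[leb]_v (kappa v * Psi a v)%:E = (Lpsi^-1)%:E * \int[leb]_v (kappa v * G a v)%:E)%E.
  rewrite -ge0_integralZl//.
  - apply: eq_integral => v _; rewrite /sample_value -EFinM; congr EFin.
    have [vK|vK] := pselect (CK v).
      by rewrite indicE mem_set// mulr1 mulrA mulrC.
    by rewrite restricted_density_out// !mul0r mulr0.
  - by apply/measurable_EFinP; exact: (measurable_funM mk (measurable_smoothed a)).
  - by move=> v _; rewrite lee_fin mulr_ge0// smoothed_ge0.
apply: le_trans (lee_wpmul2l L1 h) _.
by rewrite -EFinM lee_fin mulrC mulfK// gt_eqF.
Qed.

Let C1CK0 z : 0 <= C1 * \1_CK z. Proof. by rewrite mulr_ge0// ltW. Qed.
Let mC1CK : measurable_fun setT (fun z : plane => C1 * \1_CK z).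
Proof. exact: measurable_funM. Qed.

Lemma mean_weighted_value a : ((E (fun v => om v * Psi a v))%:E =
  (Lpsi^-1)%:E * \int[leb]_v (C1 * \1_CK v * G a v)%:E)%E.
Proof.
rewrite (mean_density mk k0 QE (bom a) (om_ge0 a)).
have L1 : (0 <= (Lpsi^-1)%:E)%E by rewrite lee_fin invr_ge0.
rewrite -ge0_integralZl//.
- apply: eq_integral => v _; rewrite /sample_value -EFinM; congr EFin.
  have [vK|vK] := pselect (CK v).
    rewrite mulrA (mulrC (kappa v)) density_weightE// indicE mem_set// !mulr1.
    by rewrite mulrA mulrC.
  by rewrite restricted_density_out// mul0r indicE memNset// mulr0 mul0r mulr0.
- by apply/measurable_EFinP; exact: (measurable_funM mC1CK (measurable_smoothed a)).
- by move=> v _; rewrite lee_fin mulr_ge0// smoothed_ge0.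
Qed.

Lemma mean_weighted_value_le (h : R) a : 0 <= h ->
  (forall w, CK w -> (\int[leb]_z (C1 * \1_CK z * normc (fn a (z - w)))%:E <= (h * nrm a)%:E)%E) ->
  E (fun v => om v * Psi a v) <= h * nrm a.
Proof.
move=> h0 HH; rewrite -lee_fin mean_weighted_value.
have n0 : 0 <= h * nrm a by rewrite mulr_ge0// nrm_ge0.
have H := integral_convolution_le psiL (mfn a) n0 psiae mC1CK C1CK0 HH.
have L1 : (0 <= (Lpsi^-1)%:E)%E by rewrite lee_fin invr_ge0.
apply: le_trans (lee_wpmul2l L1 H) _.
by rewrite -EFinM lee_fin mulrC mulfK// gt_eqF.
Qed.

Lemma mean_weighted_value_ge (m : R) a :
  ((m * Lpsi * nrm a)%:E <= L1norm CK (convolution (fn a) psi))%E ->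
  m * C1 * nrm a <= E (fun v => om v * Psi a v).
Proof.
move=> h; rewrite -lee_fin mean_weighted_value.
have L1 : (0 <= (Lpsi^-1)%:E)%E by rewrite lee_fin invr_ge0.
have -> : (\int[leb]_v (C1 * \1_CK v * G a v)%:E = C1%:E * L1norm CK (convolution (fn a) psi))%E.
  rewrite /L1norm [X in (_ * X)%E]integral_mkcond -ge0_integralZl//.
  - apply: eq_integral => v _; rewrite /patch indicE; case: ifPn => vK.
      by rewrite mulr1 EFinM.
    by rewrite mulr0 mul0r mule0.
  - apply/(measurable_restrictT _ mCK); apply: measurable_funTS.
    by apply/measurable_EFinP; exact: (measurable_smoothed a).
  - by move=> v _; rewrite /patch; case: ifPn => // _; rewrite lee_fin normc_ge0.
  - by rewrite lee_fin ltW.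
have C1E : (0 <= C1%:E)%E by rewrite lee_fin ltW.
apply: le_trans (lee_wpmul2l L1 (lee_wpmul2l C1E h)).
rewrite -!EFinM lee_fin le_eqVlt; apply/orP; left; apply/eqP.
by field; rewrite gt_eqF.
Qed.

Context dT (T : measurableType dT) (P : probability T R) (J : eqType).
Variables (X : J -> T -> plane) (s : seq J).
Hypothesis mX : forall j, measurable_fun setT (X j).
Hypothesis law : forall j A, measurable A -> P (X j @^-1` A) = Q A.
Hypothesis indep : mutually_independent P X.
Hypothesis XK : forall j w, CK (X j w).
Hypotheses (us : uniq s) (s_gt0 : (0 < size s)%N).
Local Notation M := ((size s)%:R : R).

Definition sample_sum (a : vec) (w : T) : R := \sum_(j <- s) G a (X j w).

Lemma sample_value_sum a w : \sum_(j <- s) Psi a (X j w) = sample_sum a w / Lpsi.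
Proof.
rewrite /sample_sum mulr_suml; apply: eq_bigr => j _.
by rewrite /sample_value indicE mem_set// mulr1.
Qed.

Variables (mu eta c : R) (D : nat) (a0 : vec).
Hypotheses (eta0 : 0 < eta) (eta_lt : eta < mu * C1) (c0 : 0 < c).

Definition concentrated (a : vec) :=
  ((mu * Lpsi * nrm a)%:E <= L1norm CK (convolution (fn a) psi))%E.

Hypotheses (a01 : nrm a0 = 1) (ca0 : concentrated a0).
Local Notation kap := (@profile_const R p alpha1 ct s1).
Local Notation Top := (top_const d p q K1 K2 C2).

Hypothesis window_cases : B <= 23/10 * c \/
  exists2 A : R, 0 < A & B * (kap * A `^ ((q - 1) / q)) <= 104/100 * c ^+ 2 /\
    forall w : 'rV[R]_d,
     (\int[lebesgue_rV]_(y in rV_box K2) (lattice_sum N sig2 (y - w))%:E <= (A * (2 * K2) ^+ d)%:E)%E.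
Hypotheses (ID : #|{: @coef_index d r N}| = (2 * D)%N) (D0 : (0 < D)%N).
Hypothesis x2_ge : 3 * ln 2 * D%:R <= M * rate2 eta.
Hypothesis x1_ge : 2 * (4 * c + 1) ^+ D <= expR (M * (eta ^+ 2 / (8 * c ^+ 2))).

Lemma sampling_concentration : exists Bad : set T, [/\ measurable Bad,
  (P Bad <= (2 * ((4 * c + 1) ^+ D * expR (- (M * (eta ^+ 2 / (8 * c ^+ 2)))) +
     2 * ((2 * c + 1/4) * (c + 1/4)) ^+ D / (3 * ln 2 ^+ 2 * D%:R) * expR (- (M * rate2 eta))))%:E)%E &
  forall w, ~ Bad w -> forall a, concentrated a -> nrm a = 1 ->
    M * Lpsi * (mu * C1 - eta) <= sample_sum a w <= M * Lpsi * (Top + eta)].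
Proof.
have [be be0 hbe] := nrm_up N p1 q1 PhiL stable r0.
have kap0 : 0 < kap by exact: (profile_const_gt0 (p := p) a1 ct0 sig1_gt).
have Top0 : 0 < Top.
  by rewrite /top_const !mulr_gt0// powR_gt0// mulr_gt0.
have ETop a : E (Psi a) <= Top * nrm a.
  apply: mean_sample_value; first exact: ltW.
  by move=> w _; exact: (mean_top p1 q1 K10 K20 PhiL stable mk C20 restricted_density_le).
have cases : B <= 23/10 * c \/ exists h, [/\ 0 < h, B * h <= 104/100 * c ^+ 2, eta <= h,
    forall a, E (Psi a) <= Num.sqrt (Top * h) * nrm a &
    forall a, E (fun v => om v * Psi a v) <= h * nrm a].
  case: window_cases => [|[A A0 [BA hA]]]; [by left|right].
  exists (kap * A `^ ((q - 1) / q)).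
  have h0 : 0 < kap * A `^ ((q - 1) / q) by rewrite mulr_gt0// powR_gt0.
  have Eom a : E (fun v => om v * Psi a v) <= kap * A `^ ((q - 1) / q) * nrm a.
    apply: mean_weighted_value_le; first exact: ltW.
    move=> w _.
    exact: (mean_first_moment p1 q1 K10 K20 PhiL a1 stable ct0 dec sig1_gt mk C10 restricted_density_ge k1 a A0 (hA w.2)).
  split => //.
  (* This is the use of [a0]: its weighted mean is at least [mu * C1 > eta] and at most [h], so
     [eta <= h]. *)
  - have h1 := mean_weighted_value_ge ca0; have h2 := Eom a0.
    by rewrite a01 !mulr1 in h1 h2; exact: le_trans (ltW eta_lt) (le_trans h1 h2).
  - move=> a; apply: mean_sample_value; first exact: sqrtr_ge0.
    move=> w _.
    exact: (mean_sqrt_top p1 q1 K10 K20 PhiL a1 stable ct0 dec sig1_gt mk C20 restricted_density_le k1 a A0 (hA w.2)).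
have [Bad [mBad PBad HBad]] := two_sided_deviation mX law indep us s_gt0 a1 be0
  (nrmD p1 q1 PhiL stable) (nrmZ p1 q1 PhiL stable) (nrm_low p1 q1 a1 stable) hbe
  measurable_sample_value sample_value_ge0 sample_value_le sample_value_dist
  measurable_density_weight density_weight01 B0 c0 eta0 Top0 ETop cases ID D0 x2_ge x1_ge.
exists Bad; split => // w nw a ca na.
have := HBad w nw a na; rewrite sample_value_sum ler_pdivlMr// ler_pdivrMr// => /andP[h1 h2].
have h3 := mean_weighted_value_ge ca; rewrite na mulr1 in h3.
rewrite mulrAC in h2; rewrite h2 andbT mulrAC; apply: le_trans h1.
by rewrite ler_wpM2r//; apply: ler_wpM2l => //; lra.
Qed.

End sampling.

Theorem theorem3p8 (R : realType) (p q : R) (d r : nat) (K1 K2 : R)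
    (Phi : 'I_r -> R * 'rV[R]_d -> R[i])
    (alpha1 alpha2 ct s1 s2 : R)
    (psi : R * 'rV[R]_d -> R[i])
    (rho : R * 'rV[R]_d -> R) (Crho1 Crho2 : R)
    (dT : measure_display) (T : measurableType dT) (P : probability T R)
    (X : nat -> nat -> {RV P >-> (measurableTypeR R * 'rV[R]_d)%type})
    (N : nat) (mu eta : R) (m n : nat) :
  1 < p -> 1 < q -> (0 < d)%N -> (0 < r)%N -> 0 < K1 -> 0 < K2 ->
  (forall i, in_Lpq p q (Phi i)) ->
  0 < alpha1 -> 0 < alpha2 -> stable_shifts p q alpha1 alpha2 Phi ->
  (forall i, continuous (Phi i)) ->
  0 < ct ->
  d%:R + 1 - 1 / p - d%:R / q < s1 -> d%:R + 1 - 1 / p - d%:R / q < s2 ->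
  0 < s1 -> 0 < s2 ->
  (forall i, decaying ct s1 s2 (Phi i)) ->
  in_L1 psi -> ess_support psi `<=` box K1 K2 ->
  prob_density (box K1 K2) rho ->
  0 < Crho1 -> 0 < Crho2 ->
  (forall z, box K1 K2 z -> Crho1 <= rho z <= Crho2) ->
  (forall j k w, box K1 K2 (X j k w)) ->
  (forall j k A, measurable A ->
     P (X j k @^-1` A) = (\int[@lebesgue_plane R d]_(z in A `&` box K1 K2) (rho z)%:E)%E) ->
  mutually_independent P (fun jk : nat * nat => X jk.1 jk.2) ->
  0 < mu -> mu <= 1 -> 0 < eta -> eta < mu * Crho1 ->
  54 * r%:R * Num.sqrt 2 * ln 2 * ((2 * N + 1) ^ d.+1)%:R / eta * (2 + 81 / eta)
    < (n * m)%:R ->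
  let cs := cstar d p q ct alpha1 s1 s2 in
  let L1psi := L1norm (box K1 K2) psi in
  let sampling_inequality (f : R * 'rV[R]_d -> R[i]) (w : T) :=
    let S := (\sum_(j < n) \sum_(k < m)
                (normc (convolution f psi (X j k w)))%:E)%E in
    ((n * m)%:R%:E * L1psi * (mu * Crho1 - eta)%:E * mixed_norm p q f <= S)%E /\
    (S <= (n * m)%:R%:E * L1psi
          * (Crho2 * (2 * K1) `^ ((p - 1) / p) * (2 * K2) `^ (d%:R * (q - 1) / q)
             + eta)%:E
          * mixed_norm p q f)%E in
  let event := [set w | forall f,
    concentrated_space p q N psi Phi mu (box K1 K2) f ->
    sampling_inequality f w] in
  measurable event /\
  ((1 - coef_A1 d r N cs
          * expR (- ((n * m)%:R * (3 * eta ^+ 2 / (4 * cs * (6 * cs + eta)))))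
      - coef_A2 d r N cs
          * expR (- ((n * m)%:R * (eta ^+ 2 / (18 * Num.sqrt 2 * (81 + 2 * eta))))))%:E
   <= P event)%E.
Proof.
move=> p1 q1 d0 r0 K10 K20 PhiL a1 _ stable _ ct0 s1_gt s2_gt _ _ dec psiL psiK rhoD C10 C20 rhoC XK Xlaw indep
  mu0 _ eta0 eta_lt size_gt cs L1psi sampling_inequality event.
have p0 : 0 < p by exact: lt_trans p1.
have q0 : 0 < q by exact: lt_trans q1.
(* The decay threshold is the sum of [1 - 1/p] and [d - d/q], hence at least each of them; this
   yields the two summability exponents. *)
have dq : 0 <= d%:R - d%:R / q.
  by rewrite subr_ge0 ler_pdivrMr// ler_peMr// ltW.
have ip : 0 < 1 - 1 / p by rewrite subr_gt0 div1r invf_lt1.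
have sig1_gt : 1 < s1 * p / (p - 1).
  rewrite ltr_pdivlMr ?subr_gt0// mul1r -ltr_pdivrMr//.
  have -> : (p - 1) / p = 1 - 1 / p by field; rewrite gt_eqF.
  lra.
have sig2_gt : d%:R < s2 * q / (q - 1).
  rewrite ltr_pdivlMr ?subr_gt0// -ltr_pdivrMr//.
  have -> : d%:R * (q - 1) / q = d%:R - d%:R / q by field; rewrite gt_eqF.
  lra.
pose CK := box K1 K2 : set (measurableTypeR R * 'rV[R]_d).
pose fn := @combination R d r N Phi.
pose nm := @nrm R d r N p q Phi.
pose Lp := fine (L1norm setT psi).
have Lp0 : 0 <= Lp by rewrite fine_ge0//; apply: integral_ge0 => z _; rewrite lee_fin normc_ge0.
pose Xp (jk : nat * nat) : T -> measurableTypeR R * 'rV[R]_d := X jk.1 jk.2.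
pose s := [seq (j, k) | j <- iota 0 n, k <- iota 0 m].
have us : uniq s.
  by apply: allpairs_uniq; rewrite ?iota_uniq// => -[? ?] [? ?] _ _ [-> ->].
have ss : size s = (n * m)%N by rewrite size_allpairs !size_iota.
pose Y := @sample_sum R d r N Phi psi _ T _ Xp s.
pose top := @top_const R d p q K1 K2 Crho2.
have YE a w : (\sum_(j < n) \sum_(k < m) (normc (convolution (fn a) psi (X j k w)))%:E = (Y a w)%:E)%E.
  rewrite /Y /sample_sum /s big_allpairs -sumEFin -[in RHS](subn0 n) -/(index_iota 0 n) big_mkord.
  apply: eq_bigr => j _.
  by rewrite -sumEFin -[in RHS](subn0 m) -/(index_iota 0 m) big_mkord.
have L1E : L1psi = Lp%:E by exact: (L1norm_box psiL psiK).
pose conc := @concentrated R p q d r N K1 K2 Phi psi mu.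
have concE a : concentrated_space p q N psi Phi mu CK (fn a) <-> conc a.
  rewrite /concentrated_space/= (mixed_norm_combination p1 q1 stable) (L1norm_setT_fin psiL) -!EFinM.
  split => [[]//|h]; split => //.
  by apply/shift_space_combination; exists a.
pose lo := (n * m)%:R * Lp * (mu * Crho1 - eta).
pose hi := (n * m)%:R * Lp * (top + eta).
have eventE : event = [set w | forall a, conc a -> lo * nm a <= Y a w <= hi * nm a].
  apply/seteqP; split => w /=.
    move=> H a /concE /H; rewrite /sampling_inequality YE L1E (mixed_norm_combination p1 q1 stable) -!EFinM !lee_fin.
    by move=> [h1 h2]; rewrite h1 h2.
  move=> H f fc; have [a fE] := proj1 (shift_space_combination _ _ _) fc.1.
  rewrite fE in fc *; have /andP[h1 h2] := H a (proj1 (concE a) fc).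
  rewrite /sampling_inequality YE L1E (mixed_norm_combination p1 q1 stable) -!EFinM !lee_fin.
  by split.
have cs0 : 0 < cs by exact: (cstar_gt0 p1 q1 d0 a1 ct0 sig1_gt sig2_gt).
have D0 := dim_gt0 d N r0.
have A20 : 0 <= coef_A2 d r N cs by exact: coef_A2_ge0.
have s2_gt0 : 0 < Num.sqrt 2 :> R by rewrite sqrtr_gt0.
have M0 : 0 < (n * m)%:R :> R.
  apply: le_lt_trans size_gt.
  have l2 : 0 <= ln 2 :> R by rewrite ln_ge0// ler1n.
  have e81 : 0 <= 81 / eta by apply: divr_ge0 => //; exact: ltW.
  apply: mulr_ge0; last exact: addr_ge0.
  apply: divr_ge0; last exact: ltW.
  apply: mulr_ge0; last exact: ler0n.
  apply: mulr_ge0 l2; apply: mulr_ge0; last exact: ltW.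
  by apply: mulr_ge0; exact: ler0n.
have nm0 : (0 < size s)%N by rewrite ss -(ltr_nat R).
have [be be0 hbe] := nrm_up N p1 q1 PhiL stable r0.
have [U U0 [SU Ucase]] := window_dichotomy N d0 sig2_gt K20.
pose B := @profile_const R p alpha1 ct s1 * U `^ ((q - 1) / q).
have B0 : 0 < B.
  by rewrite mulr_gt0 ?powR_gt0//; exact: (profile_const_gt0 (p := p) a1 ct0 sig1_gt).
have mXp j : measurable_fun setT (Xp j) by exact: measurable_funPT.
pose G := @smoothed R d r N Phi psi.
have G0 a z : 0 <= G a z by exact: normc_ge0.
have GB a z : CK z -> G a z <= B * nm a * Lp.
  exact: (smoothed_le p1 q1 K20 PhiL a1 stable ct0 dec sig1_gt psiL psiK U0 SU).
have GZ t a z : G (t *: a) z = `|t| * G a z.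
  exact: (smoothedZ p1 q1 d0 PhiL a1 stable ct0 dec sig1_gt sig2_gt psiL).
have Gdist a b z : `|G a z - G b z| <= G (a - b) z.
  exact: (smoothed_dist p1 q1 d0 PhiL a1 stable ct0 dec sig1_gt sig2_gt psiL).
have mG a : measurable_fun setT (G a) by exact: measurable_smoothed.
have ND := nrmD (N := N) p1 q1 PhiL stable.
have NZ := nrmZ (N := N) p1 q1 PhiL stable.
have Nlow := nrm_low (N := N) p1 q1 a1 stable.
have YZ t a w : 0 < t -> Y (t *: a) w = t * Y a w.
  move=> t0; rewrite /Y /sample_sum mulr_sumr; apply: eq_bigr => j _.
  by rewrite -/(G _ _) -/(G _ _) GZ gtr0_norm.
pose Lam := (n * m)%:R * (B * Lp).
have Lam0 : 0 <= Lam by rewrite mulr_ge0// mulr_ge0// ltW.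
have YL a b w : `|Y a w - Y b w| <= Lam * nm (a - b).
  rewrite /Y /sample_sum -sumrB; apply: le_trans (ler_norm_sum _ _ _) _.
  apply: (@le_trans _ _ (\sum_(j <- s) B * nm (a - b) * Lp)).
    apply: ler_sum => j _; apply: le_trans (Gdist a b (Xp j w)) _.
    by apply: GB; exact: XK.
  rewrite big_const_seq count_predT iter_addr_0 ss -mulr_natl /Lam le_eqVlt; apply/orP; left; apply/eqP; ring.
have mY a : measurable_fun setT (Y a).
  by apply: measurable_sum => j; exact: (measurableT_comp (mG a) (mXp j)).
have concZ t a : 0 < t -> conc a -> conc (t *: a).
  move=> t0; rewrite /conc /concentrated.
  have -> : L1norm CK (convolution (combination Phi (t *: a)) psi) =
      (t%:E * L1norm CK (convolution (combination Phi a) psi))%E.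
    rewrite /L1norm -ge0_integralZl//.
    - by apply: eq_integral => z _; have := GZ t a z; rewrite /G /smoothed gtr0_norm// => ->; rewrite EFinM.
    - exact: measurable_box.
    - by apply: measurable_funTS; apply/measurable_EFinP; exact: mG.
    - by move=> z _; rewrite lee_fin normc_ge0.
    - by rewrite lee_fin ltW.
  move=> h; rewrite NZ gtr0_norm// mulrCA EFinM; apply: lee_wpmul2l h.
  by rewrite lee_fin ltW.
have mevent : measurable event.
  rewrite eventE; exact: (measurable_uniform_event lo hi a1 be0 Lam0 ND NZ Nlow hbe concZ mY YZ YL).
split => //.
(* By homogeneity the norm 1 suffices; at norm 0 the pointwise bound on the box makes the sum of
   samples vanish. *)
have reduce w : (forall a, conc a -> nm a = 1 -> lo <= Y a w <= hi) -> event w.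
  move=> H; rewrite eventE => a ca.
  have [na|nn] := eqVneq (nm a) 0.
    have -> : Y a w = 0.
      rewrite /Y /sample_sum big1// => j _; apply/eqP; rewrite eq_le; apply/andP; split; last exact: G0.
      by have := GB a _ (XK j.1 j.2 w); rewrite na mulr0 mul0r.
    by rewrite na !mulr0 lexx.
  have npos : 0 < nm a by rewrite lt0r nn nrm_ge0.
  have t0 : 0 < (nm a)^-1 by rewrite invr_gt0.
  have n1 : nm ((nm a)^-1 *: a) = 1 by rewrite /nm NZ gtr0_norm// mulVf.
  have := H _ (concZ _ _ t0 ca) n1; rewrite YZ// ler_pdivlMl// ler_pdivrMl//.
  by rewrite (mulrC (nm a)) (mulrC (nm a)).
have full : event = setT -> ((1 - coef_A1 d r N cs
          * expR (- ((n * m)%:R * (3 * eta ^+ 2 / (4 * cs * (6 * cs + eta)))))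
      - coef_A2 d r N cs
          * expR (- ((n * m)%:R * (eta ^+ 2 / (18 * Num.sqrt 2 * (81 + 2 * eta))))))%:E
   <= P event)%E.
  move=> ->; rewrite probability_setT lee_fin.
  have : 0 <= coef_A1 d r N cs * expR (- ((n * m)%:R * (3 * eta ^+ 2 / (4 * cs * (6 * cs + eta))))).
    by rewrite mulr_ge0 ?expR_ge0// mulr_ge0 ?expR_ge0.
  have : 0 <= coef_A2 d r N cs * expR (- ((n * m)%:R * (eta ^+ 2 / (18 * Num.sqrt 2 * (81 + 2 * eta))))).
    by rewrite mulr_ge0 ?expR_ge0.
  by move=> h2 h1; rewrite -addrA -opprD gerBl; exact: addr_ge0.
(* If [psi] has norm zero, all three members of the inequality vanish and the event is
   everything. *)
have [Lpz|Lpn] := eqVneq Lp 0.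
  apply: full; apply/seteqP; split => // w _; apply: reduce => a _ _.
  have -> : Y a w = 0.
    rewrite /Y /sample_sum big1// => j _; apply/eqP; rewrite eq_le; apply/andP; split; last exact: G0.
    by have := GB a _ (XK j.1 j.2 w); rewrite Lpz mulr0.
  by rewrite /lo /hi Lpz !mulr0 !mul0r lexx.
have Lpp : 0 < Lp by rewrite lt0r Lpn.
(* Without a concentrated function of norm 1 the event is again everything; with one, [eta] can be
   compared with the means. *)
have [[a0 [ca0 a01]]|none] := pselect (exists a0, conc a0 /\ nm a0 = 1); last first.
  apply: full; apply/seteqP; split => // w _; apply: reduce => a ca na.
  by exfalso; apply: none; exists a.
have [x1_ge|x1_lt] := leP (2 * (4 * cs + 1) ^+ (r * (2 * N + 1) ^ d.+1)%N) (expR ((n * m)%:R * (eta ^+ 2 / (8 * cs ^+ 2)))); last first.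
  apply: (@le_trans _ _ 0%E) => //; rewrite lee_fin.
  have := trivial_failure cs0 eta0 (ltW M0) x1_lt.
  have : 0 <= coef_A2 d r N cs * expR (- ((n * m)%:R * (eta ^+ 2 / (18 * Num.sqrt 2 * (81 + 2 * eta))))).
    by rewrite mulr_ge0 ?expR_ge0.
  by move=> h2 h1; rewrite -addrA -opprD subr_le0; apply: le_trans h1 _; rewrite lerDl.
have x2_ge := sample_size_rate eta0 size_gt.
have cases : B <= 23/10 * cs \/
  exists2 A : R, 0 < A & B * (@profile_const R p alpha1 ct s1 * A `^ ((q - 1) / q)) <= 104/100 * cs ^+ 2 /\
    forall w : 'rV[R]_d,
     (\int[lebesgue_rV]_(y in rV_box K2) (lattice_sum N (s2 * q / (q - 1)) (y - w))%:E <= (A * (2 * K2) ^+ d)%:E)%E.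
  case: Ucase => [Us|[A A0 [UA hA]]]; [left|right].
    exact: (sup_const_small p1 q1 d0 a1 ct0 sig1_gt sig2_gt).
  exists A => //; split => //.
  exact: (sup_const_prod ct p1 q1 d0 a1 sig1_gt sig2_gt).
have ID : #|{: @coef_index d r N}| = (2 * (r * (2 * N + 1) ^ d.+1))%N.
  rewrite !card_prod card_bool card_ffun !card_ord expnS -mul2n addn1.
  by rewrite mulnC.
(* All samples have the law of the sample with index [(0, 0)], which serves as the common one. *)
pose Q : probability (measurableTypeR R * 'rV[R]_d)%type R := distribution P (X 0%N 0%N).
have QE A : measurable A -> (Q A = \int[@lebesgue_plane R d]_(z in A) (restricted_density K1 K2 rho z)%:E)%E.
  by move=> mA; rewrite integral_restricted_density; exact: Xlaw.
have law j A : measurable A -> P (Xp j @^-1` A) = Q A.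
  by move=> mA; rewrite QE// integral_restricted_density; exact: Xlaw.
rewrite -ss in M0 x1_ge x2_ge *.
have [Bad [mBad PBad HBad]] := sampling_concentration p1 q1 d0 r0 K10 K20 PhiL a1 stable ct0 dec sig1_gt sig2_gt
  psiL psiK rhoD C10 C20 rhoC U0 SU QE Lpp mXp law indep (fun j w => XK j.1 j.2 w) us nm0 eta0 eta_lt cs0 a01 ca0
  cases ID D0 x2_ge x1_ge.
apply: (@le_trans _ _ (P (~` Bad))); last first.
  apply: le_measure; rewrite ?inE//; first exact: measurableC.
  move=> w nw; apply: reduce => a ca na.
  by have := HBad w nw a ca na; rewrite ss.
rewrite probability_setC//.
apply: (@le_trans _ _ (1 - (2 * ((4 * cs + 1) ^+ (r * (2 * N + 1) ^ d.+1)%N * expR (- ((size s)%:R * (eta ^+ 2 / (8 * cs ^+ 2)))) +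
     2 * ((2 * cs + 1/4) * (cs + 1/4)) ^+ (r * (2 * N + 1) ^ d.+1)%N / (3 * ln 2 ^+ 2 * (r * (2 * N + 1) ^ d.+1)%:R) * expR (- ((size s)%:R * rate2 eta))))%:E)%E).
  rewrite -EFinB lee_fin.
  have := failure_le d r N cs0 eta0 (ltW M0).
  by rewrite /rate2 => h; rewrite -addrA -opprD lerD2l lerN2.
by apply: leeB.
Qed.
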